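(* Let $M=(M_k)$ be a weight sequence that is log-convex and has moderate growth, and let $C^{[M]}$ denote either $C^{(M)}$ or $C^{\{M\}}$; in the Beurling case $C^{[M]}=C^{(M)}$ assume in addition that $M_k^{1/k}\to\infty$ (equivalently, $C^\omega\subseteq C^{(M)}$). Let $A_1,A_2$ and $B$ be finite dimensional $C^{[M]}$-manifolds with $A_1$ and $A_2$ compact, and with $A_2$ and $B$ admitting $C^{[M]}$ Riemannian metrics. Then composition $$C^{[M]}(A_2,B)\times C^{[M]}(A_1,A_2)\to C^{[M]}(A_1,B),\quad(f,g)\mapsto f\circ g,$$ is $C^{[M]}$ with respect to the $C^{[M]}$-manifold structures on these mapping spaces described in the context.
   Context: $\mathbb N=\{0,1,2,\dots\}$. A weight sequence $M=(M_k)_{k\in\mathbb N}$ is a sequence of positive reals with $M_0=1\le M_1$. It is log-convex if $k\mapsto\log M_k$ is convex; it has moderate growth if $\sup_{j,k\ge1}\big(M_{j+k}/(M_jM_k)\big)^{1/(j+k)}<\infty$. $C^{[M]}$ stands, within one statement, either everywhere for $C^{(M)}$ or everywhere for $C^{\{M\}}$. $C^\omega$ denotes real analytic. Jets on Banach spaces. For Banach spaces $E,F$ let $L^k_{\rm sym}(E,F)$ be the Banach space of bounded symmetric $k$-linear maps $E^k\to F$ with the operator norm. For compact $K\subseteq E$ and $f=(f^k)_k\in\prod_k C(K,L^k_{\rm sym}(E,F))$ put $\|f\|_k=\sup_{x\in K}\|f^k(x)\|$, $(R^n_yf)^k(x)=f^k(x)-\sum_{j=0}^n\frac1{j!}f^{j+k}(y)(x-y,\dots,x-y,\cdot)$,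 $|||f|||_{n,k}=\sup\{(n+1)!\,\|(R^n_yf)^k(x)\|/\|x-y\|^{n+1}:x\ne y\in K\}$, and $$\|f\|_\rho=\max\Big\{\sup_m\frac{\|f\|_m}{m!\rho^mM_m},\ \sup_{n,k}\frac{|||f|||_{n,k}}{(n+k+1)!\rho^{n+k+1}M_{n+k+1}}\Big\}.$$ $C^M_\rho(E\supseteq K,F)$ is the space of those $f$ with $\|f\|_\rho<\infty$, normed by $\|\cdot\|_\rho$. For compact convex $K$ put $C^{(M)}(E\supseteq K,F)=\varprojlim_{\rho>0}C^M_\rho(E\supseteq K,F)$ and $C^{\{M\}}(E\supseteq K,F)=\varinjlim_{\rho>0}C^M_\rho(E\supseteq K,F)$ (locally convex limits). For open $U\subseteq E$, $C^{[M]}(U,F)$ is the space of all $C^\infty$ (Fréchet) maps $f:U\to F$ with $j^\infty f|_K=(f^{(k)}|_K)_k\in C^{[M]}(E\supseteq K,F)$ for all compact convex $K\subseteq U$, with the initial locally convex topology induced by the maps $f\mapsto j^\infty f|_K$. Convenient vector spaces. A convenient vector space is a real Hausdorff locally convex space that is Mackey complete. Its $c^\infty$-topology is the final topology with respect to all $C^\infty$-curves $\mathbb R\to E$. A mapping on a $c^\infty$-open set is $C^\infty$ if it maps $C^\infty$-curves to $C^\infty$-curves. $F^*$ is the space of continuous linear functionals. For closed absolutely convex bounded $B\subseteq E$, $E_B$ is the span of $B$ with the Minkowski functional of $B$ as norm (a Banach space), $i_B:E_B\to E$ the inclusion, $U_B=U\cap E_B$. For $c^\infty$-open $U\subseteq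 E$, $$C^{[M]}(U,F)=\{f\in C^\infty(U,F):\ell\circ f\circ i_B\in C^{[M]}(U_B,\mathbb R)\ \forall\ell\in F^*,\forall B\},$$ with the initial locally convex structure induced by all maps $f\mapsto\ell\circ f\circ i_B\in C^{[M]}(U_B,\mathbb R)$; this is a convenient vector space. Manifolds. A $C^{[M]}$-manifold is a smooth manifold (modeled on $c^\infty$-open subsets of convenient vector spaces) all of whose chart changes are $C^{[M]}$, with the topology induced by the $c^\infty$-topology on the charts; likewise for $C^{[M]}$ vector bundles. Finite dimensional manifolds are assumed paracompact. Mappings between $C^{[M]}$-manifolds are $C^{[M]}$ if they are so in charts (equivalently, they map $C^{[M]}$-plots, i.e. $C^{[M]}$-mappings from open unit balls $D$ of Banach spaces, to $C^{[M]}$-plots). For a $C^{[M]}$ vector bundle $p:E\to X$ with a $C^{[M]}$-atlas $u_\alpha:U_\alpha\to u_\alpha(U_\alpha)$ of $X$ and vector bundle charts $\psi_\alpha:E|_{U_\alpha}\to U_\alpha\times V$, the space $C^{[M]}(X\gets E)$ of $C^{[M]}$-sections is the convenient vector space with structure induced by $C^{[M]}(X\gets E)\to\prod_\alpha C^{[M]}(u_\alpha(U_\alpha),V)$, $s\mapsto(\operatorname{pr}_2\circ\psi_\alpha\circ s\circ u_\alpha^{-1})_\alpha$. Manifold structure on $C^{[M]}(A,B)$ ($A$ compact, $A,B$ finite dimensional, $B$ with a $C^{[M]}$ Riemannian metric). Let $\pi_B:TB\to B$ be the projection and $\exp:TB\supseteq U\to B$ the Riemannian exponential mapping on an open neighborhood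 $U$ of the zero section such that $(\pi_B,\exp):U\to B\times B$ is a $C^{[M]}$-diffeomorphism onto an open neighborhood $V$ of the diagonal. For $f\in C^{[M]}(A,B)$ the chart $u_f$ is defined on $U_f=\{g\in C^{[M]}(A,B):(f(x),g(x))\in V\ \forall x\in A\}$ by $u_f:U_f\to C^{[M]}(A\gets f^*TB)$, $u_f(g)(x)=(x,\exp_{f(x)}^{-1}(g(x)))$. These charts form a $C^{[M]}$-atlas, independent up to equivalence of the metric. *)

(* Defs.v *)
From HB Require Import structures.
From mathcomp Require Import all_boot all_order all_algebra perm.
From mathcomp Require Import all_classical all_reals all_analysis.
From mathcomp Require Import ring.

Set Implicit Arguments.
Unset Strict Implicit.
Unset Printing Implicit Defensive.

Import Order.TTheory GRing.Theory Num.Theory.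
Import numFieldNormedType.Exports.

Local Open Scope classical_set_scope.
Local Open Scope ring_scope.

Section Span.
Context {R : realType} {V : lmodType R}.
Implicit Type S : set V.

Definition lspan S : {pred V} := [pred x | `[< exists2 s : seq (R * V),
  (forall p, p \in s -> S p.2) & x = \sum_(p <- s) p.1 *: p.2 >]].

Lemma lspan_submod_closed S : submod_closed (lspan S).
Proof.
split; first by apply/asboolP; exists [::] => //; rewrite big_nil.
move=> a x y /asboolP[s sS ->] /asboolP[t tS ->]; apply/asboolP.
exists ([seq (a * p.1, p.2) | p <- s] ++ t).
  by move=> p; rewrite mem_cat => /orP[/mapP[q /sS ? ->]|/tS].
rewrite big_cat /= big_map scaler_sumr; congr (_ + _).
by apply: eq_bigr => i _; rewrite scalerA.
Qed.

HB.instance Definition _ S :=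
  GRing.isSubmodClosed.Build R V (lspan S) (lspan_submod_closed S).

Record spanType S := Span { span_val :> V; _ : span_val \in lspan S }.

HB.instance Definition _ S := [isSub for @span_val S].
HB.instance Definition _ S := [Choice of spanType S by <:].
HB.instance Definition _ S := [SubChoice_isSubLmodule of spanType S by <:].

End Span.

Section Seminorms.
Context {R : realType}.

Definition seminorm (V : lmodType R) (p : V -> R) :=
  (forall x y, p (x + y) <= p x + p y) /\
  (forall a x, p (a *: x) = `|a| * p x).

(* V with the locally convex topology generated by the seminorms in P
   (members of P that are not seminorms are ignored). *)
Definition locally_convex_type (V : lmodType R) (P : set (V -> R)) : Type := V.

Variables (V : lmodType R) (P : set (V -> R)).
Local Notation L := (locally_convex_type P).

HB.instance Definition _ := GRing.Lmodule.on L.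

Definition sn_ball (ps : seq (V -> R)) (x : V) (e : R) : set V :=
  [set y | forall p, p \in ps -> p (y - x) < e].

Definition sn_nbhs (x : L) : set_system L := [set A |
  exists ps e, [/\ forall p, p \in ps -> P p /\ seminorm p, 0 < e
    & sn_ball ps x e `<=` A]].

HB.instance Definition _ := hasNbhs.Build L sn_nbhs.

Lemma seminorm0 (p : V -> R) : seminorm p -> p 0 = 0.
Proof. by case=> _ pZ; rewrite -[X in p X](scale0r 0) pZ normr0 mul0r. Qed.

Lemma seminorm_ge0 (p : V -> R) x : seminorm p -> 0 <= p x.
Proof.
move=> sp; have [pD pZ] := sp; rewrite -(pmulr_rge0 (p x) (@ltr0n R 2)).
rewrite mulr_natl mulr2n -{2}(mul1r (p x)) -normr1 -normrN -pZ.
by rewrite -(seminorm0 sp) -(subrr x) -scaleN1r pD.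
Qed.

Lemma sn_ball_center ps x e : 0 < e ->
  (forall p, p \in ps -> P p /\ seminorm p) -> sn_ball ps x e x.
Proof. by move=> e0 ps_ p /ps_[_ sp]; rewrite subrr seminorm0. Qed.

Let sn_filter (x : L) : ProperFilter (nbhs x).
Proof.
apply: Build_ProperFilter_ex.
  move=> A [ps [e [ps_ e0 sub]]]; exists x; apply: sub; exact: sn_ball_center.
split.
- by exists [::], 1; split=> // p; rewrite in_nil.
- move=> A B [ps [e [ps_ e0 sA]]] [qs [d [qs_ d0 sB]]].
  exists (ps ++ qs), (Num.min e d); split; last move=> y yb.
  + by move=> p; rewrite mem_cat => /orP[/ps_|/qs_].
  + by rewrite lt_min e0.
  + by split; [apply: sA|apply: sB] => p pin;
      have := yb p; rewrite mem_cat pin ?orbT lt_min => /(_ isT)/andP[].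
- move=> C D CD [qs [d [qs_ d0 sC]]]; exists qs, d; split=> //.
  exact: subset_trans CD.
Qed.

Let sn_singleton (x : L) (A : set L) : nbhs x A -> A x.
Proof. by case=> ps [e [ps_ e0 sA]]; apply: sA; exact: sn_ball_center. Qed.

Let sn_nbhs_nbhs (x : L) (A : set L) : nbhs x A -> nbhs x (nbhs^~ A).
Proof.
case=> ps [e [ps_ e0 sA]]; exists ps, (e / 2); split; rewrite ?divr_gt0//.
move=> y yb; exists ps, (e / 2); split; rewrite ?divr_gt0// => z zb.
apply: sA => p pin; rewrite (splitr e) -(subrKA y).
have [_ [pD _]] := ps_ p pin; apply: le_lt_trans (pD _ _) _.
by rewrite ltrD// ?zb ?yb.
Qed.

HB.instance Definition _ := Nbhs_isNbhsTopological.Build L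
  sn_filter sn_singleton sn_nbhs_nbhs.

Let sn_add_continuous : continuous (fun x : L * L => x.1 + x.2).
Proof.
move=> [x y] A [ps [e [ps_ e0 sA]]].
exists (sn_ball ps x (e / 2), sn_ball ps y (e / 2)).
  by split; exists ps, (e / 2); split; rewrite ?divr_gt0//.
move=> [u v] [/= ub vb]; apply: sA => p pin.
rewrite opprD addrACA (splitr e); have [_ [pD _]] := ps_ p pin.
by apply: le_lt_trans (pD _ _) _; rewrite ltrD ?ub ?vb.
Qed.

Lemma sn_bound (ps : seq (V -> R)) (x : V) :
  (forall p, p \in ps -> P p /\ seminorm p) ->
  exists2 C, 0 < C & forall p, p \in ps -> p x < C.
Proof.
elim: ps => [|p ps ih] ps_; first by exists 1.
have [|C C0 CP] := ih; first by move=> q qin; apply: ps_; rewrite inE qin orbT.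
have px0 : 0 <= p x by apply/seminorm_ge0/(ps_ p _).2; rewrite mem_head.
exists (C + p x + 1) => [|q]; first by rewrite addr_gt0// ltr_wpDr.
rewrite inE => /orP[/eqP ->|/CP qC].
  by rewrite addrAC ltrDr addr_gt0.
by rewrite (lt_le_trans qC)// -addrA lerDl addr_ge0.
Qed.

Let sn_scale_continuous : continuous (fun z : R^o * L => z.1 *: z.2).
Proof.
move=> [a x] A [ps [e [ps_ e0 sA]]].
have [C C0 CP] := sn_bound x ps_.
pose d := e / 2 / (`|a| + 1).
have a1 : 0 < `|a| + 1 by rewrite ltr_wpDl.
have d0 : 0 < d by rewrite !divr_gt0.
pose r := Num.min 1 (e / 2 / C).
have r0 : 0 < r by rewrite lt_min ltr01 !divr_gt0.
exists (ball a r, sn_ball ps x d).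
  by split; [exact: (@nbhsx_ballx R R^o)|exists ps, d; split].
move=> [b u] [/= br ub]; apply: sA => p pin.
have [_ [pD pZ]] := ps_ p pin.
have -> : b *: u - a *: x = b *: (u - x) + (b - a) *: x.
  by rewrite scalerBr scalerBl subrKA.
apply: le_lt_trans (pD _ _) _; rewrite !pZ (splitr e).
have := br; rewrite -ball_normE /= distrC lt_min => /andP[br1 br2].
apply: ler_ltD.
  have bb : `|b| <= `|a| + 1.
    by rewrite -lerBlDl; apply: le_trans (lerB_dist _ _) (ltW br1).
  have -> : e / 2 = (`|a| + 1) * d by rewrite /d [RHS]mulrC divfK// gt_eqF.
  apply: ler_pM => //; first exact/seminorm_ge0/(ps_ p pin).2.
  exact: ltW (ub p pin).
have -> : e / 2 = (e / 2 / C) * C by rewrite divfK// gt_eqF.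
apply: (@le_lt_trans _ _ (`|b - a| * C)).
  by apply: ler_wpM2l => //; exact: ltW (CP p pin).
by rewrite ltr_pM2r.
Qed.

Lemma sn_ball_open (ps : seq (V -> R)) x e :
  (forall p, p \in ps -> P p /\ seminorm p) ->
  open (sn_ball ps x e : set L).
Proof.
move=> ps_; rewrite openE => y.
elim: ps ps_ => [|p ps ih] ps_ yb; first by exists [::], 1; split=> // p; rewrite in_nil.
have [||qs [d [qs_ d0 sub]]] := ih.
- by move=> q qin; apply: ps_; rewrite inE qin orbT.
- by move=> q qin; apply: yb; rewrite inE qin orbT.
have pye : p (y - x) < e by apply: yb; rewrite mem_head.
exists (p :: qs), (Num.min d (e - p (y - x))); split.
- by move=> q; rewrite inE => /orP[/eqP ->|/qs_//]; apply: ps_; rewrite mem_head.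
- by rewrite lt_min d0 subr_gt0.
move=> z zb q; rewrite inE => /orP[/eqP ->|qin].
  have [_ [pD _]] : P p /\ seminorm p by apply: ps_; rewrite mem_head.
  have := zb p (mem_head _ _); rewrite lt_min ltrBrDr => /andP[_].
  by apply: le_lt_trans; rewrite -(subrKA y); exact: pD.
apply: (sub z) qin => p' p'in.
by have := zb p'; rewrite inE p'in orbT lt_min => /(_ isT)/andP[].
Qed.

Let sn_locally_convex : exists2 B : set_system L,
  (forall b, b \in B -> convex_set b) & basis B.
Proof.
exists [set b | exists (ps : seq (V -> R)) x e, (forall p, p \in ps -> P p /\ seminorm p) /\
                  b = sn_ball ps x e].
  move=> b; rewrite inE => -[ps [x [e [ps_ ->]]]].
  apply/convex_setW => y z; rewrite !inE => yb zb l l0 l1; rewrite inE => p pin.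
  have [_ [pD pZ]] := ps_ p pin.
  rewrite [X in p X](_ : _ = l%:num *: ((y : V) - x) +
      (1 - l%:num) *: ((z : V) - x)); last first.
    rewrite !scalerBr addrACA -opprD -scalerDl.
    by rewrite [l%:num + _]addrC subrK scale1r.
  apply: le_lt_trans (pD _ _) _; rewrite !pZ.
  rewrite !ger0_norm ?subr_ge0 1?ltW//.
  have -> : e = l%:num * e + (1 - l%:num) * e.
    by rewrite -mulrDl addrC subrK mul1r.
  by rewrite ltrD// ltr_pM2l ?subr_gt0// ?yb ?zb.
split; first by move=> b [ps [x [e [ps_ ->]]]]; exact: sn_ball_open.
move=> x A [ps [e [ps_ e0 sA]]]; exists (sn_ball ps x e) => //.
by split; [exists ps, x, e|exact: sn_ball_center].
Qed.

HB.instance Definition _ := PreTopologicalLmod_isTvs.Build R L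
  sn_add_continuous sn_scale_continuous sn_locally_convex.
HB.instance Definition _ :=
  PreTopologicalNmodule_isTopologicalNmodule.Build L sn_add_continuous.
HB.instance Definition _ :=
  TopologicalNmodule_isTopologicalLmodule.Build R L sn_scale_continuous.
HB.instance Definition _ := Uniform_isTvs.Build R L sn_locally_convex.

End Seminorms.

Section WeightSequences.
Context {R : realType}.
Implicit Type M : nat -> R.

Definition weight_sequence M := (forall k, 0 < M k) /\ M 0 = 1 /\ 1 <= M 1.

Definition log_convex M := forall i j k : nat, (i < j < k)%N ->
  (k - i)%:R * ln (M j) <= (k - j)%:R * ln (M i) + (j - i)%:R * ln (M k).

Definition moderate_growth M := exists C : R, forall j k : nat,
  (0 < j)%N -> (0 < k)%N -> (M (j + k) / (M j * M k)) `^ ((j + k)%:R^-1) <= C.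

Definition root_to_infty M := M k `^ (k%:R^-1) @[k --> \oo] --> +oo.

End WeightSequences.

Variant dc_kind := Beurling | Roumieu.

Section Jets.
Context {R : realType} {E : normedModType R}.
Implicit Type K U : set E.

Definition sup_ge0 (A : set (\bar R)) : \bar R := ereal_sup (0%E |` A).

Definition opnorm k (phi : k.-tuple E -> R) : \bar R :=
  ereal_sup [set (`|phi v|)%:E | v in [set v : k.-tuple E |
    forall i, `|tnth v i| <= 1]].

Definition multilinear k (phi : k.-tuple E -> R) :=
  forall (i : 'I_k) (v : k.-tuple E) (a : R) (x y : E),
  let upd z := [tuple if j == i then z else tnth v j | j < k] in
  phi (upd (a *: x + y)) = a * phi (upd x) + phi (upd y).

Definition Lsym k (phi : k.-tuple E -> R) :=
  [/\ multilinear phi,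
      forall (s : 'S_k) v, phi [tuple tnth v (s i) | i < k] = phi v
    & (opnorm phi < +oo)%E].

(* phi k x v stands for phi^k(x)(v_1, ..., v_k); a jet on K is used only
   through its values at points of K. *)
Definition jet : Type := forall k : nat, E -> k.-tuple E -> R.

Definition jet_norm K (phi : jet) k : \bar R :=
  sup_ge0 [set opnorm (phi k x) | x in K].

Definition jet_remainder (phi : jet) n (y : E) k (x : E) (v : k.-tuple E) : R :=
  phi k x v -
  \sum_(j < n.+1) (j`!%:R)^-1 * phi (j + k)%N y [tuple of nseq j (x - y) ++ v].

Definition jet_remainder_norm K (phi : jet) n k : \bar R :=
  sup_ge0 [set ((n.+1)`!%:R / `|p.1 - p.2| ^+ n.+1)%:E *
               opnorm (@jet_remainder phi n p.2 k p.1)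
          | p in [set p : E * E | K p.1 /\ K p.2 /\ p.1 <> p.2]]%E.

Definition rho_norm (M : nat -> R) (rho : R) K (phi : jet) : \bar R :=
  let w m := ((m`!%:R * rho ^+ m * M m)^-1)%:E in
  maxe (ereal_sup [set jet_norm K phi m * w m | m in [set: nat]])%E
       (ereal_sup [set jet_remainder_norm K phi nk.1 nk.2 *
                       w (nk.1 + nk.2).+1 | nk in [set: nat * nat]])%E.

Definition C_rho (M : nat -> R) (rho : R) K (phi : jet) :=
  [/\ forall k x, K x -> Lsym (phi k x),
      forall k x, K x -> forall e : R, 0 < e ->
        \forall y \near x, K y ->
          (opnorm (fun v => phi k y v - phi k x v)%R <= e%:E)%E
    & (rho_norm M rho K phi < +oo)%E].

Definition CM_jet (kd : dc_kind) (M : nat -> R) K (phi : jet) :=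
  match kd with
  | Beurling => forall rho : R, 0 < rho -> C_rho M rho K phi
  | Roumieu => exists2 rho : R, 0 < rho & C_rho M rho K phi
  end.

(* Continuous seminorms of the locally convex space C^[M](E >= K, R).  The
   norms decrease in rho, so the projective limit topology is given by the
   single norms; a seminorm on the inductive limit is continuous iff its
   restriction to every step is. *)
Definition CM_jet_seminorm (kd : dc_kind) (M : nat -> R) K (q : jet -> R) :=
  [/\ forall phi psi, CM_jet kd M K phi -> CM_jet kd M K psi ->
        q (fun k x v => phi k x v + psi k x v) <= q phi + q psi,
      forall a phi, CM_jet kd M K phi ->
        q (fun k x v => a * phi k x v) = `|a| * q phi
    & match kd with
      | Beurling => exists2 rho : R, 0 < rho & exists C : R, forall phi,
          CM_jet Beurling M K phi ->
          ((q phi)%:E <= C%:E * rho_norm M rho K phi)%E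
      | Roumieu => forall rho : R, 0 < rho -> exists C : R, forall phi,
          C_rho M rho K phi -> ((q phi)%:E <= C%:E * rho_norm M rho K phi)%E
      end].

Definition jet_of (f : E -> R) : jet := fun k x v =>
  foldr (fun (h : E) (g : E -> R^o) (y : E) => 'D_h g y) f v x.

(* C^infty in the Frechet sense: every f^(k) takes values in L^k_sym(E, R) and
   has f^(k+1) as its derivative for the operator norm. *)
Definition frechet_smooth U (f : E -> R) :=
  let D : jet := jet_of f in
  forall k x, U x -> Lsym (D k x) /\
    forall e : R, 0 < e -> \forall h \near (0 : E),
      (opnorm (fun v => D k (x + h) v - D k x v -
                        D k.+1 x [tuple of h :: v])%R <= (e * `|h|)%:E)%E.

Definition banach_CM (kd : dc_kind) (M : nat -> R) U (f : E -> R) :=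
  frechet_smooth U f /\
  forall K, compact K -> convex_set K -> K `<=` U -> CM_jet kd M K (jet_of f).

End Jets.

Section Convenient.
Context {R : realType}.

(* Closed absolutely convex bounded sets.  The last field is automatic for a
   bounded set in a Hausdorff space, and all the spaces used below are
   Hausdorff; it makes the Minkowski functional a norm. *)
Record disk (E : tvsType R) := Disk {
  disk_set :> set E ;
  disk_closed : closed disk_set ;
  disk0 : disk_set 0 ;
  disk_absconvex : forall (a b : R) x y, disk_set x -> disk_set y ->
    `|a| + `|b| <= 1 -> disk_set (a *: x + b *: y) ;
  disk_bounded : forall U, nbhs (0 : E) U ->
    exists2 r : R, 0 < r & disk_set `<=` [set r *: x | x in U] ;
  disk_no_line : forall x, (forall r : R, disk_set (r *: x)) -> x = 0 }.

Definition disk_space (E : tvsType R) (B : disk E) : Type :=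
  spanType (disk_set B).

Definition minkowski (E : tvsType R) (B : set E) (x : E) : R :=
  inf [set r | 0 < r /\ B (r^-1 *: x)].

Section DiskSpace.
Variables (E : tvsType R) (B : disk E).
Local Notation EB := (disk_space B).
HB.instance Definition _ := GRing.Lmodule.on EB.

Definition disk_incl (x : EB) : E := span_val x.

Let gaugeset (x : E) := [set r : R | 0 < r /\ disk_set B (r^-1 *: x)].

Let absorb (x : EB) : gaugeset (disk_incl x) !=set0.
Proof.
rewrite /disk_incl; case: x => x /= /asboolP[s sB ->].
elim: s sB => [|p s ih] sB.
  exists 1; split=> //; rewrite big_nil scaler0; exact: disk0.
have [|r [r0 rB]] := ih; first by move=> q qs; apply: sB; rewrite inE qs orbT.
have Bp : disk_set B p.2 by apply: sB; rewrite mem_head.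
have c0 : 0 < `|p.1| + r by rewrite ltr_wpDl.
exists (`|p.1| + r); split=> //; rewrite big_cons scalerDr scalerA.
have -> : (`|p.1| + r)^-1 *: (\sum_(j <- s) j.1 *: j.2) =
    ((`|p.1| + r)^-1 * r) *: (r^-1 *: \sum_(j <- s) j.1 *: j.2).
  by rewrite scalerA mulfK// gt_eqF.
apply: disk_absconvex => //.
rewrite !normrM normfV !(gtr0_norm c0) (gtr0_norm r0) -mulrDr mulVf//.
by rewrite gt_eqF.
Qed.

Let gauge_lb (x : E) : lbound (gaugeset x) 0.
Proof. by move=> r [/ltW]. Qed.

Let gauge_le (x : E) r : gaugeset x r -> minkowski B x <= r.
Proof. by move=> xr; apply: ge_inf => //; exists 0; exact: gauge_lb. Qed.

Let gauge_scale_le (l : R) (x : EB) : l != 0 ->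
  minkowski B (l *: disk_incl x) <= `|l| * minkowski B (disk_incl x).
Proof.
move=> l0; rewrite -ler_pdivrMl ?normr_gt0//; apply: lb_le_inf.
  exact: absorb.
move=> r [r0 rB]; rewrite ler_pdivrMl ?normr_gt0//; apply: gauge_le; split.
  by rewrite mulr_gt0 ?normr_gt0.
have -> : (`|l| * r)^-1 *: (l *: disk_incl x) =
    (l / `|l|) *: (r^-1 *: disk_incl x) + 0 *: 0.
  by rewrite scaler0 addr0 !scalerA invfM; congr (_ *: _); ring.
apply: disk_absconvex => //; first exact: disk0.
by rewrite normr0 addr0 normrM normfV normr_id mulfV ?normr_eq0.
Qed.

Let gauge0 : minkowski B 0 = 0.
Proof.
have ge0 : 0 <= minkowski B 0.
  by apply: lb_le_inf; [exact: (absorb 0)|exact: gauge_lb].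
apply/eqP; rewrite eq_le ge0 andbT; apply/ler_addgt0Pl => e e0.
by rewrite addr0; apply: gauge_le; split=> //; rewrite scaler0; exact: disk0.
Qed.

Let normE (x : EB) : R := minkowski B (disk_incl x).

Let normE_D x y : normE (x + y) <= normE x + normE y.
Proof.
rewrite -lerBlDl; apply: lb_le_inf; first exact: absorb.
move=> b [b0 bB]; rewrite lerBlDl -lerBlDr; apply: lb_le_inf.
  exact: absorb.
move=> a [a0 aB]; rewrite lerBlDr; apply: gauge_le; split.
  exact: addr_gt0.
have ab0 : 0 < a + b by exact: addr_gt0.
have -> : (a + b)^-1 *: disk_incl (x + y) =
   (a / (a + b)) *: (a^-1 *: disk_incl x) +
   (b / (a + b)) *: (b^-1 *: disk_incl y).
  have w c : 0 < c -> c / (a + b) / c = (a + b)^-1.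
    by move=> c0; rewrite mulrAC mulfV ?mul1r// gt_eqF.
  by rewrite !scalerA !w// -scalerDr /disk_incl raddfD.
apply: disk_absconvex => //.
rewrite !normrM normfV !(gtr0_norm ab0) (gtr0_norm a0) (gtr0_norm b0).
by rewrite -mulrDl mulfV// gt_eqF.
Qed.

Let normE_Z (l : R) x : normE (l *: x) = `|l| * normE x.
Proof.
have incl_Z (a : R) (z : EB) : disk_incl (a *: z) = a *: disk_incl z.
  by [].
rewrite /normE incl_Z; have [->|l0] := eqVneq l 0.
  by rewrite scale0r gauge0 normr0 mul0r.
apply/eqP; rewrite eq_le gauge_scale_le//=.
rewrite -ler_pdivlMl ?normr_gt0// -normfV.
have := @gauge_scale_le l^-1 (l *: x); rewrite invr_eq0 => /(_ l0).
by rewrite incl_Z scalerA mulVf// scale1r.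
Qed.

Let normE_eq0 x : normE x = 0 -> x = 0.
Proof.
move=> x0; apply: val_inj => /=; apply: (@disk_no_line _ B) => r.
have [->|r0] := eqVneq r 0; first by rewrite scale0r; exact: disk0.
have rr : minkowski B (disk_incl x) < `|r|^-1.
  by rewrite [X in X < _]x0 invr_gt0 normr_gt0.
have [s [s0 sB] sr] := inf_lt (absorb x) rr.
have -> : r *: span_val x = (r * s) *: (s^-1 *: disk_incl x) + 0 *: 0.
  by rewrite scaler0 addr0 scalerA mulfK// gt_eqF.
apply: disk_absconvex => //; first exact: disk0.
rewrite normr0 addr0 normrM (gtr0_norm s0) mulrC -ler_pdivlMr ?normr_gt0//.
by rewrite mul1r ltW.
Qed.

HB.instance Definition _ := Lmodule_isNormed.Build R EB
  normE_D normE_Z normE_eq0.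

End DiskSpace.

Section Mappings.
Variables (E F : tvsType R).

Definition smooth_curve (G : tvsType R) (c : R -> G) :=
  exists2 d : nat -> R -> G, d 0 = c &
    forall k t, h^-1 *: (d k (t + h) - d k t) @[h --> (0 : R)^'] --> d k.+1 t.

Definition cinf_open (U : set E) :=
  forall c : R -> E, smooth_curve c -> open (c @^-1` U).

Definition smooth_map (U : set E) (f : E -> F) :=
  forall c : R -> E, smooth_curve c -> (forall t, U (c t)) ->
    smooth_curve (f \o c).

Variables (kd : dc_kind) (M : nat -> R).

Definition CM (U : set E) (f : E -> F) :=
  smooth_map U f /\
  forall l : {linear F -> R^o}, continuous l -> forall B : disk E,
    banach_CM kd M (@disk_incl E B @^-1` U) (l \o f \o @disk_incl E B).

(* Pull-backs to C^[M](U, F) of continuous seminorms under the maps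
   f |-> j^infty (l o f o i_B) | K; they generate its initial structure. *)
Definition CM_seminorm (U : set E) (p : (E -> F) -> R) :=
  exists (l : {linear F -> R^o}) (B : disk E) (K : set (disk_space B)) q,
    [/\ continuous l,
        [/\ compact K, convex_set K & K `<=` @disk_incl E B @^-1` U],
        CM_jet_seminorm kd M K q
      & forall f, p f = q (jet_of (l \o f \o @disk_incl E B))].

End Mappings.

End Convenient.

(* A set with charts in locally convex spaces, possibly carried by a subset of
   an ambient type. *)
Record charted (R : realType) := Charted {
  cpoint :> Type ;
  cset : set cpoint ;
  cidx : Type ;
  cmodel : cidx -> tvsType R ;
  cdom : cidx -> set cpoint ;
  cmap : forall i, cpoint -> cmodel i }.
Arguments cset {R} c _.
Arguments cdom {R} c i _.
Arguments cmap {R} c i _.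

Section Charted.
Context {R : realType}.
Implicit Type X Y : charted R.

Definition copen X (O : set X) :=
  forall i, cinf_open (cmap X i @` (cset X `&` cdom X i `&` O)).

Definition crestrict X (O : set X) : charted R :=
  @Charted R X (cset X `&` O) (cidx X) (@cmodel R X) (cdom X) (cmap X).

Definition cprod X Y : charted R :=
  @Charted R (X * Y)%type (cset X `*` cset Y) (cidx X * cidx Y)%type
    (fun ij => (cmodel ij.1 * cmodel ij.2)%type)
    (fun ij => cdom X ij.1 `*` cdom Y ij.2)
    (fun ij p => (cmap X ij.1 p.1, cmap Y ij.2 p.2)).

Variables (kd : dc_kind) (M : nat -> R).

Definition CM_map X Y (f : X -> Y) :=
  (forall x, cset X x -> cset Y (f x)) /\
  forall (i : cidx X) (j : cidx Y),
    let D := cset X `&` cdom X i `&` f @^-1` cdom Y j in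
    cinf_open (cmap X i @` D) /\
    exists2 phi : cmodel i -> cmodel j, CM kd M (cmap X i @` D) phi &
      forall x, D x -> phi (cmap X i x) = cmap Y j (f x).

End Charted.

Definition paracompact (T : topologicalType) :=
  forall C : set (set T), (forall O, C O -> open O) ->
    \bigcup_(O in C) O = [set: T] ->
  exists D : set (set T), [/\ forall O, D O -> open O,
    forall O, D O -> exists2 O', C O' & O `<=` O',
    \bigcup_(O in D) O = [set: T]
  & forall x : T, exists2 W, nbhs x W &
      finite_set [set O | D O /\ O `&` W !=set0]].

Record manifold (R : realType) (kd : dc_kind) (M : nat -> R) := Manifold {
  mpt :> topologicalType ;
  mdim : nat ;
  midx : Type ;
  mdom : midx -> set mpt ;
  mmap : midx -> mpt -> 'rV[R]_mdim ;
  minv : midx -> 'rV[R]_mdim -> mpt ;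
  m_hausdorff : hausdorff_space mpt ;
  m_paracompact : paracompact mpt ;
  m_cover : forall x, exists i, mdom i x ;
  m_dom_open : forall i, open (mdom i) ;
  m_cod_open : forall i, open (mmap i @` mdom i) ;
  m_mapK : forall i x, mdom i x -> minv i (mmap i x) = x ;
  m_map_continuous : forall i x, mdom i x -> {for x, continuous (mmap i)} ;
  m_inv_continuous : forall i x, mdom i x ->
    {for mmap i x, continuous (minv i)} ;
  m_compatible : forall i j,
    CM kd M (mmap i @` (mdom i `&` mdom j)) (mmap j \o minv i) }.

Section Manifolds.
Context {R : realType} {kd : dc_kind} {M : nat -> R}.

Definition charted_of (A : manifold kd M) : charted R :=
  @Charted R A setT (midx A) (fun _ => 'rV[R]_(mdim A)) (@mdom R kd M A)
    (@mmap R kd M A).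

Section Tangent.
Variable B : manifold kd M.
Local Notation n := (mdim B).

(* A tangent vector at b is the family of its coordinates in all the charts
   around b (and 0 for the other charts). *)
Definition tvector : Type := midx B -> 'rV[R]_n.
HB.instance Definition _ := GRing.Lmodule.on tvector.

Definition transition (i j : midx B) : 'rV[R]_n -> 'rV[R]_n :=
  @mmap _ _ _ B j \o @minv _ _ _ B i.

Definition is_tangent (b : B) (xi : tvector) :=
  (forall i, ~ mdom i b -> xi i = 0) /\
  (forall i j, mdom i b -> mdom j b ->
     xi j = 'D_(xi i) (transition i j) (mmap i b)).

Definition tangent_bundle : charted R :=
  @Charted R (B * tvector)%type [set p | is_tangent p.1 p.2] (midx B)
    (fun _ => ('rV[R]_n * 'rV[R]_n)%type)
    (fun i => [set p | mdom i p.1])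
    (fun i p => (mmap i p.1, p.2 i)).

Definition coord_vector (i : midx B) (b : B) (a : 'I_n) : tvector := fun j =>
  if `[< mdom j b >] then 'D_(delta_mx 0 a) (transition i j) (mmap i b) else 0.

Record metric := Metric {
  mform :> B -> tvector -> tvector -> R ;
  mform_sym : forall b xi eta, is_tangent b xi -> is_tangent b eta ->
    mform b xi eta = mform b eta xi ;
  mform_linear : forall b (a : R) xi eta zeta,
    is_tangent b xi -> is_tangent b eta -> is_tangent b zeta ->
    mform b (a *: xi + eta) zeta = a * mform b xi zeta + mform b eta zeta ;
  mform_pos : forall b xi, is_tangent b xi -> xi <> 0 -> 0 < mform b xi xi ;
  mform_CM : forall (i : midx B) (a c : 'I_n),
    CM kd M (@mmap _ _ _ B i @` mdom i) (fun y => mform (minv i y)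
      (coord_vector i (minv i y) a) (coord_vector i (minv i y) c) : R^o) }.

Section Geodesics.
Variable g : metric.

Definition gram (i : midx B) (y : 'rV[R]_n) : 'M[R]_n :=
  \matrix_(a, c) g (minv i y) (coord_vector i (minv i y) a)
                              (coord_vector i (minv i y) c).

Definition dgram i (a : 'I_n) (c d : 'I_n) (y : 'rV[R]_n) : R :=
  'D_(delta_mx 0 a) (fun z => gram i z c d : R^o) y.

Definition christoffel i y (k a c : 'I_n) : R :=
  2^-1 * \sum_(l < n) invmx (gram i y) k l *
    (dgram i a c l y + dgram i c a l y - dgram i l a c y).

Definition geodesic (I : set R) (gamma : R -> B) :=
  forall t, I t -> {for t, continuous gamma} /\
  forall i : midx B, mdom i (gamma t) ->
  let x : R -> 'rV[R]_n := @mmap _ _ _ B i \o gamma in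
  [/\ \forall s \near t, derivable x s 1,
      derivable (derive1 x) t 1
    & forall k, derive1 (derive1 x) t 0 k +
        \sum_(a < n) \sum_(c < n) christoffel i (x t) k a c *
          derive1 x t 0 a * derive1 x t 0 c = 0].

Definition velocity (gamma : R -> B) (t : R) : tvector := fun i =>
  if `[< mdom i (gamma t) >] then derive1 (@mmap _ _ _ B i \o gamma) t else 0.

(* The Riemannian exponential mapping on a neighborhood of the zero section
   on which (pi_B, exp) is a C^[M]-diffeomorphism onto an open neighborhood
   of the diagonal. *)
Record local_exp := LocalExp {
  exp_dom : set tangent_bundle ;
  rexp : tangent_bundle -> B ;
  exp_rng := (fun p : tangent_bundle => (p.1, rexp p)) @` exp_dom ;
  exp_dom_tangent : exp_dom `<=` cset tangent_bundle ;
  exp_dom_open : copen exp_dom ;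
  exp_dom_zero : forall b : B, exp_dom (b, 0 : tvector) ;
  exp_geodesic : forall b xi, exp_dom (b, xi) ->
    exists2 e : R, 0 < e & exists gamma : R -> B,
      [/\ geodesic `](- e), (1 + e)[%classic gamma, gamma 0 = b,
          velocity gamma 0 = xi & gamma 1 = rexp (b, xi)] ;
  exp_rng_open : open exp_rng ;
  exp_rng_diag : forall b : B, exp_rng (b, b) ;
  exp_diffeo :
    let TB := crestrict exp_dom in
    let BB := @crestrict R (cprod (charted_of B) (charted_of B)) exp_rng in
    exists inv_exp : BB -> TB,
    [/\ @CM_map R kd M TB BB (fun p => (p.1, rexp p)),
        @CM_map R kd M BB TB inv_exp
      & forall p, exp_dom p -> inv_exp (p.1, rexp p) = p] }.

End Geodesics.
End Tangent.

Section MappingSpace.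
Variables A B : manifold kd M.

Definition is_CM (f : A -> B) :=
  @CM_map R kd M (charted_of A) (charted_of B) f.

Section Sections.
Variable f : A -> B.

(* f^*TB is trivialised over the charts of A restricted to the sets
   U_i `&` f^-1 (V_j), for charts U_i of A and V_j of B. *)
Definition triv_dom (i : midx A) (j : midx B) : set 'rV[R]_(mdim A) :=
  @mmap _ _ _ A i @` (mdom i `&` f @^-1` mdom j).

Definition local_rep (i : midx A) (j : midx B) (s : A -> tvector B) :
    'rV[R]_(mdim A) -> 'rV[R]_(mdim B) :=
  fun y => s (minv i y) j.

Definition CM_sections : set (A -> tvector B) := [set s |
  (forall x, is_tangent (f x) (s x)) /\
  forall i j, CM kd M (triv_dom i j) (local_rep i j s)].

(* CM_sections is a linear subspace, hence equal to its span. *)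
Definition section_seminorms : set (spanType CM_sections -> R) := [set p |
  exists i j q, CM_seminorm kd M (triv_dom i j) q /\
    forall s : spanType CM_sections, p s = q (local_rep i j (span_val s))].

Definition section_space : tvsType R := locally_convex_type section_seminorms.

End Sections.

(* u_f is defined on U_f, with u_f(h)(x) = exp_{f(x)}^{-1}(h(x)); the default
   value of xget is irrelevant for C^[M] maps h in U_f. *)
Definition mapping_space (g : metric B) (e : local_exp g) : charted R :=
  @Charted R (A -> B) is_CM {f : A -> B | is_CM f}
    (fun f => section_space (sval f))
    (fun f => [set h | forall x, exp_rng e (sval f x, h x)])
    (fun f h => xget 0 [set s : section_space (sval f) | forall x,
       exp_dom e (sval f x, span_val s x) /\
       rexp e (sval f x, span_val s x) = h x]).

End MappingSpace.
End Manifolds.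

(* Main.v *)
(**
  A map between mapping spaces is tested along smooth curves and along the
  Banach spaces E_B, that is, on families (t, x) |-> G t x with t in T = R or
  T = E_B.  Call such a family good if, in charts, its germs are smooth and all
  its t-derivatives satisfy the Denjoy-Carleman estimates in x (jointly in t and
  x if T = E_B).  Good germs are stable under composition.  A bounded set of
  C^[M]-sections satisfies uniform estimates, also in the Roumieu case, so that a
  smooth curve of sections and a bounded linear map from E_B to sections are good
  families.  Composing them with exp, with each other and with the inverse of
  (pi, exp) shows that composition, read in exponential charts, maps good families
  to good families, on a domain that is open by compactness of A1 and A2.
  Conversely, by Taylor's formula with the estimates uniform on compact sets, a
  good family of sections is smooth as a map into the space of sections, and its
  composite with a continuous functional is C^[M] if T = E_B.  The
  finite dimensional charts have open domains because c^infty-open subsets of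
  normed spaces are open.
*)

From HB Require Import structures.
From mathcomp Require Import all_boot all_order all_algebra perm.
From mathcomp Require Import all_classical all_reals all_analysis.
From mathcomp Require Import ring lra zify.
Require Import Defs.

Set Implicit Arguments.
Unset Strict Implicit.
Unset Printing Implicit Defensive.

Import Order.TTheory GRing.Theory Num.Theory.
Import numFieldNormedType.Exports.

Local Open Scope classical_set_scope.
Local Open Scope ring_scope.

(** * Directional derivatives *)

(** No derivative is Banach valued: functions are scalar, and their derivatives are the scalars
    attached to finite lists of directions. Smoothness alone is recorded along a set [D] of
    directions, estimates along a set [V]. In the parameter, a curve of sections has every direction
    in [D] and none in [V], a Banach family none in [D] and the unit ball in [V]; one composition
    theorem serves both. Its inner maps are a linear map plus finitely many scalar functions times
    fixed vectors: the linear part carries the parameter, possibly of infinite dimension, and the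
    rest the coordinates in charts. Log-convexity controls products and compositions. Moderate
    growth keeps derivatives in the class and splits the weight of order j + k into one weight in t
    and one in x; the latter is consumed by a seminorm of the section space, the former remains as
    the estimate of the composite with a functional. The obstacle in the Roumieu case is that a
    bounded set of sections is only known to be bounded for each continuous seminorm. A common [rho]
    is extracted by building, from supposed counterexamples, a continuous seminorm that is unbounded
    on the set. *)

Section EpsilonDifferentials.
Context {R : realType} {E F : normedModType R}.
Implicit Types (f : E -> F).

Lemma near_addl (y : E) (P : E -> Prop) :
  (\forall x \near y, P x) -> \forall h \near (0 : E), P (y + h).
Proof.
move=> Py; have c : {for (0 : E), continuous (fun h => y + h)}.
  by apply: cvgD; [exact: cvg_cst|exact: cvg_id].
by apply: (c P); rewrite addr0.
Qed.

Lemma near_dist (x : E) (P : E -> Prop) : (\forall y \near x, P y) ->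
  exists2 d : R, 0 < d & forall y, `|y - x| < d -> P y.
Proof.
move=> /nbhs_ballP[d /= d0 dP]; exists d => // y yd; apply: dP.
by rewrite -ball_normE /= distrC.
Qed.

Lemma dist_near (x : E) (d : R) (P : E -> Prop) : 0 < d ->
  (forall y, `|y - x| < d -> P y) -> \forall y \near x, P y.
Proof.
move=> d0 dP; apply/nbhs_ballP; exists d => //= y; rewrite -ball_normE /= distrC.
exact: dP.
Qed.

Lemma differentiable_eps f x (df : {linear E -> F}) : continuous df ->
  (forall e : R, 0 < e -> \forall h \near (0 : E),
     `|f (x + h) - f x - df h| <= e * `|h|) ->
  differentiable f x /\ 'd f x = df :> (E -> F).
Proof.
move=> cdf H.
have fE : f \o shift x = cst (f x) + df +o_ (0 : E) id.
  apply/eqaddoP => e e0; apply: filterS (H e e0) => h.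
  by rewrite /= !fctE [h + x]addrC opprD addrA.
have dfE : 'd f x = df :> (E -> F) by exact: diff_unique.
by split=> //; apply/diff_locallyP; rewrite dfE.
Qed.

Lemma differentiable_epsP f x e : differentiable f x -> 0 < e ->
  \forall h \near (0 : E), `|f (x + h) - f x - 'd f x h| <= e * `|h|.
Proof.
move=> /diff_locallyP[_ /eqaddoP H] e0; apply: filterS (H e e0) => h.
by rewrite /= !fctE [h + x]addrC opprD addrA.
Qed.

Lemma near_eq_differentiable f g y : (\forall x \near y, f x = g x) ->
  differentiable f y -> differentiable g y.
Proof.
move=> fg df.
apply: (proj1 (@differentiable_eps g y ('d f y) (diff_continuous df) _)).
move=> e e0; have fg' := near_addl fg.
rewrite -(nbhs_singleton fg).
by apply: filterS2 fg' (differentiable_epsP df e0) => h /= <-.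
Qed.

End EpsilonDifferentials.

Section DirectionalDerivatives.
Context {R : realType} {E : normedModType R}.
Implicit Types (f g : E -> R) (U : set E) (vs : seq E).

(** [jet_of] on lists instead of tuples. The head of [vs] is the outermost derivative: [cons]
    differentiates the result once more, [rcons] replaces the function by one of its derivatives. *)
Definition dird f vs : E -> R :=
  foldr (fun (h : E) (g : E -> R^o) (y : E) => 'D_h g y) f vs.

Lemma dird_rcons f vs v :
  dird f (rcons vs v) = dird ('D_v (f : E -> R^o)) vs.
Proof. by rewrite /dird foldr_rcons. Qed.

Lemma dird_cat f vs ws : dird f (vs ++ ws) = dird (dird f ws) vs.
Proof. by rewrite /dird foldr_cat. Qed.

Lemma near_eq_dird f g (z : E) vs : (\forall y \near z, f y = g y) ->
  \forall y \near z, dird f vs y = dird g vs y.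
Proof.
move=> fg; elim: vs => [|v vs ih] //=.
by apply: filterS (near_join ih) => y yfg; exact: near_eq_derive.
Qed.

Lemma eq_dird_on U f g vs : open U -> (forall y, U y -> f y = g y) ->
  forall y, U y -> dird f vs y = dird g vs y.
Proof.
move=> oU fg y Uy; have /near_eq_dird : \forall x \near y, f x = g x.
  exact: filterS fg (open_nbhs_nbhs (conj oU Uy)).
by move=> /(_ vs)/nbhs_singleton.
Qed.

(** The derivatives up to order [n] are themselves differentiable, so the regularity is one order
    beyond [n], and [smt 0] is differentiability. Continuity of the derivatives comes with their
    differentiability. *)
Definition smt n U f := forall y, U y -> forall vs, (size vs <= n)%N ->
  differentiable (dird f vs) y.

Definition smo U f := forall y, U y -> forall vs, differentiable (dird f vs) y.

Lemma smo_smt n U f : smo U f -> smt n U f.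
Proof. by move=> fU y Uy vs _; exact: fU. Qed.

Lemma smt_smo U f : (forall n, smt n U f) -> smo U f.
Proof. by move=> fU y Uy vs; exact: (fU (size vs)). Qed.

Lemma smo_sub U V f : U `<=` V -> smo V f -> smo U f.
Proof. by move=> UV fV y /UV; exact: fV. Qed.

Lemma smo_differentiable U f y : smo U f -> U y -> differentiable f y.
Proof. by move=> fU Uy; exact: (fU y Uy [::]). Qed.

Lemma smt_leq m n U f : (m <= n)%N -> smt n U f -> smt m U f.
Proof. by move=> mn fU y Uy vs vsm; apply: fU => //; exact: leq_trans mn. Qed.

Lemma smt_dird n U f vs : smt (n + size vs) U f -> smt n U (dird f vs).
Proof.
by move=> fU y Uy ws wsn; rewrite -dird_cat; apply: fU; rewrite // size_cat leq_add2r.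
Qed.

Lemma smo_dird U f vs : smo U f -> smo U (dird f vs).
Proof. by move=> fU y Uy ws; rewrite -dird_cat; exact: fU. Qed.

Lemma smt_derive n U f v : smt n.+1 U f -> smt n U ('D_v (f : E -> R^o)).
Proof. by rewrite -addn1; exact: (@smt_dird n U f [:: v]). Qed.

Lemma smt_differentiable n U f y : smt n U f -> U y -> differentiable f y.
Proof. by move=> fU Uy; exact: (fU y Uy [::]). Qed.

(** Recursion through the innermost derivative; the rules for sums, products and composites follow
    from it by induction on [n]. *)
Lemma smtP n U f : open U ->
  smt n.+1 U f <-> (forall y, U y -> differentiable f y) /\
    forall v, smt n U ('D_v (f : E -> R^o)).
Proof.
move=> oU; split=> [fU|[f0 fU] y Uy vs].
  by split=> [y Uy|v]; [exact: (smt_differentiable fU)|exact: smt_derive].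
case/lastP: vs => [_|vs v]; first exact: f0.
by rewrite size_rcons ltnS dird_rcons => vsn; exact: fU.
Qed.

Lemma eq_smt n U f g : open U -> (forall y, U y -> f y = g y) ->
  smt n U f -> smt n U g.
Proof.
move=> oU fg fU y Uy vs vsn; apply: near_eq_differentiable (fU y Uy vs vsn).
apply: near_eq_dird.
exact: filterS fg (open_nbhs_nbhs (conj oU Uy)).
Qed.

Lemma deriveDr f (y v w : E) (a : R) : differentiable f y ->
  'D_(a *: v + w) (f : E -> R^o) y = a * 'D_v (f : E -> R^o) y + 'D_w (f : E -> R^o) y.
Proof.
by move=> df; rewrite !deriveE// linearP.
Qed.

Lemma smtD n U f g : open U -> smt n U f -> smt n U g ->
  smt n U (fun y => f y + g y).
Proof.
move=> oU; elim: n f g => [|n ih] f g.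
  move=> fU gU y Uy [|//] _; apply: differentiableD.
    exact: (fU y Uy [::]).
  exact: (gU y Uy [::]).
move=> /(smtP _ _ oU)[f0 fU] /(smtP _ _ oU)[g0 gU].
apply/(smtP _ _ oU); split=> [y Uy|v]; first by apply: differentiableD; [exact: f0|exact: g0].
apply: (eq_smt oU) (ih _ _ (fU v) (gU v)) => y Uy /=.
by rewrite deriveD//; apply: diff_derivable; [exact: f0|exact: g0].
Qed.

Lemma smtM n U f g : open U -> smt n U f -> smt n U g ->
  smt n U (fun y => f y * g y).
Proof.
move=> oU; elim: n f g => [|n ih] f g.
  move=> fU gU y Uy [|//] _; apply: differentiableM.
    exact: (fU y Uy [::]).
  exact: (gU y Uy [::]).
move=> fS gS; have /(smtP _ _ oU)[f0 fU] := fS; have /(smtP _ _ oU)[g0 gU] := gS.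
apply/(smtP _ _ oU); split=> [y Uy|v]; first by apply: differentiableM; [exact: f0|exact: g0].
have H1 := ih _ _ (fU v) (smt_leq (leqnSn n) gS).
have H2 := ih _ _ (smt_leq (leqnSn n) fS) (gU v).
apply: (eq_smt oU) (smtD oU H1 H2) => y Uy /=.
rewrite [RHS]deriveM; last 2 first.
- by apply: diff_derivable; exact: f0.
- by apply: diff_derivable; exact: g0.
by rewrite addrC; congr (_ + _); exact: mulrC.
Qed.

Lemma dird_cst (c : R) vs y : dird (fun=> c) vs y = if vs is [::] then c else 0.
Proof.
elim: vs y => [//|v vs ih] y; rewrite [LHS]/=.
have -> : dird (fun=> c) vs = cst (if vs is [::] then c else 0).
  by apply/funext => x; rewrite ih.
exact: derive_cst.
Qed.

Lemma smt_cst n U (c : R) : smt n U (fun=> c).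
Proof.
move=> y _ vs _.
have -> : dird (fun=> c) vs = cst (if vs is [::] then c else 0).
  by apply/funext => x; exact: dird_cst.
exact: differentiable_cst.
Qed.

Lemma smt_sum n U N (f : 'I_N -> E -> R) : open U -> (forall i, smt n U (f i)) ->
  smt n U (fun y => \sum_(i < N) f i y).
Proof.
move=> oU; elim: N f => [|N ih] f fU.
  by apply: (eq_smt oU) (@smt_cst n U 0) => y _; rewrite big_ord0.
apply: (eq_smt oU _ (smtD oU (ih _ (fun i => fU (widen_ord (leqnSn N) i))) (fU ord_max))).
by move=> y _; rewrite big_ord_recr.
Qed.

End DirectionalDerivatives.

Section AffineSubstitution.
Context {R : realType} {E E' : normedModType R}.

Lemma derive_affine (f : E -> R) (A : E' -> E) (x v : E') (v' : E) :
  (forall h : R, A (h *: v + x) = h *: v' + A x) ->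
  'D_v (fun y => f (A y) : R^o) x = 'D_v' (f : E -> R^o) (A x).
Proof.
move=> Av; rewrite /derive.
suff -> : (fun h : R => h^-1 *: (((fun y => f (A y) : R^o) \o shift x) (h *: v) - f (A x))) =
  (fun h : R => h^-1 *: (((f : E -> R^o) \o shift (A x)) (h *: v') - f (A x))) by [].
by apply/funext => h /=; rewrite Av.
Qed.

Lemma dird_affine (f : E -> R) (A : E' -> E) (B : E' -> E) (vs : seq E') x :
  (forall (h : R) v x, A (h *: v + x) = h *: B v + A x) ->
  dird (fun y => f (A y)) vs x = dird f (map B vs) (A x).
Proof.
move=> AB; elim: vs x => [//|v vs ih] x /=.
have -> : dird (fun y => f (A y)) vs = (fun y => dird f (map B vs) (A y)).
  exact/funext.
exact: derive_affine.
Qed.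

End AffineSubstitution.

(** * Composition of smooth functions *)

Section Lines.
Context {R : realType} {E : normedModType R}.
Implicit Types (f g : E -> R) (U : set E) (vs : seq E).

Lemma is_derive_line f (y v : E) (s : R) : derivable f (y + s *: v) v ->
  is_derive s (1 : R) (fun t : R => f (y + t *: v) : R^o) ('D_v (f : E -> R^o) (y + s *: v)).
Proof.
move=> df.
have qE : (fun h : R => h^-1 *: ((f \o (fun t : R => y + t *: v)) (h *: (1 : R) + s) -
     f (y + s *: v))) =
   (fun h : R => h^-1 *: (f (h *: v + (y + s *: v)) - f (y + s *: v))).
  apply/funext => h /=; congr (_ *: (f _ - _)).
  by rewrite [h *: 1]mulr1 scalerDl addrCA.
apply: DeriveDef; rewrite /derivable /derive /=.
- by move: df; rewrite /derivable -qE.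
- by rewrite -[RHS]/(lim _) -qE.
Qed.

Lemma MVT_line f (y v : E) :
  (forall s : R, 0 <= s <= 1 -> differentiable f (y + s *: v)) ->
  exists2 c : R, 0 <= c <= 1 & f (y + v) - f y = 'D_v (f : E -> R^o) (y + c *: v).
Proof.
move=> df.
have dl (s : R) : 0 <= s <= 1 -> is_derive s (1 : R) (fun t : R => f (y + t *: v) : R^o) ('D_v (f : E -> R^o) (y + s *: v)).
  by move=> s01; apply: is_derive_line; apply: diff_derivable; exact: df.
have [||c c01] := @MVT_segment R (fun t => f (y + t *: v)) (fun s => 'D_v (f : E -> R^o) (y + s *: v)) 0 1 ler01.
- by move=> s; rewrite in_itv /= => /andP[s0 s1]; apply: dl; rewrite !ltW.
- apply: derivable_within_continuous => s; rewrite in_itv /= => /dl ds.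
  by case: ds.
rewrite scale1r scale0r addr0 subr0 mulr1 => ->; exists c => //.
Qed.

(* The mean value theorem for [x |-> f (x + h w) - f x], so that only the
   differentiability of [f] near [y] and of [D_v f] at [y] is used. *)
Let secdiff_bound f y (v w : E) (e : R) : 0 < e ->
  (\forall x \near y, differentiable f x) ->
  differentiable ('D_v (f : E -> R^o)) y ->
  \forall h \near (0 : R)^'+,
  `|f (y + h *: v + h *: w) - f (y + h *: v) - (f (y + h *: w) - f y)
    - h ^+ 2 * 'D_w ('D_v (f : E -> R^o) : E -> R^o) y| <= e * h ^+ 2.
Proof.
move=> e0 nf dg; set g := 'D_v (f : E -> R^o).
have L0 : 0 < `|v| + `|w| + 1 by rewrite ltr_wpDl// addr_ge0.
pose e' := e / 2 / (`|v| + `|w| + 1).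
have e'0 : 0 < e' by rewrite !divr_gt0.
have [d d0 dP] := near_dist (filterI (near_addl nf) (differentiable_epsP dg e'0)).
near=> h.
have h0 : 0 < h by near: h; exact: nbhs_right_gt.
have hd : h * (`|v| + `|w| + 1) < d.
  rewrite -ltr_pdivlMr//; near: h; apply: nbhs_right_lt; exact: divr_gt0.
have kb (a b : R) : 0 <= a <= h -> 0 <= b <= h -> `|a *: v + b *: w| <= h * (`|v| + `|w| + 1).
  move=> /andP[a0 ah] /andP[b0 bh]; apply: le_trans (ler_normD _ _) _.
  rewrite !normrZ !ger0_norm// !mulrDr mulr1.
  by rewrite ler_wpDr ?(ltW h0)// lerD// ler_wpM2r.
have kd (a b : R) : 0 <= a <= h -> 0 <= b <= h -> `|(a *: v + b *: w) - 0| < d.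
  by move=> ah bh; rewrite subr0 (le_lt_trans (kb a b ah bh)).
pose phi (x : E) := f (x + h *: w) - f x.
have hh : 0 <= h <= h by rewrite lexx ltW.
have zh : (0 : R) <= 0 <= h by rewrite lexx ltW.
have sc (s : R) : 0 <= s <= 1 -> 0 <= s * h <= h.
  move=> /andP[s0 s1]; rewrite mulr_ge0 ?(ltW h0)//=.
  by rewrite ler_piMl// ltW.
have dfs (a b : R) : 0 <= a <= h -> 0 <= b <= h -> differentiable f (y + (a *: v + b *: w)).
  by move=> ah bh; have [] := dP _ (kd a b ah bh).
have dphi1 (s : R) : 0 <= s <= 1 ->
    differentiable (fun x => f (x + h *: w)) (y + s *: (h *: v)).
  move=> s01; apply: (@differentiable_comp _ _ _ _ (fun x => x + h *: w) f).
    apply: differentiableD; [exact: (@ex_diff _ _ _ _ _ id)|exact: differentiable_cst].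
  rewrite scalerA -addrA; apply: dfs => //; exact: sc.
have dphi2 (s : R) : 0 <= s <= 1 ->
    differentiable f (y + s *: (h *: v)).
  move=> s01; rewrite scalerA -[s * h *: v]addr0 -(scale0r w).
  by apply: dfs => //; exact: sc.
have [s s01|c c01] := @MVT_line phi y (h *: v).
  by apply: differentiableB; [exact: dphi1|exact: dphi2].
rewrite {1 2}/phi => ->.
have -> : 'D_(h *: v) (phi : E -> R^o) (y + c *: (h *: v)) =
   h * (g (y + (c * h *: v + h *: w)) - g (y + (c * h *: v))).
  rewrite [LHS]deriveB; last 2 first.
  - exact/diff_derivable/dphi1.
  - exact/diff_derivable/dphi2.
  have DZ x : differentiable f x -> 'D_(h *: v) (f : E -> R^o) x = h * g x.
    by move=> dx; rewrite /g !deriveE// linearZ.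
  have -> : 'D_(h *: v) (fun x => f (x + h *: w) : R^o) (y + c *: (h *: v)) =
    'D_(h *: v) (f : E -> R^o) (y + c *: (h *: v) + h *: w).
    by apply: (@derive_affine _ _ _ f (fun x => x + h *: w)) => t; exact: esym (addrA _ _ _).
  rewrite !DZ; last 2 first.
  - exact: dphi2.
  - rewrite scalerA -addrA; apply: dfs => //; exact: sc.
  by rewrite mulrBr scalerA addrA.
have [_ /= P1] := dP _ (kd (c * h) h (sc _ c01) hh).
have [_ /= P2] := dP _ (kd (c * h) 0 (sc _ c01) zh).
have b1 := kb (c * h) h (sc _ c01) hh.
have b2 := kb (c * h) 0 (sc _ c01) zh.
have e1 : e' * (h * (`|v| + `|w| + 1)) = e / 2 * h.
  by rewrite /e' [h * _]mulrC mulrA divfK// gt_eqF.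
have {}P1 : `|g (y + (c * h *: v + h *: w)) - g y - 'd g y (c * h *: v + h *: w)| <= e / 2 * h.
  by rewrite -e1; apply: le_trans P1 _; rewrite ler_wpM2l// ltW.
have {}P2 : `|g (y + (c * h *: v)) - g y - 'd g y (c * h *: v)| <= e / 2 * h.
  rewrite -e1; move: P2 b2; rewrite scale0r addr0 => P2 b2.
  by apply: le_trans P2 _; rewrite ler_wpM2l// ltW.
rewrite [in X in _ - X](deriveE _ dg).
rewrite expr2 -mulrA -mulrBr normrM (gtr0_norm h0) mulrCA ler_wpM2l ?(ltW h0)//.
have -> : e * h = e / 2 * h + e / 2 * h by rewrite -mulrDl -splitr.
apply: le_trans (lerD P1 P2); apply: le_trans (ler_normB _ _).
have dE : 'd g y (c * h *: v + h *: w) = 'd g y (c * h *: v) + h * 'd g y w.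
  by rewrite linearD; congr (_ + _); exact: linearZ.
rewrite dE le_eqVlt; apply/orP; left; apply/eqP; congr `| _ |.
ring.
Unshelve. all: by end_near.
Qed.

(** The second difference of [f] along [h *: v] and [h *: w] is symmetric, and [secdiff_bound]
    compares it with either mixed derivative. *)
Lemma derive_commute U f (y v w : E) : open U -> smt 2 U f -> U y ->
  'D_w ('D_v (f : E -> R^o) : E -> R^o) y = 'D_v ('D_w (f : E -> R^o) : E -> R^o) y.
Proof.
move=> oU fU Uy.
have nf : \forall x \near y, differentiable f x.
  by apply: filterS (open_nbhs_nbhs (conj oU Uy)) => x Ux; exact: smt_differentiable fU Ux.
have dv : differentiable ('D_v (f : E -> R^o)) y := fU y Uy [:: v] isT.
have dw : differentiable ('D_w (f : E -> R^o)) y := fU y Uy [:: w] isT.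
suff H (e : R) : 0 < e ->
    `|'D_w ('D_v (f : E -> R^o) : E -> R^o) y - 'D_v ('D_w (f : E -> R^o) : E -> R^o) y| <= e.
  by apply/eqP; rewrite -subr_eq0 -normr_le0; apply/ler_addgt0Pl => e e0; rewrite addr0 H.
move=> e0; have e2 : 0 < e / 2 by exact: divr_gt0.
(* One [h > 0] small enough for both comparisons. *)
have [h [[A B] h0]] := filter_ex (filterI (filterI (secdiff_bound w e2 nf dv)
  (secdiff_bound v e2 nf dw)) (nbhs_right_gt (0 : R))).
rewrite /= in h0.
rewrite -(@ler_pM2r _ (h ^+ 2)) ?exprn_gt0// (splitr e) [(_ + _) * _]mulrDl.
apply: le_trans (lerD B A); apply: le_trans (ler_normB _ _).
rewrite -[X in _ * X]gtr0_norm ?exprn_gt0// -normrM.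
have alg (a b c d p q k : R) :
    (p - q) * k = a - c - (b - d) - k * q - (a - b - (c - d) - k * p) by ring.
by rewrite (addrAC y (h *: w)) -alg.
Qed.

Lemma dird_swap f U vs ws (v w : E) y : open U -> smo U f -> U y ->
  dird f (vs ++ v :: w :: ws) y = dird f (vs ++ w :: v :: ws) y.
Proof.
move=> oU fU Uy; rewrite !dird_cat.
apply: (eq_dird_on vs oU _ Uy) => x Ux.
have := derive_commute w v oU (smo_smt (smo_dird ws fU)) Ux.
exact.
Qed.

Lemma dird_perm f U vs ws y : open U -> smo U f -> perm_eq vs ws -> U y ->
  dird f vs y = dird f ws y.
Proof.
move=> oU fU; elim: vs ws y => [|v vs ih] ws y.
  by rewrite perm_sym => /perm_nilP ->.
move=> vws Uy; have : v \in ws by rewrite -(perm_mem vws) mem_head.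
move=> /path.splitPr wsE; case: wsE vws => p1 p2 vws.
have {}vws : perm_eq vs (p1 ++ p2).
  by rewrite -(perm_cons v) (perm_trans vws)// perm_sym -cat1s perm_catCA.
have -> : dird f (v :: vs) y = dird f (v :: p1 ++ p2) y.
  by apply: (eq_dird_on [:: v] oU _ Uy) => x Ux; exact: ih.
elim: p1 {ih vws} y Uy => [//|w p1 ih] y Uy.
rewrite (@dird_swap f U [::] (p1 ++ p2) v w)//.
by apply: (eq_dird_on [:: w] oU _ Uy) => x Ux; exact: ih.
Qed.

(** The outermost position is linear because the differential is; symmetry brings any other position
    there. *)
Lemma dird_linear U f vs (v w : E) (a : R) ws y : open U -> smo U f -> U y ->
  dird f (vs ++ (a *: v + w) :: ws) y =
  a * dird f (vs ++ v :: ws) y + dird f (vs ++ w :: ws) y.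
Proof.
move=> oU fU Uy.
have front u : dird f (vs ++ u :: ws) y = dird f (u :: vs ++ ws) y.
  by apply: (dird_perm oU fU _ Uy); rewrite -cat1s perm_catCA.
rewrite !front; have := deriveDr v w a (smo_differentiable (smo_dird (vs ++ ws) fU) Uy).
exact.
Qed.

End Lines.

(** * Chain rule for maps with a linear part and finitely many scalar coefficients *)

Section Composition.
Context {R : realType} {X Z : normedModType R} (N : nat).
Variables (L : {linear X -> Z}) (G : 'I_N -> X -> R) (z : 'I_N -> Z).
Hypothesis cL : continuous L.

(** The inner maps of all compositions: [L] may act between infinite dimensional spaces, and the
    nonlinear part has finite rank, so that the chain rule involves only scalar functions. *)
Definition fsum (x : X) : Z := L x + \sum_(i < N) G i x *: z i.

Lemma is_diff_fsum y : (forall i, differentiable (G i) y) ->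
  differentiable fsum y /\
  forall v, 'd fsum y v = L v + \sum_(i < N) 'D_v (G i : X -> R^o) y *: z i.
Proof.
move=> dG.
have dGz i : differentiable (fun x => G i x *: z i) y by exact: differentiableZl.
have dS : differentiable (\sum_(i < N) (fun x => G i x *: z i)) y.
  exact: differentiable_sum.
have dL : differentiable L y by exact: linear_differentiable.
have fE : fsum = (L : X -> Z) + \sum_(i < N) (fun x => G i x *: z i).
  by apply/funext => x; rewrite fctE; congr (_ + _); rewrite fct_sumE.
have df : differentiable fsum y by rewrite fE; exact: differentiableD.
split=> // v; rewrite -deriveE// fE deriveD; last 2 first.
- exact: diff_derivable.
- exact: diff_derivable.
rewrite deriveE// diff_lin//; congr (_ + _).
rewrite derive_sum; last by move=> i; exact: diff_derivable.
by apply: eq_bigr => i _; rewrite deriveE// diffZl// deriveE.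
Qed.

Lemma derive_comp_fsum (g : Z -> R) y v :
  (forall i, differentiable (G i) y) -> differentiable g (fsum y) ->
  differentiable (fun x => g (fsum x)) y /\
  'D_v (fun x => g (fsum x) : R^o) y = 'D_(L v) (g : Z -> R^o) (fsum y) +
    \sum_(i < N) 'D_(z i) (g : Z -> R^o) (fsum y) * 'D_v (G i : X -> R^o) y.
Proof.
move=> dG dg; have [df dfE] := is_diff_fsum dG.
have dgf : differentiable (fun x => g (fsum x)) y.
  exact: (@differentiable_comp _ _ _ _ fsum g).
split=> //; rewrite deriveE// (@diff_comp _ _ _ _ fsum g)//= dfE.
rewrite linearD -deriveE//; congr (_ + _).
by rewrite linear_sum; apply: eq_bigr => i _; rewrite linearZ /= -deriveE// mulrC.
Qed.

Lemma smt_comp_fsum n (U : set X) (V : set Z) (g : Z -> R) : open U -> open V ->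
  (forall i, smt n U (G i)) -> smt n V g -> (forall y, U y -> V (fsum y)) ->
  smt n U (fun x => g (fsum x)).
Proof.
move=> oU oV; elim: n g => [|n ih] g GU gV UV.
  move=> y Uy [|//] _; apply: (proj1 (derive_comp_fsum 0 _ _)).
    by move=> i; exact: smt_differentiable (GU i) Uy.
  by apply: smt_differentiable gV _; exact: UV.
have dGy y i : U y -> differentiable (G i) y by exact: smt_differentiable.
have dgy y : U y -> differentiable g (fsum y).
  by move=> /UV; exact: smt_differentiable gV.
apply/smtP => //; split=> [y Uy|v].
  by apply: (proj1 (derive_comp_fsum 0 _ _)) => [i|]; [exact: dGy|exact: dgy].
have GU' i : smt n U (G i) by apply: smt_leq (GU i).
have H1 : smt n U (fun y => 'D_(L v) (g : Z -> R^o) (fsum y)).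
  by apply: (ih ('D_(L v) (g : Z -> R^o)) GU') => //; exact: smt_derive.
have H2 : smt n U (fun y => \sum_(i < N)
    'D_(z i) (g : Z -> R^o) (fsum y) * 'D_v (G i : X -> R^o) y).
  apply: smt_sum => // i; apply: smtM => //; last exact: smt_derive.
  by apply: (ih ('D_(z i) (g : Z -> R^o)) GU') => //; exact: smt_derive.
apply: (eq_smt oU) (smtD oU H1 H2) => y Uy.
by rewrite (proj2 (derive_comp_fsum v _ _))// => [i|]; [exact: dGy|exact: dgy].
Qed.

Lemma smo_comp_fsum (U : set X) (V : set Z) (g : Z -> R) : open U -> open V ->
  (forall i, smo U (G i)) -> smo V g -> (forall y, U y -> V (fsum y)) ->
  smo U (fun x => g (fsum x)).
Proof.
move=> oU oV GU gV UV; apply: smt_smo => n.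
apply: (smt_comp_fsum oU oV) UV => [i|]; exact: smo_smt.
Qed.

End Composition.

(** * Denjoy-Carleman weights *)

Section DirdAlgebra.
Context {R : realType} {E : normedModType R}.
Implicit Types (f g : E -> R) (U V : set E) (vs : seq E).

Lemma dirdD U f g vs y : open U -> smo U f -> smo U g -> U y ->
  dird (fun x => f x + g x) vs y = dird f vs y + dird g vs y.
Proof.
move=> oU fU gU; elim: vs y => [//|v vs ih] y Uy.
rewrite -[LHS]/(dird (dird (fun x => f x + g x) vs) [:: v] y).
rewrite (eq_dird_on [:: v] oU ih Uy) /= deriveD//; apply: diff_derivable.
  exact: fU.
exact: gU.
Qed.

Lemma dirdZ U f (a : R) vs y : open U -> smo U f -> U y ->
  dird (fun x => a * f x) vs y = a * dird f vs y.
Proof.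
move=> oU fU; elim: vs y => [//|v vs ih] y Uy.
rewrite -[LHS]/(dird (dird (fun x => a * f x) vs) [:: v] y).
rewrite (eq_dird_on [:: v] oU ih Uy) /=.
have := @deriveZ _ _ _ (dird f vs : E -> R^o) a y v; apply; apply: diff_derivable.
exact: fU.
Qed.

Lemma smoD U f g : open U -> smo U f -> smo U g -> smo U (fun x => f x + g x).
Proof. by move=> oU fU gU; apply: smt_smo => n; apply: smtD => //; exact: smo_smt. Qed.

Lemma smoM U f g : open U -> smo U f -> smo U g -> smo U (fun x => f x * g x).
Proof. by move=> oU fU gU; apply: smt_smo => n; apply: smtM => //; exact: smo_smt. Qed.

Lemma smo_cst U (c : R) : smo U (fun=> c).
Proof. by apply: smt_smo => n; exact: smt_cst. Qed.

Lemma smoZ U f a : open U -> smo U f -> smo U (fun x => a * f x).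
Proof. by move=> oU fU; apply: smoM => //; exact: smo_cst. Qed.

Lemma smo_sum U N (f : 'I_N -> E -> R) : open U -> (forall i, smo U (f i)) ->
  smo U (fun y => \sum_(i < N) f i y).
Proof. by move=> oU fU; apply: smt_smo => n; apply: smt_sum => // i; exact: smo_smt. Qed.

Lemma dird_sum U N (f : 'I_N -> E -> R) vs y : open U -> (forall i, smo U (f i)) -> U y ->
  dird (fun x => \sum_(i < N) f i x) vs y = \sum_(i < N) dird (f i) vs y.
Proof.
move=> oU; elim: N f => [|N ih] f fU Uy.
  have -> : (fun x => \sum_(i < 0) f i x) = (fun=> 0).
    by apply/funext => x; rewrite big_ord0.
  by rewrite dird_cst big_ord0; case: vs.
have -> : (fun x => \sum_(i < N.+1) f i x) =
   (fun x => \sum_(i < N) f (widen_ord (leqnSn N) i) x + f ord_max x).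
  by apply/funext => x; rewrite big_ord_recr.
rewrite (dirdD vs oU _ _ Uy); last 2 first.
- exact: smo_sum.
- exact: fU.
by rewrite ih// big_ord_recr.
Qed.

Lemma derive_smoM U f g v y : smo U f -> smo U g -> U y ->
  'D_v (fun x => f x * g x : R^o) y =
  'D_v (f : E -> R^o) y * g y + f y * 'D_v (g : E -> R^o) y.
Proof.
move=> fU gU Uy; rewrite [LHS]deriveM; last 2 first.
- by apply: diff_derivable; exact: smo_differentiable fU Uy.
- by apply: diff_derivable; exact: smo_differentiable gU Uy.
by rewrite addrC; congr (_ + _); exact: mulrC.
Qed.

Definition inV V vs := forall v, v \in vs -> V v.

Lemma inV_rcons V vs v : inV V (rcons vs v) -> inV V vs /\ V v.
Proof.
move=> H; split; last by apply: H; rewrite mem_rcons mem_head.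
by move=> w wvs; apply: H; rewrite mem_rcons inE wvs orbT.
Qed.

Lemma inV_cons V vs v : inV V (v :: vs) -> inV V vs /\ V v.
Proof.
move=> H; split; last by apply: H; exact: mem_head.
by move=> w wvs; apply: H; rewrite inE wvs orbT.
Qed.

Lemma inV_cat V vs ws : inV V vs -> inV V ws -> inV V (vs ++ ws).
Proof. by move=> H K v; rewrite mem_cat => /orP[/H|/K]. Qed.

Lemma inV1 V v : V v -> inV V [:: v].
Proof. by move=> Vv w; rewrite inE => /eqP ->. Qed.

Definition lbz (k : nat) (a b : nat -> R) : R :=
  \sum_(l < k.+1) 'C(k, l)%:R * (a l * b (k - l)%N).

(** Pascal's rule in the shape of the product rule: one more derivative falls on either factor. *)
Lemma lbzS k a b : lbz k.+1 a b = lbz k (a \o S) b + lbz k a (b \o S).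
Proof.
rewrite /lbz big_ord_recl /= bin0 mul1r subn0.
under eq_bigr do rewrite /bump /= add1n binS natrD mulrDl subSS.
rewrite big_split /= addrA [RHS]addrC; congr (_ + _).
rewrite [RHS]big_ord_recl bin0 mul1r subn0; congr (_ + _).
rewrite big_ord_recr /= bin_small// mul0r addr0; apply: eq_bigr => i _.
by rewrite /bump /= add1n subnSK.
Qed.

Lemma leibniz_bound U V f g (a b : nat -> R) vs y : open U -> smo U f -> smo U g -> U y ->
  (forall ws, inV V ws -> (size ws <= size vs)%N -> `|dird f ws y| <= a (size ws)) ->
  (forall ws, inV V ws -> (size ws <= size vs)%N -> `|dird g ws y| <= b (size ws)) ->
  inV V vs -> `|dird (fun x => f x * g x) vs y| <= lbz (size vs) a b.
Proof.
move=> oU; elim/last_ind: vs f g a b => [|vs v ih] f g a b fU gU Uy fa gb.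
  move=> _; rewrite /lbz big_ord1 bin0 mul1r normrM.
  by apply: ler_pM => //; [exact: (fa [::])|exact: (gb [::])].
move=> /inV_rcons[Vvs Vv]; rewrite size_rcons dird_rcons.
rewrite (eq_dird_on vs oU (fun y Uy => derive_smoM v fU gU Uy) Uy).
have fvU : smo U ('D_v (f : E -> R^o)) by exact: (smo_dird [:: v] fU).
have gvU : smo U ('D_v (g : E -> R^o)) by exact: (smo_dird [:: v] gU).
rewrite (dirdD vs oU _ _ Uy); last 2 first.
- exact: smoM.
- exact: smoM.
apply: le_trans (ler_normD _ _) _; rewrite lbzS; apply: lerD.
  apply: (ih _ _ (a \o S)) => // ws Vws wsn.
    rewrite -dird_rcons /= -(size_rcons ws v) fa//.
      by move=> w; rewrite mem_rcons inE => /orP[/eqP->|/Vws].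
    by rewrite !size_rcons.
  by apply: gb => //; rewrite size_rcons (leq_trans wsn).
apply: (ih _ _ a (b \o S)) => // ws Vws wsn.
  by apply: fa => //; rewrite size_rcons (leq_trans wsn).
rewrite -dird_rcons /= -(size_rcons ws v) gb//.
  by move=> w; rewrite mem_rcons inE => /orP[/eqP->|/Vws].
by rewrite !size_rcons.
Qed.

End DirdAlgebra.

(** * Consequences of log-convexity and moderate growth *)

Section Weights.
Context {R : realType} (M : nat -> R).
Hypotheses (hM : weight_sequence M) (hlc : log_convex M) (hmg : moderate_growth M).

Lemma weight_gt0 k : 0 < M k. Proof. exact: (hM.1 k). Qed.
Lemma weight0 : M 0 = 1. Proof. exact: hM.2.1. Qed.
Lemma weight1 : 1 <= M 1. Proof. exact: hM.2.2. Qed.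

(** The two instances of log-convexity between [i] and [i + a + b], at [i + a] and at [i + b], add
    up to [a + b] times the claim for logarithms. *)
Lemma log_convex_mul i a b : M (i + a) * M (i + b) <= M i * M (i + a + b).
Proof.
have M0 := weight_gt0.
case: a => [|a]; first by rewrite addn0.
case: b => [|b]; first by rewrite !addn0 mulrC.
have h1 : (i < i + a.+1 < i + a.+1 + b.+1)%N by lia.
have h2 : (i < i + b.+1 < i + a.+1 + b.+1)%N by lia.
have := hlc h1; have := hlc h2.
have -> : (i + a.+1 + b.+1 - i = a.+1 + b.+1)%N by lia.
have -> : (i + a.+1 + b.+1 - (i + a.+1) = b.+1)%N by lia.
have -> : (i + a.+1 + b.+1 - (i + b.+1) = a.+1)%N by lia.
have -> : (i + a.+1 - i = a.+1)%N by lia.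
have -> : (i + b.+1 - i = b.+1)%N by lia.
move=> H2 H1.
rewrite -ler_ln ?posrE ?mulr_gt0// !lnM ?posrE//.
rewrite -(@ler_pM2l _ (a.+1 + b.+1)%:R) ?ltr0n// !mulrDr.
apply: le_trans (lerD H1 H2) _; rewrite natrD.
move: (ln _) (ln _) => p q.
by rewrite le_eqVlt; apply/orP; left; apply/eqP; ring.
Qed.

Lemma weight_mul l k : M l * M k <= M (l + k).
Proof. by have := log_convex_mul 0 l k; rewrite weight0 mul1r !add0n. Qed.

(** In the chain rule one derivative of the outer function goes with one of the inner function, yet
    the pair counts once in the total order; the case [i = 1] of log-convexity accounts for this. *)
Lemma weight_shift a b : M a.+1 * M b.+1 <= M 1 * M (a + b).+1.
Proof. by have := log_convex_mul 1 a b; rewrite !add1n. Qed.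

Lemma weight_leS k : M k <= M k.+1.
Proof.
apply: le_trans (weight_mul 1 k); rewrite -[leLHS]mul1r ler_wpM2r//.
  exact/ltW/weight_gt0.
exact: weight1.
Qed.

(** [Num.max C 1] also covers [j = 0] and [k = 0], which the definition leaves out and where
    [M 0 = 1] applies. *)
Lemma moderate_growthP : exists2 H : R, 1 <= H & forall j k, M (j + k) <= H ^+ (j + k) * (M j * M k).
Proof.
have [C HC] := hmg; exists (Num.max C 1); first by rewrite le_max lexx orbT.
have M0 := weight_gt0.
move=> j k; have MM : 0 < M j * M k by exact: mulr_gt0.
have H1 n : 1 <= Num.max C 1 ^+ n by rewrite exprn_ege1// le_max lexx orbT.
case: j MM => [|j] MM.
  by rewrite weight0 mul1r add0n ler_peMl// ltW.
case: k MM => [|k] MM.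
  by rewrite weight0 mulr1 addn0 ler_peMl// ltW.
rewrite -ler_pdivrMr//.
have := HC j.+1 k.+1 isT isT; set n := (j.+1 + k.+1)%N; set x := _ / _ => xC.
have x0 : 0 <= x by rewrite divr_ge0// ltW.
have -> : x = (x `^ (n%:R^-1)) ^+ n.
  rewrite -powR_mulrn ?powR_ge0// -powRrM mulVf ?powRr1//.
  by rewrite pnatr_eq0.
apply: lerXn2r; rewrite ?nnegrE ?powR_ge0//.
  by rewrite le_max ler01 orbT.
by rewrite le_max xC.
Qed.

(** The weight by which [rho_norm] divides. *)
Definition wgt (rho : R) (m : nat) : R := m`!%:R * rho ^+ m * M m.

Lemma wgt_gt0 rho m : 0 < rho -> 0 < wgt rho m.
Proof.
by move=> r0; rewrite !mulr_gt0// ?weight_gt0 ?exprn_gt0// ltr0n fact_gt0.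
Qed.

Lemma ler_wgt rho sigma m : 0 < rho -> rho <= sigma -> wgt rho m <= wgt sigma m.
Proof.
move=> r0 rs; rewrite /wgt ler_wpM2r ?(ltW (weight_gt0 _))// ler_wpM2l//.
by rewrite lerXn2r// nnegrE ltW// (lt_le_trans r0).
Qed.

Lemma wgt0 rho : wgt rho 0 = 1.
Proof. by rewrite /wgt fact0 expr0 weight0 !mulr1. Qed.

Lemma wgt_scale c rho m : wgt (c * rho) m = c ^+ m * wgt rho m.
Proof. by rewrite /wgt exprMn; ring. Qed.

Lemma succ_le_pow2 m : (m.+1%:R : R) <= 2 ^+ m.
Proof. by rewrite -natrX ler_nat; elim: m => // m ih; rewrite expnS; lia. Qed.

(** The factor [m.+1] of the factorial is at most [2 ^+ m], and moderate growth gives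
    [M m.+1 <= H ^+ m.+1 * (M m * M 1)]; all powers go into [theta]. *)
Lemma wgt_shift : exists2 theta : R, 0 < theta &
  forall rho m, 0 < rho -> wgt rho m.+1 <= (rho * theta) * wgt (theta * rho) m.
Proof.
have [H H1 HP] := moderate_growthP.
have H0 : 0 < H by exact: lt_le_trans ltr01 H1.
have M1 : 0 < M 1 by exact: weight_gt0.
exists (2 * H * M 1); first by rewrite !mulr_gt0.
move=> rho m r0; rewrite wgt_scale /wgt factS natrM exprS.
have := HP m 1%N; rewrite addn1 => Hm.
apply: (@le_trans _ _ (2 ^+ m * m`!%:R * (rho * rho ^+ m) * (H ^+ m.+1 * (M m * M 1)))).
  apply: ler_pM => //; rewrite ?(ltW (weight_gt0 _))//.
    by rewrite !mulr_ge0// ?exprn_ge0// ltW.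
  rewrite ler_wpM2r//; first by rewrite mulr_ge0// ?exprn_ge0// ltW.
  by rewrite ler_wpM2r//; exact: succ_le_pow2.
have M1m : 1 <= M 1 ^+ m by rewrite exprn_ege1// weight1.
rewrite exprS; set a := _ ^+ m; set b := _%:R; set c := rho ^+ m; set d := H ^+ m.
rewrite !exprMn -/a -/d.
have -> : a * b * (rho * c) * (H * d * (M m * M 1)) =
  (rho * H * M 1 * (a * d * b * c * M m)) * 1 by ring.
have -> : rho * (2 * H * M 1) * (a * d * M 1 ^+ m * (b * c * M m)) =
  (rho * H * M 1 * (a * d * b * c * M m)) * (2 * M 1 ^+ m) by ring.
apply: ler_wpM2l.
  rewrite !mulr_ge0 ?(ltW (weight_gt0 _))// ?(ltW r0) ?(ltW H0)// /a /c /d ?exprn_ge0// ltW//.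
lra.
Qed.

(** Binomial coefficients are at most [2 ^+ (j + k)]; moderate growth does the rest. This separates
    the orders in the parameter from those in the space variable. *)
Lemma wgt_add : exists2 theta : R, 1 <= theta &
  forall rho j k, 0 < rho -> wgt rho (j + k) <= wgt (theta * rho) j * wgt (theta * rho) k.
Proof.
have [H H1 HP] := moderate_growthP.
have H0 : 0 < H by exact: lt_le_trans ltr01 H1.
exists (2 * H); first by lra.
move=> rho j k r0; rewrite !wgt_scale /wgt.
have F : ((j + k)`!%:R : R) <= 2 ^+ (j + k) * (j`!%:R * k`!%:R).
  rewrite -!natrM -natrX -natrM ler_nat -(bin_fact (leq_addr k j)) addKn leq_mul//.
  rewrite -[X in (X ^ _)%N]/((1 + 1)%N) expnDn.
  rewrite (bigD1 (inord j : 'I_(j + k).+1))//= inordK ?ltnS ?leq_addr//.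
  by rewrite !exp1n !muln1 leq_addr.
apply: (@le_trans _ _ (2 ^+ (j + k) * (j`!%:R * k`!%:R) * rho ^+ (j + k) *
    (H ^+ (j + k) * (M j * M k)))).
  apply: ler_pM => //; rewrite ?(ltW (weight_gt0 _))//.
    by rewrite mulr_ge0// exprn_ge0// ltW.
  by rewrite ler_wpM2r// exprn_ge0// ltW.
rewrite !exprD !exprMn le_eqVlt; apply/orP; left; apply/eqP; ring.
Qed.

(** As (j + l)! / l! <= (j + k)! / k!: a product of [j] consecutive integers grows with its starting
    point. *)
Lemma fact_shift j l k : (l <= k)%N -> ((j + l)`! * k`! <= (j + k)`! * l`!)%N.
Proof.
elim: k => [|k ih]; first by rewrite leqn0 => /eqP ->.
rewrite leq_eqVlt ltnS => /orP[/eqP -> //|/ih {}ih].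
rewrite addnS !factS mulnCA -mulnA leq_mul//.
by rewrite ltnS leq_addl.
Qed.

Lemma geometric_half k : \sum_(l < k.+1) (2^-1 : R) ^+ (k - l) <= 2.
Proof.
elim: k => [|k ih]; first by rewrite big_ord1 expr0; lra.
rewrite big_ord_recr /= subnn expr0.
have -> : \sum_(l < k.+1) (2^-1 : R) ^+ (k.+1 - l) = 2^-1 * \sum_(l < k.+1) 2^-1 ^+ (k - l).
  by rewrite mulr_sumr; apply: eq_bigr => l _; rewrite subSn ?exprS// -ltnS.
lra.
Qed.

(** The estimate that closes the induction of [comp_bound]. [fact_shift] absorbs the binomials,
    [weight_shift] merges the two weights at the price [M 1], and with m = k - l the bounds m + 1 <=
    2^m and 4 rho <= sigma turn (m + 1) rho^m into (sigma / 2)^m; the geometric series is the factor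
    2. *)
Lemma lbz_comp_bound (C A r rho sigma : R) j k : 0 <= C -> 0 <= A -> 0 < r -> 0 < rho ->
  4 * rho <= sigma ->
  lbz k (fun l => C * r ^+ j * sigma ^+ l * ((j.+1 + l)`!%:R * M (j.+1 + l)))
        (fun l => A * wgt rho l.+1) <=
  C * r ^+ j * sigma ^+ k * ((j + k).+1`!%:R * M (j + k).+1) * (2 * A * M 1 * rho).
Proof.
move=> C0 A0 r0 rho0 rs.
have s0 : 0 < sigma by apply: lt_le_trans rs; rewrite mulr_gt0.
set B := C * r ^+ j; have B0 : 0 <= B by rewrite mulr_ge0// exprn_ge0// ltW.
set K := (j + k).+1`!%:R * M (j + k).+1.
have K0 : 0 <= K by rewrite mulr_ge0// ltW// weight_gt0.
apply: (@le_trans _ _ (\sum_(l < k.+1) (B * sigma ^+ k * K * (A * M 1 * rho)) * (2^-1) ^+ (k - l))).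
  apply: ler_sum => l _; have lk : (l <= k)%N by rewrite -ltnS.
  rewrite /wgt factS natrM.
  set m := (k - l)%N.
  have F : 'C(k, l)%:R * (j.+1 + l)`!%:R * m`!%:R <= (j + k).+1`!%:R :> R.
    rewrite -!natrM ler_nat -(@leq_pmul2r l`!) ?fact_gt0//.
    rewrite -addSn; apply: leq_trans (fact_shift j.+1 lk).
    by rewrite -(bin_fact lk) -/m; apply: eq_leq; ring.
  have Mm : M (j.+1 + l) * M m.+1 <= M 1 * M (j + k).+1.
    by rewrite addSn (le_trans (weight_shift _ _))// (_ : j + l + m = j + k)%N// /m; lia.
  have P2 : m.+1%:R * sigma ^+ l * rho ^+ m <= sigma ^+ k * (2^-1) ^+ m.
    have -> : sigma ^+ k = sigma ^+ l * sigma ^+ m by rewrite -exprD /m subnKC.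
    rewrite [_ * sigma ^+ l]mulrC -!mulrA ler_wpM2l ?exprn_ge0 ?(ltW s0)//.
    apply: (@le_trans _ _ (2 ^+ m * rho ^+ m)).
      by rewrite ler_wpM2r ?exprn_ge0 ?(ltW rho0)//; exact: succ_le_pow2.
    rewrite -!exprMn; apply: lerXn2r; rewrite ?nnegrE.
    - by rewrite mulr_ge0// ltW.
    - by rewrite mulr_ge0// ltW.
    lra.
  have Q : forall c x1 x2 x3 y1 y2 s p : R,
     c * (B * s * (x1 * y1) * (A * (x2 * x3 * (rho * p) * y2))) =
     (B * A * rho) * ((c * x1 * x3) * (y1 * y2) * (x2 * s * p)) by move=> *; ring.
  rewrite exprS Q.
  have -> : B * sigma ^+ k * K * (A * M 1 * rho) * 2^-1 ^+ m =
    (B * A * rho) * ((j + k).+1`!%:R * (M 1 * M (j + k).+1) * (sigma ^+ k * 2^-1 ^+ m)).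
    by rewrite /K; ring.
  apply: ler_wpM2l; first by rewrite mulr_ge0 ?(ltW rho0)// mulr_ge0.
  have M0 := weight_gt0.
  apply: ler_pM => //.
  - by rewrite !mulr_ge0// ?ltW.
  - by rewrite !mulr_ge0// ?exprn_ge0// ?ltW.
  - by apply: ler_pM => //; rewrite !mulr_ge0// ?ltW.
rewrite -mulr_sumr; apply: le_trans (ler_wpM2l _ (geometric_half k)) _.
  by rewrite !mulr_ge0// ?exprn_ge0// ?(ltW s0)// ?ltW// weight_gt0.
rewrite le_eqVlt; apply/orP; left; apply/eqP; ring.
Qed.

End Weights.

(** * Germs of Denjoy-Carleman class *)

Section CompositionBound.
Context {R : realType} (M : nat -> R).
Hypotheses (hM : weight_sequence M) (hlc : log_convex M).
Context {X Z : normedModType R} (N : nat).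
Variables (L : {linear X -> Z}) (G : 'I_N -> X -> R) (z : 'I_N -> Z).
Hypothesis cL : continuous L.
Variables (V : set X) (V' : set Z).
Hypotheses (LV : forall v, V v -> V' (L v)) (zV : forall i, V' (z i)).
Local Notation F := (fsum L G z).

(* Induction on [vs] replaces Faa di Bruno's formula: differentiating [(D^l g) o F]
   once gives terms [(D^(l+1) g) o F * D G_i], so the estimate is proved for all
   the derivatives [D^l g] of [g] at the same time. *)
Lemma comp_bound (U : set X) (U' : set Z) g y (C A r rho sigma : R) :
  open U -> open U' -> (forall i, smo U (G i)) -> smo U' g ->
  (forall x, U x -> U' (F x)) -> U y ->
  0 < C -> 0 < A -> 0 < r -> 0 < rho -> 4 * rho <= sigma ->
  r * (1 + N%:R * (2 * A * M 1 * rho)) <= sigma ->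
  (forall l, inV V' l -> `|dird g l (F y)| <= C * wgt M r (size l)) ->
  (forall i vs, inV V vs -> `|dird (G i) vs y| <= A * wgt M rho (size vs)) ->
  forall vs l, inV V vs -> inV V' l ->
  `|dird (fun x => dird g l (F x)) vs y| <=
    C * r ^+ size l * sigma ^+ size vs *
    ((size l + size vs)`!%:R * M (size l + size vs)).
Proof.
move=> oU oU' GU gU' UU' Uy C0 A0 r0 rho0 rs rb Hg HG vs l.
have s0 : 0 < sigma by apply: lt_le_trans rs; rewrite mulr_gt0.
have M0 k : 0 <= M k by exact/ltW/weight_gt0.
(* The list [l] stays general: a derivative along [v] lengthens it by [L v] or by some [z i]. *)
elim: {vs}(size vs) {-2}vs (leqnn (size vs)) l => [|n ih] vs.
  rewrite leqn0 => /nilP -> l _ Vl /=.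
  by rewrite expr0 mulr1 addn0 (le_trans (Hg l Vl))// /wgt le_eqVlt; apply/orP; left; apply/eqP; ring.
case/lastP: vs => [_|vs v]; first by move=> l; apply: (ih [::]).
rewrite size_rcons ltnS => vsn l /inV_rcons[Vvs Vv] Vl.
set h := dird g l; have hU' : smo U' h by exact: smo_dird.
have hFU (h' : Z -> R) : smo U' h' -> smo U (fun x => h' (F x)).
  by move=> h'U; exact: (smo_comp_fsum cL oU oU' GU h'U UU').
pose k1 w := 'D_w (h : Z -> R^o).
have k1U w : smo U' (k1 w) by exact: (smo_dird [:: w] hU').
pose dG i := 'D_v (G i : X -> R^o).
have dGU i : smo U (dG i) by exact: (smo_dird [:: v] (GU i)).
have DE x : U x -> 'D_v (fun x => h (F x) : R^o) x =
    k1 (L v) (F x) + \sum_(i < N) k1 (z i) (F x) * dG i x.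
  move=> Ux; apply: (proj2 (derive_comp_fsum cL v _ _)) => [i|].
    exact: smo_differentiable (GU i) Ux.
  exact: smo_differentiable hU' (UU' _ Ux).
have prU i : smo U (fun x => k1 (z i) (F x) * dG i x).
  by apply: smoM => //; exact: hFU.
rewrite dird_rcons (eq_dird_on vs oU DE Uy) (dirdD vs oU _ _ Uy); last 2 first.
- exact: hFU.
- exact: smo_sum.
rewrite (dird_sum vs oU prU Uy).
set j := size l; set k := size vs.
have wE : (j + k.+1 = (j + k).+1)%N by rewrite addnS.
rewrite wE; set K := (_`!%:R * _).
have K0 : 0 <= K by rewrite mulr_ge0.
have T1 : `|dird (fun x => k1 (L v) (F x)) vs y| <= C * r ^+ j.+1 * sigma ^+ k * K.
  have := ih vs vsn (L v :: l) Vvs; rewrite /= -/j -/k addSn; apply.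
  by move=> w; rewrite inE => /orP[/eqP->|/Vl//]; exact: LV.
have T2 i : `|dird (fun x => k1 (z i) (F x) * dG i x) vs y| <=
    C * r ^+ j.+1 * sigma ^+ k * K * (2 * A * M 1 * rho).
  have := lbz_comp_bound hM hlc j k (ltW (mulr_gt0 C0 r0)) (ltW A0) r0 rho0 rs.
  rewrite -[C * r * r ^+ j]mulrA -exprS; apply: le_trans.
  have := @leibniz_bound _ _ U V (fun x => k1 (z i) (F x)) (dG i)
    (fun l => C * r ^+ j.+1 * sigma ^+ l * ((j.+1 + l)`!%:R * M (j.+1 + l)))
    (fun l => A * wgt M rho l.+1) vs y oU (hFU _ (k1U _)) (dGU i) Uy; apply => //.
    move=> ws Vws wsn; apply: (ih ws (leq_trans wsn vsn) (z i :: l)) => // w.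
    by rewrite inE => /orP[/eqP->|/Vl//]; exact: zV.
  move=> ws Vws _; rewrite /dG -dird_rcons -(size_rcons ws v); apply: HG => w.
  by rewrite mem_rcons inE => /orP[/eqP->|/Vws].
apply: le_trans (ler_normD _ _) _; apply: le_trans (lerD T1 (ler_norm_sum _ _ _)) _.
apply: le_trans (lerD (lexx _) (ler_sum _ (fun i _ => T2 i))) _.
rewrite sumr_const card_ord -[_ *+ N]mulr_natl exprS.
set P := C * r ^+ j * sigma ^+ k * K.
have P0 : 0 <= P by rewrite !mulr_ge0// ?exprn_ge0// ltW.
have -> : C * (r * r ^+ j) * sigma ^+ k * K + N%:R * (C * (r * r ^+ j) * sigma ^+ k * K * (2 * A * M 1 * rho))
   = P * (r * (1 + N%:R * (2 * A * M 1 * rho))) by rewrite /P; ring.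
(* [rb] pays for both terms of the chain rule with a single new factor [sigma]. *)
apply: le_trans (ler_wpM2l P0 rb) _.
by rewrite exprS /P le_eqVlt; apply/orP; left; apply/eqP; ring.
Qed.

End CompositionBound.

Section Classes.
Context {R : realType} (kd : dc_kind) (M : nat -> R).
Hypotheses (hM : weight_sequence M) (hlc : log_convex M) (hmg : moderate_growth M).

Definition kdq (P : R -> R -> Prop) : Prop :=
  match kd with
  | Beurling => forall rho, 0 < rho -> exists2 C, 0 < C & P rho C
  | Roumieu => exists2 rho, 0 < rho & exists2 C, 0 < C & P rho C
  end.

(** Neither class notices a constant factor in [rho]: for a prescribed radius the Beurling case
    starts from [theta^-1 * rho]. *)
Lemma kdq_map (theta : R) (P Q : R -> R -> Prop) : 0 < theta ->
  (forall rho C, 0 < rho -> 0 < C -> P rho C -> exists2 C', 0 < C' & Q (theta * rho) C') ->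
  kdq P -> kdq Q.
Proof.
rewrite /kdq => t0 PQ; case: kd => [H rho rho0|[rho rho0 [C C0 PC]]].
  have r0 : 0 < theta^-1 * rho by rewrite mulr_gt0// invr_gt0.
  have [C C0 PC] := H _ r0; have := PQ _ _ r0 C0 PC.
  by rewrite mulrA mulfV ?gt_eqF// mul1r.
by exists (theta * rho); [exact: mulr_gt0|exact: PQ PC].
Qed.

Lemma kdq_imp (P Q : R -> R -> Prop) :
  (forall rho C, 0 < rho -> 0 < C -> P rho C -> exists2 C', 0 < C' & Q rho C') ->
  kdq P -> kdq Q.
Proof. by move=> PQ; apply: (kdq_map ltr01) => rho; rewrite mul1r; exact: PQ. Qed.

Definition upward (P : R -> R -> Prop) := forall rho rho' C C',
  0 < rho -> rho <= rho' -> 0 < C -> C <= C' -> P rho C -> P rho' C'.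

(** In the Roumieu case the two radii differ; monotonicity lets both statements pass to the larger
    one. *)
Lemma kdq_and (P Q : R -> R -> Prop) : upward P -> upward Q ->
  kdq P -> kdq Q -> kdq (fun rho C => P rho C /\ Q rho C).
Proof.
have m0 (a b : R) : 0 < a -> 0 < Num.max a b by move=> a0; rewrite lt_max a0.
rewrite /kdq => uP uQ; case: kd => [HP HQ rho rho0|[r r0 [C C0 PC]] [s s0 [D D0 QD]]].
  have [C C0 PC] := HP _ rho0; have [D D0 QD] := HQ _ rho0.
  exists (Num.max C D); first exact: m0.
  by split; [apply: uP PC|apply: uQ QD]; rewrite // le_max lexx ?orbT.
exists (Num.max r s); first exact: m0.
exists (Num.max C D); first exact: m0.
by split; [apply: uP PC|apply: uQ QD]; rewrite // le_max lexx ?orbT.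
Qed.

Lemma kdq_all N (P : 'I_N -> R -> R -> Prop) : (forall i, upward (P i)) ->
  (forall i, kdq (P i)) -> kdq (fun rho C => forall i, P i rho C).
Proof.
elim: N P => [|N ih] P uP HP.
  have : kdq (fun _ _ => True).
    by rewrite /kdq; case: kd => [rho _|]; [exists 1|exists 1 => //; exists 1].
  by apply: kdq_imp => rho C _ C0 _; exists C => // -[].
have := kdq_and _ (uP ord0) (ih _ (fun i => uP (lift ord0 i)) (fun i => HP (lift ord0 i))) (HP ord0).
have u : upward (fun rho C => forall i, P (lift ord0 i) rho C).
  by move=> rho rho' C C' r0 rr c0 cc H i; apply: uP (H i).
move=> /(_ u); apply: kdq_imp => rho C _ C0 [H1 H2]; exists C => // i.
by case: (unliftP ord0 i) => [j ->|->].
Qed.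

Section OneSpace.
Context {E : normedModType R}.
Implicit Types (f g : E -> R) (V W D : set E) (z : E).

Definition dbound W V f (rho C : R) := forall y vs, W y -> inV V vs ->
  `|dird f vs y| <= C * wgt M rho (size vs).

Lemma upward_dbound W V f : upward (dbound W V f).
Proof.
move=> rho rho' C C' r0 rr C0 CC H y vs Wy Vvs.
apply: le_trans (H y vs Wy Vvs) _; apply: ler_pM => //; first exact: ltW.
  by apply/ltW/wgt_gt0.
exact: ler_wgt.
Qed.

(** The neighbourhood is chosen before [rho]: in the Beurling case one [W] serves all radii. *)
Definition LC V z f := exists2 W, nbhs z W & kdq (dbound W V f).

Lemma eq_LC V z f g : (\forall y \near z, f y = g y) -> LC V z f -> LC V z g.
Proof.
move=> fg [W Wz HW]; exists (W `&` [set y | \forall x \near y, f x = g x]).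
  by apply: filterI => //; exact: near_join.
apply: kdq_imp HW => rho C r0 C0 H; exists C => // y vs [Wy /= yfg] Vvs.
by have /nbhs_singleton <- := near_eq_dird vs yfg; exact: H.
Qed.

Lemma LC_cst V z c : LC V z (fun=> c).
Proof.
exists setT; first exact: filterT.
have : kdq (fun _ _ => True).
  by rewrite /kdq; case: kd => [rho _|]; [exists 1|exists 1 => //; exists 1].
apply: kdq_imp => rho C r0 C0 _; exists (`|c| + 1); first by rewrite ltr_wpDl.
move=> y vs _ _; rewrite dird_cst; case: vs => [|v vs].
  by rewrite wgt0// mulr1 lerDl.
by rewrite normr0 mulr_ge0// ?addr_ge0// ltW// wgt_gt0.
Qed.

Lemma LC_D U V z f g : open U -> U z -> smo U f -> smo U g ->
  LC V z f -> LC V z g -> LC V z (fun x => f x + g x).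
Proof.
move=> oU Uz fU gU [W Wz HW] [W' Wz' HW']; exists (U `&` (W `&` W')).
  by apply: filterI; [exact: open_nbhs_nbhs|exact: filterI].
apply: kdq_imp (kdq_and (@upward_dbound _ _ _) (@upward_dbound _ _ _) HW HW').
move=> rho C r0 C0 [H1 H2]; exists (C + C); first exact: addr_gt0.
move=> y vs [Uy [Wy Wy']] Vvs; rewrite (dirdD vs oU fU gU Uy) mulrDl.
by apply: le_trans (ler_normD _ _) _; rewrite lerD ?H1 ?H2.
Qed.

(** By log-convexity each of the [k + 1] Leibniz terms is at most [C * C * wgt M rho k]; since
    [k + 1 <= 2 ^+ k], their number is paid by doubling [rho]. *)
Lemma LC_M U V z f g : open U -> U z -> smo U f -> smo U g ->
  LC V z f -> LC V z g -> LC V z (fun x => f x * g x).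
Proof.
move=> oU Uz fU gU [W Wz HW] [W' Wz' HW']; exists (U `&` (W `&` W')).
  by apply: filterI; [exact: open_nbhs_nbhs|exact: filterI].
have := kdq_and (@upward_dbound _ _ _) (@upward_dbound _ _ _) HW HW'.
apply: (@kdq_map 2) => // rho C r0 C0 [H1 H2]; exists (C * C); first exact: mulr_gt0.
move=> y vs [Uy [Wy Wy']] Vvs.
have := @leibniz_bound _ _ U V f g (fun l => C * wgt M rho l) (fun l => C * wgt M rho l)
  vs y oU fU gU Uy; move=> /(_ _ _ Vvs) H.
apply: le_trans (H _ _) _ => [ws Vws _|ws Vws _|]; [exact: H1|exact: H2|].
set k := size vs; apply: (@le_trans _ _ (\sum_(l < k.+1) C * C * wgt M rho k)).
  apply: ler_sum => l _; have lk : (l <= k)%N by rewrite -ltnS.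
  have alg0 (a b c d : R) : a * (b * c * (b * d)) = (b * b) * (a * (c * d)) by ring.
  rewrite alg0; apply: ler_wpM2l; first by rewrite mulr_ge0// ltW.
  have rk : rho ^+ k = rho ^+ l * rho ^+ (k - l) by rewrite -exprD subnKC.
  rewrite /wgt rk -(bin_fact lk) !natrM.
  have := weight_mul hM hlc l (k - l); rewrite subnKC// => Mk.
  have alg (a b c p q m n : R) : a * (b * p * m * (c * q * n)) = (a * (b * c) * (p * q)) * (m * n) by ring.
  rewrite alg ler_wpM2l// !mulr_ge0// exprn_ge0// ltW//.
rewrite sumr_const card_ord -[_ *+ _]mulr_natl wgt_scale mulrCA ler_pM2l ?mulr_gt0//.
by apply: ler_wpM2r; [exact/ltW/wgt_gt0|exact: (@succ_le_pow2 R k)].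
Qed.

Lemma LC_sum U V z N (f : 'I_N -> E -> R) : open U -> U z -> (forall i, smo U (f i)) ->
  (forall i, LC V z (f i)) -> LC V z (fun y => \sum_(i < N) f i y).
Proof.
move=> oU Uz; elim: N f => [|N ih] f fU fV.
  by apply: eq_LC (LC_cst V z 0); near=> y; rewrite big_ord0.
have h := LC_D oU Uz (smo_sum oU (fun i => fU (widen_ord (leqnSn N) i))) (fU ord_max)
  (ih _ (fun i => fU (widen_ord (leqnSn N) i)) (fun i => fV _)) (fV ord_max).
by apply: eq_LC h; near=> y; rewrite big_ord_recr.
Unshelve. all: by end_near.
Qed.

(** Here moderate growth enters, through [wgt_shift]: the class is stable under differentiation. *)
Lemma LC_derive V z f v : V v -> LC V z f -> LC V z ('D_v (f : E -> R^o)).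
Proof.
move=> Vv [W Wz HW]; exists W => //.
have [theta t0 Ht] := wgt_shift hM hmg.
apply: (kdq_map t0) HW => rho C r0 C0 H; exists (C * (rho * theta)).
  by rewrite !mulr_gt0.
move=> y vs Wy Vvs; rewrite -dird_rcons; apply: le_trans (H y _ Wy _) _.
  by move=> w; rewrite mem_rcons inE => /orP[/eqP->|/Vvs].
by rewrite size_rcons -mulrA ler_pM2l// Ht.
Qed.

End OneSpace.

Section Comp.
Context {X Z : normedModType R} (N : nat).
Variables (L : {linear X -> Z}) (G : 'I_N -> X -> R) (z : 'I_N -> Z).
Hypothesis cL : continuous L.
Variables (V : set X) (V' : set Z).
Hypotheses (LV : forall v, V v -> V' (L v)) (zV : forall i, V' (z i)).
Local Notation F := (fsum L G z).

Lemma fsum_continuous x : (forall i, differentiable (G i) x) -> {for x, continuous F}.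
Proof. by move=> dG; apply: differentiable_continuous; exact: (is_diff_fsum z cL dG).1. Qed.

Lemma LC_comp (U : set X) (U' : set Z) g x0 :
  open U -> open U' -> (forall i, smo U (G i)) -> smo U' g ->
  (forall x, U x -> U' (F x)) -> U x0 ->
  (forall i, LC V x0 (G i)) -> LC V' (F x0) g -> LC V x0 (fun x => g (F x)).
Proof.
move=> oU oU' GU gU' UU' Ux0 GL [W' Wz' HW'].
have [W W0 HW] : exists2 W, nbhs x0 W & kdq (fun rho C => forall i, dbound W V (G i) rho C).
  have GL' i : exists W : set X, nbhs x0 W /\ kdq (dbound W V (G i)).
    by have [W] := GL i; exists W.
  have [W HW] := choice GL'.
  exists [set x | forall i, W i x].
    by apply: filter_forall => i; exact: (HW i).1.
  apply: kdq_all => i; first exact: upward_dbound.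
  apply: kdq_imp (HW i).2 => rho C r0 C0 H; exists C => // y vs Wy; apply: H.
  exact: Wy.
have cF : {for x0, continuous F}.
  by apply: fsum_continuous => i; exact: smo_differentiable (GU i) Ux0.
exists (U `&` (W `&` F @^-1` W')).
  apply: filterI; first exact: open_nbhs_nbhs.
  by apply: filterI => //; exact: cF.
have step A C rho r sigma : 0 < C -> 0 < A -> 0 < r -> 0 < rho -> 4 * rho <= sigma ->
    r * (1 + N%:R * (2 * A * M 1 * rho)) <= sigma ->
    (forall i, dbound W V (G i) rho A) -> dbound W' V' g r C ->
    dbound (U `&` (W `&` F @^-1` W')) V (fun x => g (F x)) sigma C.
  move=> C0 A0 r0 rho0 s4 sr HG Hg y vs [Uy [Wy /= Wy']] Vvs.
  have := @comp_bound _ M hM hlc X Z N L G z cL V V' LV zV U U' g y C A r rho sigma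
    oU oU' GU gU' UU' Uy C0 A0 r0 rho0 s4 sr
    (fun l Vl => Hg _ _ Wy' Vl) (fun i vs Vvs => HG i _ _ Wy Vvs) vs [::] Vvs _.
  rewrite /= expr0 mulr1 add0n => /(_ _)/le_trans; apply => //.
  by rewrite /wgt le_eqVlt; apply/orP; left; apply/eqP; ring.
have Mp : 0 < M 1 by exact: weight_gt0.
have e0 A rho : 0 < A -> 0 < rho -> 0 < 1 + N%:R * (2 * A * M 1 * rho).
  by move=> A0 r0; rewrite ltr_wpDr// !mulr_ge0// ltW.
move: HW HW'; rewrite /kdq; case: kd => [HG Hg sigma s0|[rho rho0 [A A0 HG]] [r r0 [C C0 Hg]]].
  (* The order of the choices matters: the radius [sigma / 4] for the [G i] produces [A], and the
     radius [r] for [g] depends on [A]. *)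
  have rho0 : 0 < sigma / 4 by rewrite divr_gt0.
  have [A A0 HA] := HG _ rho0.
  have r0 : 0 < sigma / (1 + N%:R * (2 * A * M 1 * (sigma / 4))).
    by rewrite divr_gt0// e0.
  have [C C0 HC] := Hg _ r0; exists C => //.
  apply: (step A C (sigma / 4) (sigma / (1 + N%:R * (2 * A * M 1 * (sigma / 4))))) => //.
    by rewrite mulrC divfK.
  by rewrite divfK// gt_eqF// e0.
exists (Num.max (4 * rho) (r * (1 + N%:R * (2 * A * M 1 * rho)))).
  by rewrite lt_max mulr_gt0.
by exists C => //; apply: (step A C rho r) => //; rewrite le_max lexx ?orbT.
Qed.

End Comp.

Section Germs.
Context {E : normedModType R}.
Implicit Types (f g : E -> R) (V D U : set E) (z : E).

(** [GG] cut off at order [n] along [D], for inductions on that order. *)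
Definition SC D V (n : nat) z f :=
  forall es, inV D es -> (size es <= n)%N -> LC V z (dird f es).

(* Estimates along [V] for all the derivatives in the directions of [D]; for a
   function of [(t, y)] this allows smooth but not ultradifferentiable
   dependence on [t]. *)
Definition GG D V z f := exists U, [/\ open U, U z, smo U f &
  forall es, inV D es -> LC V z (dird f es)].

Lemma SC0 D V z f : LC V z f -> SC D V 0 z f.
Proof. by move=> H [|//] _ _. Qed.

Lemma SCS D V n z f : SC D V n.+1 z f <->
  LC V z f /\ forall e, D e -> SC D V n z ('D_e (f : E -> R^o)).
Proof.
split=> [H|[H0 HS] es].
  split=> [|e De es Ves esn]; first exact: (H [::]).
  rewrite -dird_rcons; apply: H; last by rewrite size_rcons.
  by move=> w; rewrite mem_rcons inE => /orP[/eqP->|/Ves].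
case/lastP: es => [//|es e] /inV_rcons[Ves De]; rewrite size_rcons ltnS dird_rcons => esn.
exact: HS.
Qed.

Lemma SC_leq m n D V z f : (m <= n)%N -> SC D V n z f -> SC D V m z f.
Proof. by move=> mn H es Des esm; apply: H => //; exact: leq_trans mn. Qed.

Lemma eq_SC D V n z f g : (\forall y \near z, f y = g y) -> SC D V n z f -> SC D V n z g.
Proof.
move=> fg H es Des esn; apply: eq_LC (H es Des esn); exact: near_eq_dird.
Qed.

Lemma near_open U z : open U -> U z -> \forall y \near z, U y.
Proof. by move=> oU Uz; exact: open_nbhs_nbhs. Qed.

Lemma SC_D U D V n z f g : open U -> U z -> smo U f -> smo U g ->
  SC D V n z f -> SC D V n z g -> SC D V n z (fun x => f x + g x).
Proof.
move=> oU Uz fU gU Hf Hg es Des esn.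
apply: (@eq_LC _ V z (fun x => dird f es x + dird g es x)).
  by apply: filterS (near_open oU Uz) => x Ux; rewrite (dirdD es oU fU gU Ux).
by apply: (LC_D oU Uz); [exact: smo_dird|exact: smo_dird|exact: Hf|exact: Hg].
Qed.

Lemma SC_M U D V n z f g : open U -> U z -> smo U f -> smo U g ->
  SC D V n z f -> SC D V n z g -> SC D V n z (fun x => f x * g x).
Proof.
move=> oU Uz; elim: n f g => [|n ih] f g fU gU Hf Hg.
  by apply: SC0; apply: (LC_M oU Uz) => //; [exact: (Hf [::])|exact: (Hg [::])].
have /SCS[f0 fS] := Hf; have /SCS[g0 gS] := Hg.
apply/SCS; split=> [|e De]; first exact: (LC_M oU Uz).
have feU : smo U ('D_e (f : E -> R^o)) by exact: (smo_dird [:: e] fU).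
have geU : smo U ('D_e (g : E -> R^o)) by exact: (smo_dird [:: e] gU).
apply: (@eq_SC _ _ _ _ (fun y => 'D_e (f : E -> R^o) y * g y + f y * 'D_e (g : E -> R^o) y)).
  apply: filterS (near_open oU Uz) => x Ux; exact/esym/(derive_smoM e fU gU Ux).
apply: (SC_D oU Uz); [exact: smoM|exact: smoM| |].
  by apply: ih => //; [exact: fS|exact: SC_leq Hg].
by apply: ih => //; [exact: SC_leq Hf|exact: gS].
Qed.

Lemma SC_sum U D V n z N (f : 'I_N -> E -> R) : open U -> U z -> (forall i, smo U (f i)) ->
  (forall i, SC D V n z (f i)) -> SC D V n z (fun y => \sum_(i < N) f i y).
Proof.
move=> oU Uz fU Hf es Des esn.
apply: (@eq_LC _ V z (fun x => \sum_(i < N) dird (f i) es x)).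
  by apply: filterS (near_open oU Uz) => x Ux; rewrite (dird_sum es oU fU Ux).
by apply: (LC_sum oU Uz) => i; [exact: smo_dird|exact: Hf].
Qed.

Lemma GG_SC D V z f n : GG D V z f -> SC D V n z f.
Proof. by move=> [U [oU Uz fU H]] es Des _; exact: H. Qed.

Lemma GG_LC D V z f : GG D V z f -> LC V z f.
Proof. by move=> [U [_ _ _ H]]; exact: (H [::]). Qed.

Lemma eq_GG D V z f g : (\forall y \near z, f y = g y) -> GG D V z f -> GG D V z g.
Proof.
move=> fg [U [oU Uz fU H]]; exists (U `&` [set y | \forall x \near y, f x = g x]^°).
split.
- apply: openI => //; exact: open_interior.
- by split=> //; rewrite /interior /=; exact: near_join fg.
- move=> y [Uy /nbhs_singleton /= yfg] vs.
  by apply: near_eq_differentiable (fU y Uy vs); exact: near_eq_dird.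
- by move=> es Des; apply: eq_LC (H es Des); exact: near_eq_dird.
Qed.

Lemma GG_derive D V z f v : D v \/ V v -> GG D V z f -> GG D V z ('D_v (f : E -> R^o)).
Proof.
move=> Dv [U [oU Uz fU H]]; exists U; split=> //; first exact: (smo_dird [:: v] fU).
case: Dv => [Dv es Des|Vv es Des].
  rewrite -dird_rcons; apply: H => w.
  by rewrite mem_rcons inE => /orP[/eqP->|/Des].
(* A derivative along [V] is moved from the innermost to the outermost place, where [LC_derive]
   applies to [dird f es]. *)
rewrite -dird_rcons; apply: eq_LC (LC_derive Vv (H es Des)).
apply: filterS (near_open oU Uz) => x Ux.
by apply: (@dird_perm _ _ f U (v :: es)) => //; rewrite perm_sym perm_rcons.
Qed.

End Germs.

Section GermComposition.
Context {X Z : normedModType R} (N : nat).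
Variables (L : {linear X -> Z}) (G : 'I_N -> X -> R) (z : 'I_N -> Z).
Hypothesis cL : continuous L.
Variables (D V : set X) (D' V' : set Z).
Hypotheses (LD : forall v, D v -> D' (L v)).
Hypotheses (LV : forall v, V v -> V' (L v)) (zV : forall i, V' (z i)).
Local Notation F := (fsum L G z).

(** A derivative of the composite along [D] brings out derivatives of [g] along [L e], in [D'], and
    along [z i], in [V']. [GG_derive] keeps both in [GG], so the induction runs over all such
    [g]. *)
Let SC_comp n (U : set X) (U' : set Z) g x0 :
  open U -> open U' -> (forall i, smo U (G i)) -> smo U' g ->
  (forall x, U x -> U' (F x)) -> U x0 ->
  (forall i, SC D V n x0 (G i)) -> GG D' V' (F x0) g ->
  SC D V n x0 (fun x => g (F x)).
Proof.
move=> oU oU' GU + UU' Ux0; elim: n g => [|n ih] g gU' HG Hg.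
  apply: SC0; apply: (LC_comp cL LV zV oU oU') => //; last exact: GG_LC Hg.
  by move=> i; exact: (HG i [::]).
have HG0 i : LC V x0 (G i) by have /SCS[] := HG i.
have HGn i : SC D V n x0 (G i) by exact: SC_leq (HG i).
have HG1 e i : D e -> SC D V n x0 ('D_e (G i : X -> R^o)).
  by move=> De; have /SCS[_] := HG i; exact.
apply/SCS; split=> [|e De].
  by apply: (LC_comp cL LV zV oU oU') => //; exact: GG_LC Hg.
have kU w : smo U' ('D_w (g : Z -> R^o)) by exact: (smo_dird [:: w] gU').
have dGU i : smo U ('D_e (G i : X -> R^o)) by exact: (smo_dird [:: e] (GU i)).
have hFU (h : Z -> R) : smo U' h -> smo U (fun x => h (F x)).
  by move=> hU; exact: (smo_comp_fsum cL oU oU' GU hU UU').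
apply: (@eq_SC _ _ _ _ _ (fun x => 'D_(L e) (g : Z -> R^o) (F x) +
    \sum_(i < N) 'D_(z i) (g : Z -> R^o) (F x) * 'D_e (G i : X -> R^o) x)).
  apply: filterS (near_open oU Ux0) => x Ux.
  apply/esym/(proj2 (derive_comp_fsum cL e _ _)) => [i|].
    exact: smo_differentiable (GU i) Ux.
  exact: smo_differentiable gU' (UU' _ Ux).
have prU i : smo U (fun x => 'D_(z i) (g : Z -> R^o) (F x) * 'D_e (G i : X -> R^o) x).
  by apply: (smoM oU _ (dGU i)); exact: (hFU ('D_(z i) (g : Z -> R^o)) (kU _)).
have hkU w : smo U (fun x => 'D_w (g : Z -> R^o) (F x)).
  exact: (hFU ('D_w (g : Z -> R^o)) (kU _)).
apply: (SC_D oU Ux0); [exact: hkU|exact: smo_sum| |].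
  by apply: (ih ('D_(L e) (g : Z -> R^o))) => //; apply: GG_derive Hg; left; exact: LD.
apply: (SC_sum oU Ux0 prU) => i; apply: (SC_M oU Ux0 (hkU _) (dGU i)).
  by apply: (ih ('D_(z i) (g : Z -> R^o))) => //; apply: GG_derive Hg; right.
exact: HG1.
Qed.

(** Directions in which only smoothness is known pass through the linear part alone; the nonlinear
    part enters [g] along the [z i], where [g] has estimates. *)
Lemma GG_comp g x0 : (forall i, GG D V x0 (G i)) -> GG D' V' (F x0) g ->
  GG D V x0 (fun x => g (F x)).
Proof.
move=> HG Hg; have [U' [oU' Uz gU' _]] := Hg.
have [U oU [Ux0 GU]] : exists2 U, open U & U x0 /\ forall i, smo U (G i).
  have [W HW] := choice HG.
  exists [set x | forall i, W i x]^°; first exact: open_interior.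
  split.
    rewrite /interior /=; apply: filter_forall => i.
    by have [oW Wx _ _] := HW i; exact: open_nbhs_nbhs.
  move=> i; have [_ _ + _] := HW i; apply: smo_sub => y /interior_subset; exact.
have oU1 : open (U `&` F @^-1` U').
  rewrite openE => x [Ux U'x]; rewrite /interior; apply: filterI.
    exact: open_nbhs_nbhs.
  have cF : {for x, continuous F}.
    by apply: (fsum_continuous cL) => i; exact: smo_differentiable (GU i) Ux.
  by apply: cF; exact: open_nbhs_nbhs.
have GU1 i : smo (U `&` F @^-1` U') (G i) by apply: smo_sub (GU i); exact: subIsetl.
have UU1 x : (U `&` F @^-1` U') x -> U' (F x) by case.
exists (U `&` F @^-1` U'); split=> //; first exact: (smo_comp_fsum cL oU1 oU' GU1 gU' UU1).
move=> es Des.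
apply: (@SC_comp (size es) _ _ _ _ oU1 oU' GU1 gU' UU1) => // i.
exact: GG_SC.
Qed.

End GermComposition.

End Classes.

(** * Taylor remainders *)

Section Multilinearity.
Context {R : realType} {E : normedModType R}.
Implicit Types (f : E -> R) (U : set E) (vs : seq E).

Definition uball : set E := [set v | `|v| <= 1].

Definition mlin (phi : seq E -> R) := forall vs ws (a : R) v w,
  phi (vs ++ (a *: v + w) :: ws) = a * phi (vs ++ v :: ws) + phi (vs ++ w :: ws).

Lemma mlin_zero phi vs ws : mlin phi -> phi (vs ++ 0 :: ws) = 0.
Proof.
by move=> /(_ vs ws (-1) 0 0); rewrite scaler0 addr0 mulN1r addNr.
Qed.

Lemma mlin_homog phi vs (a : R) v ws : mlin phi ->
  phi (vs ++ (a *: v) :: ws) = a * phi (vs ++ v :: ws).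
Proof.
by move=> ml; have := ml vs ws a v 0; rewrite addr0 (mlin_zero _ _ ml) addr0.
Qed.

Lemma mlin_homogs phi (a : R) ws vs : mlin phi ->
  phi (ws ++ [seq a *: v | v <- vs]) = a ^+ size vs * phi (ws ++ vs).
Proof.
move=> ml; elim: vs ws => [|v vs ih] ws; first by rewrite mul1r.
rewrite /= (mlin_homog _ _ _ _ ml).
by have := ih (rcons ws v); rewrite !cat_rcons => ->; rewrite exprS mulrA.
Qed.

Lemma dird_mlin U f y : open U -> smo U f -> U y -> mlin (fun vs => dird f vs y).
Proof. by move=> oU fU Uy vs ws a v w; exact: (dird_linear vs v w a ws oU fU Uy). Qed.

Lemma dird_zero U f vs ws y : open U -> smo U f -> U y ->
  dird f (vs ++ 0 :: ws) y = 0.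
Proof. by move=> oU fU Uy; exact: (mlin_zero vs ws (dird_mlin oU fU Uy)). Qed.

Lemma dird_homog U f vs (a : R) v ws y : open U -> smo U f -> U y ->
  dird f (vs ++ (a *: v) :: ws) y = a * dird f (vs ++ v :: ws) y.
Proof. by move=> oU fU Uy; exact: (mlin_homog vs a v ws (dird_mlin oU fU Uy)). Qed.

Lemma dird_homogs U f (a : R) vs y : open U -> smo U f -> U y ->
  dird f [seq a *: v | v <- vs] y = a ^+ size vs * dird f vs y.
Proof. by move=> oU fU Uy; exact: (mlin_homogs a [::] vs (dird_mlin oU fU Uy)). Qed.

Lemma opnorm_le k (phi : k.-tuple E -> R) (c : R) :
  (forall v : k.-tuple E, inV uball v -> `|phi v| <= c) -> (opnorm phi <= c%:E)%E.
Proof.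
move=> H; apply: ge_ereal_sup => _ [v /= v1 <-]; rewrite lee_fin H//.
by move=> w /tnthP[i ->]; exact: v1.
Qed.

Lemma le_opnorm k (phi : k.-tuple E -> R) (v : k.-tuple E) : inV uball v ->
  ((`|phi v|)%:E <= opnorm phi)%E.
Proof.
by move=> v1; apply: ereal_sup_ubound; exists v => // i; apply: v1; exact: mem_tnth.
Qed.

Lemma tuple_upd k (v : k.-tuple E) (i : 'I_k) (z : E) :
  [tuple if j == i then z else tnth v j | j < k] = take i v ++ z :: drop i.+1 v :> seq E.
Proof.
have sz : size (take i v ++ z :: drop i.+1 v) = k.
  by rewrite size_cat /= size_takel ?size_drop size_tuple ?(ltnW (ltn_ord i))// subnSK ?subnKC// ltnW.
apply: (@eq_from_nth _ 0); first by rewrite sz size_tuple.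
move=> j; rewrite size_tuple => jk; have := @nth_mktuple _ _ (fun j => if j == i then z else tnth v j) 0 (Ordinal jk).
rewrite /= => ->; rewrite nth_cat size_takel ?size_tuple ?(ltnW (ltn_ord i))//.
rewrite -val_eqE /=; case: ltngtP => ji.
- by rewrite nth_take// (tnth_nth 0).
- have -> : (j - i = (j - i.+1).+1)%N by lia.
  by rewrite /= nth_drop (tnth_nth 0) /= subnKC.
- by rewrite ji subnn.
Qed.

Lemma Lsym_jet U f k x (C : R) : open U -> smo U f -> U x ->
  (forall vs, inV uball vs -> size vs = k -> `|dird f vs x| <= C) ->
  Lsym (jet_of f (k := k) x).
Proof.
move=> oU fU Ux fC; split.
- move=> i v a y z /=; rewrite /jet_of -/(dird f _ x) -!/(dird f _ x) !tuple_upd.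
  exact: (dird_linear (take i v) y z a (drop i.+1 v) oU fU Ux).
- move=> s v; apply: (dird_perm oU fU _ Ux).
  by apply/tuple_permP; exists s.
- apply: le_lt_trans (opnorm_le (c := C) _) (ltry _) => v v1.
  by apply: fC; rewrite ?size_tuple.
Qed.

End Multilinearity.

Section Taylor.
Context {R : realType} {E : normedModType R}.
Implicit Types (f : E -> R) (U : set E) (vs : seq E).

(** Both [theta + psi] and [theta - psi] vanish at 0 and have nonnegative derivatives. *)
Lemma derive_bound_mono (psi dpsi theta dtheta : R -> R) :
  (forall t : R, 0 <= t <= 1 -> is_derive t (1 : R) psi (dpsi t)) ->
  (forall t : R, 0 <= t <= 1 -> is_derive t (1 : R) theta (dtheta t)) ->
  psi 0 = 0 -> theta 0 = 0 -> (forall t : R, 0 <= t <= 1 -> `|dpsi t| <= dtheta t) ->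
  forall t : R, 0 <= t <= 1 -> `|psi t| <= theta t.
Proof.
move=> dp dt p0 t0 H t /andP[t0' t1].
have sub (s : R) : 0 <= s <= t -> 0 <= s <= 1.
  by move=> /andP[-> st]; rewrite (le_trans st).
have pos (h dh : R -> R) : (forall s : R, 0 <= s <= 1 -> is_derive s (1 : R) h (dh s)) ->
    h 0 = 0 -> (forall s : R, 0 <= s <= 1 -> 0 <= dh s) -> 0 <= h t.
  move=> hh h0 dh0.
  have [||c] := @MVT_segment R h dh 0 t t0'.
  - by move=> s; rewrite in_itv /= => /andP[s0 st]; apply/hh/sub; rewrite !ltW.
  - apply: derivable_within_continuous => s; rewrite in_itv /= => /sub/hh ds.
    by case: ds.
  by rewrite in_itv /= h0 !subr0 => /sub/dh0 c0 ->; rewrite mulr_ge0.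
rewrite ler_norml; apply/andP; split.
  rewrite lerNl -subr_ge0 opprK.
  apply: (pos (fun s => theta s + psi s) (fun s => dtheta s + dpsi s)).
  - by move=> s s01; apply: is_deriveD; [exact: dt|exact: dp].
  - by rewrite p0 t0 addr0.
  - by move=> s s01; have := H s s01; rewrite ler_norml => /andP[]; rewrite -subr_ge0 opprK addrC.
rewrite -subr_ge0; apply: (pos (fun s => theta s - psi s) (fun s => dtheta s - dpsi s)).
- by move=> s s01; apply: is_deriveB; [exact: dt|exact: dp].
- by rewrite p0 t0 subrr.
- by move=> s s01; have := H s s01; rewrite ler_norml subr_ge0 => /andP[].
Qed.

Lemma is_derive_pow (n : nat) (c t : R) :
  is_derive t (1 : R) (fun s : R => s ^+ n.+1 / (n.+1)`!%:R * c) (t ^+ n / n`!%:R * c).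
Proof.
have h := @is_deriveX R R id n t (1 : R) (1 : R) (is_derive_id _ _).
have k : is_derive t (1 : R) ((c / (n.+1)`!%:R) \*: (id ^+ n.+1 : R -> R)) ((c / (n.+1)`!%:R) *: ((n.+1%:R * t ^+ n) *: (1:R))).
  by apply: is_deriveZ; exact: h.
have -> : (fun s : R => s ^+ n.+1 / (n.+1)`!%:R * c) = ((c / (n.+1)`!%:R) \*: (id ^+ n.+1 : R -> R)).
  by apply/funext => s; rewrite /= !fctE [RHS]/GRing.scale /= ; ring.
apply: is_derive_eq k _; rewrite [n.+1`!]factS natrM.
rewrite /GRing.scale /= mulr1; field.
by rewrite -(natrD _ 1) !pnatr_eq0 -lt0n fact_gt0.
Qed.

(** Taylor's formula without integrals: the remainder of order [n + 1] has as its derivative in [t]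
    the remainder of order [n] of ['D_d f], and is compared with a primitive of the bound for the
    latter. *)
Lemma taylor_line U f y d (B : R) n (t : R) : open U -> smo U f ->
  (forall s : R, 0 <= s <= 1 -> U (y + s *: d)) ->
  (forall s : R, 0 <= s <= 1 -> `|dird f (nseq n d) (y + s *: d)| <= B) ->
  0 <= t <= 1 ->
  `|f (y + t *: d) - \sum_(j < n) t ^+ j / j`!%:R * dird f (nseq j d) y|
     <= t ^+ n / n`!%:R * B.
Proof.
move=> oU; elim: n f t => [|n ih] f t fU Uyd fB t01.
  by rewrite big_ord0 subr0 fact0 expr0 invr1 !mul1r; exact: fB.
have fdU : smo U ('D_d (f : E -> R^o)) by exact: (smo_dird [:: d] fU).
pose psi t := f (y + t *: d) - \sum_(j < n.+1) t ^+ j / j`!%:R * dird f (nseq j d) y.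
pose dpsi t := 'D_d (f : E -> R^o) (y + t *: d) -
   \sum_(j < n) t ^+ j / j`!%:R * dird ('D_d (f : E -> R^o)) (nseq j d) y.
have nS j : dird ('D_d (f : E -> R^o)) (nseq j d) = dird f (nseq j.+1 d).
  by rewrite -dird_rcons; congr (dird f _); elim: j => //= j ->.
apply: (@derive_bound_mono psi dpsi (fun t => t ^+ n.+1 / (n.+1)`!%:R * B)
  (fun t => t ^+ n / n`!%:R * B)) => //.
- move=> s s01; rewrite /psi /dpsi.
  have -> : (fun t => f (y + t *: d) - \sum_(j < n.+1) t ^+ j / j`!%:R * dird f (nseq j d) y) =
    (fun t => f (y + t *: d) - (\sum_(j < n) (fun t => t ^+ j.+1 / (j.+1)`!%:R * dird f (nseq j.+1 d) y) + cst (f y)) t).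
    apply/funext => r; rewrite big_ord_recl /= fact0 expr0 invr1 !mul1r; congr (_ - _).
    rewrite addrC fctE fct_sumE; congr (_ + _).
  apply: is_deriveB.
    by apply: is_derive_line; apply: diff_derivable; apply: (fU _ (Uyd _ s01) [::]).
  rewrite -[X in is_derive _ _ _ X]addr0; apply: is_deriveD.
  by apply: is_derive_sum => i; rewrite nS; exact: is_derive_pow.
- by move=> s _; exact: is_derive_pow.
- rewrite /psi scale0r addr0 big_ord_recl /= fact0 expr0 invr1 !mul1r big1 ?addr0 ?subrr// => i _.
  by rewrite expr0n /= !mul0r.
- by rewrite expr0n /= !mul0r.
- move=> s s01; apply: ih => // r r01; rewrite nS; exact: fB.
Qed.

End Taylor.

(** * From bounds of directional derivatives to norms of jets *)

Section JetNorms.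
Context {R : realType} {E : normedModType R}.
Implicit Types (f : E -> R) (U K : set E) (vs : seq E).

(** Local bounds uniform over unit directions, which turn smoothness along each direction into
    smoothness in operator norm. *)
Definition locbd U f := forall k x, U x -> exists C, \forall y \near x,
  forall vs, inV uball vs -> size vs = k -> `|dird f vs y| <= C.

Lemma dird_norm2 U f (a b : E) vs y (C : R) : open U -> smo U f -> U y ->
  (forall ws, inV uball ws -> size ws = (size vs).+2 -> `|dird f ws y| <= C) ->
  inV uball vs -> `|dird f (a :: b :: vs) y| <= `|a| * `|b| * C.
Proof.
move=> oU fU Uy fC vs1.
have [->|a0] := eqVneq a 0.
  by have := dird_zero [::] (b :: vs) oU fU Uy; rewrite cat0s => ->; rewrite !normr0 !mul0r.
have [->|b0] := eqVneq b 0.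
  by have := dird_zero [:: a] vs oU fU Uy; rewrite cat1s => ->; rewrite !normr0 mulr0 mul0r.
have nn (c : E) : c != 0 -> c = `|c| *: (`|c|^-1 *: c).
  by move=> c0; rewrite scalerA divff ?scale1r// normr_eq0.
have n1 (c : E) : c != 0 -> uball (`|c|^-1 *: c).
  by move=> c0; rewrite /uball /= normrZ normfV normr_id mulVf// normr_eq0.
rewrite {1}(nn a a0) {1}(nn b b0).
rewrite (dird_homog [::] _ _ _ oU fU Uy) (dird_homog [:: _] _ _ _ oU fU Uy).
rewrite !normrM !normr_id -mulrA !ler_wpM2l// fC//.
move=> w; rewrite !inE => /or3P[/eqP->|/eqP->|/vs1//]; exact: n1.
Qed.

Lemma dird_norm1 U f (a : E) vs y (C : R) : open U -> smo U f -> U y ->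
  (forall ws, inV uball ws -> size ws = (size vs).+1 -> `|dird f ws y| <= C) ->
  inV uball vs -> `|dird f (a :: vs) y| <= `|a| * C.
Proof.
move=> oU fU Uy fC vs1.
have [->|a0] := eqVneq a 0.
  by have := dird_zero [::] vs oU fU Uy; rewrite cat0s => ->; rewrite !normr0 !mul0r.
have nn : a = `|a| *: (`|a|^-1 *: a) by rewrite scalerA divff ?scale1r// normr_eq0.
have n1 : uball (`|a|^-1 *: a).
  by rewrite /uball /= normrZ normfV normr_id mulVf// normr_eq0.
rewrite {1}nn (dird_homog [::] _ _ _ oU fU Uy).
rewrite !normrM !normr_id ler_wpM2l// fC//.
by move=> w; rewrite !inE => /orP[/eqP->|/vs1//].
Qed.

Lemma locbd_ball U f k x : open U -> locbd U f -> U x ->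
  exists2 d : R, 0 < d & exists C : R, 0 < C /\ forall y, `|y - x| < d ->
    U y /\ forall vs, inV uball vs -> size vs = k -> `|dird f vs y| <= C.
Proof.
move=> oU fb Ux; have [C HC] := fb k x Ux.
have [d d0 dP] := near_dist (filterI (near_open oU Ux) HC).
exists d => //; exists (`|C| + 1); split; first by rewrite ltr_wpDl.
move=> y /dP[Uy Hy]; split=> // vs v1 vk; rewrite (le_trans (Hy vs v1 vk))//.
by rewrite (le_trans (ler_norm _))// lerDl.
Qed.

(** Two applications of the mean value theorem express the error as a second derivative along
    multiples of [h], at most [C * |h|^2] uniformly in unit [v]. *)
Lemma frechet_jet U f : open U -> smo U f -> locbd U f -> frechet_smooth U f.
Proof.
move=> oU fU fb D k x Ux; split.
  have [C /nbhs_singleton HC] := fb k x Ux.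
  exact: (Lsym_jet (k := k) oU fU Ux HC).
move=> e e0; have [d d0 [C [C0 dP]]] := locbd_ball k.+2 oU fb Ux.
apply: (@dist_near _ _ _ (Num.min d (e / C))).
  by rewrite lt_min d0 divr_gt0.
move=> h; rewrite subr0 lt_min => /andP[hd he].
apply: opnorm_le => v v1.
rewrite /D /jet_of -/(dird f v (x + h)) -/(dird f v x) -/(dird f (h :: v) x).
have seg (c : R) : 0 <= c <= 1 -> `|x + c *: h - x| < d.
  move=> /andP[c0 c1]; rewrite addrAC subrr add0r normrZ ger0_norm//.
  by rewrite (le_lt_trans _ hd)// ler_piMl.
have dv := smo_dird v fU.
have [s s01|c c01 ->] := @MVT_line _ _ (dird f v) x h.
  exact: (smo_differentiable dv (dP _ (seg _ s01)).1).
rewrite -/(dird f (h :: v) _).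
have seg2 (s : R) : 0 <= s <= 1 -> 0 <= s * c <= 1.
  move=> /andP[s0 s1]; have /andP[c0 c1] := c01; rewrite mulr_ge0//=.
  by rewrite (le_trans (ler_piMl c0 s1)).
have [s s01|c' c01' ->] := @MVT_line _ _ (dird f (h :: v)) x (c *: h).
  apply: (smo_differentiable (smo_dird (h :: v) fU)).
  by rewrite scalerA; exact: (dP _ (seg _ (seg2 _ s01))).1.
rewrite -/(dird f [:: c *: h, h & v] _) scalerA.
have [Uz Hz] := dP _ (seg _ (seg2 _ c01')).
have Hz' ws : inV uball ws -> size ws = (size v).+2 -> `|dird f ws (x + c' * c *: h)| <= C.
  by rewrite size_tuple; exact: Hz.
apply: le_trans (dird_norm2 _ _ oU fU Uz Hz' v1) _.
have /andP[c0 c1] := c01.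
rewrite normrZ ger0_norm// -mulrA mulrC -mulrA.
apply: le_trans (_ : `|h| * C * `|h| <= _).
  by rewrite mulrA ler_wpM2l ?mulr_ge0 ?(ltW C0)// ler_piMl.
by rewrite ler_wpM2r// -ler_pdivlMr// ltW.
Qed.

Lemma convex_line K x y (t : R) : convex_set K -> K x -> K y -> 0 <= t <= 1 ->
  K (y + t *: (x - y)).
Proof.
move=> cK Kx Ky t01.
have tP : Itv.spec (@Itv.num_sem R) (Itv.Real `[0, 1]%Z) t.
  by rewrite /= /Itv.num_sem /= in_itv /= num_real.
have := cK x y (Itv.Def tP); rewrite !inE => /(_ Kx Ky).
rewrite /conv /= /isConvexSpace.conv /=.
suff -> : y + t *: (x - y) = t *: x + (1 - t) *: y by [].
by rewrite scalerBr scalerBl scale1r addrCA.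
Qed.

Section Rho.
Context (M : nat -> R) (hM : weight_sequence M).
Variables (K U : set E) (f : E -> R) (rho C : R).
Hypotheses (oU : open U) (fU : smo U f) (fb : locbd U f) (KU : K `<=` U).
Hypotheses (cK : convex_set K) (rho0 : 0 < rho) (C0 : 0 <= C).
Hypothesis fC : forall x vs, K x -> inV uball vs -> `|dird f vs x| <= C * wgt M rho (size vs).

Let sup_le (A : set (\bar R)) (c : R) : 0 <= c -> (forall a, A a -> (a <= c%:E)%E) ->
  (sup_ge0 A <= c%:E)%E.
Proof. by move=> c0 H; apply: ge_ereal_sup => a [->|/H//]; rewrite lee_fin. Qed.

Let w0 m : 0 < wgt M rho m. Proof. exact: wgt_gt0. Qed.

(** Convexity keeps the segment from [y] to [x] in [K], and the bound of Taylor's remainder has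
    exactly the normalisation of [jet_remainder_norm]; neither [rho] nor [C] changes. *)
Lemma rho_norm_jet : (rho_norm M rho K (jet_of f) <= C%:E)%E.
Proof.
rewrite /rho_norm ge_max; apply/andP; split; apply: ge_ereal_sup.
  move=> _ [m _ <-]; rewrite -/(wgt M rho m) lee_pdivrMr// -EFinM.
  apply: sup_le; first by rewrite mulr_ge0// ltW.
  move=> _ [x Kx <-]; apply: opnorm_le => v v1.
  by have := fC Kx v1; rewrite size_tuple.
move=> _ [[n k] _ <-] /=; rewrite -/(wgt M rho (n + k).+1) lee_pdivrMr// -EFinM.
apply: sup_le; first by rewrite mulr_ge0// ltW.
move=> _ [[x y] /= [Kx [Ky xy]] <-].
have n0 : 0 < `|x - y| by rewrite normr_gt0 subr_eq0; apply/eqP.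
have f0 : 0 < (n.+1)`!%:R :> R by rewrite ltr0n fact_gt0.
rewrite muleC -lee_pdivlMr ?divr_gt0 ?exprn_gt0// -EFinM.
apply: opnorm_le => v v1; rewrite /jet_remainder.
have seg (s : R) : 0 <= s <= 1 -> K (y + s *: (x - y)) by exact: convex_line.
have dnU := smo_dird v fU.
pose B := `|x - y| ^+ n.+1 * (C * wgt M rho (n + k).+1).
have h1 (s : R) : 0 <= s <= 1 -> `|dird (dird f v) (nseq n.+1 (x - y)) (y + s *: (x - y))| <= B.
  move=> s01; rewrite -dird_cat.
  have nE : nseq n.+1 (x - y) = [seq `|x - y| *: u | u <- nseq n.+1 (`|x - y|^-1 *: (x - y))].
    by rewrite map_nseq scalerA divff ?scale1r// gt_eqF.
  have := dird_homogs `|x - y| (nseq n.+1 (`|x - y|^-1 *: (x - y))) oU (smo_dird v fU) (KU (seg s s01)).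
  rewrite -nE -!dird_cat size_nseq => ->.
  rewrite normrM ger0_norm ?exprn_ge0// ler_wpM2l ?exprn_ge0//.
  have -> : (n + k).+1 = size (nseq n.+1 (`|x - y|^-1 *: (x - y)) ++ v).
    by rewrite size_cat size_nseq size_tuple.
  apply: fC; first exact: seg.
  apply: inV_cat => // w /nseqP[-> _].
  by rewrite /uball /= normrZ normfV normr_id mulVf// gt_eqF.
have h2 (s : R) : 0 <= s <= 1 -> U (y + s *: (x - y)) by move=> /seg /KU.
have t1 : (0 : R) <= (1 : R) <= (1 : R) by rewrite ler01 lexx.
have := taylor_line oU dnU h2 h1 t1; rewrite scale1r subrKC expr1n.
rewrite mul1r => H; apply: le_trans (le_trans H _).
  rewrite le_eqVlt; apply/orP; left; apply/eqP; congr (`| _ - _ |).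
  apply: eq_bigr => j _; rewrite expr1n mul1r -dird_cat.
  by [].
rewrite /B invfM invrK le_eqVlt; apply/orP; left; apply/eqP; ring.
Qed.

Lemma C_rho_jet : C_rho M rho K (jet_of f).
Proof.
split.
- move=> k x Kx; apply: (@Lsym_jet _ _ U f k x (C * wgt M rho k) oU fU (KU Kx)).
  by move=> vs v1 <-; exact: fC.
- move=> k x Kx e e0.
  have [d d0 [D [D0 dP]]] := locbd_ball k.+1 oU fb (KU Kx).
  apply: (@dist_near _ _ _ (Num.min d (e / D))); first by rewrite lt_min d0 divr_gt0.
  move=> y; rewrite lt_min => /andP[yd ye] Ky; apply: opnorm_le => v v1.
  rewrite /jet_of -!/(dird f v _).
  have seg (s : R) : 0 <= s <= 1 -> `|x + s *: (y - x) - x| < d.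
    move=> /andP[c0 c1]; rewrite addrAC subrr add0r normrZ ger0_norm//.
    by rewrite (le_lt_trans _ yd)// ler_piMl.
  have [s s01|c c01] := @MVT_line _ _ (dird f v) x (y - x).
    exact: (smo_differentiable (smo_dird v fU) (dP _ (seg _ s01)).1).
  rewrite subrKC => ->; rewrite -/(dird f (y - x :: v) _).
  have [Uz Hz] := dP _ (seg _ c01).
  have Hz' ws : inV uball ws -> size ws = (size v).+1 -> `|dird f ws (x + c *: (y - x))| <= D.
    by rewrite size_tuple; exact: Hz.
  apply: le_trans (dird_norm1 _ oU fU Uz Hz' v1) _.
  by rewrite -ler_pdivlMr// ltW.
- exact: le_lt_trans rho_norm_jet (ltry _).
Qed.

End Rho.

End JetNorms.

(** * Local estimates imply membership in the class on a normed space *)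

Section BanachCriterion.
Context {R : realType} (kd : dc_kind) (M : nat -> R) (hM : weight_sequence M).
Context {E : normedModType R}.
Implicit Types (f : E -> R) (U K : set E).

Definition LCon U f := forall x, U x -> LC kd M uball x f.

Lemma LC_locbd U f : LCon U f -> locbd U f.
Proof.
move=> fL k x Ux; have [W Wx HW] := fL x Ux.
have [rho [C [rho0 C0 H]]] : exists rho C, [/\ 0 < rho, 0 < C & dbound M W uball f rho C].
  move: HW; rewrite /kdq; case: (kd) => [|[rho r0 [C C0 H]]]; last by exists rho, C.
  by move=> /(_ 1 ltr01)[C C0 H]; exists 1, C.
exists (C * wgt M rho k); apply: filterS Wx => y Wy vs v1 <-; exact: H.
Qed.

Lemma LC_compact K f : compact K -> (forall x, K x -> LC kd M uball x f) ->
  kdq kd (dbound M K uball f).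
Proof.
move=> /compact_near_coveringP cK fL; rewrite /kdq.
have : match kd with
  | Beurling => forall rho, 0 < rho -> forall x, K x -> exists2 W, nbhs x W & exists2 C, 0 < C & dbound M W uball f rho C
  | Roumieu => forall x, K x -> exists2 W, nbhs x W & exists2 rho, 0 < rho & exists2 C, 0 < C & dbound M W uball f rho C end.
  move: fL; rewrite /LC /kdq; case: kd => H; last exact: H.
  by move=> rho r0 x /H[W Wx HW]; exists W => //; exact: HW.
case: kd => H.
  move=> rho r0.
  have := cK R (pinfty_nbhs R) (fun C y => forall vs, inV uball vs -> `|dird f vs y| <= C * wgt M rho (size vs)) _.
  have : forall x, K x -> \forall x' \near x & i \near pinfty_nbhs R,
      forall vs, inV uball vs -> `|dird f vs x'| <= i * wgt M rho (size vs).
    move=> x /(H rho r0)[W Wx [C C0 HC]].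
    exists (W, [set i | C <= i]); first by split=> //; apply: nbhs_pinfty_ge; exact: num_real.
    move=> [y i] /= [Wy Ci] vs v1; apply: (upward_dbound hM r0 (lexx _) C0 Ci HC) => //.
  move=> h /(_ _ h) h2.
  have [C [C0 HC]] := filter_ex (filterI (nbhs_pinfty_gt (num_real (0 : R))) h2).
  by exists C => // y vs Ky; exact: HC.
(* A single real number plays the parts of both the radius and the constant, so that the covering
   argument runs along one filter. *)
have := cK R (pinfty_nbhs R) (fun C y => forall vs, inV uball vs -> `|dird f vs y| <= C * wgt M C (size vs)) _.
have : forall x, K x -> \forall x' \near x & i \near pinfty_nbhs R,
    forall vs, inV uball vs -> `|dird f vs x'| <= i * wgt M i (size vs).
  move=> x /H[W Wx [rho r0 [C C0 HC]]].
  exists (W, [set i | rho <= i /\ C <= i]).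
    by split=> //=; apply: filterI; apply: nbhs_pinfty_ge; exact: num_real.
  by move=> [y i] /= [Wy [ri Ci]] vs v1; apply: (upward_dbound hM r0 ri C0 Ci HC).
move=> h /(_ _ h) h2.
have [C [C0 HC]] := filter_ex (filterI (nbhs_pinfty_gt (num_real (0 : R))) h2).
by exists C => //; exists C => // y vs Ky; exact: HC.
Qed.

Lemma CM_jet_of U K f : open U -> smo U f -> LCon U f -> compact K -> convex_set K ->
  K `<=` U -> CM_jet kd M K (jet_of f).
Proof.
move=> oU fU fL cK xK KU; have fb := LC_locbd fL.
have := LC_compact cK (fun x Kx => fL x (KU x Kx)); rewrite /kdq /CM_jet; case: kd => H.
  move=> rho r0; have [C C0 HC] := H _ r0.
  by apply: (@C_rho_jet _ _ M hM K U f rho C) => //; exact: ltW.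
have [rho r0 [C C0 HC]] := H; exists rho => //.
by apply: (@C_rho_jet _ _ M hM K U f rho C) => //; exact: ltW.
Qed.

Lemma banach_CM_of U f : open U -> smo U f -> LCon U f -> banach_CM kd M U f.
Proof.
move=> oU fU fL; split; first by apply: frechet_jet => //; exact: LC_locbd.
by move=> K cK xK KU; exact: CM_jet_of KU.
Qed.

End BanachCriterion.

(** * Frechet smoothness and Banach disks *)

Section LinearMaps.
Context {R : realType} {V W : normedModType R}.

Lemma lipschitz_continuous (f : {linear V -> W}) (K : R) :
  (forall x, `|f x| <= K * `|x|) -> continuous f.
Proof.
move=> fK; apply: bounded_linear_continuous; apply/linear_boundedP.
apply: filterS (nbhs_pinfty_ge (num_real K)) => r Kr x.
by apply: le_trans (fK x) _; rewrite ler_wpM2r.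
Qed.

End LinearMaps.

Section FrechetSmooth.
Context {R : realType} {E : normedModType R}.
Implicit Types (f : E -> R) (U K : set E).

Lemma Lsym_mlin f x : (forall k, Lsym (jet_of f (k := k) x)) ->
  mlin (fun vs => dird f vs x).
Proof.
move=> H vs ws a v w.
have sz : (size vs < size (vs ++ v :: ws))%N by rewrite size_cat /= -addSnnS leq_addr.
have [/(_ (Ordinal sz) (in_tuple (vs ++ v :: ws)) a v w) /= + _ _] := H (size (vs ++ v :: ws)).
rewrite /jet_of -!/(dird f _ x) !tuple_upd /= take_size_cat//.
have -> // : drop (size vs).+1 (vs ++ v :: ws) = ws.
by rewrite -cat_rcons -(size_rcons vs v) drop_size_cat.
Qed.

(** Estimates are stated for unit directions; multilinearity extends them to a given list at the
    price of a power of [c]. *)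
Lemma unit_scale (vs : seq E) : exists2 c : R, 1 <= c &
  exists2 us : seq E, inV uball us & vs = [seq c *: u | u <- us].
Proof.
have [c c1 cv] : exists2 c : R, 1 <= c & forall v, v \in vs -> `|v| <= c.
  elim: vs => [|v vs [c c1 cv]]; first by exists 1.
  exists (Num.max c `|v|); first by rewrite le_max c1.
  move=> w; rewrite inE => /orP[/eqP->|/cv wc]; rewrite le_max ?lexx ?orbT//.
  by rewrite wc.
have c0 : 0 < c by apply: lt_le_trans c1.
exists c => //; exists [seq c^-1 *: v | v <- vs].
  move=> w /mapP[v /cv vc ->]; rewrite /uball /= normrZ gtr0_norm ?invr_gt0//.
  by rewrite ler_pdivrMl// mulr1.
rewrite -map_comp -[LHS]map_id; apply: eq_map => v /=.
by rewrite scalerA mulfV ?scale1r// gt_eqF.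
Qed.

(** Evaluating the estimates in operator norm at fixed directions, scaled into the unit ball, yields
    the differential [h |-> dird f (h :: vs) x], which is bounded because the next jet component
    is. *)
Lemma frechet_smo U f : open U -> frechet_smooth U f -> smo U f.
Proof.
move=> oU fU x Ux vs.
have ml y : U y -> mlin (fun vs => dird f vs y).
  by move=> Uy; apply: Lsym_mlin => k; exact: (fU k y Uy).1.
pose df h := dird f (h :: vs) x.
have df_lin : linear df.
  by move=> a v w; have := ml x Ux [::] vs a v w; rewrite /df.
pose dfl : {linear E -> R} := HB.pack df (GRing.isLinear.Build R E R *%R df df_lin).
have [c c1 [us u1 vsE]] := unit_scale vs.
have c0 : 0 < c by apply: lt_le_trans c1.
set k := size vs; have usk : size us = k by rewrite /k vsE size_map.
have ck : 0 < c ^+ k by exact: exprn_gt0.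
have scl y (h : E) : U y -> dird f (h :: vs) y = c ^+ k * dird f (h :: us) y.
  by move=> Uy; rewrite vsE (mlin_homogs c [:: h] us (ml y Uy)) usk.
have scl0 y : U y -> dird f vs y = c ^+ k * dird f us y.
  by move=> Uy; rewrite vsE (mlin_homogs c [::] us (ml y Uy)) usk.
have [K K0 HK] : exists2 K, 0 <= K & forall v : k.+1.-tuple E, inV uball v -> `|dird f v x| <= K.
  have [_ _ fin] := (fU k.+1 x Ux).1.
  have h0 : (0 <= opnorm (jet_of f (k := k.+1) x))%E.
    apply: le_trans (le_opnorm _ (v := [tuple of nseq k.+1 0]) _); first by rewrite lee_fin.
    by move=> w /nseqP[-> _]; rewrite /uball /= normr0.
  exists (fine (opnorm (jet_of f (k := k.+1) x))); first exact: fine_ge0.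
  move=> v v1; rewrite -lee_fin fineK; first exact: le_opnorm.
  by rewrite fin_numElt fin andbT (lt_le_trans _ h0).
have dflE h : dfl h = dird f (h :: vs) x by [].
have cdf : continuous dfl.
  apply: (@lipschitz_continuous _ _ _ dfl (c ^+ k * K)) => h; rewrite dflE (scl _ _ Ux).
  rewrite normrM gtr0_norm// -mulrA ler_pM2l//.
  have [->|h0] := eqVneq h 0.
    by rewrite (mlin_zero [::] us (ml x Ux)) !normr0 mulr0.
  have hE : h = `|h| *: (`|h|^-1 *: h) by rewrite scalerA divff ?scale1r// normr_eq0.
  rewrite {1}hE (mlin_homog [::] _ _ us (ml x Ux)) normrM normr_id mulrC ler_wpM2r//.
  have sz : size ((`|h|^-1 *: h) :: us) == k.+1 by rewrite /= usk.
  apply: (HK (Tuple sz)) => w; rewrite inE => /orP[/eqP->|/u1//].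
  by rewrite /uball /= normrZ normfV normr_id mulVf// normr_eq0.
apply: (proj1 (differentiable_eps cdf _)) => e e0.
have e1 : 0 < e / c ^+ k by exact: divr_gt0.
have Ux' := near_addl (near_open oU Ux).
apply: filterS2 Ux' ((fU k x Ux).2 _ e1) => h Uxh H.
have sz : size us == k by rewrite usk.
have := le_trans (le_opnorm _ (v := Tuple sz) u1) H; rewrite lee_fin.
rewrite /jet_of /= -!/(dird f _ _) => H'.
rewrite -[df h]/(dird f (h :: vs) x) (scl _ _ Ux) (scl0 _ Ux) (scl0 _ Uxh).
rewrite -!mulrBr normrM gtr0_norm// -ler_pdivlMl// mulrA [_^-1 * e]mulrC; exact: H'.
Qed.

Lemma rho_norm_bound (M : nat -> R) (rho c : R) K (phi : jet) m x (v : m.-tuple E) :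
  weight_sequence M -> 0 < rho -> (rho_norm M rho K phi <= c%:E)%E -> K x -> inV uball v ->
  `|phi m x v| <= c * wgt M rho m.
Proof.
move=> hM r0 H Kx v1; have w0 : 0 < wgt M rho m by exact: wgt_gt0.
rewrite -lee_fin EFinM; apply: le_trans (le_opnorm _ v1) _.
apply: (@le_trans _ _ (jet_norm K phi m)).
  by apply: ereal_sup_ubound; right; exists x.
rewrite -lee_pdivrMr//; apply: le_trans H; rewrite /rho_norm le_max; apply/orP; left.
by apply: ereal_sup_ubound; exists m.
Qed.

Lemma CM_jet_dbound kd (M : nat -> R) K f : weight_sequence M -> CM_jet kd M K (jet_of f) ->
  kdq kd (dbound M K uball f).
Proof.
move=> hM; have key rho : 0 < rho -> C_rho M rho K (jet_of f) ->
    exists2 C, 0 < C & dbound M K uball f rho C.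
  move=> r0 [_ _ fin].
  have [C C0 HC] : exists2 C : R, 0 < C & (rho_norm M rho K (jet_of f) <= C%:E)%E.
    move: fin; case: (rho_norm _ _ _ _) => [r _|//|_].
      by exists (`|r| + 1); [rewrite ltr_wpDl|rewrite lee_fin (le_trans (ler_norm r))// lerDl].
    by exists 1 => //; exact: leNye.
  exists C => // y vs Ky v1.
  exact: (@rho_norm_bound M rho C K (jet_of f) (size vs) y (in_tuple vs) hM r0 HC Ky v1).
rewrite /CM_jet /kdq; case: kd => [H rho r0|[rho r0 H]]; first exact: key (H _ r0).
by exists rho => //; exact: key H.
Qed.

End FrechetSmooth.

(** * The normed spaces spanned by disks *)

Section DiskNorm.
Context {R : realType} {E : tvsType R} (B : disk E).
Local Notation EB := (disk_space B).

Lemma disk_normE (x : EB) : `|x| = minkowski B (disk_incl x).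
Proof. by []. Qed.

Lemma gauge_nonempty (x : EB) : [set r : R | 0 < r /\ disk_set B (r^-1 *: disk_incl x)] !=set0.
Proof.
(* Were the set empty, its [inf] would be the default 0, hence [x = 0], whose gauge set contains
   1. *)
apply: contrapT => H.
have G0 : [set r : R | 0 < r /\ disk_set B (r^-1 *: disk_incl x)] = set0.
  by apply/seteqP; split=> // r Hr; apply: H; exists r.
have : `|x| = 0 by rewrite disk_normE /minkowski G0 inf0.
move=> /normr0_eq0 x0; apply: H; exists 1; split=> //.
have -> : disk_incl x = 0 by rewrite x0.
by rewrite scaler0; exact: disk0.
Qed.

Lemma disk_set_scale (x : EB) (r : R) : `|x| < r -> disk_set B (r^-1 *: disk_incl x).
Proof.
move=> xr; have r0 : 0 < r by apply: le_lt_trans xr.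
rewrite disk_normE in xr.
have [s [s0 sB] sr] := inf_lt (gauge_nonempty x) xr.
have -> : r^-1 *: disk_incl x = (s / r) *: (s^-1 *: disk_incl x) + 0 *: 0.
  rewrite scaler0 addr0 scalerA; congr (_ *: _); field.
  by rewrite !gt_eqF.
apply: disk_absconvex => //; first exact: disk0.
rewrite normr0 addr0 ger0_norm ?divr_ge0 ?ltW//.
by rewrite ltr_pdivrMr// mul1r.
Qed.

Lemma disk_norm_le (x : EB) (r : R) : 0 < r -> disk_set B (r^-1 *: disk_incl x) -> `|x| <= r.
Proof. by move=> r0 rB; rewrite disk_normE; apply: ge_inf => //; exists 0 => s [/ltW]. Qed.

Lemma disk_incl_is_linear : linear (@disk_incl R E B).
Proof. by []. Qed.

HB.instance Definition _ := GRing.isLinear.Build R EB E *:%R (@disk_incl R E B) disk_incl_is_linear.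

Lemma disk_incl_inj : injective (@disk_incl R E B).
Proof. exact: val_inj. Qed.

End DiskNorm.

Section NormedDisk.
Context {R : realType} {Z : normedModType R}.

Lemma disk_incl_bounded (B : disk Z) : exists2 c : R, 0 < c &
  forall x : disk_space B, `|disk_incl x| <= c * `|x|.
Proof.
have [r r0 rB] := @disk_bounded _ _ B (ball (0 : Z) 1) (nbhsx_ballx _ _ ltr01).
exists r => // x; apply/ler_addgt0Pl => e e0.
have d0 : 0 < e / r by exact: divr_gt0.
have xr : `|x| < `|x| + e / r by rewrite ltrDl.
have s0 : 0 < `|x| + e / r by apply: le_lt_trans xr.
have [u ub uE] := rB _ (disk_set_scale xr).
have -> : disk_incl x = (`|x| + e / r) *: (r *: u).
  by rewrite uE scalerA mulfV ?scale1r// gt_eqF.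
rewrite !normrZ !gtr0_norm//.
have u1 : `|u| <= 1 by move: ub; rewrite -ball_normE /= sub0r normrN => /ltW.
apply: (@le_trans _ _ ((`|x| + e / r) * r)).
  by rewrite ler_pM2l// ler_piMr// ltW.
by rewrite mulrDl divfK ?gt_eqF// mulrC addrC.
Qed.

Lemma disk_incl_continuous (B : disk Z) : continuous (@disk_incl R Z B).
Proof. by have [c c0 cP] := disk_incl_bounded B; exact: lipschitz_continuous cP. Qed.

Let cball : set Z := [set x | `|x| <= 1].

Let cball_closed : closed cball.
Proof.
have -> : cball = (fun x => `|x|) @^-1` [set r : R | r <= 1] by [].
by apply: closed_comp => [x _|]; [exact: norm_continuous|exact: closed_le].
Qed.

Let cball_absconvex (a b : R) x y : cball x -> cball y -> `|a| + `|b| <= 1 ->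
  cball (a *: x + b *: y).
Proof.
move=> x1 y1 ab; apply: le_trans (ler_normD _ _) _; rewrite !normrZ.
by apply: le_trans ab; rewrite lerD// ler_piMr.
Qed.

Let cball_bounded (U : set Z) : nbhs (0 : Z) U ->
  exists2 r : R, 0 < r & cball `<=` [set r *: x | x in U].
Proof.
move=> /near_dist[d d0 dP]; exists (2 / d); first exact: divr_gt0.
move=> x x1; exists ((d / 2) *: x).
  apply: dP; rewrite subr0 normrZ gtr0_norm ?divr_gt0//.
  rewrite (@le_lt_trans _ _ (d / 2))//; first by rewrite ler_piMr// ltW// divr_gt0.
  by rewrite ltr_pdivrMr// ltr_pMr// ltr1n.
by rewrite scalerA mulrA divfK ?gt_eqF// mulfV// scale1r.
Qed.

Let cball_no_line x : (forall r : R, cball (r *: x)) -> x = 0.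
Proof.
move=> H; apply/eqP; rewrite -normr_le0; apply/ler_addgt0Pl => e e0.
have := H e^-1; rewrite /cball /= normrZ gtr0_norm ?invr_gt0// ler_pdivrMl//.
by rewrite mulr1 addr0.
Qed.

Let cball0 : cball 0. Proof. by rewrite /cball /= normr0. Qed.

(** The closed unit ball as a disk. Its [disk_space] is isometric to [Z], so a class that is tested
    on disks can be read on [Z] itself. *)
Definition unit_disk : disk Z :=
  Disk cball_closed cball0 cball_absconvex cball_bounded cball_no_line.

Lemma unit_disk_norm (x : disk_space unit_disk) : `|x| = `|disk_incl x|.
Proof.
apply/eqP; rewrite eq_le; apply/andP; split.
  apply/ler_addgt0Pl => e e0; have r0 : 0 < e + `|disk_incl x| by rewrite ltr_pwDl.
  apply: disk_norm_le => //; rewrite /= /cball /= normrZ gtr0_norm ?invr_gt0//.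
  by rewrite ler_pdivrMl// mulr1 lerDr ltW.
apply/ler_addgt0Pl => e e0; have r0 : `|x| < e + `|x| by rewrite ltrDr.
have s0 : 0 < e + `|x| by apply: le_lt_trans r0.
have := disk_set_scale r0; rewrite /= /cball /= normrZ gtr0_norm ?invr_gt0//.
by rewrite ler_pdivrMl// mulr1.
Qed.

Let in_span (z : Z) : z \in lspan (disk_set unit_disk).
Proof.
apply/asboolP; have [->|z0] := eqVneq z 0.
  by exists [::] => //; rewrite big_nil.
exists [:: (`|z|, `|z|^-1 *: z)].
  move=> p; rewrite inE => /eqP -> /=.
  by rewrite /cball /= normrZ normfV normr_id mulVf// normr_eq0.
by rewrite big_seq1 /= scalerA divff ?scale1r// normr_eq0.
Qed.

Definition unit_emb (z : Z) : disk_space unit_disk := Span (in_span z).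

Lemma unit_embK z : disk_incl (unit_emb z) = z. Proof. by []. Qed.

Lemma unit_inclK x : unit_emb (disk_incl x) = x.
Proof. by apply: disk_incl_inj. Qed.

Lemma unit_emb_linear : linear unit_emb.
Proof. by move=> a x y; apply: disk_incl_inj; rewrite linearP !unit_embK. Qed.

HB.instance Definition _ := GRing.isLinear.Build R Z (disk_space unit_disk) *:%R unit_emb unit_emb_linear.

Lemma unit_emb_norm z : `|unit_emb z| = `|z|.
Proof. by rewrite unit_disk_norm unit_embK. Qed.

Lemma unit_emb_continuous : continuous unit_emb.
Proof. by apply: (@lipschitz_continuous _ _ _ _ 1) => z; rewrite unit_emb_norm mul1r. Qed.

End NormedDisk.

Section CurvesAndDerivatives.
Context {R : realType}.

Lemma cvg_is_derive (V : normedModType R) (f : R -> V) (t : R) (df : V) :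
  h^-1 *: (f (t + h) - f t) @[h --> (0 : R)^'] --> df <-> is_derive t (1 : R) f df.
Proof.
have qE : (fun h : R => h^-1 *: (f (t + h) - f t)) =
    (fun h : R => h^-1 *: ((f \o shift t) (h *: (1 : R)) - f t)).
  by apply/funext => h /=; have -> : h *: (1 : R) = h := mulr1 h; rewrite [h + t]addrC.
rewrite qE; split=> [H|H].
  apply: DeriveDef; first by apply/cvg_ex; exists df.
  exact: cvg_lim H.
case: H => dH <-; exact: dH.
Qed.

Lemma dird_real (a : nat -> R -> R) :
  (forall k t, is_derive t (1 : R) (a k) (a k.+1 t)) ->
  forall k vs t, dird (a k) vs t = \prod_(v <- vs) v * a (k + size vs)%N t.
Proof.
move=> da k vs; elim: vs => [|v vs ih] t; first by rewrite big_nil mul1r addn0.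
rewrite /= big_cons.
have -> : dird (a k) vs = (fun t => \prod_(v <- vs) v * a (k + size vs)%N t) by exact/funext.
have dk : differentiable (a (k + size vs)%N) t by apply/derivable1_diffP; case: (da (k + size vs)%N t).
have dp : differentiable (fun t => \prod_(v <- vs) v * a (k + size vs)%N t) t.
  by apply: differentiableM => //; exact: differentiable_cst.
rewrite -[v in LHS]mulr1 -/(v *: (1 : R)) deriveE// linearZ /= -deriveE//.
have -> : 'D_1 (fun t => \prod_(v <- vs) v * a (k + size vs)%N t : R^o) t = \prod_(v <- vs) v * a (k + size vs).+1 t.
  have := @deriveZ _ _ _ (a (k + size vs)%N : R -> R^o) (\prod_(v <- vs) v) t 1.
  move=> ->; last by case: (da (k + size vs)%N t).
  by case: (da (k + size vs)%N t) => _ ->.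
by rewrite addnS [LHS]mulrA.
Qed.

Lemma smo_real (a : nat -> R -> R) :
  (forall k t, is_derive t (1 : R) (a k) (a k.+1 t)) -> forall k, smo setT (a k).
Proof.
move=> da k t _ vs.
have -> : dird (a k) vs = (fun t => \prod_(v <- vs) v * a (k + size vs)%N t).
  by apply/funext => s; exact: dird_real.
apply: differentiableM; first exact: differentiable_cst.
by apply/derivable1_diffP; case: (da (k + size vs)%N t).
Qed.

Lemma is_derive_coord n (f : R -> 'rV[R]_n) t df i :
  is_derive t (1 : R) f df -> is_derive t (1 : R) (fun s => f s 0 i) (df 0 i).
Proof.
case=> df1 <-; have /derivable_mxP d1 := df1.
apply: DeriveDef; first exact: d1.
by rewrite (derive_mx df1) mxE.
Qed.

Lemma smooth_curve_coord n (c : R -> 'rV[R]_n) i :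
  smooth_curve c -> smo setT (fun t => c t 0 i).
Proof.
move=> [d d0 dP]; rewrite -d0.
apply: (@smo_real (fun k t => d k t 0 i)) 0%N => k t.
by apply: is_derive_coord; apply/cvg_is_derive; exact: dP.
Qed.

Lemma smo_smooth_curve n (c : R -> 'rV[R]_n) :
  (forall i, smo setT (fun t => c t 0 i)) -> smooth_curve c.
Proof.
move=> cU; pose D k t := \row_i dird (fun t => c t 0 i) (nseq k (1 : R)) t.
exists D; first by apply/funext => t; apply/rowP => i; rewrite mxE.
move=> k t; apply: (proj2 (cvg_is_derive (D k) t (D k.+1 t))).
have dk : derivable (D k) t (1 : R).
  apply/derivable_mxP => j i; rewrite ord1.
  have -> : (fun x => (\row_i dird (fun t => c t 0 i) (nseq k 1) x) 0 i) =
    dird (fun t => c t 0 i) (nseq k 1) by apply/funext => x; rewrite mxE.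
  by apply: diff_derivable; exact: (cU i).
apply: DeriveDef => //; rewrite (derive_mx dk); apply/rowP => i; rewrite !mxE.
have -> : (fun x => (\row_i dird (fun t => c t 0 i) (nseq k 1) x) 0 i) =
    dird (fun t => c t 0 i) (nseq k 1) by apply/funext => x; rewrite mxE.
by [].
Qed.

End CurvesAndDerivatives.

(** * Passage between the class on open sets and germs *)

Section GermsFromCM.
Context {R : realType} (kd : dc_kind) (M : nat -> R).
Hypotheses (hM : weight_sequence M) (hlc : log_convex M) (hmg : moderate_growth M).

(** Derivatives along 0 vanish, so for [D = [set 0]] only the empty list carries information. *)
Lemma GG_of_LC {Z : normedModType R} (V : set Z) U z f : open U -> U z -> smo U f ->
  LC kd M V z f -> GG kd M [set 0] V z f.
Proof.
move=> oU Uz fU fL; exists U; split=> // es; case: es => [//|e es] /inV_cons[_ /= ->].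
apply: eq_LC (LC_cst kd hM V z 0) => //.
apply: filterS (near_open oU Uz) => y Uy.
exact: esym (dird_zero [::] es oU fU Uy).
Qed.

(** By homogeneity a larger ball of directions costs [c ^+ k], that is, [c * rho] instead of
    [rho]. *)
Lemma LC_scale {Z : normedModType R} U z f (c : R) : open U -> U z -> smo U f -> 0 < c ->
  LC kd M uball z f -> LC kd M [set v : Z | `|v| <= c] z f.
Proof.
move=> oU Uz fU c0 [W Wz HW]; exists (U `&` W).
  by apply: filterI => //; exact: near_open.
apply: (kdq_map c0) HW => rho C r0 C0 H; exists C => // y vs [Uy Wy] Vvs.
have -> : vs = [seq c *: u | u <- [seq c^-1 *: v | v <- vs]].
  rewrite -map_comp -[LHS]map_id; apply: eq_map => v /=.
  by rewrite scalerA mulfV ?scale1r// gt_eqF.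
rewrite (dird_homogs c _ oU fU Uy) normrM gtr0_norm ?exprn_gt0// !size_map wgt_scale mulrCA.
rewrite ler_pM2l ?exprn_gt0//; have := H y [seq c^-1 *: v | v <- vs] Wy.
rewrite size_map; apply => w /mapP[v /Vvs /= vc ->].
by rewrite /uball /= normrZ gtr0_norm ?invr_gt0// ler_pdivrMl// mulr1.
Qed.

Lemma convex_setI {Z : normedModType R} (K : set Z) :
  (forall x y (t : R), 0 <= t <= 1 -> K x -> K y -> K (t *: x + (1 - t) *: y)) -> convex_set K.
Proof.
move=> H; apply/convex_setW => x y; rewrite !inE => Kx Ky l l0 l1; rewrite inE.
have h : 0 <= (l%:num : R) <= 1 by rewrite !ltW.
exact: H h Kx Ky.
Qed.

Lemma fsum0 {X Z : normedModType R} (L : {linear X -> Z}) (G : 'I_0 -> X -> R) z x :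
  fsum L G z x = L x.
Proof. by rewrite /fsum big_ord0 addr0. Qed.

(** The class bounds jets on compact convex sets; compactness of the unit ball makes a closed ball
    around [z0] such a set, and its bounds hold on a neighbourhood. *)
Lemma CM_germ {Z : normedModType R} (F : tvsType R) (U : set Z) (g : Z -> F)
    (l : {linear F -> R^o}) z0 : compact [set x : Z | `|x| <= 1] -> open U ->
  CM kd M U g -> continuous l -> U z0 ->
  GG kd M [set 0] uball z0 (fun z => l (g z)).
Proof.
move=> cZ oU [_ gCM] cl Uz0.
have [fs fJ] := gCM l cl (@unit_disk R Z).
set U' := _ @^-1` U in fs fJ; set f' : disk_space unit_disk -> R := _ \o _ in fs fJ.
have oU' : open U'.
  by apply: open_comp => // x _; exact: disk_incl_continuous.
have fU' := frechet_smo oU' fs.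
have [d d0 dU] := near_dist (near_open oU Uz0).
pose K := [set x : disk_space (@unit_disk R Z) | `|disk_incl x - z0| <= d / 2].
have cK : compact K.
  have -> : K = (fun z : Z => unit_emb (z0 + (d / 2) *: z)) @` [set x : Z | `|x| <= 1].
    apply/seteqP; split=> x /=.
      move=> xd; exists ((d / 2)^-1 *: (disk_incl x - z0)).
        by rewrite /= normrZ gtr0_norm ?invr_gt0 ?divr_gt0// ler_pdivrMl ?divr_gt0// mulr1.
      by rewrite scalerA mulfV ?scale1r ?subrKC ?unit_inclK// gt_eqF// divr_gt0.
    move=> [z z1 <-]; change (`|z0 + (d / 2) *: z - z0| <= d / 2).
    rewrite addrAC subrr add0r normrZ gtr0_norm ?divr_gt0//.
    by rewrite ler_piMr// ltW// divr_gt0.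
  apply: continuous_compact => //; apply: continuous_subspaceT => z.
  apply: (@continuous_comp _ _ _ (fun z => z0 + (d / 2) *: z) unit_emb); last exact: unit_emb_continuous.
  by apply: cvgD; [exact: cvg_cst|exact: scaler_continuous].
have xK : convex_set K.
  apply: convex_setI => x y t /andP[t0 t1]; rewrite /K /= => xd yd.
  have -> : disk_incl (t *: x + (1 - t) *: y) - z0 =
     t *: (disk_incl x - z0) + (1 - t) *: (disk_incl y - z0).
    rewrite linearP linearZ /= !scalerBr addrACA -opprD -scalerDl.
    by rewrite [t + _]addrC subrK scale1r.
  apply: le_trans (ler_normD _ _) _; rewrite !normrZ !ger0_norm ?subr_ge0//.
  rewrite (_ : d / 2 = t * (d / 2) + (1 - t) * (d / 2)); last by ring.
  by rewrite lerD// ler_wpM2l// subr_ge0.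
have KU : K `<=` U'.
  move=> x xd; apply: dU; apply: le_lt_trans xd _.
  by rewrite ltr_pdivrMr// ltr_pMr// ltr1n.
have LK : LC kd M uball (unit_emb z0) f'.
  exists K; last exact: CM_jet_dbound hM (fJ K cK xK KU).
  apply: (@dist_near R _ (unit_emb z0) (d / 2) K); first exact: divr_gt0.
  move=> y; rewrite unit_disk_norm.
  by have -> : disk_incl (y - unit_emb z0) = disk_incl y - z0 by []; exact: ltW.
have Uz0' : U' (unit_emb z0) by [].
have G' := GG_of_LC oU' Uz0' fU' LK.
(* A composition without scalar functions, which transports the germ along the linear isometry
   [unit_emb]. *)
have := @GG_comp R kd M hM hlc hmg Z _ 0 unit_emb (fun _ _ => 0) (fun _ => 0)
  unit_emb_continuous [set 0] uball [set 0] uball.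
have h1 : forall v : Z, [set 0] v -> [set (0 : disk_space unit_disk)] (unit_emb v).
  by move=> v /= ->; rewrite linear0.
have h2 : forall v : Z, uball v -> uball (unit_emb v) by move=> v; rewrite /uball /= unit_emb_norm.
have h3 : forall i : 'I_0, uball ((fun=> 0) i : disk_space (@unit_disk R Z)) by case.
move=> /(_ h1 h2 h3 f' z0); rewrite fsum0 => /(_ _ G') H.
by apply: eq_GG (H _) => [|[]//]; near=> z; rewrite fsum0.
Unshelve. all: by end_near.
Qed.

Lemma incl_germ {Z : normedModType R} (B : disk Z) U (f : Z -> R) : open U ->
  smo U f -> LCon kd M U f ->
  smo (@disk_incl R Z B @^-1` U) (fun x => f (disk_incl x)) /\
  LCon kd M (@disk_incl R Z B @^-1` U) (fun x => f (disk_incl x)).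
Proof.
move=> oU fU fL; set U' := _ @^-1` U.
have oU' : open U' by apply: open_comp => // x _; exact: disk_incl_continuous.
have eq0 : (fun x => f (disk_incl x)) =
    (fun x : disk_space B => f (fsum (@disk_incl R Z B) (fun (_ : 'I_0) _ => 0) (fun=> 0) x)).
  by apply/funext => x; rewrite fsum0.
have gU : forall i : 'I_0, smo U' ((fun _ _ => 0 : R) i) by case.
have UU : forall x, U' x -> U (fsum (@disk_incl R Z B) (fun (_ : 'I_0) _ => 0) (fun=> 0) x).
  by move=> x; rewrite fsum0.
split; first by rewrite eq0; exact: (smo_comp_fsum (@disk_incl_continuous _ _ B) oU' oU gU fU UU).
move=> x Ux; rewrite eq0; have [c c0 cP] := disk_incl_bounded B.
apply: (@LC_comp R kd M hM hlc _ _ 0 (@disk_incl R Z B) _ (fun=> 0) (@disk_incl_continuous _ _ B) uball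
  [set v | `|v| <= c] _ _ U' U) => //.
- move=> v /= v1; apply: le_trans (cP v) _; rewrite ler_piMr// ltW//.
- by case.
- by case.
- rewrite fsum0; apply: (LC_scale oU) => //; exact: fL.
Qed.

Lemma smo_curve_comp n (U : set 'rV[R]_n) (f : 'rV[R]_n -> R) (c : R -> 'rV[R]_n) :
  open U -> smo U f -> (forall t, U (c t)) -> (forall i, smo setT (fun t => c t 0 i)) ->
  smo setT (fun t => f (c t)).
Proof.
move=> oU fU Uc cU.
have cE t : c t = fsum (\0 : R -> 'rV[R]_n) (fun i t => c t 0 i) (fun i => delta_mx 0 i) t.
  by rewrite /fsum /= add0r -row_sum_delta.
have -> : (fun t => f (c t)) =
   (fun t => f (fsum (\0 : R -> 'rV[R]_n) (fun i t => c t 0 i) (fun i => delta_mx 0 i) t)).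
  by apply/funext => t; rewrite -cE.
apply: (@smo_comp_fsum _ _ _ _ _ _ _ _ setT U) => //.
- exact: cst_continuous.
- exact: openT.
- by move=> t _; rewrite -cE.
Qed.

Lemma linear_row n (l : {linear 'rV[R]_n -> R^o}) v :
  l v = \sum_(i < n) v 0 i * l (delta_mx 0 i).
Proof. by rewrite [in LHS](row_sum_delta v) linear_sum; apply: eq_bigr => i _; rewrite linearZ. Qed.

Lemma CM_of_smo n m (U : set 'rV[R]_n) (g : 'rV[R]_n -> 'rV[R]_m) : open U ->
  (forall i, smo U (fun x => g x 0 i)) -> (forall i, LCon kd M U (fun x => g x 0 i)) ->
  CM kd M U g.
Proof.
move=> oU gU gL; split.
  move=> c sc Uc; apply: smo_smooth_curve => i.
  apply: (smo_curve_comp oU (gU i) Uc) => j; exact: smooth_curve_coord.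
move=> l cl B.
have lU : smo U (l \o g).
  have -> : l \o g = (fun x => \sum_(i < m) g x 0 i * l (delta_mx 0 i)).
    by apply/funext => x; rewrite /= linear_row.
  by apply: smo_sum => // i; apply: smoM => //; exact: smo_cst.
have lL : LCon kd M U (l \o g).
  move=> x Ux; have -> : l \o g = (fun x => \sum_(i < m) g x 0 i * l (delta_mx 0 i)).
    by apply/funext => y; rewrite /= linear_row.
  have gi i : smo U (fun x => g x 0 i * l (delta_mx 0 i)).
    by apply: smoM => //; exact: smo_cst.
  apply: (LC_sum hM oU Ux gi) => i.
  by apply: (LC_M hM hlc oU Ux) => //; [exact: smo_cst|exact: gL|exact: LC_cst].
have [sU sL] := incl_germ B oU lU lL.
apply: banach_CM_of => //.
by apply: open_comp => // x _; exact: disk_incl_continuous.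
Qed.

End GermsFromCM.

(** * The c^infty-topology of a normed space *)

Section OpenCinf.
Context {R : realType}.

Lemma smooth_curve_continuous (E : tvsType R) (c : R -> E) : smooth_curve c -> continuous c.
Proof.
move=> [d d0 dP] t; have h := dP 0%N t; rewrite d0 in h.
have cid : (h0 : R^o) @[h0 --> (0 : R)^'] --> (0 : R^o) by exact: cvg_within.
have q : (h0 : R) *: (h0^-1 *: (c (t + h0) - c t)) @[h0 --> (0 : R)^'] --> (0 : R) *: d 1%N t.
  by apply: (cvg_comp _ _ (cvg_pair cid h) (@scale_continuous R E (0, d 1%N t))).
have q1 : c t + (h0 : R) *: (h0^-1 *: (c (t + h0) - c t)) @[h0 --> (0 : R)^'] --> c t + (0 : R) *: d 1%N t.
  apply: (cvg_comp _ _ (cvg_pair _ q) (@add_continuous E (c t, (0 : R) *: d 1%N t))).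
  exact: cvg_cst.
have q2 : c (t + h0) @[h0 --> (0 : R)^'] --> c t.
  move: q1; rewrite /= scale0r addr0; apply: cvg_trans; apply: near_eq_cvg.
  near=> h0; have h00 : h0 != 0 by near: h0; exact: nbhs_dnbhs_neq.
  by rewrite /= scalerA mulfV// scale1r subrKC.
move=> A At; have := q2 A At; rewrite /= => H.
have {}H : \forall h0 \near (0 : R), h0 != 0 -> A (c (t + h0)) by exact: H.
suff : \forall h0 \near (0 : R), A (c (t + h0)).
  by rewrite -(@nbhs0P R R (fun s => A (c s)) t).
apply: filterS H => h0; have [->|h00] := eqVneq h0 0; last exact.
by rewrite addr0 => _; exact: nbhs_singleton.
Unshelve. all: by end_near.
Qed.

Lemma open_cinf (E : tvsType R) (U : set E) : open U -> cinf_open U.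
Proof.
by move=> oU c sc; apply: open_comp => // t _; exact: smooth_curve_continuous.
Qed.

(** The functions x^(-m) exp(-1/x). Differentiation turns each into a combination of two others, so
    that smoothness is proved for all [m] at once. *)
Definition flat (m : nat) (x : R) : R := if 0 < x then x^-1 ^+ m * expR (- x^-1) else 0.

(** The inequality [s <= expR s] at s = 1 / ((m + 2) x), raised to the power m + 2. The two spare
    powers of [x] make the derivative at 0 vanish. *)
Lemma flat_bound m (x : R) : 0 < x -> flat m x <= (m.+2)%:R ^+ m.+2 * x ^+ 2.
Proof.
move=> x0; rewrite /flat x0 expRN.
have k0 : 0 < (m.+2)%:R :> R by rewrite ltr0n.
have u0 : 0 < x^-1 by rewrite invr_gt0.
have E0 : ((m.+2)%:R^-1 * x^-1) ^+ m.+2 <= expR x^-1.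
  rewrite -[x^-1 in leRHS](mulVKf (lt0r_neq0 k0)) expRM_natl.
  apply: lerXn2r; rewrite ?nnegrE; [|exact: expR_ge0|].
    by rewrite mulr_ge0 ?invr_ge0 ?ltW.
  by apply: le_trans (expR_ge1Dx _); rewrite lerDr.
rewrite ler_pdivrMr ?expR_gt0//.
apply: le_trans (ler_wpM2l _ E0); last by rewrite mulr_ge0 ?sqr_ge0// exprn_ge0.
rewrite exprMn mulrACA -exprMn mulfV ?gt_eqF// expr1n mul1r.
have -> // : x ^+ 2 * x^-1 ^+ m.+2 = x^-1 ^+ m.
by rewrite -[m.+2]addn2 exprD mulrCA -exprMn mulfV ?gt_eqF// expr1n mulr1.
Qed.

Lemma is_derive_flat m (x : R) :
  is_derive x (1 : R) (flat m) (flat m.+2 x - m%:R * flat m.+1 x).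
Proof.
have [x0|x0|x0] := ltgtP 0 x.
- apply: (@near_eq_is_derive _ _ _ (fun y : R => y^-1 ^+ m * expR (- y^-1))).
    by near=> y; rewrite /flat ifT//; near: y; exact: lt_nbhsr.
  rewrite /flat x0.
  have i1 : is_derive x (1 : R) (fun y : R => y^-1) (- x ^- 2 *: (1 : R)).
    apply: DeriveDef; first by apply: derivableV; [exact: lt0r_neq0|exact: derivable_id].
    by rewrite deriveV ?derive_id//; exact: lt0r_neq0.
  have i2 := @is_deriveX R R (fun y : R => y^-1) m x _ _ i1.
  have i3 : is_derive x (1 : R) (fun y : R => expR (- y^-1)) (expR (- x^-1) * - (- x ^- 2 *: (1 : R))).
    exact: (@is_derive1_comp _ expR (fun y : R => - y^-1)).
  have i4 := is_deriveM i2 i3.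
  have -> : (fun y : R => y^-1 ^+ m * expR (- y^-1)) = (fun y : R => y^-1) ^+ m * (fun y : R => expR (- y^-1)).
    by apply/funext => y; rewrite !fctE.
  apply: is_derive_eq i4 _.
  rewrite /GRing.scale /= !mulr1 -!exprVn !fctE.
  case: m {i2} => [|m]; first by rewrite /= !mul0r expr0 !mul1r mulr0 addr0 subr0; ring.
  by rewrite /= !exprS; ring.
- have z k : flat k x = 0 by rewrite /flat ltNge (ltW x0).
  rewrite !z mulr0 subr0; apply: (@near_eq_is_derive _ _ _ (cst 0)).
    near=> y; rewrite /flat /= ltNge ifF//; apply/negbTE; rewrite negbK.
    by apply/ltW; near: y; exact: lt_nbhsl.
- have z k : flat k 0 = 0 by rewrite /flat ltxx.
  rewrite -x0 !z mulr0 subr0; apply/cvg_is_derive; rewrite z.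
  apply/cvgrPdist_le => e e0.
  have K0 : 0 < (m.+2)%:R ^+ m.+2 :> R by rewrite exprn_gt0// ltr0n.
  near=> h; rewrite sub0r normrN subr0 add0r.
  have h0 : h != 0 by near: h; exact: nbhs_dnbhs_neq.
  have he : `|h| < e / (m.+2)%:R ^+ m.+2 by near: h; apply: dnbhs0_lt; exact: divr_gt0.
  have F : `|flat m h| <= (m.+2)%:R ^+ m.+2 * h ^+ 2.
    have [hp|hn] := ltP 0 h; last by rewrite /flat ltNge hn /= normr0 mulr_ge0 ?sqr_ge0// ltW.
    rewrite ger0_norm ?flat_bound// /flat hp mulr_ge0 ?expR_ge0// exprn_ge0// invr_ge0 ltW//.
  rewrite normrZ normfV ler_pdivrMl ?normr_gt0//; apply: le_trans F _.
  rewrite -real_normK ?num_real// expr2 mulrCA ler_pM2l ?normr_gt0//.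
  by rewrite mulrC -ler_pdivlMr// ltW.
Unshelve. all: by end_near.
Qed.

Lemma derive_real (f : R -> R) (v t : R) : differentiable f t ->
  'D_v (f : R -> R^o) t = v * 'D_1 (f : R -> R^o) t.
Proof.
move=> df; by rewrite !deriveE// diff1E//= scale1r.
Qed.

Lemma smo_flat m : smo setT (flat m).
Proof.
apply: smt_smo => n; elim: n m => [|n ih] m.
  move=> t _ [|//] _; apply/derivable1_diffP; by case: (is_derive_flat m t).
have df t : differentiable (flat m) t by apply/derivable1_diffP; case: (is_derive_flat m t).
apply/smtP; first exact: openT.
split=> [t _|v]; first exact: df.
apply: (@eq_smt _ _ _ _ (fun t => v * (flat m.+2 t + (- m%:R) * flat m.+1 t))); first exact: openT.
  by move=> t _; rewrite derive_real// mulNr; case: (is_derive_flat m t) => _ ->.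
apply: smtM; [exact: openT|exact: smt_cst|].
by apply: smtD; [exact: openT|exact: ih|apply: smtM; [exact: openT|exact: smt_cst|exact: ih]].
Qed.

Lemma smo_affine {E E' : normedModType R} (U : set E) (U' : set E') (f : E -> R) (A B : E' -> E) :
  (forall (h : R) v x, A (h *: v + x) = h *: B v + A x) ->
  (forall x, differentiable A x) -> (forall x, U' x -> U (A x)) ->
  smo U f -> smo U' (fun x => f (A x)).
Proof.
move=> AB dA UU fU x Ux vs.
have -> : dird (fun x => f (A x)) vs = (fun x => dird f (map B vs) (A x)).
  by apply/funext => y; exact: dird_affine.
by apply: (@differentiable_comp _ _ _ _ A); [exact: dA|exact: fU _ (UU _ Ux) _].
Qed.

(** Normalised to the value 1 at 1. It vanishes outside the interval from 1/2 to 3/2, hence at every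
    other power of 2: at 2^-n only the bump of index [n] is seen. *)
Definition bump (s : R) : R := flat 0 (2^-1) ^- 2 * (flat 0 (s - 2^-1) * flat 0 (3 / 2 - s)).

Lemma flat_half : 0 < flat 0 (2^-1 : R).
Proof. by rewrite /flat ifT ?invr_gt0// expr0 mul1r expR_gt0. Qed.

Lemma smo_bump : smo setT bump.
Proof.
have T : open [set: R] by exact: openT.
apply: smoZ => //; apply: smoM => //.
  apply: (@smo_affine R R setT setT (flat 0) (fun s => s - 2^-1) id _ _ _ (smo_flat 0)) => //.
    by move=> h v x; rewrite addrA.
apply: (@smo_affine R R setT setT (flat 0) (fun s => 3 / 2 - s) (fun s => - s) _ _ _ (smo_flat 0)) => //.
  by move=> h v x; rewrite opprD addrCA scalerN.
Qed.

Lemma bump1 : bump 1 = 1.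
Proof.
rewrite /bump (_ : 1 - 2^-1 = 2^-1 :> R); last by field.
rewrite (_ : 3 / 2 - 1 = 2^-1 :> R); last by field.
by rewrite -expr2 mulVf// expf_neq0// gt_eqF// flat_half.
Qed.

Lemma bump_out s : s <= 2^-1 \/ 3 / 2 <= s -> bump s = 0.
Proof.
move=> [H|H]; rewrite /bump /flat.
  by rewrite (ltNge 0 (s - _)) subr_le0 H /= mul0r mulr0.
by rewrite (ltNge 0 (3 / 2 - s)) subr_le0 H /= !mulr0.
Qed.

Definition bumpd k : R -> R := dird bump (nseq k 1).

Lemma bumpd_out k s : s < 2^-1 \/ 3 / 2 < s -> bumpd k s = 0.
Proof.
move=> H; have n0 : \forall y \near s, bump y = cst 0 y.
  case: H => H; near=> y; apply: bump_out.
    by left; apply/ltW; near: y; exact: lt_nbhsl.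
  by right; apply/ltW; near: y; exact: lt_nbhsr.
have /nbhs_singleton := near_eq_dird (nseq k (1 : R)) n0.
rewrite -/(bumpd k) => ->; have := dird_cst (0 : R) (nseq k (1 : R)) s.
by case: (nseq _ _) => [|? ?].
Unshelve. all: by end_near.
Qed.

Lemma bumpd_bounded k : exists2 B, 0 < B & forall s, `|bumpd k s| <= B.
Proof.
have cb : continuous (fun s => `|bumpd k s|).
  move=> s; apply: (@continuous_comp _ _ _ (bumpd k) (fun x : R => `|x|)).
    by apply: differentiable_continuous; exact: smo_bump.
  exact: norm_continuous.
have [c _ cP] := @EVT_max R (fun s => `|bumpd k s|) (2^-1) (3 / 2) ltac:(lra) (continuous_subspaceT cb).
exists (`|bumpd k c| + 1); first by rewrite ltr_wpDl.
move=> s; have [sl|sl] := ltP s 2^-1.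
  by rewrite bumpd_out ?normr0 ?addr_ge0//; left.
have [sr|sr] := ltP (3 / 2) s.
  by rewrite bumpd_out ?normr0 ?addr_ge0//; right.
by rewrite (@le_trans _ _ `|bumpd k c|) ?lerDl// cP// in_itv /= sl.
Qed.

Lemma is_derive_bumpd k s : is_derive s (1 : R) (bumpd k) (bumpd k.+1 s).
Proof.
apply: DeriveDef => //; apply: diff_derivable; exact: (smo_bump I).
Qed.

(* The derivatives of the k-th bump [theta (2^k t) z_k] at 2^-k are of order
   2^(k m) |z_k|, hence the quadratic exponent in the decay of [z]. *)
Lemma smooth_curve_through (Z : normedModType R) (z : nat -> Z) :
  (forall n, `|z n| <= (2^-1) ^+ (n * n)) ->
  exists2 c : R -> Z, smooth_curve c & c 0 = 0 /\ forall n, c ((2^-1) ^+ n) = z n.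
Proof.
move=> zb; pose T k n t : Z := ((2 ^+ n) ^+ k * bumpd k (2 ^+ n * t)) *: z n.
have T_neg k n t : t <= 0 -> T k n t = 0.
  move=> t0; rewrite /T bumpd_out ?mulr0 ?scale0r//; left.
  by rewrite (@le_lt_trans _ _ 0) ?invr_gt0// pmulr_rle0// exprn_gt0.
have T_far k n t : 0 < t -> 2 / t <= n%:R -> T k n t = 0.
  move=> t0 tn; rewrite /T bumpd_out ?mulr0 ?scale0r//; right.
  apply: (@lt_le_trans _ _ 2); first by lra.
  rewrite -ler_pdivrMr//; apply: le_trans tn _; apply: le_trans (succ_le_pow2 n).
  by rewrite ler_nat.
(* For [t > 0] the terms with n >= 2/t vanish, since then 2^n t >= 2 is beyond the support; [S] is a
   finite sum whose length depends on [t]. *)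
pose N (t : R) := Num.bound (2 / t).
have N_le t : 0 < t -> 2 / t <= (N t)%:R.
  by move=> t0; rewrite ltW// archi_boundP// divr_ge0// ltW.
pose S k t := \sum_(n < N t) T k n t.
have S_neg k t : t <= 0 -> S k t = 0.
  by move=> t0; rewrite /S big1// => i _; exact: T_neg.
have sub k t a b : (forall n, (a <= n)%N -> T k n t = 0) -> (a <= b)%N ->
    \sum_(n < b) T k n t = \sum_(n < a) T k n t.
  move=> H ab; rewrite -!(big_mkord xpredT (fun n => T k n t)) (@big_cat_nat _ _ _ a 0 b)//=.
  have -> : \sum_(a <= i < b) T k i t = 0; last by rewrite addr0.
  by rewrite big_nat_cond big1// => n /andP[/andP[an _] _]; exact: H.
have S_eq k t n' : 0 < t -> 2 / t <= n'%:R -> S k t = \sum_(n < n') T k n t.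
  move=> t0 tn; have far m n : 2 / t <= m%:R -> (m <= n)%N -> T k n t = 0.
    by move=> tm mn; apply: T_far => //; apply: le_trans tm _; rewrite ler_nat.
  rewrite /S -(@sub k t (N t) (maxn (N t) n')) ?leq_maxl//.
    by apply: sub; [move=> n; exact: far|exact: leq_maxr].
  by move=> n; apply: far; exact: N_le.
have dT k n (t : R) : is_derive t (1 : R) (T k n) (T k.+1 n t).
  have i1 : is_derive t (1 : R) (fun t : R => 2 ^+ n * t) (2 ^+ n).
    have := @is_deriveZ R R R id (2 ^+ n) t 1 1 (is_derive_id _ _).
    by move=> h; apply: is_derive_eq h _; exact: mulr1.
  have i2 := @is_derive1_comp R (bumpd k) (fun t : R => 2 ^+ n * t) t _ _ (is_derive_bumpd k _) i1.
  have d2 : differentiable (bumpd k \o (fun t : R => 2 ^+ n * t)) t.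
    by apply/derivable1_diffP; case: i2.
  have d3 : differentiable (fun t : R => (2 ^+ n) ^+ k * bumpd k (2 ^+ n * t)) t.
    by apply: differentiableM; [exact: differentiable_cst|exact: d2].
  have d4 : differentiable (T k n) t by exact: differentiableZl.
  apply: DeriveDef; first exact/derivable1_diffP.
  rewrite deriveE// diffZl// -deriveE//.
  have -> : 'D_1 (fun t : R => (2 ^+ n) ^+ k * bumpd k (2 ^+ n * t) : R^o) t =
     (2 ^+ n) ^+ k.+1 * bumpd k.+1 (2 ^+ n * t).
    have := @deriveZ _ _ _ (bumpd k \o (fun t : R => 2 ^+ n * t) : R -> R^o) ((2 ^+ n) ^+ k) t 1.
    move=> ->; last by case: i2.
    case: i2 => _ ->; rewrite exprS /GRing.scale /=; ring.
  by [].
have Sb k : exists2 K, 0 < K & forall t, `|S k t| <= K * t ^+ 2.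
  have [B B0 HB] := bumpd_bounded k.
  (* With q = k + 3, the inequality n q <= q^2 + n^2 gives 2^(nk) 2^(-n^2) <= D 2^(-3n). On the
     support 2^(-n) <= 2t: two of the three factors become the square of [t], the third makes the
     sum over [n] converge. *)
  pose D : R := 2 ^+ ((k + 3) * (k + 3)).
  have D0 : 0 < D by rewrite exprn_gt0.
  exists (B * D * 4 * 2); first by rewrite !mulr_gt0.
  move=> t; have [t0|t0] := leP t 0.
    by rewrite S_neg// normr0 mulr_ge0 ?sqr_ge0// !mulr_ge0// ltW.
  have Tb n : `|T k n t| <= B * D * 4 * t ^+ 2 * 2^-1 ^+ n.
    have [s|s] := ltP (2 ^+ n * t) 2^-1.
      rewrite /T bumpd_out; last by left.
      by rewrite mulr0 scale0r normr0 !mulr_ge0 ?sqr_ge0 ?exprn_ge0// ltW.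
    have n2 : 2^-1 ^+ n <= 2 * t.
      rewrite exprVn -[leLHS]mul1r ler_pdivrMr ?exprn_gt0//.
      by rewrite -mulrA [t * _]mulrC -ler_pdivrMl// mulr1.
    have nn : (2 ^+ n) ^+ k * 2^-1 ^+ (n * n) <= D * (2^-1 ^+ n * (2^-1 ^+ n * 2^-1 ^+ n)).
      rewrite -exprM !exprVn -ler_pdivlMr ?invr_gt0 ?exprn_gt0// invrK.
      rewrite -!invfM -!exprD mulrAC ler_pdivlMr ?exprn_gt0// /D -!exprD.
      by apply: ler_weXn2l; [lra|nia].
    rewrite /T normrZ normrM ger0_norm ?exprn_ge0//.
    apply: (@le_trans _ _ (B * ((2 ^+ n) ^+ k * 2^-1 ^+ (n * n)))).
      rewrite [X in X * _]mulrC -mulrA ler_pM//.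
      by rewrite ler_wpM2l ?exprn_ge0.
    apply: (@le_trans _ _ (B * (D * (2^-1 ^+ n * ((2 * t) * (2 * t)))))).
      rewrite ler_pM2l//; apply: le_trans nn _; rewrite ler_pM2l// ler_wpM2l ?exprn_ge0//.
      by rewrite ler_pM ?exprn_ge0.
    by rewrite le_eqVlt; apply/orP; left; apply/eqP; ring.
  rewrite /S; apply: le_trans (ler_norm_sum _ _ _) _.
  apply: (@le_trans _ _ (\sum_(i < N t) B * D * 4 * t ^+ 2 * 2^-1 ^+ i)).
    by apply: ler_sum => i _; exact: Tb.
  rewrite -mulr_sumr.
  rewrite [leRHS]mulrAC; apply: ler_wpM2l.
    by rewrite mulr_ge0 ?sqr_ge0// !mulr_ge0// ltW.
  case: (N t) => [|m]; first by rewrite big_ord0.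
  rewrite -(@big_mkord _ _ _ _ xpredT (fun i => 2^-1 ^+ i)) big_nat_rev /= big_mkord.
  by under eq_bigr do rewrite add0n subSS; exact: geometric_half.
exists (S 0).
  exists S => // k t; apply/cvg_is_derive.
  have [t0|t0|t0] := ltgtP 0 t.
  (* The length [N (t / 2)] serves all points to the right of [t / 2], so near [t] the function is
     one finite sum. *)
  - have n2 : 2 / (t / 2) <= (N (t / 2))%:R by apply: N_le; rewrite divr_gt0.
    rewrite (@S_eq k.+1 t (N (t / 2)))//; last first.
      apply: le_trans n2; rewrite ler_pM2l// lef_pV2 ?posrE ?divr_gt0//.
      by rewrite ler_pdivrMr// ler_pMr// ler1n.
    apply: (@near_eq_is_derive _ _ _ (\sum_(n < N (t / 2)) T k n)).
      near=> s; have s2 : t / 2 < s.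
        by near: s; apply: lt_nbhsr; rewrite ltr_pdivrMr// ltr_pMr// ltr1n.
      have s0 : 0 < s by apply: lt_trans s2; rewrite divr_gt0.
      rewrite (@S_eq k s (N (t / 2)))// ?fct_sumE//.
      by apply: le_trans n2; rewrite ler_pM2l// lef_pV2 ?posrE ?divr_gt0// ltW.
  - rewrite S_neg ?ltW//; apply: (@near_eq_is_derive _ _ _ (cst 0)).
      near=> s; rewrite S_neg//; apply/ltW; near: s; exact: lt_nbhsl.
  - rewrite -t0 S_neg//; apply/cvg_is_derive; rewrite (S_neg k 0)//.
    have [K K0 HK] := Sb k; apply/cvgrPdist_le => e e0.
    near=> h; rewrite sub0r normrN subr0 add0r.
    have h0 : h != 0 by near: h; exact: nbhs_dnbhs_neq.
    have he : `|h| < e / K by near: h; apply: dnbhs0_lt; exact: divr_gt0.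
    rewrite normrZ normfV ler_pdivrMl ?normr_gt0//; apply: le_trans (HK h) _.
    rewrite -real_normK ?num_real// expr2 mulrCA ler_pM2l ?normr_gt0//.
    by rewrite mulrC -ler_pdivlMr// ltW.
split; first exact: S_neg.
move=> n; have t0 : 0 < (2^-1 : R) ^+ n by rewrite exprn_gt0// invr_gt0.
pose n' := maxn (N (2^-1 ^+ n)) n.+1.
rewrite (@S_eq 0%N _ n')//; last by apply: le_trans (N_le _ t0) _; rewrite ler_nat leq_maxl.
have nn' : (n < n')%N by rewrite leq_max ltnSn orbT.
rewrite (bigD1 (Ordinal nn'))//= big1 ?addr0.
  by rewrite /T expr0 mul1r -exprMn mulfV// expr1n /bumpd /= bump1 scale1r.
move=> i; rewrite -val_eqE /= => /eqP ni.
rewrite /T /bumpd /= bump_out ?mulr0 ?scale0r//.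
have [li|gi] : (i < n)%N \/ (n < i)%N by lia.
  left; rewrite -(subnK (ltnW li)) exprD mulrCA -exprMn mulfV// expr1n mulr1.
  by rewrite -[leRHS]expr1; apply: ler_wiXn2l; rewrite ?subn_gt0//; lra.
right; rewrite -(subnK gi) -[X in 2 ^+ (_ + X)]add1n addnA exprD -mulrA -exprMn mulfV// expr1n mulr1.
apply: (@le_trans _ _ (2 ^+ 1)); first lra.
by apply: ler_weXn2l; lra || lia.
Unshelve. all: by end_near.
Qed.

(** If [U] were no neighbourhood of [x], points outside [U] would converge to [x] fast enough to lie
    on a smooth curve through [x], along which the preimage of [U] is open. *)
Lemma cinf_open_normed (Z : normedModType R) (U : set Z) : cinf_open U -> open U.
Proof.
move=> cU; rewrite openE => x Ux; rewrite /interior; apply: contrapT => nU.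
have ex n : exists y, `|y - x| <= (2^-1 : R) ^+ (n * n) /\ ~ U y.
  apply: contrapT => /forallNP H; apply: nU.
  apply: (@dist_near _ _ _ ((2^-1 : R) ^+ (n * n))); first by rewrite exprn_gt0// invr_gt0.
  by move=> y yx; apply: contrapT => Uy; apply: (H y); split=> //; exact: ltW.
have [y yP] := choice ex.
have [c [d d0 dP] [c0 cn]] := smooth_curve_through (fun n => (yP n).1).
have sc : smooth_curve (fun t => x + c t).
  exists (fun k t => if k is 0%N then x + c t else d k t) => //.
  case=> [|k] t; last exact: dP.
  have := dP 0%N t; rewrite d0.
  have -> // : (fun h : R => h^-1 *: (c (t + h) - c t)) = (fun h : R => h^-1 *: (x + c (t + h) - (x + c t))).
  by apply/funext => h; rewrite opprD addrACA subrr add0r.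
have oc := cU _ sc; have U0 : (fun t => x + c t) @^-1` U `&` setT `<=` (fun t => x + c t) @^-1` U by move=> ? [].
have [e e0 eP] : exists2 e : R, 0 < e & forall t, `|t - 0| < e -> U (x + c t).
  by apply: near_dist; apply: (near_open oc); rewrite /= c0 addr0.
have [n ne] : exists n, (2^-1 : R) ^+ n < e.
  exists (Num.bound e^-1); rewrite exprVn invf_plt ?posrE ?exprn_gt0//.
  apply: lt_le_trans (archi_boundP _) _; first by rewrite invr_ge0 ltW.
  by apply: le_trans (succ_le_pow2 _); rewrite ler_nat.
apply: (yP n).2; have := eP (2^-1 ^+ n); rewrite cn subrKC subr0 ger0_norm ?exprn_ge0//.
exact.
Qed.

End OpenCinf.

(** * Jointly smooth families *)

(** For properties with neighbourhoods or constants that vary from point to point. The covering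
    criterion is applied along the filter generated by the [P]-sets containing a given one. *)
Lemma compact_induct {X : topologicalType} (K : set X) (P : set X -> Prop) :
  P set0 -> (forall A B, P A -> P B -> P (A `|` B)) ->
  (forall A B, A `<=` B -> P B -> P A) -> compact K ->
  (forall x, K x -> exists2 W, nbhs x W & P W) -> P K.
Proof.
move=> P0 PU Psub /compact_near_coveringP cK KP.
pose F : set_system (set X) := [set Q | exists2 A, P A & forall B, A `<=` B -> P B -> Q B].
have FF : Filter F.
  split; first by exists set0.
  - move=> Q Q' [A PA AQ] [A' PA' AQ']; exists (A `|` A'); first exact: PU.
    by move=> B AB PB; split; [apply: AQ|apply: AQ'] => // x Ax; apply: AB; [left|right].
  - by move=> Q Q' QQ [A PA AQ]; exists A => // B AB PB; apply: QQ; exact: AQ.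
have [|A PA AK] := cK _ F (fun B x => B x) FF.
  move=> x /KP[W Wx PW]; exists (W, [set B | W `<=` B]).
    by split=> //; exists W.
  by move=> [y B] /= [Wy WB]; exact: WB.
exact: Psub (AK A (fun _ h => h) PA) PA.
Qed.

Lemma compact_unit_row {R : realType} n : compact [set x : 'rV[R]_n | `|x| <= 1].
Proof.
apply: bounded_closed_compact.
  by exists 1; split=> // x x1 y /= /le_trans; apply; exact: ltW.
have -> : [set x : 'rV[R]_n | `|x| <= 1] = (fun x => `|x|) @^-1` [set r : R | r <= 1] by [].
by apply: closed_comp => [x _|]; [exact: norm_continuous|exact: closed_le].
Qed.

Lemma compact_unit_prod {R : realType} (X Y : normedModType R) :
  compact [set x : X | `|x| <= 1] -> compact [set x : Y | `|x| <= 1] ->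
  compact [set x : X * Y | `|x| <= 1].
Proof.
move=> cX cY; have := compact_setX cX cY; congr compact.
apply/seteqP; split=> -[x y] /=; rewrite prod_normE ge_max /=; first by case=> -> ->.
by move/andP.
Qed.

(** * Directions in the product of parameter space and coordinate space *)

Section Axes.
Context {R : realType} (kd : dc_kind) (M : nat -> R).
Hypotheses (hM : weight_sequence M) (hlc : log_convex M) (hmg : moderate_growth M).

(** Only directions along one factor are tested: since derivatives commute, those in [T] can then be
    separated from those in [Y]. *)
Definition axisD {T Y : normedModType R} (Dt : set T) : set (T * Y) :=
  [set p | Dt p.1 /\ p.2 = 0].
Definition axisV {T Y : normedModType R} (Vt : set T) : set (T * Y) :=
  [set p | (Vt p.1 /\ p.2 = 0) \/ (p.1 = 0 /\ uball p.2)].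

Lemma uball0 (X : normedModType R) : uball (0 : X).
Proof. by rewrite /uball /= normr0. Qed.

Lemma uball_delta m (a : 'I_m) : uball (delta_mx 0 a : 'rV[R]_m).
Proof.
rewrite /uball /= /Num.norm /= mx_normrE; apply: bigmax_le => // -[i b] _ /=.
by rewrite mxE; case: (_ && _); rewrite ?normr1 ?normr0.
Qed.

Section Products.
Context {T Y : normedModType R}.

Definition psnd (p : T * Y) : Y := p.2.
Lemma psnd_linear : linear psnd. Proof. by []. Qed.
HB.instance Definition _ := GRing.isLinear.Build R (T * Y)%type Y *:%R psnd psnd_linear.
Lemma psnd_continuous : continuous psnd. Proof. by move=> p; exact: cvg_snd. Qed.

Definition inj1 (Y' : normedModType R) (p : T * Y) : T * Y' := (p.1, 0).
Lemma inj1_linear Y' : linear (@inj1 Y').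
Proof. move=> a p q; rewrite /inj1; apply/eqP; rewrite xpair_eqE /= eqxx /=.
by rewrite scaler0 addr0. Qed.
HB.instance Definition _ (Y' : normedModType R) := GRing.isLinear.Build R (T * Y)%type (T * Y')%type *:%R
  (@inj1 Y') (@inj1_linear Y').
Lemma inj1_continuous Y' : continuous (@inj1 Y').
Proof. by move=> p; apply: cvg_pair => /=; [exact: cvg_fst|exact: cvg_cst]. Qed.

Lemma GG_snd (Dt Vt : set T) (g : Y -> R) (x0 : T * Y) : GG kd M [set 0] uball x0.2 g ->
  GG kd M (axisD Dt) (axisV Vt) x0 (fun p => g p.2).
Proof.
move=> Hg.
have := @GG_comp R kd M hM hlc hmg _ _ 0 psnd (fun _ _ => 0) (fun _ => 0)
  psnd_continuous (axisD Dt) (axisV Vt) [set 0] uball.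
have h1 (v : T * Y) : axisD Dt v -> [set (0 : Y)] (psnd v) by case.
have h2 (v : T * Y) : axisV Vt v -> uball (psnd v) by case=> [[_]|[_]//]; rewrite /psnd => ->; exact: uball0.
have h3 : forall i : 'I_0, uball ((fun=> 0) i : Y) by case.
move=> /(_ h1 h2 h3 g x0); rewrite fsum0 => H.
by apply: eq_GG (H _ Hg) => [|[]//]; near=> z; rewrite fsum0.
Unshelve. all: by end_near.
Qed.

(** With linear part 0, the smooth directions reach [g] only through the coefficients [u i], so that
    [D' = [set 0]] suffices for [g]. *)
Lemma GG_static {X Z : normedModType R} (D V : set X) N (u : 'I_N -> X -> R) (z : 'I_N -> Z) g x0 :
  (forall i, GG kd M D V x0 (u i)) -> (forall i, uball (z i)) ->
  GG kd M [set 0] uball (\sum_i u i x0 *: z i) g ->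
  GG kd M D V x0 (fun p => g (\sum_i u i p *: z i)).
Proof.
move=> Hu Hz Hg.
have := @GG_comp R kd M hM hlc hmg X Z N (\0 : X -> Z) u z (@cst_continuous _ _ (0 : Z)) D V [set 0] uball.
have h1 (v : X) : D v -> [set (0 : Z)] ((\0 : X -> Z) v) by [].
have h2 (v : X) : V v -> uball ((\0 : X -> Z) v) by move=> _; exact: uball0.
move=> /(_ h1 h2 Hz g x0 Hu); rewrite /fsum /= add0r => /(_ Hg) H.
by apply: eq_GG H; near=> p; rewrite add0r.
Unshelve. all: by end_near.
Qed.

(** Substitution over a common parameter: the linear part keeps [t], and the coordinates are
    replaced along directions in which [g] has estimates. *)
Lemma GG_row (Dt Vt : set T) m (u : 'I_m -> T * Y -> R) (g : T * 'rV[R]_m -> R) x0 :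
  (forall a, GG kd M (axisD Dt) (axisV Vt) x0 (u a)) ->
  GG kd M (axisD Dt) (axisV Vt) (x0.1, \row_a u a x0) g ->
  GG kd M (axisD Dt) (axisV Vt) x0 (fun p => g (p.1, \row_a u a p)).
Proof.
move=> Hu Hg; pose z (a : 'I_m) : T * 'rV[R]_m := (0, delta_mx 0 a).
have zE (p : T * Y) : fsum (@inj1 'rV[R]_m) u z p = (p.1, \row_a u a p).
  rewrite /fsum /inj1 (_ : \sum_(i < m) _ = (0, \row_a u a p)).
    by apply/eqP; rewrite xpair_eqE /= addr0 add0r !eqxx.
  rewrite [\row_a u a p in RHS]row_sum_delta.
  rewrite [LHS]surjective_pairing; congr (_, _).
    by rewrite (big_morph fst (id1 := 0) (op1 := +%R))// big1// => i _ /=; rewrite scaler0.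
  rewrite (big_morph snd (id1 := 0) (op1 := +%R))//.
  by apply: eq_bigr => i _; rewrite mxE.
have := @GG_comp R kd M hM hlc hmg _ _ m (@inj1 'rV[R]_m) u z (@inj1_continuous _)
   (axisD Dt) (axisV Vt) (axisD Dt) (axisV Vt).
have h1 (v : T * Y) : axisD Dt v -> axisD Dt (inj1 'rV[R]_m v) by case.
have h2 (v : T * Y) : axisV Vt v -> axisV Vt (inj1 'rV[R]_m v).
  by case=> [[? _]|[? _]]; [left|right; split=> //; exact: uball0].
have h3 i : axisV Vt (z i).
  by right; split=> //; exact: uball_delta.
move=> /(_ h1 h2 h3 g x0 Hu); rewrite zE => /(_ Hg) H.
by apply: eq_GG H; near=> p; rewrite zE.
Unshelve. all: by end_near.
Qed.

End Products.
End Axes.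

(** * Joint smoothness from separate derivatives *)

Section JointFamilies.
Context {R : realType} {T Y : normedModType R}.

Lemma mlin_norm {X : normedModType R} (phi : seq X -> R) v vs (K : R) : mlin phi ->
  (forall u, uball u -> `|phi (u :: vs)| <= K) -> `|phi (v :: vs)| <= `|v| * K.
Proof.
move=> ml H; have [->|v0] := eqVneq v 0.
  by rewrite (mlin_zero [::] vs ml) !normr0 mul0r.
have nv : 0 < `|v| by rewrite normr_gt0.
have {1}-> : v = `|v| *: (`|v|^-1 *: v) by rewrite scalerA mulfV ?scale1r// gt_eqF.
rewrite (mlin_homog [::] _ _ vs ml) normrM normr_id ler_wpM2l//; apply: H.
by rewrite /uball /= normrZ normfV normr_id mulVf// gt_eqF.
Qed.

(* [Phi vs tau] plays the role of the derivative at [tau], in the directions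
   [vs], of a map from [T] to a space of functions on [U]. *)
Record jfam (U : set Y) (Phi : seq T -> T -> Y -> R) := JFam {
  jfam_smo : forall vs tau, smo U (Phi vs tau) ;
  jfam_mlin : forall tau y, U y -> mlin (fun vs => Phi vs tau y) ;
  jfam_bound : forall tau0 y0 k m, U y0 -> exists d K : R, 0 < d /\
    forall tau y vs ws, `|tau - tau0| < d -> `|y - y0| < d ->
      inV uball vs -> inV uball ws -> size vs = k -> size ws = m ->
      `|dird (Phi vs tau) ws y| <= K ;
  jfam_derive : forall vs v tau ws y (s : R), U y ->
    is_derive s (1 : R) (fun s => dird (Phi vs (tau + s *: v)) ws y)
      (dird (Phi (v :: vs) (tau + s *: v)) ws y) }.

Variable (U : set Y).
Hypothesis oU : open U.

Let oTU : open ([set: T] `*` U).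
Proof.
have -> : [set: T] `*` U = (fun p : T * Y => p.2) @^-1` U.
  by apply/seteqP; split=> [p []|p].
by apply: open_comp => // p _; exact: cvg_snd.
Qed.

Lemma jfam_dird_mlin Phi tau ws y : jfam U Phi -> U y ->
  mlin (fun vs => dird (Phi vs tau) ws y).
Proof.
move=> [fs fm _ _] Uy vs vs' a v w.
rewrite -(dirdZ a ws oU (fs _ _) Uy) -(dirdD ws oU _ (fs _ _) Uy); last first.
  exact: smoZ.
by apply: (eq_dird_on ws oU _ Uy) => z Uz; exact: fm.
Qed.

Lemma jfam_rcons Phi v : jfam U Phi -> jfam U (fun vs => Phi (rcons vs v)).
Proof.
move=> J; have [fs fm fb fd] := J; split.
- by move=> vs tau; exact: fs.
- by move=> tau y Uy vs ws a x w; rewrite /= !rcons_cat /=; exact: fm.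
- move=> tau0 y0 k m Uy0; have [d [K [d0 H]]] := fb tau0 y0 k.+1 m Uy0.
  have [d' d'0 dU] := near_dist (near_open oU Uy0).
  exists (Num.min d d'), (`|v| * K); split; first by rewrite lt_min d0.
  move=> tau y vs ws; rewrite !lt_min => /andP[td _] /andP[yd yd'] v1 w1 sv sw.
  have ml := jfam_dird_mlin tau ws J (dU _ yd').
  have -> : dird (Phi (rcons vs v) tau) ws y = dird (Phi (vs ++ [:: v]) tau) ws y by rewrite cats1.
  have ml' : mlin (fun us => dird (Phi (vs ++ us) tau) ws y).
    by move=> us us' a x w; have := ml (vs ++ us) us' a x w; rewrite !catA.
  apply: (mlin_norm v ml') => u u1; apply: H => //; first by apply: inV_cat => //; exact: inV1.
  by rewrite size_cat sv addn1.
- by move=> vs w tau ws y s Uy; exact: fd.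
Qed.

Lemma jfam_derive_snd Phi w : jfam U Phi ->
  jfam U (fun vs tau => 'D_w (Phi vs tau : Y -> R^o)).
Proof.
move=> J; have [fs fm fb fd] := J; split.
- by move=> vs tau; exact: (smo_dird [:: w]).
- by move=> tau y Uy; exact: (jfam_dird_mlin tau [:: w] J Uy).
- move=> tau0 y0 k m Uy0; have [d [K [d0 H]]] := fb tau0 y0 k m.+1 Uy0.
  have [d' d'0 dU] := near_dist (near_open oU Uy0).
  exists (Num.min d d'), (`|w| * K); split; first by rewrite lt_min d0.
  move=> tau y vs ws; rewrite !lt_min => /andP[td _] /andP[yd yd'] v1 w1 sv sw.
  rewrite -dird_rcons.
  have -> : dird (Phi vs tau) (rcons ws w) y = dird (Phi vs tau) (w :: ws) y.
    by apply: (dird_perm oU (fs _ _) _ (dU _ yd')); rewrite perm_rcons.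
  apply: (mlin_norm (phi := fun us => dird (Phi vs tau) us y)).
    exact: dird_mlin (dU _ yd').
  move=> u u1; apply: H => //=; last by rewrite sw.
  by move=> x; rewrite inE => /orP[/eqP ->|/w1].
- by move=> vs v tau ws y s Uy; rewrite -dird_rcons; under eq_fun do rewrite -dird_rcons; exact: fd.
Qed.

Definition joint (Phi : seq T -> T -> Y -> R) (p : T * Y) : R := Phi [::] p.1 p.2.

(** The increment splits into a remainder in [T] at [y0 + w], a mixed difference, and a remainder in
    [Y] at [t0]. Bounds of orders (2, 0) and (1, 1) make the first two quadratic; those of orders
    (1, 0) and (0, 1) make the differential continuous. *)
Lemma jfam_differentiable Phi p : jfam U Phi -> U p.2 ->
  differentiable (joint Phi) p /\ forall v w,
  'D_(v, w) (joint Phi : T * Y -> R^o) p = Phi [:: v] p.1 p.2 + 'D_w (Phi [::] p.1 : Y -> R^o) p.2.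
Proof.
case: p => t0 y0 J /= Uy0; have [fs fm fb fd] := J.
pose df (q : T * Y) : R := Phi [:: q.1] t0 y0 + 'D_q.2 (Phi [::] t0 : Y -> R^o) y0.
have dfl : linear df.
  move=> a [v w] [v' w']; rewrite /df /=.
  rewrite (fm t0 y0 Uy0 [::] [::] a v v') /= deriveDr; last exact: smo_differentiable (fs _ _) Uy0.
  by rewrite /GRing.scale /=; ring.
pose dfL : {linear (T * Y)%type -> R} := HB.pack df (GRing.isLinear.Build R (T * Y)%type R *%R df dfl).
have [d1 [K1 [d10 H1]]] := fb t0 y0 1%N 0%N Uy0.
have [d2 [K2 [d20 H2]]] := fb t0 y0 0%N 1%N Uy0.
have [d3 [K3 [d30 H3]]] := fb t0 y0 2%N 0%N Uy0.
have [d4 [K4 [d40 H4]]] := fb t0 y0 1%N 1%N Uy0.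
have [d5 d50 dU] := near_dist (near_open oU Uy0).
have n0 (X : normedModType R) (x : X) (d : R) : 0 < d -> `|x - x| < d by rewrite subrr normr0.
have cdf : continuous dfL.
  apply: (@lipschitz_continuous _ _ _ dfL (K1 + K2)) => -[v w].
  apply: le_trans (ler_normD _ _) _; rewrite /= mulrDl.
  have [l1 l2] : `|v| <= `|(v, w)| /\ `|w| <= `|(v, w)|.
    by rewrite prod_normE !le_max /= !lexx ?orbT.
  have a1 : `|Phi [:: v] t0 y0| <= `|v| * K1.
    apply: (mlin_norm (phi := fun vs => Phi vs t0 y0)) => [|u u1]; first exact: fm.
    by apply: (H1 t0 y0 [:: u] [::]); rewrite ?n0//; exact: inV1.
  have a2 : `|'D_w (Phi [::] t0 : Y -> R^o) y0| <= `|w| * K2.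
    apply: (mlin_norm w (vs := [::]) (dird_mlin oU (fs [::] t0) Uy0)) => u u1.
    by apply: (H2 t0 y0 [::] [:: u]); rewrite ?n0//; exact: inV1.
  have p1 : 0 <= K1 by apply: le_trans (H1 t0 y0 [:: 0] [::] _ _ _ _ _ _); rewrite ?n0//; apply: inV1; exact: uball0.
  have p2 : 0 <= K2 by apply: le_trans (H2 t0 y0 [::] [:: 0] _ _ _ _ _ _); rewrite ?n0//; apply: inV1; exact: uball0.
  apply: lerD; [apply: le_trans a1 _|apply: le_trans a2 _]; rewrite mulrC ler_wpM2l//.
have p3 : 0 <= K3.
  apply: le_trans (H3 t0 y0 [:: 0; 0] [::] _ _ _ _ _ _); rewrite ?n0//.
  by move=> x; rewrite !inE orbb => /eqP ->; exact: uball0.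
have p4 : 0 <= K4.
  by apply: le_trans (H4 t0 y0 [:: 0] [:: 0] _ _ _ _ _ _); rewrite ?n0//; apply: inV1; exact: uball0.
have D : differentiable (joint Phi) (t0, y0) /\ 'd (joint Phi) (t0, y0) = dfL :> (T * Y -> R).
  apply: (differentiable_eps cdf) => e e0.
  have e2 : 0 < e / 2 by rewrite divr_gt0.
  have hC := differentiable_epsP (smo_differentiable (fs [::] t0) Uy0) e2.
  have [d6 d60 HC] := near_dist hC.
  (* The last entry makes the quadratic terms at most [e / 2] times the norm of the increment. *)
  pose d := Num.min (Num.min (Num.min d3 d4) (Num.min d5 d6)) (e / 2 / (K3 + K4 + 1)).
  have KK : 0 < K3 + K4 + 1 by rewrite ltr_wpDl// addr_ge0.
  apply: (@dist_near _ _ _ d); first by rewrite !lt_min d30 d40 d50 d60 divr_gt0.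
  move=> [v w]; rewrite subr0 !lt_min => /andP[/andP[/andP[q3 q4] /andP[q5 q6]] q7].
  have [l1 l2] : `|v| <= `|(v, w)| /\ `|w| <= `|(v, w)|.
    by rewrite prod_normE !le_max /= !lexx ?orbT.
  set N := `|(v, w)| in q3 q4 q5 q6 q7 l1 l2 *.
  have N0 : 0 <= N by exact: normr_ge0.
  have tv (s : R) : 0 <= s <= 1 -> `|t0 + s *: v - t0| <= N.
    move=> /andP[s0 s1]; rewrite addrAC subrr add0r normrZ ger0_norm//.
    by apply: le_trans l1; rewrite ler_piMl.
  have yw (s : R) : 0 <= s <= 1 -> `|y0 + s *: w - y0| <= N.
    move=> /andP[s0 s1]; rewrite addrAC subrr add0r normrZ ger0_norm//.
    by apply: le_trans l2; rewrite ler_piMl.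
  have yw1 : `|y0 + w - y0| <= N by rewrite addrAC subrr add0r.
  have Uyw : U (y0 + w) by apply: dU; apply: le_lt_trans q5.
  have b2 (s : R) : 0 <= s <= 1 -> `|Phi [:: v; v] (t0 + s *: v) (y0 + w)| <= N * (N * K3).
    move=> s01; have ml := fm (t0 + s *: v) (y0 + w) Uyw.
    have h u : uball u -> `|Phi [:: u; v] (t0 + s *: v) (y0 + w)| <= N * K3.
      move=> u1; apply: (@le_trans _ _ (`|v| * K3)); last by rewrite ler_wpM2r.
      have ml' : mlin (fun vs => Phi (u :: vs) (t0 + s *: v) (y0 + w)).
        by move=> us us' a x z; have := ml (u :: us) us' a x z.
      apply: (mlin_norm v (vs := [::]) ml') => u' u'1.
      apply: (H3 _ _ [:: u; u'] [::]) => //; [exact: le_lt_trans (tv _ s01) _|exact: le_lt_trans yw1 _|].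
      by move=> x; rewrite !inE => /orP[] /eqP ->.
    apply: (@le_trans _ _ (`|v| * (N * K3))); last by rewrite ler_wpM2r// mulr_ge0.
    exact: (mlin_norm (phi := fun vs => Phi vs (t0 + s *: v) (y0 + w))).
  have b1 (s : R) : 0 <= s <= 1 ->
      `|Phi [:: v] (t0 + s *: v) (y0 + w) - Phi [:: v] t0 (y0 + w)| <= s * (N * (N * K3)).
    apply: (@derive_bound_mono _ (fun s => Phi [:: v] (t0 + s *: v) (y0 + w) - Phi [:: v] t0 (y0 + w))
      (fun s => Phi [:: v; v] (t0 + s *: v) (y0 + w)) (fun s => s * (N * (N * K3))) (fun=> N * (N * K3))) => //.
    - move=> t _; apply: is_derive_eq (is_deriveB (fd [:: v] v t0 [::] (y0 + w) t Uyw) (is_derive_cst _ _ _)) _.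
      by rewrite /= subr0.
    - move=> t _; have := @is_deriveM R R id (cst (N * (N * K3))) t 1 1 0 (is_derive_id _ _) (is_derive_cst _ _ _).
      by move=> h; apply: is_derive_eq h _; rewrite /cst /GRing.scale /=; ring.
    - by rewrite scale0r addr0 subrr.
    - by rewrite mul0r.
  have bA : `|Phi [::] (t0 + v) (y0 + w) - Phi [::] t0 (y0 + w) - Phi [:: v] t0 (y0 + w)| <= N * (N * K3).
    have h : forall s : R, 0 <= s <= 1 ->
      `|Phi [::] (t0 + s *: v) (y0 + w) - Phi [::] t0 (y0 + w) - s * Phi [:: v] t0 (y0 + w)| <= s * (N * (N * K3)).
      apply: (@derive_bound_mono _ _
        (fun s => Phi [:: v] (t0 + s *: v) (y0 + w) - Phi [:: v] t0 (y0 + w)) _ (fun=> N * (N * K3))) => //.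
      - move=> t _; have i1 := is_deriveB (fd [::] v t0 [::] (y0 + w) t Uyw) (is_derive_cst (Phi [::] t0 (y0 + w)) t 1).
        have i2 := @is_deriveM R R id (cst (Phi [:: v] t0 (y0 + w))) t 1 1 0 (is_derive_id _ _) (is_derive_cst _ _ _).
        apply: is_derive_eq (is_deriveB i1 i2) _.
        by rewrite /cst /GRing.scale /=; ring.
      - move=> t _; have := @is_deriveM R R id (cst (N * (N * K3))) t 1 1 0 (is_derive_id _ _) (is_derive_cst _ _ _).
        by move=> h; apply: is_derive_eq h _; rewrite /cst /GRing.scale /=; ring.
      - by rewrite scale0r addr0 subrr mul0r subr0.
      - by rewrite mul0r.
      - move=> s s01; apply: le_trans (b1 s s01) _; case/andP: s01 => s0 s1.
        by rewrite ler_piMl// !mulr_ge0.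
    by have := h 1; rewrite scale1r !mul1r; apply; rewrite ler01 lexx.
  have bB : `|Phi [:: v] t0 (y0 + w) - Phi [:: v] t0 y0| <= N * (N * K4).
    have [|c c01 ->] := @MVT_line _ _ (Phi [:: v] t0) y0 w.
      move=> s s01; apply: smo_differentiable (fs _ _) _; apply: dU.
      exact: le_lt_trans (yw _ s01) _.
    have Uc : U (y0 + c *: w) by apply: dU; exact: le_lt_trans (yw _ c01) _.
    have h u : uball u -> `|dird (Phi [:: v] t0) [:: u] (y0 + c *: w)| <= N * K4.
      move=> u1; apply: (@le_trans _ _ (`|v| * K4)); last by rewrite ler_wpM2r.
      apply: (mlin_norm v (vs := [::]) (jfam_dird_mlin t0 [:: u] J Uc)) => u' u'1.
      apply: (H4 _ _ [:: u'] [:: u]); rewrite ?n0//; [exact: le_lt_trans (yw _ c01) _|exact: inV1|exact: inV1].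
    apply: (@le_trans _ _ (`|w| * (N * K4))); last by rewrite ler_wpM2r// mulr_ge0.
    exact: (mlin_norm w (vs := [::]) (dird_mlin oU (fs [:: v] t0) Uc)).
  have bC : `|Phi [::] t0 (y0 + w) - Phi [::] t0 y0 - 'D_w (Phi [::] t0 : Y -> R^o) y0| <= e / 2 * N.
    have := HC w; rewrite subr0 => /(_ (le_lt_trans l2 q6)).
    rewrite -deriveE; last exact: smo_differentiable (fs _ _) Uy0.
    by move=> h; apply: le_trans h _; rewrite ler_wpM2l// ltW.
  have -> : joint Phi ((t0, y0) + (v, w)) - joint Phi (t0, y0) - dfL (v, w) =
    (Phi [::] (t0 + v) (y0 + w) - Phi [::] t0 (y0 + w) - Phi [:: v] t0 (y0 + w)) +
    ((Phi [:: v] t0 (y0 + w) - Phi [:: v] t0 y0) +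
     (Phi [::] t0 (y0 + w) - Phi [::] t0 y0 - 'D_w (Phi [::] t0 : Y -> R^o) y0)).
    by rewrite /joint /= /df /=; ring.
  apply: le_trans (ler_normD _ _) _; apply: le_trans (lerD bA (le_trans (ler_normD _ _) (lerD bB bC))) _.
  have h7 : N * (K3 + K4) <= e / 2.
    have : N * (K3 + K4 + 1) < e / 2 by rewrite -ltr_pdivlMr.
    by move/ltW; apply: le_trans; rewrite ler_wpM2l// lerDl.
  rewrite addrA -!mulrDr [e in leRHS]splitr mulrDl lerD2r.
  by rewrite mulrC ler_wpM2r.
split=> [|v w]; first exact: D.1.
by rewrite deriveE ?D.2//; exact: D.1.
Qed.

(** A directional derivative of the joint map is a sum of the joint maps of two families of the same
    kind, which closes the induction. *)
Lemma jfam_joint_smo Phi : jfam U Phi -> smo ([set: T] `*` U) (joint Phi).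
Proof.
move=> J; apply: smt_smo => n.
elim: n Phi J => [|n ih] Phi J.
  by move=> p [_ Up] [|//] _; exact: (jfam_differentiable J Up).1.
apply/smtP => //; split=> [p [_ Up]|[v w]]; first exact: (jfam_differentiable J Up).1.
apply: (@eq_smt _ _ _ _ (fun p => joint (fun vs => Phi (rcons vs v)) p +
    joint (fun vs tau => 'D_w (Phi vs tau : Y -> R^o)) p)) => //.
  by move=> p [_ Up]; rewrite (jfam_differentiable J Up).2.
by apply: smtD => //; apply: ih; [exact: jfam_rcons|exact: jfam_derive_snd].
Qed.

Definition ax1 (v : T) : T * Y := (v, 0).
Definition ax2 (w : Y) : T * Y := (0, w).

Lemma dird_ax2 (f : T * Y -> R) ws p :
  dird f (map ax2 ws) p = dird (fun y => f (p.1, y)) ws p.2.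
Proof.
rewrite (@dird_affine _ _ _ f (fun y => (p.1, y)) ax2) -?surjective_pairing//.
by move=> h v x; apply/eqP; rewrite xpair_eqE /= scaler0 add0r !eqxx.
Qed.

Lemma dird_ax1 (f : T * Y -> R) vs p :
  dird f (map ax1 vs) p = dird (fun t => f (t, p.2)) vs p.1.
Proof.
rewrite (@dird_affine _ _ _ f (fun y => (y, p.2)) ax1) -?surjective_pairing//.
by move=> h v x; apply/eqP; rewrite xpair_eqE /= scaler0 add0r !eqxx.
Qed.

Lemma axis_perm (S1 : set T) (S2 : set Y) es :
  inV [set p : T * Y | (S1 p.1 /\ p.2 = 0) \/ (p.1 = 0 /\ S2 p.2)] es ->
  exists vs ws, [/\ inV S1 vs, inV S2 ws & perm_eq es (map ax1 vs ++ map ax2 ws)].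
Proof.
elim: es => [|[v w] es ih]; first by exists [::], [::].
move=> H; have [/ih[vs [ws [v1s w1s pe]]] [[/= v1 ->]|[/= -> w1]]] := inV_cons H.
  exists (v :: vs), ws; split=> //; last by rewrite /= perm_cons.
  by move=> x; rewrite inE => /orP[/eqP ->|/v1s].
exists vs, (w :: ws); split=> //; last first.
  by rewrite perm_sym (perm_catCA _ [:: ax2 w]) /= perm_cons perm_sym.
by move=> x; rewrite inE => /orP[/eqP ->|/w1s].
Qed.

Lemma dird_joint Phi vs ws p : jfam U Phi -> U p.2 ->
  dird (joint Phi) (map ax1 vs ++ map ax2 ws) p = dird (Phi vs p.1) ws p.2.
Proof.
move=> J; elim: vs p => [|v vs ih] p Up; first by rewrite dird_ax2.
have [_ _ _ fd] := J; have i := fd vs v p.1 ws p.2 0 Up.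
rewrite scale0r addr0 in i; case: i => _ <-.
have E : forall q, ([set: T] `*` U) q -> dird (joint Phi) (map ax1 vs ++ map ax2 ws) q =
  dird (Phi vs q.1) ws q.2 by move=> q [_ Uq]; exact: ih.
have /= -> := eq_dird_on [:: ax1 v] oTU E (conj I Up).
have := @derive_affine _ _ _ (fun q : T * Y => dird (Phi vs q.1) ws q.2)
  (fun s : R => (p.1 + s *: v, p.2)) (0 : R) (1 : R) (ax1 v).
rewrite /= scale0r addr0 -surjective_pairing => ->//.
move=> h; apply/eqP; rewrite xpair_eqE /= scaler0 add0r eqxx andbT.
by rewrite addr0 -[h%:A]/(h * 1) mulr1 addrC.
Qed.

End JointFamilies.

(** * Estimates for joint families *)

Section JointGerms.
Context {R : realType} (kd : dc_kind) (M : nat -> R).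
Hypotheses (hM : weight_sequence M) (hlc : log_convex M) (hmg : moderate_growth M).
Context {T Y : normedModType R}.
Implicit Types (U : set Y) (f : T * Y -> R).

Lemma inV_map {X Z : normedModType R} (S : set Z) (f : X -> Z) vs :
  inV (fun x => S (f x)) vs -> inV S (map f vs).
Proof. by move=> H _ /mapP[x /H ? ->]. Qed.

(** By symmetry the derivatives along [T] can be gathered in the index of [Phi], and those along [Y]
    then act on a single function. *)
Lemma GG_joint (Dt Vt : set T) U Phi (p0 : T * Y) : open U -> U p0.2 -> jfam U Phi ->
  (forall es, inV Dt es -> exists2 W, nbhs p0 W & kdq kd (fun rho C =>
     forall p vs ws, W p -> inV Vt vs -> inV uball ws ->
       `|dird (Phi (vs ++ es) p.1) ws p.2| <= C * wgt M rho (size vs + size ws))) ->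
  GG kd M (axisD Dt) (axisV Vt) p0 (joint Phi).
Proof.
move=> oU Up0 J H.
have oTU : open ([set: T] `*` U).
  have -> : [set: T] `*` U = (fun p : T * Y => p.2) @^-1` U.
    by apply/seteqP; split=> [p []|p].
  by apply: open_comp => // p _; exact: cvg_snd.
have JU := jfam_joint_smo oU J.
exists ([set: T] `*` U); split=> // es Des.
have [es' Des' ->] : exists2 es', inV Dt es' & es = map (@ax1 _ T Y) es'.
  elim: es Des => [|[e e'] es ih]; first by exists [::].
  move=> He; have [/ih[es' Des' ->] [/= De ->]] := inV_cons He.
  by exists (e :: es') => // x; rewrite inE => /orP[/eqP ->|/Des'].
have [W Wp HW] := H es' Des'; exists (W `&` ([set: T] `*` U)).
  by apply: filterI => //; apply: open_nbhs_nbhs; split.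
apply: kdq_imp HW => rho C r0 C0 HC; exists C => // p xs [Wp' TUp] Vxs.
have [vs [ws [v1 w1 pe]]] := axis_perm Vxs.
rewrite -dird_cat (perm_size pe) size_cat !size_map.
have -> : dird (joint Phi) (xs ++ map (@ax1 _ T Y) es') p =
    dird (joint Phi) (map (@ax1 _ T Y) (vs ++ es') ++ map (@ax2 _ T Y) ws) p.
  apply: (dird_perm oTU JU) => //; rewrite map_cat.
  by apply: perm_trans (_ : perm_eq _ ((map (@ax1 _ T Y) vs ++ map (@ax2 _ T Y) ws) ++ map (@ax1 _ T Y) es')) _;
    rewrite ?perm_cat2r// -!catA perm_cat2l perm_catC.
rewrite (dird_joint oU _ _ J); last by case: TUp.
exact: HC.
Qed.

(* In the directions of [T] only smoothness is recorded, in those of [Y] the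
   estimates of the class. *)
Definition GT (z : T * Y) f := exists U : set (T * Y), [/\ open U, U z, smo U f &
  forall k, exists2 W, nbhs z W & kdq kd (fun rho C => forall p vs ws, W p ->
    inV uball vs -> size vs = k -> inV uball ws ->
    `|dird f (map (@ax2 _ T Y) ws ++ map (@ax1 _ T Y) vs) p| <= C * wgt M rho (size ws))].

(** [wgt_add] splits the joint weight; the order in [T] is fixed, so its factor goes into the
    constant. *)
Lemma GT_banach (Dt : set T) z f : GG kd M (axisD Dt) (axisV uball) z f -> GT z f.
Proof.
move=> [U [oU Uz fU H]]; exists U; split=> // k.
have [W Wz HW] := H [::] (fun _ => ltac:(by [])); exists W => //.
have [theta t1 Ht] := wgt_add hM hmg; have t0 : 0 < theta by apply: lt_le_trans t1.
apply: (kdq_map t0) HW => rho C r0 C0 HC; exists (C * wgt M (theta * rho) k).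
  by rewrite mulr_gt0// wgt_gt0// mulr_gt0.
move=> p vs ws Wp v1 sk w1; apply: le_trans (HC p _ Wp _) _.
  apply: inV_cat; apply: inV_map => x; first by move/w1; right.
  by move/v1; left.
rewrite size_cat !size_map sk -mulrA ler_pM2l// [leRHS]mulrC; exact: Ht.
Qed.

End JointGerms.

Section RealGerms.
Context {R : realType} (kd : dc_kind) (M : nat -> R) {Y : normedModType R}.

Lemma mlin_axis (phi : seq (R * Y) -> R) us vs ws : mlin phi ->
  phi (us ++ map (@ax1 _ R Y) vs ++ ws) =
  \prod_(v <- vs) v * phi (us ++ nseq (size vs) (@ax1 _ R Y 1) ++ ws).
Proof.
move=> ml; elim: vs us => [|v vs ih] us; first by rewrite big_nil mul1r.
rewrite /= big_cons.
have -> : @ax1 _ R Y v = v *: @ax1 _ R Y 1.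
  by apply/eqP; rewrite xpair_eqE /= scaler0 -[v%:A]/(v * 1) mulr1 !eqxx.
rewrite (mlin_homog us v (@ax1 _ R Y 1) (map (@ax1 _ R Y) vs ++ ws) ml) -mulrA; congr (_ * _).
by have := ih (rcons us (@ax1 _ R Y 1)); rewrite !cat_rcons.
Qed.

(** On the line every direction is a multiple of 1, so [k] derivatives in [t] reduce to [k] times
    the direction 1, which lies in [D]. *)
Lemma GT_real (Vt : set R) z (f : R * Y -> R) : GG kd M (axisD setT) (axisV Vt) z f -> GT kd M z f.
Proof.
move=> [U [oU Uz fU H]]; exists U; split=> // k.
have [|W Wz HW] := H (nseq k (@ax1 _ R Y 1)); first by move=> x /nseqP[-> _].
exists (U `&` W); first by apply: filterI => //; apply: open_nbhs_nbhs; split.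
apply: kdq_imp HW => rho C r0 C0 HC; exists C => // p vs ws [Up Wp] v1 sk w1.
have := mlin_axis (map (@ax2 _ R Y) ws) vs [::] (dird_mlin oU fU Up).
rewrite !cats0 => ->; rewrite normrM dird_cat sk.
apply: (@le_trans _ _ (1 * `|dird (dird f (nseq k (@ax1 _ R Y 1))) [seq @ax2 _ R Y i | i <- ws] p|)).
  apply: ler_wpM2r => //; elim: vs v1 {sk} => [|v vs ih] v1; first by rewrite big_nil normr1.
  by rewrite big_cons normrM; have [h1 h2] := inV_cons v1; rewrite mulr_ile1// ih.
rewrite mul1r -(size_map (@ax2 _ R Y)); apply: HC => //.
by apply: inV_map => x /w1; right.
Qed.

End RealGerms.

(** * Sections over charts *)

Section Coordinates.
Context {R : realType} (kd : dc_kind) (M : nat -> R).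
Hypotheses (hM : weight_sequence M) (hlc : log_convex M) (hmg : moderate_growth M).

Definition row_coord m (a : 'I_m) (v : 'rV[R]_m) : R^o := v 0 a.
Lemma row_coord_linear m a : linear (@row_coord m a).
Proof. by move=> c x y; rewrite /row_coord !mxE. Qed.
HB.instance Definition _ m a := GRing.isLinear.Build R 'rV[R]_m R^o *:%R
  (@row_coord m a) (@row_coord_linear m a).
Lemma row_coord_continuous m a : continuous (@row_coord m a).
Proof.
apply: (@lipschitz_continuous _ _ _ _ 1) => v; rewrite mul1r.
rewrite /Num.norm /= mx_normrE; exact: (@le_bigmax _ _ _ 0 (fun ij : 'I_1 * 'I_m => `|v ij.1 ij.2|) (0, a)).
Qed.

Lemma CM_coords n m (U : set 'rV[R]_n) (g : 'rV[R]_n -> 'rV[R]_m) : open U ->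
  CM kd M U g <-> forall a, smo U (fun y => g y 0 a) /\ LCon kd M U (fun y => g y 0 a).
Proof.
move=> oU; split=> [gU a|H]; last first.
  by apply: CM_of_smo => // a; case: (H a).
have G y : U y -> GG kd M [set 0] uball y (fun y => g y 0 a).
  exact: (CM_germ hM hlc hmg (@compact_unit_row R n) oU gU (@row_coord_continuous m a)).
split=> y /G; last exact: GG_LC.
by move=> [U' [oU' Uy' fU' _]] vs; exact: fU'.
Qed.

Lemma rho_norm_ge0 {E : normedModType R} (rho : R) (K : set E) phi : 0 < rho ->
  (0 <= rho_norm M rho K phi)%E.
Proof.
move=> r0; have w0 : 0 < wgt M rho 0 by exact: wgt_gt0.
apply: (@le_trans _ _ (jet_norm K phi 0 * ((wgt M rho 0)^-1)%:E)%E).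
  apply: mule_ge0; first by apply: ereal_sup_ubound; left.
  by rewrite lee_fin invr_ge0 ltW.
by rewrite /rho_norm le_max; apply/orP; left; apply: ereal_sup_ubound; exists 0%N.
Qed.

(* The quantifiers of the constants in the continuity estimate of a seminorm on
   C^[M], dual to those of [kdq]. *)
Definition kdd (P : R -> R -> Prop) : Prop :=
  match kd with
  | Beurling => exists2 rho, 0 < rho & exists2 C, 0 < C & P rho C
  | Roumieu => forall rho, 0 < rho -> exists2 C, 0 < C & P rho C
  end.

Lemma kd_case (P Q : Prop) : match kd with Beurling => P | Roumieu => Q end ->
  kd = Beurling /\ P \/ kd = Roumieu /\ Q.
Proof. by case: kd => H; [left|right]. Qed.

Lemma kddB (P : R -> R -> Prop) : kd = Beurling ->
  (exists2 rho, 0 < rho & exists2 C, 0 < C & P rho C) -> kdd P.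
Proof. by rewrite /kdd; case: kd. Qed.

Lemma kddR (P : R -> R -> Prop) : kd = Roumieu ->
  (forall rho, 0 < rho -> exists2 C, 0 < C & P rho C) -> kdd P.
Proof. by rewrite /kdd; case: kd. Qed.

Lemma not_kdq (P : R -> R -> Prop) : ~ kdq kd P ->
  kd = Beurling /\ (exists rho, 0 < rho /\ forall C, 0 < C -> ~ P rho C) \/
  kd = Roumieu /\ forall rho C, 0 < rho -> 0 < C -> ~ P rho C.
Proof.
rewrite /kdq; case: kd => H; [left|right]; split=> //.
  apply: contrapT => /forallNP H'; apply: H => rho r0; apply: contrapT => H''.
  by apply: (H' rho); split=> // C C0 PC; apply: H''; exists C.
by move=> rho C r0 C0 PC; apply: H; exists rho => //; exists C.
Qed.

Lemma kdq_kdd (P Q : R -> R -> Prop) : kdq kd P -> kdd Q ->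
  exists rho C A, [/\ 0 < rho, 0 < C, 0 < A, P rho C & Q rho A].
Proof.
rewrite /kdq /kdd; case: kd => [HP [rho r0 [A A0 HQ]]|[rho r0 [C C0 HP]] HQ].
  by have [C C0 HC] := HP _ r0; exists rho, C, A.
by have [A A0 HA] := HQ _ r0; exists rho, C, A.
Qed.

Section JetSup.
Context {E : normedModType R}.
Variables (K : set E) (m : nat -> nat) (x : nat -> E) (v : forall n, (m n).-tuple E) (r : nat -> R).

(* A continuous seminorm for constant [r] (Beurling) and for [r n = n + 1]
   (Roumieu), by [jsup_seminorm]; it detects the points at which the Roumieu
   estimates of a family fail to be uniform. *)
Definition jsup (phi : jet) := sup (range (fun n => `|phi (m n) (x n) (v n)| / wgt M (r n) (m n))).

Lemma eq_jsup (phi psi : jet) : (forall n, phi (m n) (x n) (v n) = psi (m n) (x n) (v n)) ->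
  jsup phi = jsup psi.
Proof. by move=> H; rewrite /jsup; under eq_fun do rewrite H. Qed.

Hypotheses (Kx : forall n, K (x n)) (v1 : forall n, inV uball (v n)) (r0 : forall n, 0 < r n).
Hypothesis rB : kd = Beurling -> exists rho, forall n, r n = rho.
Hypothesis rR : kd = Roumieu -> forall n, r n = n.+1%:R.

Let w0 n : 0 < wgt M (r n) (m n). Proof. exact: wgt_gt0. Qed.

Let ratio rho : 0 < rho -> (kd = Beurling -> forall n, r n = rho) ->
  exists2 D, 0 < D & forall n, wgt M rho (m n) <= D * wgt M (r n) (m n).
Proof.
move=> rho0 Br; case: (kd) rR Br => [_ /(_ erefl) Br|/(_ erefl) Rr _].
  by exists 1 => // n; rewrite Br mul1r.
(* In the Roumieu case the ratio of the weights is (rho / (n + 1))^m, at most 1 once n >= N; the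
   finitely many other indices go into the constant. *)
pose N := Num.bound rho.
have e0 (i : nat) : 0 <= (rho / i.+1%:R) ^+ m i by rewrite exprn_ge0// divr_ge0// ltW.
exists (1 + \sum_(i < N) (rho / i.+1%:R) ^+ m i); first by rewrite ltr_pwDl// sumr_ge0.
move=> n; rewrite Rr.
have -> : wgt M rho (m n) = (rho / n.+1%:R) ^+ m n * wgt M n.+1%:R (m n).
  by rewrite -wgt_scale divfK.
apply: ler_wpM2r; first exact/ltW/wgt_gt0.
have [nN|Nn] := ltnP n N.
  rewrite (bigD1 (Ordinal nN))//= addrCA lerDl addr_ge0// sumr_ge0//.
rewrite (@le_trans _ _ 1)//; last by rewrite lerDl sumr_ge0.
rewrite exprn_ile1 ?divr_ge0// ?(ltW rho0)// ler_pdivrMr// mul1r.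
apply: le_trans (ltW (archi_boundP (ltW rho0))) _; rewrite ler_nat.
exact: leq_trans Nn _.
Qed.

Let bound rho phi : 0 < rho -> (kd = Beurling -> forall n, r n = rho) -> C_rho M rho K phi ->
  exists D, forall n, `|phi (m n) (x n) (v n)| / wgt M (r n) (m n) <= D * fine (rho_norm M rho K phi).
Proof.
move=> rho0 Br [_ _ fin]; have [D D0 HD] := ratio rho0 Br; exists D => n.
have nf : rho_norm M rho K phi \is a fin_num.
  by rewrite fin_numElt fin andbT (lt_le_trans _ (rho_norm_ge0 K phi rho0)).
rewrite ler_pdivrMr//.
have := @rho_norm_bound _ _ M rho (fine (rho_norm M rho K phi)) K phi (m n) (x n) (v n) hM rho0.
rewrite fineK// lexx => /(_ isT (Kx n) (@v1 n)); move/le_trans; apply.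
rewrite mulrAC mulrC ler_wpM2r//.
by apply: fine_ge0; exact: rho_norm_ge0.
Qed.

Let unif rho phi : 0 < rho -> (kd = Beurling -> forall n, r n = rho) -> C_rho M rho K phi ->
  has_ubound (range (fun n => `|phi (m n) (x n) (v n)| / wgt M (r n) (m n))).
Proof.
by move=> rho0 Br /(bound rho0 Br)[D H]; exists (D * fine (rho_norm M rho K phi)) => _ [n _ <-].
Qed.

Let bnd phi : CM_jet kd M K phi ->
  has_ubound (range (fun n => `|phi (m n) (x n) (v n)| / wgt M (r n) (m n))).
Proof.
move=> H; have : exists2 rho, 0 < rho /\ (kd = Beurling -> forall n, r n = rho) & C_rho M rho K phi.
  move: H rB; rewrite /CM_jet; case: (kd) => [H /(_ erefl)[rho Hr]|[rho rho0 H] _].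
    have rho0 : 0 < rho by rewrite -(Hr 0%N).
    by exists rho => //; exact: H.
  by exists rho.
by move=> [rho [rho0 Br] Cr]; exact: unif Cr.
Qed.

Lemma jsup_ge phi n : CM_jet kd M K phi ->
  `|phi (m n) (x n) (v n)| / wgt M (r n) (m n) <= jsup phi.
Proof. by move=> H; apply: ub_le_sup; [exact: bnd|exists n]. Qed.

Lemma jsup_le phi c : (forall n, `|phi (m n) (x n) (v n)| / wgt M (r n) (m n) <= c) -> jsup phi <= c.
Proof. by move=> H; apply: ge_sup; [exists (`|phi (m 0) (x 0) (v 0)| / wgt M (r 0) (m 0)), 0%N|move=> _ [n _ <-]]. Qed.

Lemma jsup_seminorm : CM_jet_seminorm kd M K jsup.
Proof.
have ge0 phi : CM_jet kd M K phi -> 0 <= jsup phi.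
  by move=> H; apply: le_trans (jsup_ge 0 H); rewrite divr_ge0// ltW.
split.
- move=> phi psi Hp Hq; apply: jsup_le => n.
  apply: le_trans (lerD (jsup_ge n Hp) (jsup_ge n Hq)).
  by rewrite -mulrDl ler_wpM2r ?ler_normD// invr_ge0 ltW.
- move=> a phi H; have [->|a0] := eqVneq a 0.
    rewrite normr0 mul0r; apply/eqP; rewrite eq_le; apply/andP; split.
      by apply: jsup_le => n; rewrite mul0r normr0 mul0r.
    by apply: ub_le_sup; [exists 0 => _ [n _ <-]|exists 0%N] => //; rewrite mul0r normr0 mul0r.
  have an : 0 < `|a| by rewrite normr_gt0.
  have ub : forall n, `|a * phi (m n) (x n) (v n)| / wgt M (r n) (m n) <= `|a| * jsup phi.
    by move=> n; rewrite normrM -mulrA ler_pM2l// jsup_ge.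
  apply/eqP; rewrite eq_le jsup_le//= -ler_pdivlMl//; apply: jsup_le => n.
  rewrite ler_pdivlMl//; apply: ub_le_sup; first by exists (`|a| * jsup phi) => _ [k _ <-]; exact: ub.
  by exists n => //; rewrite normrM mulrA.
- have key rho : 0 < rho -> (kd = Beurling -> forall n, r n = rho) ->
    exists C : R, forall phi, C_rho M rho K phi -> ((jsup phi)%:E <= C%:E * rho_norm M rho K phi)%E.
    move=> rho0 Br; have [D D0 HD] := ratio rho0 Br; exists D => phi Cr.
    have [_ _ fin] := Cr.
    have nf : rho_norm M rho K phi \is a fin_num.
      by rewrite fin_numElt fin andbT (lt_le_trans _ (rho_norm_ge0 K phi rho0)).
    rewrite -(fineK nf) -EFinM lee_fin; apply: jsup_le => n.
    rewrite ler_pdivrMr//.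
    have := @rho_norm_bound _ _ M rho (fine (rho_norm M rho K phi)) K phi (m n) (x n) (v n) hM rho0.
    rewrite fineK// lexx => /(_ isT (Kx n) (@v1 n)); move/le_trans; apply.
    rewrite mulrAC mulrC ler_wpM2r//.
    by apply: fine_ge0; exact: rho_norm_ge0.
  move: key rB; case: (kd) => [key /(_ erefl)[rho Hr]|key _ rho rho0]; last exact: key.
  have rho0 : 0 < rho by rewrite -(Hr 0%N).
  exists rho => //; have [C HC] := key rho rho0 (fun _ => Hr).
  by exists C => phi H; apply: HC; exact: H.
Qed.

End JetSup.
End Coordinates.

Section EmbeddedBalls.
Context {R : realType} {Z : normedModType R}.
Local Notation EZ := (disk_space (@unit_disk R Z)).

Definition emb_ball (z0 : Z) (d : R) : set EZ := [set x | `|disk_incl x - z0| <= d].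

Lemma emb_ball_compact z0 d : 0 < d -> compact [set x : Z | `|x| <= 1] -> compact (emb_ball z0 d).
Proof.
move=> d0 cZ.
have -> : emb_ball z0 d = (fun z : Z => unit_emb (z0 + d *: z)) @` [set x : Z | `|x| <= 1].
  apply/seteqP; split=> x /=.
    move=> xd; exists (d^-1 *: (disk_incl x - z0)).
      by rewrite /= normrZ gtr0_norm ?invr_gt0// ler_pdivrMl// mulr1.
    by rewrite scalerA mulfV ?scale1r ?subrKC ?unit_inclK// gt_eqF.
  move=> [z z1 <-]; change (`|z0 + d *: z - z0| <= d).
  rewrite addrAC subrr add0r normrZ gtr0_norm//.
  by rewrite ler_piMr// ltW.
apply: continuous_compact => //; apply: continuous_subspaceT => z.
apply: (@continuous_comp _ _ _ (fun z => z0 + d *: z) unit_emb); last exact: unit_emb_continuous.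
by apply: cvgD; [exact: cvg_cst|exact: scaler_continuous].
Qed.

Lemma emb_ball_convex z0 d : convex_set (emb_ball z0 d).
Proof.
apply: convex_setI => x y t /andP[t0 t1]; rewrite /emb_ball /= => xd yd.
have -> : disk_incl (t *: x + (1 - t) *: y) - z0 =
   t *: (disk_incl x - z0) + (1 - t) *: (disk_incl y - z0).
  rewrite linearP linearZ /= !scalerBr addrACA -opprD -scalerDl.
  by rewrite [t + _]addrC subrK scale1r.
apply: le_trans (ler_normD _ _) _; rewrite !normrZ !ger0_norm ?subr_ge0//.
rewrite (_ : d = t * d + (1 - t) * d); last by ring.
by rewrite lerD// ler_wpM2l// subr_ge0.
Qed.

End EmbeddedBalls.

(** * Tangent vectors in coordinates *)

Section Tangents.
Context {R : realType} {kd : dc_kind} {M : nat -> R}.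
Hypotheses (hM : weight_sequence M) (hlc : log_convex M) (hmg : moderate_growth M).
Variable B : manifold kd M.
Local Notation n := (mdim B).
Implicit Types (i j : midx B) (b : B) (xi eta : tvector B).

Lemma mmap_inj i x x' : mdom i x -> mdom i x' -> mmap i x = mmap i x' -> x = x'.
Proof. by move=> ix ix' e; rewrite -(m_mapK ix) -(m_mapK ix') e. Qed.

Lemma chart_near i x (P : B -> Prop) : mdom i x ->
  (\forall y \near mmap i x, P (minv i y)) <-> (\forall x' \near x, P x').
Proof.
move=> ix; split=> H.
  have := m_map_continuous ix H; apply: filterS2 (open_nbhs_nbhs (conj (m_dom_open i) ix)).
  by move=> x' ix'; rewrite /= m_mapK.
have c := m_inv_continuous ix; rewrite /prop_for /continuous_at m_mapK// in c; exact: c H.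
Qed.

Lemma chart_image_open i (O : set B) : open O -> open (@mmap _ _ _ B i @` (mdom i `&` O)).
Proof.
move=> oO; rewrite openE => _ [x [ix Ox] <-]; rewrite /interior.
have h : \forall y \near mmap i x, O (minv i y).
  by apply/chart_near => //; exact: open_nbhs_nbhs.
have h2 : nbhs (mmap i x) (@mmap _ _ _ B i @` mdom i).
  by apply: open_nbhs_nbhs; split; [exact: m_cod_open|exists x].
apply: filterS2 h h2 => y Oy [x' ix' yE]; exists x' => //; split=> //.
by rewrite -yE m_mapK in Oy.
Qed.

Definition jac i j b : 'M[R]_n :=
  \matrix_(c, a) 'D_(delta_mx 0 c) (fun y => transition i j y 0 a : R^o) (mmap i b).

Lemma transition_smo i j a :
  smo (@mmap _ _ _ B i @` (mdom i `&` mdom j)) (fun y => transition i j y 0 a).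
Proof.
have oU : open (@mmap _ _ _ B i @` (mdom i `&` mdom j)) by exact: chart_image_open (m_dom_open j).
by have [H _] := CM_coords kd hM hlc hmg (transition i j) oU; case: (H (m_compatible i j) a).
Qed.

Lemma derive_transition i j b v : mdom i b -> mdom j b ->
  'D_v (transition i j) (mmap i b) = v *m jac i j b.
Proof.
move=> ib jb; have d a : differentiable (fun y => transition i j y 0 a : R^o) (mmap i b).
  by apply: (smo_differentiable (@transition_smo i j a)); exists b.
have dv : derivable (transition i j) (mmap i b) v.
  by apply/derivable_mxP => k a; rewrite ord1; apply: diff_derivable.
rewrite (derive_mx dv); apply/rowP => a; rewrite !mxE deriveE// (linear_row _ v).
by apply: eq_bigr => c _; rewrite mxE deriveE.
Qed.

(** With Jacobian matrices in place of derivatives of transitions, tangency is visibly linear in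
    [xi]. *)
Lemma tangentP b xi : is_tangent b xi <-> (forall i, ~ mdom i b -> xi i = 0) /\
  (forall i j, mdom i b -> mdom j b -> xi j = xi i *m jac i j b).
Proof.
by split=> -[H0 H]; split=> // i j ib jb; rewrite (H i j ib jb) derive_transition.
Qed.

Lemma tangent_lin b (c : R) xi eta : is_tangent b xi -> is_tangent b eta ->
  is_tangent b (c *: xi + eta).
Proof.
move=> /tangentP[x0 x1] /tangentP[e0 e1]; apply/tangentP; split=> [i ib|i j ib jb].
  by rewrite !fctE x0// e0// scaler0 addr0.
by rewrite !fctE (x1 i j)// (e1 i j)// mulmxDl scalemxAl.
Qed.

Lemma tangent0 b : is_tangent b (0 : tvector B).
Proof. by apply/tangentP; split=> [//|i j _ _]; exact: esym (mul0mx _ _). Qed.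

Lemma tangent_eq b i xi eta : is_tangent b xi -> is_tangent b eta -> mdom i b ->
  xi i = eta i -> xi = eta.
Proof.
move=> /tangentP[x0 x1] /tangentP[e0 e1] ib xe; apply/funext => j.
have [jb|jb] := pselect (mdom j b); last by rewrite x0// e0.
by rewrite (x1 i j)// (e1 i j)// xe.
Qed.

End Tangents.

(** * The space of sections and its seminorms *)

Section Sections.
Context {R : realType} {kd : dc_kind} {M : nat -> R}.
Hypotheses (hM : weight_sequence M) (hlc : log_convex M) (hmg : moderate_growth M).
Variables (A B : manifold kd M) (f : A -> B).
Hypothesis oTr : forall i j, open (triv_dom f i j).
Implicit Types (i : midx A) (j : midx B) (s t : A -> tvector B).
Local Notation Sec := (spanType (@CM_sections R kd M A B f)).

Definition lrep i j s (a : 'I_(mdim B)) (y : 'rV[R]_(mdim A)) : R := s (minv i y) j 0 a.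

Lemma sectionP s : CM_sections f s <-> (forall x, is_tangent (f x) (s x)) /\
  forall i j a, smo (triv_dom f i j) (lrep i j s a) /\ LCon kd M (triv_dom f i j) (lrep i j s a).
Proof.
split=> -[H0 H]; split=> // i j.
  by have [h _] := CM_coords kd hM hlc hmg (local_rep i j s) (@oTr i j); exact: h (H i j).
by have [_ h] := CM_coords kd hM hlc hmg (local_rep i j s) (@oTr i j); exact: h (H i j).
Qed.

Lemma section_lin (c : R) s t : CM_sections f s -> CM_sections f t ->
  CM_sections f (c *: s + t).
Proof.
move=> /sectionP[s0 s1] /sectionP[t0 t1]; apply/sectionP; split=> [x|i j a].
  exact: tangent_lin.
have [su sl] := s1 i j a; have [tu tl] := t1 i j a; have oU := @oTr i j.
have cu : smo (triv_dom f i j) (fun y => c * lrep i j s a y) by exact: smoZ.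
have -> : lrep i j (c *: s + t) a = (fun y => c * lrep i j s a y + lrep i j t a y).
  by apply/funext => y; rewrite /lrep !fctE !mxE.
split; first exact: smoD.
move=> y Uy; apply: (LC_D hM oU Uy) => //; last exact: tl.
apply: (LC_M hM hlc oU Uy) => //; [exact: smo_cst|exact: LC_cst|exact: sl].
Qed.

Lemma section0 : CM_sections f 0.
Proof.
apply/sectionP; split=> [x|i j a]; first exact: tangent0.
have -> : lrep i j 0 a = fun=> 0 by apply/funext => y; rewrite /lrep mxE.
by split; [exact: smo_cst|move=> y _; exact: LC_cst].
Qed.

Lemma span_section (s : Sec) : CM_sections f (span_val s).
Proof.
case: s => s /= /asboolP[ps psP ->].
elim: ps psP => [|p ps ih] psP; first by rewrite big_nil; exact: section0.
rewrite big_cons; apply: section_lin; first by apply: psP; rewrite mem_head.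
by apply: ih => q qs; apply: psP; rewrite inE qs orbT.
Qed.

Lemma section_span s : CM_sections f s -> s \in lspan (@CM_sections R kd M A B f).
Proof.
move=> H; apply/asboolP; exists [:: (1, s)]; last by rewrite big_seq1 scale1r.
by move=> p; rewrite inE => /eqP ->.
Qed.

Definition mk_section s (H : CM_sections f s) : Sec := Span (section_span H).

Definition sbound (K : set 'rV[R]_(mdim A)) i j (rho C : R) (s : A -> tvector B) :=
  forall a, dbound M K uball (lrep i j s a) rho C.

(** A functional on row vectors is a combination of coordinates, and the inclusion of a disk, of
    norm at most [c], only rescales [rho]: every defining seminorm is controlled by estimates of
    coordinates on one compact set. *)
Lemma section_seminorm_bound p : section_seminorms (f := f) p -> exists i j (K : set 'rV[R]_(mdim A)),
  [/\ compact K, K `<=` triv_dom f i j & kdd kd (fun rho C => forall (s : Sec) c, 0 < c ->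
    sbound K i j rho c (span_val s) -> p s <= C * c)].
Proof.
move=> [i [j [q [[l [D [K [q' [cl [cK xK KU] [_ _ Hq'] qE]]]]] pE]]]]; exists i, j.
have cI := @disk_incl_continuous R _ D.
exists ((@disk_incl R _ D) @` K); split.
- by apply: continuous_compact => //; exact: continuous_subspaceT.
- by move=> _ [x Kx <-]; exact: KU.
have [c c0 cP] := disk_incl_bounded D.
pose L := \sum_(a < mdim B) `|l (delta_mx 0 a)| + 1.
have L0 : 0 < L by rewrite ltr_wpDl// sumr_ge0.
have oU := @oTr i j.
pose h (s : Sec) (x : 'rV[R]_(mdim A)) : R := l (local_rep i j (span_val s) x).
have hE (s : Sec) : h s = (fun x => \sum_(a < mdim B) lrep i j (span_val s) a x * l (delta_mx 0 a)).
  by apply/funext => x; rewrite /h linear_row.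
have sU (s : Sec) a : smo (triv_dom f i j) (lrep i j (span_val s) a).
  by have /sectionP[_ /(_ i j a)[]] := span_section s.
have sL (s : Sec) a : LCon kd M (triv_dom f i j) (lrep i j (span_val s) a).
  by have /sectionP[_ /(_ i j a)[]] := span_section s.
have cU (s : Sec) a : smo (triv_dom f i j) (fun x => lrep i j (span_val s) a x * l (delta_mx 0 a)).
  by apply: smoM => //; exact: smo_cst.
have hU (s : Sec) : smo (triv_dom f i j) (h s) by rewrite hE; exact: smo_sum.
have hL (s : Sec) : LCon kd M (triv_dom f i j) (h s).
  move=> x Ux; rewrite hE; apply: (LC_sum hM oU Ux (cU s)) => a.
  by apply: (LC_M hM hlc oU Ux) => //; [exact: smo_cst|exact: sL|exact: LC_cst].
have oV : open (@disk_incl R _ D @^-1` triv_dom f i j).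
  by apply: open_comp => // x _; exact: cI.
have bound (s : Sec) (rho C : R) : 0 < rho -> 0 < C ->
    sbound (@disk_incl R _ D @` K) i j (c^-1 * rho) C (span_val s) ->
    forall x vs, K x -> inV uball vs ->
    `|dird (fun x => h s (disk_incl x)) vs x| <= L * C * wgt M rho (size vs).
  move=> r0 C0 HC x vs Kx v1.
  rewrite (@dird_affine _ _ _ _ (@disk_incl R _ D) (@disk_incl R _ D)); last first.
    by move=> a v y; rewrite linearP.
  have Ux : triv_dom f i j (disk_incl x) by exact: KU.
  rewrite hE (dird_sum _ oU (cU s) Ux) -mulrA mulrDl mul1r mulr_suml.
  apply: (@le_trans _ _ (\sum_(a < mdim B) `|l (delta_mx 0 a)| * (C * wgt M rho (size vs)))); last first.
    by rewrite lerDl mulr_ge0 ?(ltW C0)// ltW// wgt_gt0.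
  apply: le_trans (ler_norm_sum _ _ _) _; apply: ler_sum => a _.
  have -> : dird (fun x => lrep i j (span_val s) a x * l (delta_mx 0 a)) (map (@disk_incl R _ D) vs) (disk_incl x) =
      l (delta_mx 0 a) * dird (lrep i j (span_val s) a) (map (@disk_incl R _ D) vs) (disk_incl x).
    rewrite -(dirdZ _ _ oU (sU s a) Ux); congr (dird _ _ _).
    by apply/funext => y; rewrite mulrC.
  rewrite normrM ler_wpM2l//.
  have -> : map (@disk_incl R _ D) vs = [seq c *: u | u <- [seq c^-1 *: disk_incl v | v <- vs]].
    by rewrite -map_comp; apply: eq_map => v /=; rewrite scalerA mulfV ?scale1r// gt_eqF.
  rewrite (dird_homogs c _ oU (sU s a) Ux) normrM ger0_norm ?exprn_ge0 ?(ltW c0)// size_map.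
  have := HC a (disk_incl x) [seq c^-1 *: disk_incl v | v <- vs].
  have h1 : (@disk_incl R _ D @` K) (disk_incl x) by exists x.
  have h2 : inV uball [seq c^-1 *: disk_incl v | v <- vs].
    move=> _ /mapP[v /v1 /= vu ->]; rewrite /uball /= normrZ gtr0_norm ?invr_gt0//.
    by rewrite ler_pdivrMl// mulr1 (le_trans (cP v))// ler_piMr// ltW.
  move=> /(_ h1 h2); rewrite size_map wgt_scale => H.
  have cm : 0 < c ^+ size vs by exact: exprn_gt0.
  rewrite -ler_pdivlMl// (le_trans H)// mulrCA exprVn; exact: lexx.
have pq (s : Sec) : p s = q' (jet_of (fun x => h s (@disk_incl R _ D x))) by rewrite pE qE.
have [gU gL] : (forall s : Sec, smo (@disk_incl R _ D @^-1` triv_dom f i j) (fun x => h s (disk_incl x))) /\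
    (forall s : Sec, LCon kd M (@disk_incl R _ D @^-1` triv_dom f i j) (fun x => h s (disk_incl x))).
  by split=> s; have [] := incl_germ hM hlc D oU (hU s) (@hL s).
have fin (rho : R) (C0 : R) : 0 < rho ->
    (forall s : Sec, C_rho M rho K (jet_of (fun x => h s (@disk_incl R _ D x))) ->
      ((p s)%:E <= C0%:E * rho_norm M rho K (jet_of (fun x => h s (@disk_incl R _ D x))))%E) ->
    exists2 C, 0 < C & forall (s : Sec) c0, 0 < c0 ->
      sbound (@disk_incl R _ D @` K) i j (c^-1 * rho) c0 (span_val s) -> p s <= C * c0.
  move=> r0 H; exists ((`|C0| + 1) * L); first by rewrite mulr_gt0// ltr_wpDl.
  move=> s c1 c10 Hs; have LC0 : 0 <= L * c1 by rewrite mulr_ge0// ltW.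
  have b := bound s rho c1 r0 c10 Hs.
  have Cr := C_rho_jet hM oV (gU s) (LC_locbd (@gL s)) KU xK r0 LC0 b.
  have nr := rho_norm_jet hM oV (gU s) KU xK r0 LC0 b.
  rewrite -lee_fin; apply: le_trans (H s Cr) _.
  have n0 : (0 <= rho_norm M rho K (jet_of (fun x => h s (@disk_incl R _ D x))))%E by exact: rho_norm_ge0.
  apply: (@le_trans _ _ ((`|C0| + 1)%:E * rho_norm M rho K (jet_of (fun x => h s (@disk_incl R _ D x))))%E).
    apply: lee_wpmul2r => //; rewrite lee_fin (le_trans (ler_norm _))// lerDl//.
  apply: le_trans (lee_wpmul2l _ nr) _; first by rewrite lee_fin addr_ge0.
  by rewrite -EFinM lee_fin mulrA.
have ci : 0 < c^-1 by rewrite invr_gt0.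
have [[e [rho r0 [C0 HC0]]]|[e H]] := kd_case Hq'.
  apply: (kddB e); exists (c^-1 * rho); first exact: mulr_gt0.
  apply: (fin rho C0) => // s _; rewrite pq; apply: HC0; rewrite -e.
  exact: (CM_jet_of hM oV (gU s) (@gL s) cK xK KU).
apply: (kddR e) => rho r0; have r1 : 0 < c * rho by exact: mulr_gt0.
have [C0 HC0] := H _ r1.
have [s Cs|C C1 HC] := fin (c * rho) C0 r1; first by rewrite pq; exact: HC0.
by exists C => // s c1 c10 Hs; apply: HC => //; rewrite mulKf// gt_eqF.
Qed.

Lemma span_valD (x y : Sec) : span_val (x + y) = span_val x + span_val y.
Proof. by []. Qed.

Lemma span_valZ (c : R) (x : Sec) : span_val (c *: x) = c *: span_val x.
Proof. by []. Qed.

Lemma lrepD i j s t a y : lrep i j (s + t) a y = lrep i j s a y + lrep i j t a y.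
Proof. by rewrite /lrep !fctE mxE. Qed.

Lemma lrepZ i j c s a y : lrep i j (c *: s) a y = c * lrep i j s a y.
Proof. by rewrite /lrep !fctE mxE. Qed.

(** [jsup] becomes a defining seminorm of the section space when the disk is the unit ball and the
    functional a coordinate. *)
Lemma section_jsup i j (a : 'I_(mdim B)) y0 (d : R) (m : nat -> nat)
    (x : nat -> disk_space (@unit_disk R 'rV[R]_(mdim A)))
    (v : forall n, (m n).-tuple (disk_space (@unit_disk R 'rV[R]_(mdim A)))) (r : nat -> R) :
  [set y | `|y - y0| <= d] `<=` triv_dom f i j -> 0 < d ->
  (forall n, emb_ball y0 d (x n)) -> (forall n, inV uball (v n)) -> (forall n, 0 < r n) ->
  (kd = Beurling -> exists rho, forall n, r n = rho) -> (kd = Roumieu -> forall n, r n = n.+1%:R) ->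
  exists p : Sec -> R, [/\ section_seminorms (f := f) p, seminorm p & forall (s : Sec) n,
    `|dird (lrep i j (span_val s) a) (map (@disk_incl R _ _) (v n)) (disk_incl (x n))| / wgt M (r n) (m n) <= p s].
Proof.
move=> WU d0 Kx v1 r0 rB rR; have oU := @oTr i j.
have sU (s : Sec) b : smo (triv_dom f i j) (lrep i j (span_val s) b).
  by have /sectionP[_ /(_ i j b)[]] := span_section s.
have sL (s : Sec) b : LCon kd M (triv_dom f i j) (lrep i j (span_val s) b).
  by have /sectionP[_ /(_ i j b)[]] := span_section s.
pose E := disk_space (@unit_disk R 'rV[R]_(mdim A)).
pose K : set E := emb_ball y0 d.
have cK : compact K by apply: emb_ball_compact => //; exact: compact_unit_row.
have xK : convex_set K by exact: emb_ball_convex.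
have KU : K `<=` @disk_incl R _ (@unit_disk R _) @^-1` triv_dom f i j by move=> z Kz; exact: WU.
pose l := @row_coord R (mdim B) a.
pose J (s : Sec) : jet := jet_of (l \o local_rep i j (span_val s) \o @disk_incl R _ (@unit_disk R 'rV[R]_(mdim A))).
have oV : open (@disk_incl R _ (@unit_disk R _) @^-1` triv_dom f i j).
  by apply: open_comp => // z _; exact: disk_incl_continuous.
have CJ (s : Sec) : CM_jet kd M K (J s).
  have [gU gL] := incl_germ hM hlc (@unit_disk R _) oU (sU s a) (@sL s a).
  exact: (CM_jet_of hM oV gU gL cK xK KU).
pose p (s : Sec) := jsup M x v r (J s).
have pP : section_seminorms (f := f) p.
  exists i, j, (fun h => jsup M x v r (jet_of (l \o h \o @disk_incl R _ (@unit_disk R 'rV[R]_(mdim A))))).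
  split=> //; exists (@row_coord R (mdim B) a), (@unit_disk R _), K, (jsup M x v r); split=> //.
  - exact: row_coord_continuous.
  - exact: jsup_seminorm.
have JE (s : Sec) k z (w : k.-tuple E) : J s k z w = dird (lrep i j (span_val s) a) (map (@disk_incl R _ _) w) (disk_incl z).
  rewrite /J /jet_of -/(dird _ _ _).
  by rewrite (@dird_affine _ _ _ (lrep i j (span_val s) a) (@disk_incl R _ _) (@disk_incl R _ _))// => b w' z'; rewrite linearP.
have ps : seminorm p.
  have [qD qZ _] := jsup_seminorm hM Kx v1 r0 rB rR.
  split=> [s s'|c s].
    apply: le_trans (qD _ _ (CJ s) (CJ s')); rewrite /p le_eqVlt; apply/orP; left; apply/eqP.
    apply: eq_jsup => n; rewrite !JE -(dirdD _ oU (sU s a) (sU s' a)); last exact: (KU _ (Kx n)).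
    by congr (dird _ _ _); apply/funext => y; rewrite span_valD lrepD.
  rewrite /p -(qZ _ _ (CJ s)); apply: eq_jsup => n; rewrite !JE -(dirdZ _ _ oU (sU s a)); last exact: (KU _ (Kx n)).
  by congr (dird _ _ _); apply/funext => y; rewrite span_valZ lrepZ.
exists p; split=> // s n; rewrite -JE; exact: (jsup_ge hM Kx v1 r0 rB rR n (CJ s)).
Qed.

(* Regularity of the inductive limit: a bounded set of sections satisfies
   uniform estimates. *)
Lemma section_regular (S : set Sec) i j y0 : triv_dom f i j y0 ->
  (forall p, section_seminorms (f := f) p -> seminorm p -> exists Bp, forall s : Sec, S s -> p s <= Bp) ->
  exists2 W, nbhs y0 W & kdq kd (fun rho C => forall s : Sec, S s -> sbound W i j rho C (span_val s)).
Proof.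
move=> Uy0 HS; have oU := @oTr i j; have [d d0 dU] := near_dist (near_open oU Uy0).
have d2 : 0 < d / 2 by rewrite divr_gt0.
pose W := [set y : 'rV[R]_(mdim A) | `|y - y0| <= d / 2].
have WU : W `<=` triv_dom f i j.
  by move=> y yd; apply: dU; apply: le_lt_trans yd _; rewrite ltr_pdivrMr// ltr_pMr// ltr1n.
exists W; first by apply: (@dist_near R _ y0 (d / 2) W) => // y /ltW.
have upw (a : 'I_(mdim B)) : upward (fun rho C => forall s : Sec, S s -> dbound M W uball (lrep i j (span_val s) a) rho C).
  by move=> rho rho' C C' r0 rr C0 CC H s Ss; apply: (upward_dbound hM r0 rr C0 CC); exact: H.
have sU (s : Sec) a : smo (triv_dom f i j) (lrep i j (span_val s) a).
  by have /sectionP[_ /(_ i j a)[]] := span_section s.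
have sL (s : Sec) a : LCon kd M (triv_dom f i j) (lrep i j (span_val s) a).
  by have /sectionP[_ /(_ i j a)[]] := span_section s.
suff Ha (a : 'I_(mdim B)) : kdq kd (fun rho C => forall s : Sec, S s -> dbound M W uball (lrep i j (span_val s) a) rho C).
  apply: kdq_imp (kdq_all upw Ha) => rho C r0 C0 H; exists C => // s Ss a; exact: H.
apply: contrapT => nk.
(* The estimates fail at every rank [n] with constant n + 1, at a fixed radius in the Beurling case
   and at radius n + 1 in the Roumieu case. The [jsup] of the witnesses will exceed any bound on
   [S]. *)
have [r [r0 rB rR] nr] : exists2 r : nat -> R, [/\ forall n, 0 < r n,
    kd = Beurling -> exists rho, forall n, r n = rho & kd = Roumieu -> forall n, r n = n.+1%:R] &
    forall n, ~ (forall s : Sec, S s -> dbound M W uball (lrep i j (span_val s) a) (r n) n.+1%:R).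
  have [[e [rho [rho0 H]]]|[e H]] := not_kdq nk.
    exists (fun=> rho); last by move=> n; apply: H; rewrite ltr0n.
    by split=> //; [exists rho|rewrite e].
  exists (fun n => n.+1%:R); last by move=> n; apply: H; rewrite ltr0n.
  by split=> //; rewrite e.
have ex n : exists t : Sec * 'rV[R]_(mdim A) * seq 'rV[R]_(mdim A), [/\ S t.1.1, W t.1.2, inV uball t.2 &
    n.+1%:R * wgt M (r n) (size t.2) < `|dird (lrep i j (span_val t.1.1) a) t.2 t.1.2|].
  apply: contrapT => /forallNP H; apply: (nr n) => s Ss y vs Wy v1.
  rewrite leNgt; apply/negP => lt; apply: (H (s, y, vs)); split=> //.
have [t tP] := choice ex.
pose E := disk_space (@unit_disk R 'rV[R]_(mdim A)).
pose m n := size (t n).2; pose x n : E := unit_emb (t n).1.2.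
pose v n : (m n).-tuple E := map_tuple unit_emb (in_tuple (t n).2).
pose K : set E := emb_ball y0 (d / 2).
have Kx n : K (x n) by have [_ Wt _ _] := tP n.
have v1 n : inV uball (v n).
  have [_ _ u1 _] := tP n; move=> _ /mapP[w /u1 wu ->].
  by rewrite /uball /= unit_emb_norm.
have [p [pP ps pge]] := section_jsup a WU d2 (v := v) Kx v1 r0 rB rR.
have [Bp HB] := HS p pP ps.
pose N := Num.bound `|Bp|.
have [St _ _ lt] := tP N.
have := le_trans (pge (t N).1.1 N) (HB _ St).
rewrite /= -map_comp (eq_map (g := id)) ?map_id//.
rewrite leNgt => /negP; apply.
rewrite ltr_pdivlMr ?wgt_gt0//; apply: le_lt_trans lt.
apply: ler_wpM2r; first exact/ltW/wgt_gt0.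
apply: le_trans (ler_norm _) _; apply/ltW; apply: lt_le_trans (archi_boundP (normr_ge0 _)) _.
by rewrite ler_nat.
Qed.

End Sections.

(** * Families of maps between manifolds *)

Lemma continuous_pair {Z Y1 Y2 : topologicalType} (f : Z -> Y1) (g : Z -> Y2) z :
  {for z, continuous f} -> {for z, continuous g} -> {for z, continuous (fun p => (f p, g p))}.
Proof. by move=> cf cg; exact: cvg_pair. Qed.

Section PairGerms.
Context {R : realType} (kd : dc_kind) (M : nat -> R).
Hypotheses (hM : weight_sequence M) (hlc : log_convex M) (hmg : moderate_growth M).
Context {X : normedModType R} (D V : set X).

Lemma GG_differentiable z f : GG kd M D V z f -> differentiable f z.
Proof. by move=> [U [oU Uz fU _]]; exact: smo_differentiable fU Uz. Qed.

Lemma row_continuous n (u : 'I_n -> X -> R) z : (forall a, GG kd M D V z (u a)) ->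
  {for z, continuous (fun p => \row_a u a p)}.
Proof.
move=> Hu.
have E : (fun p => \row_a u a p) = fsum (\0 : X -> 'rV[R]_n) u (fun a => delta_mx 0 a).
  apply/funext => p; rewrite /fsum add0r [LHS]row_sum_delta.
  by apply: eq_bigr => a _; rewrite mxE.
rewrite E; apply: fsum_continuous => [|a]; first exact: cst_continuous.
exact: GG_differentiable (Hu a).
Qed.

Definition pair_coord2 n m (a : 'I_m) (p : 'rV[R]_n * 'rV[R]_m) : R^o := p.2 0 a.
Lemma pair_coord2_linear n m a : linear (@pair_coord2 n m a).
Proof. by move=> c x y; rewrite /pair_coord2 !mxE. Qed.
HB.instance Definition _ n m a := GRing.isLinear.Build R ('rV[R]_n * 'rV[R]_m)%type R^o *:%R
  (@pair_coord2 n m a) (@pair_coord2_linear n m a).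
Lemma pair_coord2_continuous n m a : continuous (@pair_coord2 n m a).
Proof.
move=> p; apply: (@continuous_comp _ _ _ snd (@row_coord R m a)); first exact: cvg_snd.
exact: row_coord_continuous.
Qed.

Lemma GG_pair n m (u : 'I_n -> X -> R) (w : 'I_m -> X -> R) (g : 'rV[R]_n * 'rV[R]_m -> R) z :
  (forall a, GG kd M D V z (u a)) -> (forall a, GG kd M D V z (w a)) ->
  GG kd M [set 0] uball (\row_a u a z, \row_a w a z) g ->
  GG kd M D V z (fun p => g (\row_a u a p, \row_a w a p)).
Proof.
move=> Hu Hw Hg.
pose h (i : 'I_(n + m)) (p : X) : R := match fintype.split i with inl a => u a p | inr b => w b p end.
pose zz (i : 'I_(n + m)) : 'rV[R]_n * 'rV[R]_m :=
  match fintype.split i with inl a => (delta_mx 0 a, 0) | inr b => (0, delta_mx 0 b) end.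
have E p : \sum_i h i p *: zz i = (\row_a u a p, \row_a w a p).
  rewrite big_split_ord /=.
  have -> : \sum_(a < n) h (lshift m a) p *: zz (lshift m a) = (\row_a u a p, 0).
    rewrite [LHS]surjective_pairing; apply/eqP; rewrite xpair_eqE; apply/andP; split; apply/eqP.
      rewrite (big_morph fst (id1 := 0) (op1 := +%R))// [RHS]row_sum_delta.
      by apply: eq_bigr => a _; rewrite /h /zz (unsplitK (inl a : 'I_n + 'I_m)) mxE.
    rewrite (big_morph snd (id1 := 0) (op1 := +%R))// big1// => a _.
    by rewrite /h /zz (unsplitK (inl a : 'I_n + 'I_m)) /= scaler0.
  have -> : \sum_(a < m) h (rshift n a) p *: zz (rshift n a) = (0, \row_a w a p).
    rewrite [LHS]surjective_pairing; apply/eqP; rewrite xpair_eqE; apply/andP; split; apply/eqP.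
      rewrite (big_morph fst (id1 := 0) (op1 := +%R))// big1// => a _.
      by rewrite /h /zz (unsplitK (inr a : 'I_n + 'I_m)) /= scaler0.
    rewrite (big_morph snd (id1 := 0) (op1 := +%R))// [RHS]row_sum_delta.
    by apply: eq_bigr => a _; rewrite /h /zz (unsplitK (inr a : 'I_n + 'I_m)) mxE.
  by apply/eqP; rewrite xpair_eqE /= addr0 add0r !eqxx.
have := @GG_static R kd M hM hlc hmg X _ D V (n + m) h zz g z.
rewrite E => H; apply: eq_GG (H _ _ Hg); first by near=> p; rewrite E.
  by move=> i; rewrite /h; case: (fintype.split i) => a.
move=> i; rewrite /zz; case: (fintype.split i) => a; rewrite /uball /= prod_normE ge_max /= normr0 ler01 ?andbT//=;
  exact: uball_delta.
Unshelve. all: by end_near.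
Qed.

End PairGerms.

Section GoodMaps.
Context {R : realType} {kd : dc_kind} {M : nat -> R}.
Hypotheses (hM : weight_sequence M) (hlc : log_convex M) (hmg : moderate_growth M).
Context {T : normedModType R} (Dt Vt : set T).

Local Notation GGT A := (@GG R kd M (T * 'rV[R]_(mdim A))%type (axisD Dt) (axisV Vt)).

(** The first clause is continuity into the target chart; without it the coordinates in the second
    clause would not describe [G] near the point. *)
Definition goodmap (A B : manifold kd M) (G : T -> A -> B) t0 x0 :=
  forall i j, mdom i x0 -> mdom j (G t0 x0) ->
  (\forall p \near (t0, mmap i x0), mdom j (G p.1 (minv i p.2))) /\
  forall a, GGT A (t0, mmap i x0) (fun p => mmap j (G p.1 (minv i p.2)) 0 a).

Definition goodsec (A B : manifold kd M) (f : A -> B) (s : T -> A -> tvector B) t0 x0 :=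
  forall i j, mdom i x0 -> mdom j (f x0) ->
  forall a, GGT A (t0, mmap i x0) (fun p => s p.1 (minv i p.2) j 0 a).

Lemma near_snd {Y : normedModType R} (t0 : T) (y0 : Y) (P : Y -> Prop) :
  (\forall y \near y0, P y) -> \forall p \near (t0, y0), P p.2.
Proof. by move=> H; exact: (@cvg_snd _ _ (nbhs t0) (nbhs y0) _ P H). Qed.

Lemma is_CM_open (A B : manifold kd M) (f : A -> B) i j : is_CM f -> open (triv_dom f i j).
Proof.
move=> [_ H]; have [oD _] := H i j; have := cinf_open_normed oD.
by rewrite /triv_dom /= setTI.
Qed.

Lemma goodmap_const (A B : manifold kd M) (f : A -> B) t0 x0 : is_CM f ->
  goodmap (fun _ => f) t0 x0.
Proof.
move=> fCM i j ix jx; have oD := @is_CM_open A B f i j fCM.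
have [_ H] := fCM; have [_ [phi CMphi phiE]] := H i j.
have DE : [set: A] `&` mdom i `&` f @^-1` mdom j = mdom i `&` f @^-1` mdom j by rewrite setTI.
rewrite /= DE in CMphi phiE.
have near_D : \forall y \near mmap i x0, triv_dom f i j y.
  by apply: near_open => //; exists x0.
have yE y : triv_dom f i j y -> mdom i (minv i y) /\ mdom j (f (minv i y)) /\ mmap i (minv i y) = y.
  by move=> [x [ix' jx'] <-]; rewrite m_mapK.
split; first by apply: (near_snd t0 (P := fun y => mdom j (f (minv i y)))); apply: filterS near_D => y /yE[_ []].
move=> a.
have G := CM_germ hM hlc hmg (@compact_unit_row R (mdim A)) oD CMphi (@row_coord_continuous R _ a)
  (nbhs_singleton near_D).
have := @GG_snd R kd M hM hlc hmg T _ Dt Vt _ (t0, mmap i x0) G.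
apply: eq_GG; apply: (near_snd t0 (P := fun y => row_coord a (phi y) = mmap j (f (minv i y)) 0 a)).
apply: filterS near_D => y /yE[iy [jy yK]].
by rewrite /= /row_coord -{1}yK phiE.
Qed.

(** In a chart around the intermediate point this is [GG_row], with the coordinates of [G]
    substituted and the parameter shared. *)
Lemma goodmap_comp (A B C : manifold kd M) (G : T -> A -> B) (H : T -> B -> C) t0 x0 :
  goodmap G t0 x0 -> goodmap H t0 (G t0 x0) -> goodmap (fun t x => H t (G t x)) t0 x0.
Proof.
move=> gG gH i k ix kx; have [j jx] := m_cover (G t0 x0).
have [nG GG1] := gG i j ix jx; have [nH GG2] := gH j k jx kx.
have rE : \row_a mmap j (G t0 (minv i (mmap i x0))) 0 a = mmap j (G t0 x0).
  by apply/rowP => a; rewrite mxE m_mapK.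
have cF := row_continuous GG1.
have rEp (p : T * 'rV[R]_(mdim A)) : \row_a mmap j (G p.1 (minv i p.2)) 0 a = mmap j (G p.1 (minv i p.2)).
  by apply/rowP => a; rewrite mxE.
have c2 : {for (t0, mmap i x0), continuous (fun p : T * 'rV[R]_(mdim A) =>
    (p.1, mmap j (G p.1 (minv i p.2))))}.
  apply: continuous_pair; first exact: cvg_fst.
  by move: cF; rewrite /prop_for /continuous_at /= (funext rEp) rE m_mapK.
have nF : \forall p \near (t0, mmap i x0), mdom k (H p.1 (minv j (mmap j (G p.1 (minv i p.2))))).
  by rewrite /prop_for /continuous_at /= m_mapK// in c2; exact: c2 _ nH.
split; first by apply: filterS2 nG nF => p jG; rewrite m_mapK.
move=> a; have := @GG_row R kd M hM hlc hmg T _ Dt Vt _ (fun b p => mmap j (G p.1 (minv i p.2)) 0 b)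
  (fun q => mmap k (H q.1 (minv j q.2)) 0 a) (t0, mmap i x0) GG1.
rewrite rE => /(_ (GG2 a)); apply: eq_GG; apply: filterS nG => p jG.
have -> : \row_b mmap j (G p.1 (minv i p.2)) 0 b = mmap j (G p.1 (minv i p.2)) by apply/rowP => b; rewrite mxE.
by rewrite /= m_mapK.
Qed.

(** * The exponential mapping and its inverse on families *)

Section Exponential.
Variables (A B : manifold kd M) (g : metric B) (e : local_exp g).

Let TB := crestrict (exp_dom e).
Let BB := @crestrict R (cprod (charted_of B) (charted_of B)) (exp_rng e).

(** The exponential acts on finitely many coordinates of base point and vector, and [t] enters only
    through them: this is [GG_pair]. *)
Lemma goodmap_exp (f : A -> B) (s : T -> A -> tvector B) t0 x0 :
  goodmap (fun _ => f) t0 x0 -> goodsec f s t0 x0 -> (forall t x, is_tangent (f x) (s t x)) ->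
  exp_dom e (f x0, s t0 x0) ->
  (forall i, mdom i x0 -> \forall p \near (t0, mmap i x0), exp_dom e (f (minv i p.2), s p.1 (minv i p.2))) /\
  goodmap (fun t x => rexp e (f x, s t x)) t0 x0.
Proof.
move=> gf gs stan ed; have [inv_exp [[H1 H2] _ _]] := exp_diffeo e.
have key i j k : mdom i x0 -> mdom j (f x0) -> mdom k (rexp e (f x0, s t0 x0)) ->
  (\forall p \near (t0, mmap i x0), exp_dom e (f (minv i p.2), s p.1 (minv i p.2)) /\
     mdom k (rexp e (f (minv i p.2), s p.1 (minv i p.2)))) /\
  forall a, GGT A (t0, mmap i x0) (fun p => mmap k (rexp e (f (minv i p.2), s p.1 (minv i p.2))) 0 a).
  move=> ix jx kx; have /= [oD [phi CMphi phiE]] := H2 j (j, k).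
  set D := (X in cmap TB j @` X) in oD CMphi phiE.
  have {}oD := @cinf_open_normed R ('rV[R]_(mdim B) * 'rV[R]_(mdim B))%type _ oD.
  have [nf Gf] := gf i j ix jx; have Gs := gs i j ix jx.
  pose F (p : T * 'rV[R]_(mdim A)) := (\row_a mmap j (f (minv i p.2)) 0 a, \row_a s p.1 (minv i p.2) j 0 a).
  have FE p : F p = (mmap j (f (minv i p.2)), s p.1 (minv i p.2) j).
    by congr (_, _); apply/rowP => a; rewrite mxE.
  have F0 : (cmap TB j @` D) (F (t0, mmap i x0)).
    exists (f x0, s t0 x0); last by rewrite FE /= m_mapK.
    by split=> //; split=> //; split=> //; exact: stan.
  (* The image of [D] is open, so nearby coordinates are those of some point of [D]; injectivity of
     the chart on tangent vectors identifies that point. *)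
  have nD : \forall p \near (t0, mmap i x0), D (f (minv i p.2), s p.1 (minv i p.2)).
    have cF : F @ (t0, mmap i x0) --> F (t0, mmap i x0).
      by apply: continuous_pair; [exact: (row_continuous Gf)|exact: (row_continuous Gs)].
    have := cF _ (near_open oD F0); apply: filterS2 nf => p jf [[b xi] Dbx].
    rewrite FE => -[be xie]; have [[[/= tb _] /= jb] _] := Dbx.
    have bE := mmap_inj jb jf be; subst b.
    by rewrite -(tangent_eq hM hlc hmg tb (stan _ _) jb xie).
  split; first by apply: filterS nD => p [[[_ ?] _] [_ ?]].
  move=> a.
  have G := @CM_germ R kd M hM hlc hmg ('rV[R]_(mdim B) * 'rV[R]_(mdim B))%type _ _ phi (@pair_coord2 R _ _ a) _
    (compact_unit_prod (@compact_unit_row R _) (@compact_unit_row R _)) oD CMphi (@pair_coord2_continuous R _ _ a) F0.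
  have := @GG_pair R kd M hM hlc hmg _ _ _ _ _ _ _ _ (t0, mmap i x0) Gf Gs G.
  apply: eq_GG; apply: filterS nD => p Dp; rewrite -/(F p) FE.
  by have := phiE _ Dp; rewrite /= => ->.
have [j jx] := m_cover (f x0); have [k kx] := m_cover (rexp e (f x0, s t0 x0)).
split=> [i ix|i k' ix kx'].
  by have [+ _] := key i j k ix jx kx; apply: filterS => p [].
by have [n G] := key i j k' ix jx kx'; split=> //; apply: filterS n => p [].
Qed.

Lemma goodsec_inv_exp (h : A -> B) (G : T -> A -> B) inv_exp t0 x0 :
  @CM_map R kd M BB TB inv_exp ->
  (forall p, exp_dom e p -> inv_exp (p.1, rexp e p) = p) ->
  goodmap (fun _ => h) t0 x0 -> goodmap G t0 x0 -> exp_rng e (h x0, G t0 x0) ->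
  (forall i, mdom i x0 -> \forall p \near (t0, mmap i x0), exp_rng e (h (minv i p.2), G p.1 (minv i p.2))) /\
  goodsec h (fun t x => (inv_exp (h x, G t x)).2) t0 x0.
Proof.
move=> [H1 H2] HK gh gG er.
have rngK q : exp_rng e q -> (inv_exp q).1 = q.1.
  by move=> [p pd <-]; rewrite HK.
have key i j k : mdom i x0 -> mdom j (h x0) -> mdom k (G t0 x0) ->
  (\forall p \near (t0, mmap i x0), exp_rng e (h (minv i p.2), G p.1 (minv i p.2))) /\
  forall a, GGT A (t0, mmap i x0) (fun p => (inv_exp (h (minv i p.2), G p.1 (minv i p.2))).2 j 0 a).
  move=> ix jx kx; have /= [oD [phi CMphi phiE]] := H2 (j, k) j.
  set D := (X in cmap BB (j, k) @` X) in oD CMphi phiE.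
  have {}oD := @cinf_open_normed R ('rV[R]_(mdim B) * 'rV[R]_(mdim B))%type _ oD.
  have [nh Gh] := gh i j ix jx; have [nG GG'] := gG i k ix kx.
  pose F (p : T * 'rV[R]_(mdim A)) := (\row_a mmap j (h (minv i p.2)) 0 a, \row_a mmap k (G p.1 (minv i p.2)) 0 a).
  have FE p : F p = (mmap j (h (minv i p.2)), mmap k (G p.1 (minv i p.2))).
    by congr (_, _); apply/rowP => a; rewrite mxE.
  have F0 : (cmap BB (j, k) @` D) (F (t0, mmap i x0)).
    exists (h x0, G t0 x0); last by rewrite FE /= m_mapK.
    by split=> //=; rewrite rngK.
  have nD : \forall p \near (t0, mmap i x0), D (h (minv i p.2), G p.1 (minv i p.2)).
    have cF : F @ (t0, mmap i x0) --> F (t0, mmap i x0).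
      by apply: continuous_pair; [exact: (row_continuous Gh)|exact: (row_continuous GG')].
    have := cF _ (near_open oD F0); apply: filterS3 nh nG => p jh kG [[b b'] Db].
    rewrite FE => -[be be']; have [[_ [/= jb kb]] _] := Db.
    by rewrite -(mmap_inj jb jh be) -(mmap_inj kb kG be').
  split; first by apply: filterS nD => p [[[_ ?] _] _].
  move=> a.
  have G' := @CM_germ R kd M hM hlc hmg ('rV[R]_(mdim B) * 'rV[R]_(mdim B))%type _ _ phi (@pair_coord2 R _ _ a) _
    (compact_unit_prod (@compact_unit_row R _) (@compact_unit_row R _)) oD CMphi (@pair_coord2_continuous R _ _ a) F0.
  have := @GG_pair R kd M hM hlc hmg _ _ _ _ _ _ _ _ (t0, mmap i x0) Gh GG' G'.
  apply: eq_GG; apply: filterS nD => p Dp; rewrite -/(F p) FE.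
  by have := phiE _ Dp; rewrite /= => ->.
have [k kx] := m_cover (G t0 x0); have [j jx] := m_cover (h x0).
split=> [i ix|i j' ix jx' a].
  by have [+ _] := key i j k ix jx kx.
by have [_] := key i j' k ix jx' kx; exact.
Qed.

End Exponential.
End GoodMaps.

(** * Curves and linear families of sections *)

Section Slices.
Context {R : realType} {kd : dc_kind} {M : nat -> R}.
Hypotheses (hM : weight_sequence M) (hlc : log_convex M) (hmg : moderate_growth M).

Lemma pair_continuous {T Y : topologicalType} (t0 : T) : continuous (fun y : Y => (t0, y)).
Proof. by move=> y; apply: (@continuous_pair Y T Y (cst t0) id) => //; exact: cvg_cst. Qed.

Lemma near_fst {T Y : normedModType R} (t0 : T) (y0 : Y) (P : T -> Prop) :
  (\forall t \near t0, P t) -> \forall p \near (t0, y0), P p.1.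
Proof. by move=> H; exact: (@cvg_fst _ _ (nbhs t0) (nbhs y0) _ P H). Qed.

Lemma near_slice {T Y : topologicalType} (t0 : T) (y0 : Y) (P : T * Y -> Prop) :
  (\forall p \near (t0, y0), P p) -> \forall y \near y0, P (t0, y).
Proof.
by move=> H; exact: pair_continuous H.
Qed.

(** The tube lemma, with neighbourhoods read in charts; compactness of the source manifolds enters
    here. *)
Lemma tube (A : manifold kd M) {T : topologicalType} (t0 : T) (Q : T -> A -> Prop) :
  compact [set: A] ->
  (forall x i, mdom i x -> \forall p \near (t0, mmap i x), Q p.1 (minv i p.2)) ->
  \forall t \near t0, forall x, Q t x.
Proof.
move=> cA H; have := @compact_induct A setT (fun S => \forall t \near t0, forall x, S x -> Q t x).
move=> /(_ _ _ _ cA _) K; apply: filterS (K _ _ _ _) => [t HQ x|||S S' SS|x _]; first exact: HQ.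
- by apply: filterE.
- by move=> S S' HS HS'; apply: filterS2 HS HS' => t h h' x [/h|/h'].
- by apply: filterS => t h x /SS /h.
have [i ix] := m_cover x; have [[A1 A2] /= [nA1 nA2] A12] := H x i ix.
exists [set x' | mdom i x' /\ A2 (mmap i x')].
  apply: filterI; first exact: open_nbhs_nbhs (conj (m_dom_open i) ix).
  exact: m_map_continuous ix _ nA2.
apply: filterS nA1 => t A1t x' [ix' A2x'].
by have := A12 (t, mmap i x') (conj A1t A2x'); rewrite /= m_mapK.
Qed.

Section OneT.
Context {T : normedModType R} (Dt Vt : set T).
Hypothesis HT : forall n (z : T * 'rV[R]_n) f, GG kd M (axisD Dt) (axisV Vt) z f -> GT kd M z f.

(** Freezes the parameter after differentiating in it. The directions [vs] are first scaled into the
    unit ball, where [GT] has its bounds. *)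
Lemma GT_slice {Y : normedModType R} (z : T * Y) f vs : GT kd M z f ->
  (exists2 O, open O & O z.2 /\ smo O (fun y => dird f (map (@ax1 _ T Y) vs) (z.1, y))) /\
  LC kd M uball z.2 (fun y => dird f (map (@ax1 _ T Y) vs) (z.1, y)).
Proof.
move=> [U [oU Uz fU H]]; have [c c1 [us u1 ->]] := unit_scale vs.
have c0 : 0 < c by apply: lt_le_trans c1.
have U2 : \forall y \near z.2, U (z.1, y).
  by apply: (@near_slice T Y); rewrite -surjective_pairing; exact: near_open.
split.
  exists [set y | U (z.1, y)].
    apply: (@open_comp _ _ (fun y => (z.1, y)) U) => // y _.
    exact: pair_continuous.
  split; first exact: nbhs_singleton U2.
  apply: (@smo_affine R _ _ U _ _ (fun y => (z.1, y)) (@ax2 _ T Y)) => //; last exact: smo_dird.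
  by move=> h v x; apply/eqP; rewrite xpair_eqE /= scaler0 add0r !eqxx.
have [W Wz HW] := H (size us).
exists [set y | U (z.1, y) /\ W (z.1, y)].
  by apply: filterI => //; apply: (@near_slice T Y); rewrite -surjective_pairing.
apply: kdq_imp HW => rho C r0 C0 HC; exists (c ^+ size us * C); first by rewrite mulr_gt0// exprn_gt0.
move=> y ws [Uy Wy] w1.
rewrite -(dird_ax2 (dird f (map (@ax1 _ T Y) [seq c *: u | u <- us])) ws (z.1, y)) -dird_cat.
have -> : map (@ax1 _ T Y) [seq c *: u | u <- us] = [seq c *: u | u <- map (@ax1 _ T Y) us].
  rewrite -!map_comp; apply: eq_map => u /=.
  by apply/eqP; rewrite xpair_eqE /= scaler0 !eqxx.
rewrite (mlin_homogs c _ _ (dird_mlin oU fU Uy)) normrM ger0_norm ?exprn_ge0 ?(ltW c0)//.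
by rewrite size_map -mulrA ler_pM2l ?exprn_gt0//; exact: HC.
Qed.

Lemma goodmap_is_CM (A B : manifold kd M) (G : T -> A -> B) t0 :
  (forall x, goodmap Dt Vt G t0 x) -> is_CM (G t0).
Proof.
move=> gG; split=> // i j /=; rewrite setTI.
have oD : open (@mmap _ _ _ A i @` (mdom i `&` G t0 @^-1` mdom j)).
  rewrite openE => _ [x [ix jx] <-]; rewrite /interior.
  have [+ _] := gG x i j ix jx; move=> /(@near_slice T _).
  have oi : \forall y \near mmap i x, (@mmap _ _ _ A i @` mdom i) y.
    by apply: near_open; [exact: m_cod_open|exists x].
  apply: filterS2 oi => y [x' ix' <-] /=; rewrite m_mapK// => jx'.
  by exists x'.
split; first exact: open_cinf.
exists (fun y => mmap j (G t0 (minv i y))); last by move=> x [[_ ix] _]; rewrite m_mapK.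
apply/(CM_coords kd hM hlc hmg) => // a.
have sl y : (@mmap _ _ _ A i @` (mdom i `&` G t0 @^-1` mdom j)) y ->
    GT kd M (t0, y) (fun p : T * 'rV[R]_(mdim A) => mmap j (G p.1 (minv i p.2)) 0 a).
  by move=> [x [ix jx] <-]; apply: HT; have [_] := gG x i j ix jx; exact.
split=> y Uy; have [[N oN [Ny sN]] lc] := GT_slice [::] (sl y Uy); last exact: lc.
by move=> vs; exact: sN.
Qed.

Lemma goodsec_section (A B : manifold kd M) (f : A -> B) (s : T -> A -> tvector B) t0 :
  is_CM f -> (forall x, is_tangent (f x) (s t0 x)) ->
  (forall x, goodsec Dt Vt f s t0 x) -> CM_sections f (s t0).
Proof.
move=> fCM ts gs; apply/(sectionP hM hlc hmg) => [i j|]; first exact: is_CM_open.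
split=> // i j a.
have sl y : triv_dom f i j y -> GT kd M (t0, y) (fun p : T * 'rV[R]_(mdim A) => s p.1 (minv i p.2) j 0 a).
  by move=> [x [ix jx] <-]; apply: HT; exact: gs.
split=> y Uy; have [[N oN [Ny sN]] lc] := GT_slice [::] (sl y Uy); last exact: lc.
by move=> vs; exact: sN.
Qed.

End OneT.
End Slices.

(** * Point evaluations of derivatives as continuous functionals *)

Section SectionFunctionals.
Context {R : realType} {kd : dc_kind} {M : nat -> R}.
Hypotheses (hM : weight_sequence M) (hlc : log_convex M) (hmg : moderate_growth M).
Variables (A B : manifold kd M) (f : A -> B).
Hypothesis fCM : is_CM f.
Local Notation Sec := (spanType (@CM_sections R kd M A B f)).
Let oTr i j : open (triv_dom f i j). Proof. exact: is_CM_open. Qed.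

Lemma lrep_smo (s : Sec) i j a : smo (triv_dom f i j) (lrep i j (span_val s) a).
Proof. by have /(sectionP hM hlc hmg oTr)[_ /(_ i j a)[]] := span_section hM hlc hmg oTr s. Qed.

Lemma dird_lrep_lin i j a y ws (b : R) (s s' : Sec) : triv_dom f i j y ->
  dird (lrep i j (span_val (b *: s + s')) a) ws y =
  b * dird (lrep i j (span_val s) a) ws y + dird (lrep i j (span_val s') a) ws y.
Proof.
move=> Uy; rewrite -(dirdZ _ _ (@oTr i j) (lrep_smo s a) Uy).
rewrite -(dirdD _ (@oTr i j) _ (lrep_smo s' a) Uy); last first.
  by apply: smoZ => //; exact: lrep_smo.
by congr (dird _ _ _); apply/funext => z; rewrite span_valD span_valZ lrepD lrepZ.
Qed.

Lemma dird_seminorm i j a y ws : triv_dom f i j y -> exists (p : Sec -> R) (C : R),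
  [/\ section_seminorms (f := f) p, seminorm p &
  forall s : Sec, `|dird (lrep i j (span_val s) a) ws y| <= C * p s].
Proof.
move=> Uy; have oU := @oTr i j; have [c c1 [us u1 ->]] := unit_scale ws.
have c0 : 0 < c by apply: lt_le_trans c1.
have [d d0 dU] := near_dist (near_open oU Uy).
have d2 : 0 < d / 2 by rewrite divr_gt0.
(* The sequence of points and directions is constant; [r] takes the form that [section_jsup] asks
   for, and only its value at 0 is used. *)
pose r (n : nat) : R := if `[< kd = Beurling >] then 1 else n.+1%:R.
have r0 n : 0 < r n by rewrite /r; case: ifP; rewrite ?ltr0n.
have WU : [set z : 'rV[R]_(mdim A) | `|z - y| <= d / 2] `<=` triv_dom f i j.
  by move=> z yd; apply: dU; apply: le_lt_trans yd _; rewrite ltr_pdivrMr// ltr_pMr// ltr1n.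
have [|n w /mapP[u /u1 uu ->]|e|e|p [pP ps pge]] := section_jsup hM hlc hmg oTr a (r := r)
  (m := fun=> size us) (x := fun=> unit_emb y) (v := fun=> map_tuple unit_emb (in_tuple us)) WU d2 _ _ r0.
- by move=> _; change (`|y - y| <= d / 2); rewrite subrr normr0 ltW.
- by rewrite /uball /= unit_emb_norm.
- by exists 1 => n; rewrite /r asboolT.
- by move=> n; rewrite /r asboolF// e.
exists p, (c ^+ size us * wgt M (r 0) (size us)); split=> // s.
have w0 : 0 < wgt M (r 0) (size us) by exact: wgt_gt0.
have := pge s 0%N; rewrite /= -map_comp (eq_map (g := id)) ?map_id// ?unit_embK ler_pdivrMr// => H.
rewrite (dird_homogs c _ oU (lrep_smo s a) Uy) normrM ger0_norm ?exprn_ge0 ?(ltW c0)//.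
by rewrite -mulrA ler_pM2l ?exprn_gt0// mulrC.
Qed.

Lemma cvg_seminorm {X : Type} (F : set_system X) (h : X -> section_space f) (l : section_space f) p e :
  h @ F --> l -> section_seminorms (f := f) p -> seminorm p -> 0 < e ->
  F (fun x => p ((h x : Sec) - (l : Sec)) < e).
Proof.
move=> hl pP ps e0; apply: (hl (fun s => p ((s : Sec) - (l : Sec)) < e)); exists [:: p], e; split=> //.
  by move=> q; rewrite inE => /eqP ->.
by move=> s /(_ p); rewrite mem_head; apply.
Qed.

Lemma kdq_ex (P : R -> R -> Prop) : kdq kd P -> exists rho C, [/\ 0 < rho, 0 < C & P rho C].
Proof.
rewrite /kdq; case: kd => [H|[rho r0 [C C0 H]]]; last by exists rho, C.
by have [C C0 H1] := H 1 ltr01; exists 1, C.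
Qed.

Lemma seminormB (p : Sec -> R) (s s' : Sec) : seminorm p -> p s <= p (s - s') + p s'.
Proof. by move=> [pD _]; have := pD (s - s') s'; rewrite subrK. Qed.

End SectionFunctionals.

Lemma wgtS_ge {R : realType} (M : nat -> R) (hM : weight_sequence M) (hlc : log_convex M) m (rho : R) :
  0 < rho -> rho * wgt M rho m <= wgt M rho m.+1.
Proof.
move=> r0; rewrite /wgt exprS.
have -> : rho * (m`!%:R * rho ^+ m * M m) = (m`!%:R * M m) * (rho * rho ^+ m) by ring.
have -> : (m.+1)`!%:R * (rho * rho ^+ m) * M m.+1 = ((m.+1)`!%:R * M m.+1) * (rho * rho ^+ m) by ring.
rewrite ler_pM2r ?mulr_gt0 ?exprn_gt0//; apply: ler_pM => //.
- exact/ltW/weight_gt0.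
- by rewrite ler_nat factS leq_pmull.
- exact: weight_leS.
Qed.

Section CurveFamilies.
Context {R : realType} {kd : dc_kind} {M : nat -> R}.
Hypotheses (hM : weight_sequence M) (hlc : log_convex M) (hmg : moderate_growth M).
Variables (A B : manifold kd M) (f : A -> B).
Hypothesis fCM : is_CM f.
Local Notation Sec := (spanType (@CM_sections R kd M A B f)).
Let oTr i j : open (triv_dom f i j). Proof. exact: is_CM_open. Qed.

Lemma prod_unit_le1 (vs : seq R) : inV uball vs -> `|\prod_(v <- vs) v| <= 1.
Proof.
elim: vs => [|v vs ih] v1; first by rewrite big_nil normr1.
by rewrite big_cons normrM; have [h1 h2] := inV_cons v1; rewrite mulr_ile1// ih.
Qed.

(** Point evaluations of derivatives are continuous, so the curve can be differentiated in [t]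
    pointwise. On a compact interval each of its derivatives is bounded in every seminorm, and
    [section_regular] makes the estimates uniform. *)
Lemma curve_goodsec (c : R -> section_space f) t0 x0 : smooth_curve c ->
  goodsec setT set0 f (fun t x => span_val (c t : Sec) x) t0 x0.
Proof.
move=> [d d0 dP] i j ix jx a; have Uy0 : triv_dom f i j (mmap i x0) by exists x0.
have oU := @oTr i j; set U := triv_dom f i j in Uy0 oU.
pose D k (t : R) ws y := dird (lrep i j (span_val (d k t : Sec)) a) ws y.
have dD k ws y t : U y -> is_derive t (1 : R) (fun t => D k t ws y) (D k.+1 t ws y).
  move=> Uy; apply/cvg_is_derive.
  have [p [C [pP ps pC]]] := dird_seminorm hM hlc hmg fCM a ws Uy.
  apply/cvgrPdist_le => e e0.
  have C0 : 0 < `|C| + 1 by rewrite ltr_wpDl.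
  have := cvg_seminorm (dP k t) pP ps (divr_gt0 e0 C0); apply: filterS => h hp.
  have -> : D k.+1 t ws y - h^-1 *: (D k (t + h) ws y - D k t ws y) =
    - dird (lrep i j (span_val ((h^-1 *: ((d k (t + h) : Sec) - (d k t : Sec)) : Sec) - (d k.+1 t : Sec))) a) ws y.
    have lin := @dird_lrep_lin _ _ _ hM hlc hmg _ _ _ fCM i j a y ws.
    have linN (s s' : Sec) : dird (lrep i j (span_val (s - s')) a) ws y =
      dird (lrep i j (span_val s) a) ws y - dird (lrep i j (span_val s') a) ws y.
      by rewrite -[s - s']addrC -scaleN1r lin// mulN1r addrC.
    rewrite linN -[h^-1 *: _ in RHS]addr0 lin// linN.
    have -> : dird (lrep i j (span_val (0 : Sec)) a) ws y = 0.
      by have := linN 0 0; rewrite subrr subrr.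
    by rewrite addr0 /D opprB.
  rewrite normrN; apply: le_trans (pC _) _.
  apply: (@le_trans _ _ ((`|C| + 1) * p ((h^-1 *: ((d k (t + h) : Sec) - (d k t : Sec)) : Sec) - (d k.+1 t : Sec)))).
    by apply: ler_wpM2r; [exact: seminorm_ge0|rewrite (le_trans (ler_norm C))// lerDl].
  by rewrite -ler_pdivlMl// mulrC ltW.
have bd k t1 (p : Sec -> R) : section_seminorms (f := f) p -> seminorm p ->
    exists Bp, forall t, `|t - t1| <= 1 -> p (d k t : Sec) <= Bp.
  move=> pP ps.
  pose P (S : set R) := exists Bp, forall t, S t -> p (d k t : Sec) <= Bp.
  have [||||t _|Bp HB] := @compact_induct R `[t1 - 1, t1 + 1]%classic P.
  - by exists 0.
  - move=> S S' [b hb] [b' hb']; exists (Num.max b b') => t; rewrite le_max.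
    by case=> [/hb ->|/hb' ->]; rewrite ?orbT.
  - by move=> S S' SS [b hb]; exists b => t /SS /hb.
  - exact: segment_compact.
  - have sck : smooth_curve (fun t => d k t : section_space f).
      by exists (fun m => d (k + m)%N); rewrite ?addn0// => m t'; rewrite addnS; exact: dP.
    have ck := @smooth_curve_continuous _ _ _ sck t.
    exists [set t' | p ((d k t' : Sec) - (d k t : Sec)) < 1].
      exact: (cvg_seminorm ck pP ps ltr01).
    exists (1 + p (d k t : Sec)) => t' /= ht'.
    by apply: le_trans (seminormB _ (d k t : Sec) ps) _; rewrite lerD2r ltW.
  by exists Bp => t; rewrite ler_distl => ht; apply: HB; rewrite /= in_itv.
have reg k t1 y1 : U y1 -> exists2 W, nbhs y1 W & kdq kd (fun rho C => forall t : R, `|t - t1| <= 1 ->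
    sbound W i j rho C (span_val (d k t : Sec))).
  move=> Uy1.
  have [p pP ps|W Wy HW] := section_regular hM hlc hmg oTr (S := [set s : Sec | exists2 t, `|t - t1| <= 1 & s = d k t]) Uy1.
    by have [Bp HB] := bd k t1 p pP ps; exists Bp => s [t tt ->]; exact: HB.
  exists W => //; apply: kdq_imp HW => rho C r0 C0 H; exists C => // t tt.
  by apply: H; exists t.
(* On the line, the derivative along [vs] is the product of the numbers in [vs] times the derivative
   of order [size vs]. *)
pose Phi (vs : seq R) (t : R) y := \prod_(v <- vs) v * lrep i j (span_val (d (size vs) t : Sec)) a y.
have PhiE vs t ws y : U y -> dird (Phi vs t) ws y = \prod_(v <- vs) v * D (size vs) t ws y.
  by move=> Uy; rewrite /Phi (dirdZ _ _ oU) //; exact: lrep_smo.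
have J : jfam U Phi.
  split.
  - by move=> vs t; apply: smoZ => //; exact: lrep_smo.
  - move=> t y Uy vs ws b v w; rewrite /Phi !size_cat !big_cat !big_cons /=.
    by rewrite /GRing.scale /=; ring.
  - move=> t1 y1 k m Uy1; have [W Wy HW] := reg k t1 y1 Uy1.
    have [rho [C [r0 C0 H]]] := kdq_ex HW.
    have [e e0 He] := near_dist (filterI Wy (near_open oU Uy1)).
    exists (Num.min 1 e), (C * wgt M rho m); split; first by rewrite lt_min ltr01.
    move=> t y vs ws; rewrite !lt_min => /andP[tt _] /andP[_ ye] v1 w1 sv sw.
    have [Wy' Uy'] := He _ ye; rewrite PhiE// normrM sv -sw -[leRHS]mul1r.
    by apply: ler_pM => //; [exact: prod_unit_le1|apply: H => //; exact: ltW].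
  - move=> vs v t ws y s Uy; rewrite PhiE//=.
    have dk := dD (size vs) ws y (t + s *: v) Uy.
    have dd : differentiable (fun t => D (size vs) t ws y) (t + s *: v).
      by apply/derivable1_diffP; case: dk.
    have dv : derivable (fun t => D (size vs) t ws y : R^o) (t + s *: v) v by exact: diff_derivable.
    have il := is_derive_line dv.
    have iz := is_deriveZ (\prod_(v <- vs) v) il.
    have -> : (fun s => dird (Phi vs (t + s *: v)) ws y) =
      (\prod_(v <- vs) v *: (fun s : R => D (size vs) (t + s *: v) ws y : R^o)).
      by apply/funext => s'; rewrite PhiE.
    apply: is_derive_eq iz _; rewrite derive_real//; case: dk => _ ->.
    by rewrite big_cons /GRing.scale /=; ring.
have G := @GG_joint R kd M R _ setT set0 U Phi (t0, mmap i x0) oU Uy0 J.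
apply: eq_GG (G _).
  by near=> p; rewrite /joint /Phi big_nil mul1r d0.
move=> es _; have [W Wy HW] := reg (size es) t0 _ Uy0.
exists [set p | `|p.1 - t0| <= 1 /\ (W p.2 /\ U p.2)].
  apply: filterI.
    apply: (near_fst _ (P := fun t => `|t - t0| <= 1)).
    by apply: (@dist_near R _ t0 1 (fun t => `|t - t0| <= 1)) => // t /ltW.
  by apply: (near_snd t0 (P := fun y => W y /\ U y)); exact: (filterI Wy (near_open oU Uy0)).
apply: kdq_imp HW => rho C r0 C0 H; exists ((`|\prod_(v <- es) v| + 1) * C).
  by rewrite mulr_gt0// ltr_wpDl.
move=> p vs ws [pt [Wp Up]] vs0 w1.
have -> : vs = [::] by case: vs vs0 => // v vs /inV_cons[].
rewrite PhiE// normrM -mulrA; apply: ler_pM => //; first by rewrite lerDl.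
exact: H.
Unshelve. all: by end_near.
Qed.

Lemma linear_goodsec {T : normedModType R} (L : {linear T -> Sec}) t0 x0 :
  (forall p, section_seminorms (f := f) p -> seminorm p -> exists C, forall t, p (L t) <= C * `|t|) ->
  goodsec set0 uball f (fun t x => span_val (L t) x) t0 x0.
Proof.
move=> LC i j ix jx a; have Uy0 : triv_dom f i j (mmap i x0) by exists x0.
have oU := @oTr i j; set U := triv_dom f i j in Uy0 oU.
pose D (t : T) ws y := dird (lrep i j (span_val (L t)) a) ws y.
have Dlin b t t' ws y : U y -> D (b *: t + t') ws y = b * D t ws y + D t' ws y.
  by move=> Uy; rewrite /D linearP (dird_lrep_lin hM hlc hmg fCM).
have reg t1 y1 : U y1 -> exists2 W, nbhs y1 W & kdq kd (fun rho C => forall t : T, `|t| <= t1 ->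
    sbound W i j rho C (span_val (L t))).
  move=> Uy1.
  have [p pP ps|W Wy HW] := section_regular hM hlc hmg oTr (S := [set s : Sec | exists2 t, `|t| <= t1 & s = L t]) Uy1.
    have [C HC] := LC p pP ps; exists (`|C| * t1) => s [t tt ->]; apply: le_trans (HC t) _.
    apply: (@le_trans _ _ (`|C| * `|t|)); first by rewrite ler_wpM2r// ler_norm.
    by rewrite ler_wpM2l.
  exists W => //; apply: kdq_imp HW => rho C r0 C0 H; exists C => // t tt.
  by apply: H; exists t.
(* A linear map is its own derivative: order one evaluates [L] at the direction, and higher orders
   vanish. *)
pose Phi (vs : seq T) (t : T) : 'rV[R]_(mdim A) -> R :=
  match vs with [::] => lrep i j (span_val (L t)) a | [:: v] => lrep i j (span_val (L v)) a | _ => fun=> 0 end.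
have Phi2 vs t ws y : (1 < size vs)%N -> dird (Phi vs t) ws y = 0.
  by case: vs => [|? [|? ?]]// _; rewrite /Phi dird_cst; case: ws.
have J : jfam U Phi.
  split.
  - by move=> [|v [|w vs]] t; [exact: lrep_smo|exact: lrep_smo|exact: smo_cst].
  - move=> t y Uy [|v' [|w' vs]] [|w'' ws] b v w; rewrite /Phi /=; rewrite ?mulr0 ?addr0//.
    exact: (Dlin b v w [::] y Uy).
  - move=> t1 y1 k m Uy1; have [W Wy HW] := reg (`|t1| + 1) y1 Uy1.
    have [rho [C [r0 C0 H]]] := kdq_ex HW.
    have [e e0 He] := near_dist Wy.
    exists (Num.min 1 e), (C * wgt M rho m); split; first by rewrite lt_min ltr01.
    move=> t y vs ws; rewrite !lt_min => /andP[tt _] /andP[_ ye] v1 w1 sv sw.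
    have t1' : `|t| <= `|t1| + 1.
      by rewrite -lerBlDl (le_trans (lerB_dist _ _))// ltW.
    case: vs v1 {sv} => [|v [|w vs]] v1.
    + by rewrite -sw; apply: H => //; exact: He.
    + rewrite -sw; apply: H => //; last exact: He.
      by have [_ h] := inV_cons v1; apply: le_trans h _; rewrite lerDr.
    + by rewrite Phi2// normr0 mulr_ge0 ?(ltW C0)// ltW// wgt_gt0.
  - move=> [|v' [|w' vs]] v t ws y s Uy /=.
    + have E : (fun s : R => dird (lrep i j (span_val (L (t + s *: v))) a) ws y) =
         cst (D t ws y) + (D v ws y *: id).
        apply/funext => s'; rewrite -/(D _ ws y) addrC Dlin// /= addrC; congr (_ + _).
        exact: mulrC.
      rewrite E; apply: is_derive_eq (is_deriveD (is_derive_cst _ _ _) (is_deriveZ _ (is_derive_id _ _))) _.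
      by rewrite add0r /GRing.scale /= mulr1.
    + by rewrite dird_cst; apply: is_derive_eq (is_derive_cst _ _ _) _; case: ws.
    + rewrite !dird_cst; apply: is_derive_eq (is_derive_cst _ _ _) _; case: ws => //.
have G := @GG_joint R kd M T _ set0 uball U Phi (t0, mmap i x0) oU Uy0 J.
apply: eq_GG (G _); first by near=> p.
case=> [_|v es /inV_cons[]//].
have [W Wy HW] := reg (`|t0| + 1) _ Uy0.
exists [set p | `|p.1 - t0| <= 1 /\ W p.2].
  apply: filterI.
    apply: (near_fst _ (P := fun t => `|t - t0| <= 1)).
    by apply: (@dist_near R _ t0 1 (fun t => `|t - t0| <= 1)) => // t /ltW.
  by apply: (near_snd t0 (P := W)).
(* The first derivative in [t] is bounded by the weight of order [size ws] but compared with that of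
   order [1 + size ws]; [wgtS_ge] costs the factor [rho^-1]. *)
apply: kdq_imp HW => rho C r0 C0 H; exists (C * (1 + rho^-1)).
  by rewrite mulr_gt0// ltr_pwDl// invr_ge0 ltW.
move=> p vs ws [pt Wp] v1 w1; rewrite cats0.
have t1' : `|p.1| <= `|t0| + 1.
  by rewrite -lerBlDl (le_trans (lerB_dist _ _)).
have r1 : 0 <= rho^-1 by rewrite invr_ge0 ltW.
case: vs v1 => [|v [|w vs]] v1.
- apply: le_trans (H _ t1' a _ _ Wp w1) _; rewrite add0n ler_wpM2r ?(ltW (wgt_gt0 _ _ _))//.
  by rewrite ler_peMr ?(ltW C0)// lerDl.
- have [_ /= h] := inV_cons v1.
  apply: le_trans (H v _ a _ _ Wp w1) _; first by apply: le_trans h _; rewrite lerDr.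
  rewrite -mulrA ler_pM2l// add1n mulrDl mul1r.
  have := wgtS_ge hM hlc (size ws) r0; rewrite -ler_pdivlMl// => h1.
  by apply: le_trans h1 _; rewrite lerDr ltW// wgt_gt0.
- rewrite Phi2// normr0 mulr_ge0 ?(ltW (wgt_gt0 _ _ _))//.
  by rewrite mulr_ge0 ?(ltW C0)// addr_ge0.
Unshelve. all: by end_near.
Qed.

End CurveFamilies.

(** * Families of sections as maps into the section space *)

Lemma kdqT (R : realType) (kd : dc_kind) : kdq kd (fun _ _ : R => True).
Proof. by rewrite /kdq; case: kd => [rho _|]; [exists 1|exists 1 => //; exists 1]. Qed.

Section Outputs.
Context {R : realType} {kd : dc_kind} {M : nat -> R}.
Hypotheses (hM : weight_sequence M) (hlc : log_convex M) (hmg : moderate_growth M).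
Context {T : normedModType R} (Dt Vt : set T).
Hypothesis HT : forall n (z : T * 'rV[R]_n) f, GG kd M (axisD Dt) (axisV Vt) z f -> GT kd M z f.
Variables (A B : manifold kd M) (f : A -> B).
Hypothesis fCM : is_CM f.
Local Notation Sec := (spanType (@CM_sections R kd M A B f)).
Let oTr i j : open (triv_dom f i j). Proof. exact: is_CM_open. Qed.
Variables (s : T -> A -> tvector B) (U : set T).
Hypothesis oU : open U.
Hypothesis stan : forall t x, U t -> is_tangent (f x) (s t x).
Hypothesis sgood : forall t x, U t -> goodsec Dt Vt f s t x.

Lemma span_val_inj (r r' : Sec) : span_val r = span_val r' -> r = r'.
Proof. exact: val_inj. Qed.

Lemma span_lin_eq (r1 r2 r3 : Sec) h1 h2 h3 (b : R) : span_val r1 = h1 -> span_val r2 = h2 ->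
  span_val r3 = h3 -> h1 = b *: h2 + h3 -> r1 = b *: r2 + r3.
Proof. by move=> <- <- <- E; apply: span_val_inj; rewrite E. Qed.

(** Total, with default 0, so that difference quotients in the section space can be written before
    membership is proved. *)
Definition sec_of (r : A -> tvector B) : Sec :=
  match pselect (CM_sections f r) with left H => mk_section H | right _ => 0 end.

Lemma sec_ofE r : CM_sections f r -> span_val (sec_of r) = r.
Proof. by rewrite /sec_of; case: pselect. Qed.

Definition sder (vs : seq T) (t : T) : A -> tvector B :=
  fun x j => \row_a dird (fun t => s t x j 0 a) vs t.

Lemma sder0 t : sder [::] t = s t.
Proof. by apply/funext => x; apply/funext => j; apply/rowP => a; rewrite mxE. Qed.

Let g i j a (p : T * 'rV[R]_(mdim A)) : R := s p.1 (minv i p.2) j 0 a.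
Let N i j : set (T * 'rV[R]_(mdim A)) := [set p | U p.1 /\ triv_dom f i j p.2].

Let oN i j : open (N i j).
Proof.
have -> : N i j = (fst @^-1` U) `&` (snd @^-1` triv_dom f i j) by [].
apply: openI; apply: open_comp => // p _; [exact: cvg_fst|exact: cvg_snd].
Qed.

Let gGG i j a p : N i j p -> GG kd M (axisD Dt) (axisV Vt) p (g i j a).
Proof. by case: p => t y [/= Ut [x [ix jx] <-]]; apply: sgood. Qed.

Let g_smo i j a : smo (N i j) (g i j a).
Proof. by move=> p /(gGG a)[N' [oN' Np gN _]] vs; exact: gN. Qed.

Lemma lrep_sder i j a vs t y : lrep i j (sder vs t) a y = dird (g i j a) (map (@ax1 _ T _) vs) (t, y).
Proof. by rewrite dird_ax1 /lrep mxE. Qed.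

Lemma dird_lrep_sder i j a vs t ws y : dird (lrep i j (sder vs t) a) ws y =
  dird (g i j a) (map (@ax2 _ T _) ws ++ map (@ax1 _ T _) vs) (t, y).
Proof.
rewrite dird_cat dird_ax2 /=; congr (dird _ _ _); apply/funext => z.
exact: lrep_sder.
Qed.

(** The base map does not depend on [t], so tangency is a linear relation with constant coefficients
    and survives differentiation in [t]; the estimates in the space variable come from
    [GT_slice]. *)
Lemma sder_section vs t : U t -> CM_sections f (sder vs t).
Proof.
move=> Ut; apply/(sectionP hM hlc hmg oTr); split=> [x|i j a]; last first.
  have sl y : triv_dom f i j y -> GT kd M (t, y) (g i j a) by move=> Uy; apply: HT; exact: gGG.
  have E : lrep i j (sder vs t) a = (fun y => dird (g i j a) (map (@ax1 _ T _) vs) (t, y)).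
    by apply/funext => y; exact: lrep_sder.
  rewrite E; split=> y Uy; have [[N' oN' [Ny sN]] lc] := GT_slice vs (sl y Uy); last exact: lc.
  by move=> ws; exact: sN.
apply/(tangentP hM hlc hmg); split=> [j jx|i j ib jb].
  apply/rowP => a; rewrite !mxE.
  have /= -> := @eq_dird_on _ _ U _ (fun=> 0) vs oU _ t Ut; first by rewrite dird_cst; case: vs.
  by move=> t' Ut'; have [-> //] := stan x Ut'; rewrite mxE.
have [k kx] := m_cover x.
have smox j' a : mdom j' (f x) -> smo U (fun t => s t x j' 0 a).
  move=> jx; have := @smo_affine R _ _ (N k j') U (g k j' a) (fun t => (t, mmap k x)) (@ax1 _ T _).
  rewrite /g /= => H t' Ut' vs'.
  have {}H : smo U (fun t => s t (minv k (mmap k x)) j' 0 a).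
    apply: H; last exact: g_smo.
    - by move=> h v y; apply/eqP; rewrite xpair_eqE /= scaler0 add0r !eqxx.
    - by [].
    - by move=> t'' Ut''; split=> //; exists x.
  by rewrite m_mapK// in H; exact: H.
apply/rowP => a; rewrite !mxE.
have sm c : smo U (fun t => jac i j (f x) c a * s t x i 0 c) by apply: smoZ => //; exact: smox.
rewrite (@eq_dird_on _ _ U _ (fun t => \sum_c jac i j (f x) c a * s t x i 0 c) vs oU _ t Ut); last first.
  move=> t' Ut'; have /(tangentP hM hlc hmg)[_ /(_ i j ib jb) ->] := stan x Ut'.
  by rewrite mxE; apply: eq_bigr => c _; rewrite mulrC.
rewrite (dird_sum _ oU sm Ut); apply: eq_bigr => c _.
by rewrite (dirdZ _ _ oU (smox _ _ ib) Ut) mulrC; congr (_ * _); rewrite /sder mxE.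
Qed.

Let SE vs t : U t -> span_val (sec_of (sder vs t)) = sder vs t.
Proof. by move=> Ut; rewrite sec_ofE//; exact: sder_section. Qed.

Lemma sder_cons_lin (b : R) v w vs t : U t ->
  sec_of (sder ((b *: v + w) :: vs) t) = b *: sec_of (sder (v :: vs) t) + sec_of (sder (w :: vs) t).
Proof.
move=> Ut; apply: (span_lin_eq (SE ((b *: v + w) :: vs) Ut) (SE (v :: vs) Ut) (SE (w :: vs) Ut)).
apply/funext => x; apply/funext => j; apply/rowP => a.
rewrite /sder !fctE !mxE; have [k kx] := m_cover x.
have [jx|jx] := pselect (mdom j (f x)).
  have E vs' : dird (fun t => s t x j 0 a) vs' t = dird (g k j a) (map (@ax1 _ T _) vs') (t, mmap k x).
    by rewrite dird_ax1 /g /= m_mapK.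
  rewrite !E /=; have Np : N k j (t, mmap k x) by split=> //; exists x.
  have := dird_mlin (@oN k j) (@g_smo k j a) Np [::] (map (@ax1 _ T _) vs) b (@ax1 _ T _ v) (@ax1 _ T _ w).
  rewrite /= => <-; congr ('D_ _ _ _).
  by apply/eqP; rewrite xpair_eqE /= scaler0 addr0 !eqxx.
have Z vs' : dird (fun t => s t x j 0 a) vs' t = 0.
  rewrite (@eq_dird_on _ _ U _ (fun=> 0) vs' oU _ t Ut); first by rewrite dird_cst; case: vs'.
  by move=> t' Ut'; have [-> //] := stan x Ut'; rewrite mxE.
by rewrite !Z mulr0 addr0.
Qed.

Lemma unif_bound i j (K : set 'rV[R]_(mdim A)) t0 (P : R -> R -> T -> 'rV[R]_(mdim A) -> Prop) :
  (forall t y, upward (fun rho C => P rho C t y)) ->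
  compact K -> K `<=` triv_dom f i j -> U t0 ->
  (forall y, triv_dom f i j y -> exists2 W, nbhs (t0, y) W & kdq kd (fun rho C => forall p, W p -> P rho C p.1 p.2)) ->
  exists2 W, nbhs t0 W & kdq kd (fun rho C => forall t y, W t -> K y -> P rho C t y).
Proof.
move=> uP cK KU Ut0 H.
have up (W : set T) (S : set 'rV[R]_(mdim A)) : upward (fun rho C => forall t y, W t -> S y -> P rho C t y).
  by move=> rho rho' C C' r0 rr C0 CC h t y Wt Sy; apply: (uP t y rho rho' C C') => //; exact: h.
apply: (@compact_induct _ K (fun S => exists2 W, nbhs t0 W & kdq kd (fun rho C => forall t y, W t -> S y -> P rho C t y))) => //.
- exists setT; first exact: filterT.
  by apply: kdq_imp (kdqT R kd) => rho C r0 C0 _; exists C.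
- move=> S S' [W Wt HW] [W' Wt' HW']; exists (W `&` W'); first exact: filterI.
  apply: kdq_imp (kdq_and (up W S) (up W' S') HW HW') => rho C r0 C0 [h h']; exists C => // t y [Wt1 Wt2].
  by case; [exact: h|exact: h'].
- move=> S S' SS [W Wt HW]; exists W => //; apply: kdq_imp HW => rho C r0 C0 h; exists C => // t y Wt1 Sy.
  by apply: h => //; exact: SS.
- move=> y Ky; have [W [[W1 W2] /= [nW1 nW2] W12] HW] := H y (KU _ Ky).
  exists W2 => //; exists W1 => //; apply: kdq_imp HW => rho C r0 C0 h; exists C => // t z W1t W2z.
  by apply: (h (t, z)); apply: W12.
Qed.

Lemma sder_bound k i j (K : set 'rV[R]_(mdim A)) t0 : compact K -> K `<=` triv_dom f i j -> U t0 ->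
  exists2 W, nbhs t0 W & kdq kd (fun rho C => forall t vs, W t -> inV uball vs -> size vs = k ->
     sbound K i j rho C (sder vs t)).
Proof.
move=> cK KU Ut0.
have := @unif_bound i j K t0 (fun rho C t y => forall a vs ws, inV uball vs -> size vs = k -> inV uball ws ->
  `|dird (g i j a) (map (@ax2 _ T _) ws ++ map (@ax1 _ T _) vs) (t, y)| <= C * wgt M rho (size ws)) _ cK KU Ut0.
case.
- move=> t y rho rho' C C' r0 rr C0 CC h a vs ws v1 sv w1; apply: le_trans (h a vs ws v1 sv w1) _.
  apply: ler_pM => //; [exact: ltW|exact/ltW/wgt_gt0|exact: ler_wgt].
- move=> y Uy.
  have Ha a : exists W, nbhs (t0, y) W /\ kdq kd (fun rho C => forall p vs ws, W p ->
    inV uball vs -> size vs = k -> inV uball ws ->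
    `|dird (g i j a) (map (@ax2 _ T _) ws ++ map (@ax1 _ T _) vs) p| <= C * wgt M rho (size ws)).
    have Np : N i j (t0, y) by [].
    have [_ [_ _ _ /(_ k)[W Wz HW]]] := HT (gGG a Np).
    by exists W.
  have [W HW] := choice Ha.
  exists (fun p => forall a, W a p).
    exact: (@filter_forall _ _ W (nbhs (t0, y)) (nbhs_filter _) (fun a => (HW a).1)).
  have up a : upward (fun rho C => forall p vs ws, W a p ->
    inV uball vs -> size vs = k -> inV uball ws ->
    `|dird (g i j a) (map (@ax2 _ T _) ws ++ map (@ax1 _ T _) vs) p| <= C * wgt M rho (size ws)).
    move=> rho rho' C C' r0 rr C0 CC h p vs ws Wp v1 sv w1; apply: le_trans (h p vs ws Wp v1 sv w1) _.
    apply: ler_pM => //; [exact: ltW|exact/ltW/wgt_gt0|exact: ler_wgt].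
  apply: kdq_imp (kdq_all up (fun a => (HW a).2)) => rho C r0 C0 h; exists C => // p Wp a vs ws v1 sv w1.
  by rewrite -surjective_pairing; apply: h.
move=> W Wt HW; exists W => //; apply: kdq_imp HW => rho C r0 C0 h; exists C => // t vs Wt' v1 sv a y ws Ky w1.
by rewrite dird_lrep_sder; apply: h.
Qed.

Lemma sder_mlin i j a ws p : N i j p ->
  mlin (fun vs => dird (g i j a) (map (@ax2 _ T _) ws ++ map (@ax1 _ T _) vs) p).
Proof.
move=> Np us us' b v w; rewrite !map_cat /= !catA.
have := dird_mlin (@oN i j) (@g_smo i j a) Np (map (@ax2 _ T _) ws ++ map (@ax1 _ T _) us) (map (@ax1 _ T _) us')
  b (@ax1 _ T _ v) (@ax1 _ T _ w).
move=> <-; congr (dird _ (_ ++ _ :: _) _).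
by apply/eqP; rewrite xpair_eqE /= scaler0 addr0 !eqxx.
Qed.

Lemma sder_bound_cat k vs i j (K : set 'rV[R]_(mdim A)) t0 : compact K -> K `<=` triv_dom f i j -> U t0 ->
  exists2 W, nbhs t0 W & kdq kd (fun rho C => forall t us, W t -> inV uball us -> size us = k ->
     sbound K i j rho C (sder (us ++ vs) t)).
Proof.
move=> cK KU Ut0; have [c c1 [vs' v1 ->]] := unit_scale vs.
have c0 : 0 < c by apply: lt_le_trans c1.
have [W Wt HW] := sder_bound (k + size vs') cK KU Ut0.
exists (W `&` U); first by apply: filterI => //; exact: near_open.
apply: kdq_imp HW => rho C r0 C0 H; exists (c ^+ size vs' * C); first by rewrite mulr_gt0 ?exprn_gt0.
move=> t us [Wt' Ut'] u1 su a y ws Ky w1.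
have Np : N i j (t, y) by split=> //; exact: KU.
rewrite dird_lrep_sder (mlin_homogs c us vs' (sder_mlin a ws Np)).
rewrite normrM ger0_norm ?exprn_ge0 ?(ltW c0)// -mulrA ler_pM2l ?exprn_gt0//.
rewrite -dird_lrep_sder; apply: H => //; last by rewrite size_cat su.
exact: inV_cat.
Qed.

Lemma dird_lrepB i j a y ws (r r' : Sec) : triv_dom f i j y ->
  dird (lrep i j (span_val (r - r')) a) ws y =
  dird (lrep i j (span_val r) a) ws y - dird (lrep i j (span_val r') a) ws y.
Proof.
move=> Uy; have -> : r - r' = (-1) *: r' + r by rewrite scaleN1r addrC.
by rewrite (dird_lrep_lin hM hlc hmg fCM)// mulN1r addrC.
Qed.

Lemma dird_lrepBB i j a y ws (r1 r2 r3 : Sec) h1 h2 h3 : triv_dom f i j y ->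
  span_val r1 = h1 -> span_val r2 = h2 -> span_val r3 = h3 ->
  dird (lrep i j (span_val (r1 - r2 - r3)) a) ws y =
  dird (lrep i j h1 a) ws y - dird (lrep i j h2 a) ws y - dird (lrep i j h3 a) ws y.
Proof. by move=> Uy <- <- <-; rewrite !dird_lrepB. Qed.

Lemma sder_pbound p vs t0 : section_seminorms (f := f) p -> U t0 ->
  exists2 C, 0 < C & forall v, uball v -> p (sec_of (sder (v :: vs) t0)) <= C.
Proof.
move=> /(section_seminorm_bound hM hlc hmg oTr)[i [j [K [cK KU Hp]]]] Ut0.
have [W Wt HW] := sder_bound_cat 1 vs cK KU Ut0.
have [rho [C [D [r0 C0 D0 HC HD]]]] := kdq_kdd HW Hp.
exists (D * C); first exact: mulr_gt0.
move=> v v1; apply: HD => //; rewrite SE//.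
by apply: (HC t0 [:: v]) => //; [exact: nbhs_singleton|exact: inV1].
Qed.

(** Taylor's formula of order two in [t], applied to all derivatives in [y]: on the compact set
    belonging to [p] the estimates of the remainder section carry the factor [|v|^2]. *)
Lemma sder_remainder p vs t0 : section_seminorms (f := f) p -> U t0 ->
  exists d C : R, [/\ 0 < d, 0 < C & forall v, `|v| < d -> v != 0 -> U (t0 + v) /\
    p (sec_of (sder vs (t0 + v)) - sec_of (sder vs t0) - sec_of (sder (v :: vs) t0)) <= C * `|v| ^+ 2].
Proof.
move=> /(section_seminorm_bound hM hlc hmg oTr)[i [j [K [cK KU Hp]]]] Ut0.
have [W Wt HW] := sder_bound_cat 2 vs cK KU Ut0.
have [rho [C [D [r0 C0 D0 HC HD]]]] := kdq_kdd HW Hp.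
have [d d0 dW] := near_dist (filterI Wt (near_open oU Ut0)).
exists d, (D * C); split=> //; first exact: mulr_gt0.
move=> v vd v0; have seg (b : R) : 0 <= b <= 1 -> W (t0 + b *: v) /\ U (t0 + b *: v).
  move=> /andP[b0 b1]; apply: dW; rewrite addrAC subrr add0r normrZ ger0_norm//.
  by apply: le_lt_trans vd; rewrite ler_piMl.
have Uv : U (t0 + v) by have [|_] := seg 1; rewrite ?scale1r// ler01 lexx.
split=> //; have nv : 0 < `|v| by rewrite normr_gt0.
(* [v != 0] makes the constant positive, as the estimate of [p] requires. *)
rewrite -mulrA; apply: HD; first by rewrite mulr_gt0 ?exprn_gt0.
move=> a y ws Ky w1; have Uy := KU _ Ky.
rewrite (dird_lrepBB a ws Uy (SE vs Uv) (SE vs Ut0) (SE (v :: vs) Ut0)) !dird_lrep_sder.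
set G := dird (g i j a) (map (@ax2 _ T _) ws ++ map (@ax1 _ T _) vs).
have GN : smo (N i j) G by apply: smo_dird; exact: g_smo.
have NP (b : R) : 0 <= b <= 1 -> N i j ((t0, y) + b *: (@ax1 _ T _ v)).
  by move=> /seg[_ ?]; split=> //=; rewrite scaler0 addr0.
have u1 : uball (`|v|^-1 *: v) by rewrite /uball /= normrZ normfV normr_id mulVf// gt_eqF.
have vE : v = `|v| *: (`|v|^-1 *: v) by rewrite scalerA mulfV ?scale1r// gt_eqF.
have b2 (b : R) : 0 <= b <= 1 -> `|dird G (nseq 2 (@ax1 _ T _ v)) ((t0, y) + b *: (@ax1 _ T _ v))| <=
    `|v| ^+ 2 * (C * wgt M rho (size ws)).
  move=> b01; have Np := NP b b01; set q := (t0, y) + _ in Np *.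
  have qE : q = (t0 + b *: v, y).
    by apply/eqP; rewrite xpair_eqE /= scaler0 addr0 !eqxx.
  rewrite /G -dird_cat.
  have -> : dird (g i j a) (nseq 2 (@ax1 _ T _ v) ++ map (@ax2 _ T _) ws ++ map (@ax1 _ T _) vs) q =
      dird (g i j a) (map (@ax2 _ T _) ws ++ map (@ax1 _ T _) (v :: v :: vs)) q.
    apply: (dird_perm (@oN i j) (@g_smo i j a)) => //.
    by rewrite -[map _ (v :: v :: vs)]/(nseq 2 (@ax1 _ T _ v) ++ map (@ax1 _ T _) vs) perm_catCA.
  have ml := sder_mlin a ws Np.
  rewrite {1}vE (mlin_homog [::] _ _ _ ml).
  have := mlin_homog [:: `|v|^-1 *: v] `|v| (`|v|^-1 *: v) vs ml; rewrite -vE /= => ->.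
  rewrite mulrA -expr2 normrM ger0_norm ?exprn_ge0// ler_pM2l ?exprn_gt0//.
  rewrite qE -(dird_lrep_sder i j a (`|v|^-1 *: v :: `|v|^-1 *: v :: vs)).
  apply: (HC _ [:: `|v|^-1 *: v; `|v|^-1 *: v]) => //; first exact: (seg b b01).1.
  by move=> x; rewrite !inE orbb => /eqP ->.
have h01 : 0 <= (1 : R) <= 1 by rewrite ler01 lexx.
have := taylor_line (@oN i j) GN NP b2 h01.
rewrite scale1r !big_ord_recl big_ord0 /= expr0 expr1n !fact0 mul1r invr1 !mul1r addr0 expr1n.
have -> : (t0, y) + @ax1 _ T _ v = (t0 + v, y).
  by apply/eqP; rewrite xpair_eqE /= addr0 !eqxx.
have -> : 'D_(@ax1 _ T _ v) (G : _ -> R^o) (t0, y) =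
    dird (g i j a) (map (@ax2 _ T _) ws ++ @ax1 _ T _ v :: map (@ax1 _ T _) vs) (t0, y).
  have Np : N i j (t0, y) by [].
  have := @dird_perm _ _ (g i j a) (N i j) (@ax1 _ T _ v :: map (@ax2 _ T _) ws ++ map (@ax1 _ T _) vs)
    (map (@ax2 _ T _) ws ++ @ax1 _ T _ v :: map (@ax1 _ T _) vs) (t0, y) (@oN i j) (@g_smo i j a) _ Np.
  by apply; rewrite -[_ :: map _ vs]cat1s perm_sym perm_catCA.
rewrite opprD addrA => H; apply: le_trans H _.
have h : 0 <= `|v| ^+ 2 * (C * wgt M rho (size ws)).
  by rewrite mulr_ge0 ?exprn_ge0// mulr_ge0 ?(ltW C0)// ltW// wgt_gt0.
have -> : C * `|v| ^+ 2 * wgt M rho (size ws) = `|v| ^+ 2 * (C * wgt M rho (size ws)) by ring.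
by apply: ler_piMl => //; rewrite ler_pdivrMr ?ltr0n// mul1r ler1n.
Qed.

Lemma continuous_functional_bound (l : {linear (section_space f) -> R^o}) : continuous l ->
  exists (ps : seq (Sec -> R)) (C : R), [/\ 0 < C,
    forall p, p \in ps -> section_seminorms (f := f) p /\ seminorm p &
    forall r : section_space f, `|l r| <= C * \sum_(p <- ps) p r].
Proof.
move=> cl; have [ps [e [psP e0 sub]]] : nbhs (0 : section_space f) (l @^-1` [set x : R^o | `|x| < 1]).
  apply: cl; rewrite linear0; apply: (@dist_near R R^o 0 1 (fun x => `|x| < 1)) => // x.
  by rewrite subr0.
exists ps, (2 / e); split=> //; first exact: divr_gt0.
move=> r; set S := \sum_(p <- ps) p r.
have S0 : 0 <= S.
  by rewrite /S big_seq; apply: sumr_ge0 => p /psP[_ sp]; exact: seminorm_ge0.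
have pS p : p \in ps -> p r <= S.
  move=> pin; rewrite /S (big_rem p pin) /= lerDl big_seq; apply: sumr_ge0 => q /mem_rem /psP[_ sq].
  exact: seminorm_ge0.
apply/ler_addgt0Pl => eta eta0.
(* The term [e / 2 * eta] keeps the divisor positive when [S = 0]; after rescaling it contributes
   exactly [eta]. *)
have q0 : 0 < S + e / 2 * eta by rewrite ltr_wpDl// !mulr_gt0// invr_gt0.
have k0 : 0 < e / 2 / (S + e / 2 * eta) by rewrite !divr_gt0.
have : `|l ((e / 2 / (S + e / 2 * eta)) *: r)| < 1.
  apply: (sub ((e / 2 / (S + e / 2 * eta)) *: r)) => p pin; have [_ [_ pZ]] := psP p pin.
  rewrite subr0 pZ gtr0_norm//.
  apply: (@le_lt_trans _ _ (e / 2 / (S + e / 2 * eta) * (S + e / 2 * eta))).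
    by rewrite ler_wpM2l ?(ltW k0)// (le_trans (pS p pin))// lerDl !mulr_ge0// ?ltW// invr_ge0.
  by rewrite divfK ?gt_eqF// ltr_pdivrMr// ltr_pMr// ltr1n.
rewrite linearZ normrZ gtr0_norm// -ltr_pdivlMl// mulr1 invf_div => /ltW H; apply: le_trans H _.
rewrite le_eqVlt; apply/orP; left; apply/eqP; field.
by rewrite gt_eqF.
Qed.

Lemma sder_consZ (b : R) v vs t : U t -> sec_of (sder ((b *: v) :: vs) t) = b *: sec_of (sder (v :: vs) t).
Proof.
move=> Ut; have Z : sec_of (sder (0 :: vs) t) = 0.
  have := sder_cons_lin 1 0 0 vs Ut; rewrite !scale1r addr0 => /eqP.
  by rewrite -subr_eq0 opprD addrA subrr sub0r oppr_eq0 => /eqP.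
by have := sder_cons_lin b v 0 vs Ut; rewrite addr0 Z addr0.
Qed.

Lemma near_all_seq {X : Type} {I : eqType} (F : set_system X) (ps : seq I) (P : I -> X -> Prop) : Filter F ->
  (forall p, p \in ps -> \forall x \near F, P p x) -> \forall x \near F, forall p, p \in ps -> P p x.
Proof.
move=> FF; elim: ps => [|p ps ih] H; first by apply: filterE.
have h1 : \forall x \near F, P p x by apply: H; rewrite mem_head.
have h2 := ih (fun q qin => H q (mem_behead (qin : q \in behead (p :: ps)))).
apply: filterS2 h1 h2 => x h1x h2x q; rewrite inE => /orP[/eqP ->//|]; exact: h2x.
Qed.

Lemma sder_cvg v vs t0 : U t0 -> v != 0 ->
  (h^-1 *: (sec_of (sder vs (t0 + h *: v)) - sec_of (sder vs t0)) : section_space f) @[h --> (0 : R)^']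
    --> (sec_of (sder (v :: vs) t0) : section_space f).
Proof.
move=> Ut0 v0 S [ps [e [psP e0 sub]]].
have nv : 0 < `|v| by rewrite normr_gt0.
suff : \forall h \near (0 : R)^', forall p, p \in ps ->
   p (h^-1 *: (sec_of (sder vs (t0 + h *: v)) - sec_of (sder vs t0)) - sec_of (sder (v :: vs) t0)) < e.
  by apply: filterS => h H; apply: sub.
apply: near_all_seq => p /psP[pP [pD pZ]].
have [d [C [d0 C0 H]]] := sder_remainder vs pP Ut0.
near=> h; have h0 : h != 0 by near: h; exact: nbhs_dnbhs_neq.
have hd : `|h| < d / `|v| by near: h; apply: dnbhs0_lt; exact: divr_gt0.
have he : `|h| < e / (C * `|v| ^+ 2) by near: h; apply: dnbhs0_lt; rewrite divr_gt0// mulr_gt0// exprn_gt0.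
have hv : `|h *: v| < d by rewrite normrZ -ltr_pdivlMr.
have hv0 : h *: v != 0 by rewrite scaler_eq0 negb_or h0.
have [_ Hp] := H _ hv hv0.
rewrite sder_consZ// in Hp.
have -> : h^-1 *: (sec_of (sder vs (t0 + h *: v)) - sec_of (sder vs t0)) - sec_of (sder (v :: vs) t0) =
  h^-1 *: (sec_of (sder vs (t0 + h *: v)) - sec_of (sder vs t0) - h *: sec_of (sder (v :: vs) t0)).
  by rewrite [RHS]scalerBr scalerA mulVf// scale1r.
rewrite pZ normfV ltr_pdivrMl ?normr_gt0//; apply: le_lt_trans Hp _.
rewrite normrZ exprMn mulrCA expr2 -mulrA ltr_pM2l ?normr_gt0//.
by rewrite -ltr_pdivlMr// mulr_gt0// exprn_gt0.
Unshelve. all: by end_near.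
Qed.

(** The two quantifier patterns meet: in the Beurling case the seminorm fixes [rho1], and the
    estimate is taken at the smaller radius; in the Roumieu case the estimate fixes [rho], and the
    seminorm is used there. *)
Lemma kdq_kdd_map (P Q S : R -> R -> Prop) : upward S ->
  (forall rho rho1 C C', 0 < rho -> rho <= rho1 -> 0 < C -> 0 < C' -> P rho C -> Q rho1 C' -> S rho (C' * C)) ->
  kdq kd P -> kdd kd Q -> kdq kd S.
Proof.
move=> uS PQS; rewrite /kdq /kdd; case: (kd) => [HP [rho1 r1 [C' C'0 HQ]] rho r0|[rho r0 [C C0 HP]] HQ].
  have m0 : 0 < Num.min rho rho1 by rewrite lt_min r0.
  have [C C0 HC] := HP _ m0; exists (C' * C); first exact: mulr_gt0.
  apply: (uS _ _ _ _ m0 _ _ (lexx _)); rewrite ?mulr_gt0 ?ge_min ?lexx//.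
  by apply: (PQS _ rho1) => //; rewrite ge_min lexx orbT.
have [C' C'0 HC'] := HQ _ r0; exists rho => //; exists (C' * C); first exact: mulr_gt0.
by apply: (PQS rho rho).
Qed.

(** [wgt_add] splits the joint estimate. The weight in [y] is consumed by the seminorm [p], and the
    weight in [t] remains as the estimate of the class. *)
Lemma sder_bound_all p t0 : uball `<=` Vt -> section_seminorms (f := f) p -> U t0 ->
  exists2 W, nbhs t0 W & kdq kd (fun rho C => forall t vs, W t -> inV uball vs ->
     p (sec_of (sder vs t)) <= C * wgt M rho (size vs)).
Proof.
move=> VV /(section_seminorm_bound hM hlc hmg oTr)[i [j [K [cK KU Hp]]]] Ut0.
have := @unif_bound i j K t0 (fun rho C t y => forall a vs ws, inV uball vs -> inV uball ws ->
  `|dird (g i j a) (map (@ax2 _ T _) ws ++ map (@ax1 _ T _) vs) (t, y)| <= C * wgt M rho (size ws + size vs)) _ cK KU Ut0.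
case.
- move=> t y rho rho' C C' r0 rr C0 CC h a vs ws v1 w1; apply: le_trans (h a vs ws v1 w1) _.
  apply: ler_pM => //; [exact: ltW|exact/ltW/wgt_gt0|exact: ler_wgt].
- move=> y Uy.
  have Ha a : exists W, nbhs (t0, y) W /\ kdq kd (dbound M W (axisV Vt) (g i j a)).
    have Np : N i j (t0, y) by [].
    by have [W Wz HW] := GG_LC (gGG a Np); exists W.
  have [W HW] := choice Ha.
  exists (fun p => forall a, W a p).
    exact: (@filter_forall _ _ W (nbhs (t0, y)) (nbhs_filter _) (fun a => (HW a).1)).
  apply: kdq_imp (kdq_all (fun a => @upward_dbound _ _ hM _ _ _ _) (fun a => (HW a).2)) => rho C r0 C0 h.
  exists C => // q Wq a vs ws v1 w1.
  have := h a q (map (@ax2 _ T _) ws ++ map (@ax1 _ T _) vs) (Wq a).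
  rewrite -surjective_pairing size_cat !size_map; apply.
  apply: inV_cat; apply: inV_map => x; first by move/w1; right.
  by move/v1/VV; left.
move=> W Wt HW; exists (W `&` U); first by apply: filterI => //; exact: near_open.
have [theta t1 Ht] := wgt_add hM hmg; have th0 : 0 < theta by apply: lt_le_trans t1.
have HW' : kdq kd (fun rho C => forall t y, W t -> K y -> forall a vs ws, inV uball vs -> inV uball ws ->
  `|dird (g i j a) (map (@ax2 _ T _) ws ++ map (@ax1 _ T _) vs) (t, y)| <=
     C * wgt M rho (size vs) * wgt M rho (size ws)).
  apply: (kdq_map th0) HW => rho C r0 C0 h; exists C => // t y Wt' Ky a vs ws v1 w1.
  apply: le_trans (h t y Wt' Ky a vs ws v1 w1) _; rewrite -mulrA ler_pM2l// [leRHS]mulrC; exact: Ht.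
apply: kdq_kdd_map HW' Hp.
  move=> rho rho' C C' r0 rr C0 CC h t vs St v1; apply: le_trans (h t vs St v1) _.
  apply: ler_pM => //; [exact: ltW|exact/ltW/wgt_gt0|exact: ler_wgt].
move=> rho rho1 C C' r0 rr C0 C'0 HP HQ t vs [Wt' Ut'] v1; rewrite -mulrA; apply: HQ.
  by rewrite mulr_gt0// wgt_gt0.
move=> a y ws Ky w1; rewrite SE// dird_lrep_sder; apply: le_trans (HP t y Wt' Ky a vs ws v1 w1) _.
apply: ler_wpM2l; first by rewrite mulr_ge0 ?(ltW C0)// ltW// wgt_gt0.
exact: ler_wgt.
Qed.

(** * Composition with a continuous functional *)

Section Scalar.
Variables (l : {linear (section_space f) -> R^o}) (ps : seq (Sec -> R)) (L : R).
Hypotheses (L0 : 0 < L)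
  (psP : forall p, p \in ps -> section_seminorms (f := f) p /\ seminorm p)
  (lL : forall r : section_space f, `|l r| <= L * \sum_(p <- ps) p r).

Let F vs t : R := l (sec_of (sder vs t)).

(** The remainder bounds of the finitely many seminorms dominating [l] add up, and [l] maps the
    remainder section to the remainder of [F vs]. *)
Lemma scalar_differentiable vs t0 : U t0 ->
  differentiable (F vs) t0 /\ forall v, 'D_v (F vs : T -> R^o) t0 = F (v :: vs) t0.
Proof.
move=> Ut0; pose df v := F (v :: vs) t0.
have dfl : linear df.
  by move=> b v w; rewrite /df /F sder_cons_lin// linearP.
pose dfL : {linear T -> R} := HB.pack df (GRing.isLinear.Build R T R *%R df dfl).
have [K K0 HK] : exists2 K, 0 < K & forall v, uball v -> `|df v| <= K.
  have [K K0 HK] : exists2 K, 0 < K & forall v, uball v -> \sum_(p <- ps) p (sec_of (sder (v :: vs) t0)) <= K.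
    elim: (ps) psP => [|p qs ih] H.
      by exists 1 => // v _; rewrite big_nil.
    have [K K0 HK] := ih (fun q qin => H q (mem_behead (qin : q \in behead (p :: qs)))).
    have [pP _] := H p (mem_head _ _); have [C C0 HC] := sder_pbound vs pP Ut0.
    exists (C + K); first exact: addr_gt0.
    by move=> v v1; rewrite big_cons lerD ?HC ?HK.
  exists (L * K); first exact: mulr_gt0.
  by move=> v v1; apply: le_trans (lL _) _; rewrite ler_pM2l// HK.
have cdf : continuous dfL.
  apply: (@lipschitz_continuous _ _ _ dfL K) => v.
  have [->|v0] := eqVneq v 0; first by rewrite linear0 !normr0 mulr0.
  have nv : 0 < `|v| by rewrite normr_gt0.
  have vE : v = `|v| *: (`|v|^-1 *: v) by rewrite scalerA mulfV ?scale1r// gt_eqF.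
  rewrite {1}vE linearZ normrM normr_id mulrC ler_pM2r//; apply: HK.
  by rewrite /uball /= normrZ normfV normr_id mulVf// gt_eqF.
have [d [C [d0 C0 HR]]] : exists d C : R, [/\ 0 < d, 0 < C & forall v, `|v| < d -> v != 0 ->
    \sum_(p <- ps) p (sec_of (sder vs (t0 + v)) - sec_of (sder vs t0) - sec_of (sder (v :: vs) t0)) <= C * `|v| ^+ 2].
  elim: (ps) psP => [|p qs ih] H.
    by exists 1, 1; split=> // v _ _; rewrite big_nil mul1r exprn_ge0.
  have [d [C [d0 C0 HC]]] := ih (fun q qin => H q (mem_behead (qin : q \in behead (p :: qs)))).
  have [pP _] := H p (mem_head _ _); have [d' [C' [d'0 C'0 HC']]] := sder_remainder vs pP Ut0.
  exists (Num.min d d'), (C' + C); split; [by rewrite lt_min d0|exact: addr_gt0|].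
  move=> v; rewrite lt_min => /andP[vd vd'] v0; rewrite big_cons mulrDl lerD ?HC//.
  by have [] := HC' v vd' v0.
have [D DE] : differentiable (F vs) t0 /\ 'd (F vs) t0 = dfL :> (T -> R).
  apply: (differentiable_eps cdf) => e e0.
  apply: (@dist_near _ _ _ (Num.min d (e / (L * C)))).
    by rewrite lt_min d0 divr_gt0// mulr_gt0.
  move=> v; rewrite subr0 lt_min => /andP[vd ve].
  have [->|v0] := eqVneq v 0; first by rewrite addr0 subrr linear0 subr0 !normr0 mulr0.
  have -> : F vs (t0 + v) - F vs t0 - dfL v =
     l (sec_of (sder vs (t0 + v)) - sec_of (sder vs t0) - sec_of (sder (v :: vs) t0)).
    by rewrite !linearB.
  apply: le_trans (lL _) _; apply: (@le_trans _ _ (L * (C * `|v| ^+ 2))).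
    by rewrite ler_pM2l// HR.
  rewrite mulrA expr2 mulrA ler_wpM2r// mulrC -ler_pdivlMr ?mulr_gt0// ltW//.
by split=> // v; rewrite deriveE// DE.
Qed.

Lemma dird_scalar vs t : U t -> dird (F [::]) vs t = F vs t.
Proof.
elim: vs t => [//|v vs ih] t Ut.
have /= -> := eq_dird_on [:: v] oU ih Ut.
by have [_ ->] := scalar_differentiable vs Ut.
Qed.

Lemma scalar_smo : smo U (F [::]).
Proof.
move=> t Ut vs; apply: near_eq_differentiable (scalar_differentiable vs Ut).1.
by apply: filterS (near_open oU Ut) => t' Ut'; rewrite dird_scalar.
Qed.

Lemma sum_bound t0 : uball `<=` Vt -> U t0 ->
  exists2 W, nbhs t0 W & kdq kd (fun rho C => forall t vs, W t -> inV uball vs ->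
     \sum_(p <- ps) p (sec_of (sder vs t)) <= C * wgt M rho (size vs)).
Proof.
move=> VV Ut0; elim: (ps) psP => [|p qs ih] H.
  exists setT; first exact: filterT.
  apply: kdq_imp (kdqT R kd) => rho C r0 C0 _; exists 1 => // t vs _ _.
  by rewrite big_nil mul1r ltW// wgt_gt0.
have [W Wt HW] := ih (fun q qin => H q (mem_behead (qin : q \in behead (p :: qs)))).
have [pP _] := H p (mem_head _ _).
have [W' Wt' HW'] := sder_bound_all VV pP Ut0.
exists (W `&` W'); first exact: filterI.
have up (q : seq T -> T -> R) (S : set T) : upward (fun rho C => forall t vs, S t -> inV uball vs ->
     q vs t <= C * wgt M rho (size vs)).
  move=> rho rho' C C' r0 rr C0 CC h t vs St v1; apply: le_trans (h t vs St v1) _.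
  apply: ler_pM => //; [exact: ltW|exact/ltW/wgt_gt0|exact: ler_wgt].
apply: kdq_imp (kdq_and (up _ _) (up _ _) HW HW') => rho C r0 C0 [h h'].
exists (C + C); first exact: addr_gt0.
move=> t vs [Wt1 Wt2] v1; rewrite big_cons addrC mulrDl.
by apply: lerD; [exact: h|exact: h'].
Qed.

Lemma scalar_LC t0 : uball `<=` Vt -> U t0 -> LC kd M uball t0 (F [::]).
Proof.
move=> VV Ut0; have [W Wt HW] := sum_bound VV Ut0.
exists (W `&` U); first by apply: filterI => //; exact: near_open.
apply: kdq_imp HW => rho C r0 C0 H; exists (L * C); first exact: mulr_gt0.
move=> t vs [Wt' Ut'] v1; rewrite dird_scalar//; apply: le_trans (lL _) _.
by rewrite -mulrA ler_pM2l//; exact: H.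
Qed.

End Scalar.

End Outputs.

(** * The composition in exponential charts *)

Section Charts.
Context {R : realType} {kd : dc_kind} {M : nat -> R}.
Hypotheses (hM : weight_sequence M) (hlc : log_convex M) (hmg : moderate_growth M).

Lemma real_GT n (z : R * 'rV[R]_n) f : GG kd M (axisD setT) (axisV set0) z f -> GT kd M z f.
Proof. exact: GT_real. Qed.

Lemma const_smooth_curve (E : tvsType R) (x : E) : smooth_curve (fun _ : R => x).
Proof.
exists (fun k _ => if k is 0%N then x else 0) => // k t.
have -> : (fun h : R => h^-1 *: ((if k is 0%N then x else 0) - (if k is 0%N then x else 0))) = fun=> 0.
  by apply/funext => h; rewrite subrr scaler0.
exact: cvg_cst.
Qed.

(** The case of families constant in a real parameter. *)
Lemma is_CM_comp (A B C : manifold kd M) (f : B -> C) (g : A -> B) :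
  is_CM f -> is_CM g -> is_CM (f \o g).
Proof.
move=> fCM gCM; have T0 : R by exact: 0.
apply: (@goodmap_is_CM R kd M hM hlc hmg R setT set0 real_GT A C (fun _ => f \o g) 0) => x.
by apply: (goodmap_comp hM hlc hmg (G := fun _ => g) (H := fun _ => f)); exact: goodmap_const.
Qed.

Variables (A B : manifold kd M) (gB : metric B) (e : local_exp gB).
Local Notation Sec f := (spanType (@CM_sections R kd M A B f)).

Lemma section_tangent (f : A -> B) (fCM : is_CM f) (s : Sec f) x : is_tangent (f x) (span_val s x).
Proof.
have oTr i j : open (triv_dom f i j) by exact: is_CM_open.
by have /(sectionP hM hlc hmg oTr)[] := span_section hM hlc hmg oTr s.
Qed.

Lemma rexp_is_CM (f : A -> B) (fCM : is_CM f) (s : Sec f) :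
  (forall x, exp_dom e (f x, span_val s x)) -> is_CM (fun x => rexp e (f x, span_val s x)).
Proof.
move=> sd; apply: (@goodmap_is_CM R kd M hM hlc hmg R setT set0 real_GT A B
  (fun _ x => rexp e (f x, span_val s x)) 0) => x.
have gf : @goodmap R kd M R setT set0 A B (fun _ => f) 0 x by exact: goodmap_const.
apply: (@goodmap_exp R kd M hM hlc hmg R setT set0 A B gB e f (fun _ => span_val s) 0 x gf _ _ (sd x)).2.
  exact: (@curve_goodsec R kd M hM hlc hmg A B f fCM (fun _ => s) 0 x (const_smooth_curve (s : section_space f))).
by move=> _ y; exact: section_tangent.
Qed.

Variable inv_exp : @crestrict R (cprod (charted_of B) (charted_of B)) (exp_rng e) -> crestrict (exp_dom e).
Hypotheses (invCM : @CM_map R kd M _ _ inv_exp)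
  (invK : forall p, exp_dom e p -> inv_exp (p.1, rexp e p) = p).

Lemma inv_expP b b' : exp_rng e (b, b') ->
  exp_dom e (b, (inv_exp (b, b')).2) /\ rexp e (b, (inv_exp (b, b')).2) = b'.
Proof.
by move=> [p pd [pb pb']]; rewrite -pb -pb' invK// -surjective_pairing.
Qed.

Lemma inv_exp_rexp b xi : exp_dom e (b, xi) -> (inv_exp (b, rexp e (b, xi))).2 = xi.
Proof. by move=> bd; rewrite (invK bd). Qed.

Lemma inv_exp_section (f h : A -> B) : is_CM f -> is_CM h -> (forall x, exp_rng e (f x, h x)) ->
  CM_sections f (fun x => (inv_exp (f x, h x)).2).
Proof.
move=> fCM hCM fh.
apply: (@goodsec_section R kd M hM hlc hmg R setT set0 real_GT A B f
  (fun _ x => (inv_exp (f x, h x)).2) 0 fCM) => x.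
  exact: exp_dom_tangent (inv_expP (fh x)).1.
have gf : @goodmap R kd M R setT set0 A B (fun _ => f) 0 x by exact: goodmap_const.
have gh : @goodmap R kd M R setT set0 A B (fun _ => h) 0 x by exact: goodmap_const.
exact: (@goodsec_inv_exp R kd M hM hlc hmg R setT set0 A B gB e f (fun _ => h) inv_exp 0 x invCM invK gf gh (fh x)).2.
Qed.

(** By [invK] the exponential is injective on each fibre of its domain, so [xget] has only one
    choice. *)
Lemma cmap_unique (f : {f : A -> B | is_CM f}) (h : A -> B) (s : Sec (sval f)) :
  (forall x, exp_dom e (sval f x, span_val s x) /\ rexp e (sval f x, span_val s x) = h x) ->
  cmap (mapping_space A e) f h = s.
Proof.
move=> sP; apply: xget_unique => //= s' s'P; apply: span_val_inj; apply/funext => x.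
have [d1 r1] := sP x; have [d2 r2] := s'P x.
by rewrite -(inv_exp_rexp d1) -(inv_exp_rexp d2) r1 r2.
Qed.

Lemma cmapP (f : {f : A -> B | is_CM f}) (h : A -> B) : is_CM h -> (forall x, exp_rng e (sval f x, h x)) ->
  forall x, exp_dom e (sval f x, span_val (cmap (mapping_space A e) f h : Sec (sval f)) x) /\
    rexp e (sval f x, span_val (cmap (mapping_space A e) f h : Sec (sval f)) x) = h x.
Proof.
move=> hCM fh; have sc := inv_exp_section (svalP f) hCM fh.
have H x : exp_dom e (sval f x, span_val (sec_of (sval f) (fun x => (inv_exp (sval f x, h x)).2)) x) /\
    rexp e (sval f x, span_val (sec_of (sval f) (fun x => (inv_exp (sval f x, h x)).2)) x) = h x.
  by rewrite (sec_ofE sc); exact: inv_expP.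
by rewrite (cmap_unique H).
Qed.

End Charts.

Section CompositeDefs.
Context {R : realType} {kd : dc_kind} {M : nat -> R} {T : Type}.
Variables (A1 A2 B : manifold kd M).
Variables (g2 : metric A2) (e2 : local_exp g2) (gB : metric B) (eB : local_exp gB).
Variable inv_exp : @crestrict R (cprod (charted_of B) (charted_of B)) (exp_rng eB) -> crestrict (exp_dom eB).
Variables (f0 : A2 -> B) (g0 : A1 -> A2) (h0 : A1 -> B).
Variables (s : T -> A2 -> tvector B) (r : T -> A1 -> tvector A2).

(** The composite of the maps with exponential coordinates [s] at [f0] and [r] at [g0]; [comp_sec]
    is its coordinate at the centre [h0]. *)
Definition exp_comp t x : B := rexp eB (f0 (rexp e2 (g0 x, r t x)), s t (rexp e2 (g0 x, r t x))).

Definition comp_dom : set T := [set t | (forall y, exp_dom eB (f0 y, s t y)) /\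
  (forall x, exp_dom e2 (g0 x, r t x)) /\ forall x, exp_rng eB (h0 x, exp_comp t x)].

Definition comp_sec t x : tvector B := (inv_exp (h0 x, exp_comp t x)).2.

End CompositeDefs.

Section CompositeFamily.
Context {R : realType} {kd : dc_kind} {M : nat -> R}.
Hypotheses (hM : weight_sequence M) (hlc : log_convex M) (hmg : moderate_growth M).
Context {T : normedModType R} (Dt Vt : set T).
Variables (A1 A2 B : manifold kd M).
Hypotheses (cA1 : compact [set: A1]) (cA2 : compact [set: A2]).
Variables (g2 : metric A2) (e2 : local_exp g2) (gB : metric B) (eB : local_exp gB).
Variable inv_exp : @crestrict R (cprod (charted_of B) (charted_of B)) (exp_rng eB) -> crestrict (exp_dom eB).
Hypotheses (invCM : @CM_map R kd M _ _ inv_exp)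
  (invK : forall p, exp_dom eB p -> inv_exp (p.1, rexp eB p) = p).
Variables (f0 : A2 -> B) (g0 : A1 -> A2) (h0 : A1 -> B).
Hypotheses (f0CM : is_CM f0) (g0CM : is_CM g0) (h0CM : is_CM h0).
Variables (s : T -> A2 -> tvector B) (r : T -> A1 -> tvector A2).
Hypotheses (stan : forall t y, is_tangent (f0 y) (s t y)) (rtan : forall t x, is_tangent (g0 x) (r t x)).
Hypotheses (sgood : forall t y, goodsec Dt Vt f0 s t y) (rgood : forall t x, goodsec Dt Vt g0 r t x).

Local Notation exp_comp := (exp_comp e2 eB f0 g0 s r).
Local Notation comp_dom := (comp_dom e2 eB f0 g0 h0 s r).
Local Notation comp_sec := (comp_sec e2 inv_exp f0 g0 h0 s r).

Let f0good t y : goodmap Dt Vt (fun _ => f0) t y. Proof. exact: goodmap_const. Qed.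
Let g0good t x : goodmap Dt Vt (fun _ => g0) t x. Proof. exact: goodmap_const. Qed.
Let h0good t x : goodmap Dt Vt (fun _ => h0) t x. Proof. exact: goodmap_const. Qed.

Let comp_good t x : comp_dom t -> goodmap Dt Vt exp_comp t x.
Proof.
move=> [sd [rd _]].
apply: (@goodmap_comp R kd M hM hlc hmg T Dt Vt A1 A2 B (fun t x => rexp e2 (g0 x, r t x))
   (fun t y => rexp eB (f0 y, s t y))).
  by have [] := goodmap_exp hM hlc hmg (@g0good t x) (@rgood t x) rtan (rd x).
by have [] := goodmap_exp hM hlc hmg (@f0good t _) (@sgood t _) stan (sd (rexp e2 (g0 x, r t x))).
Qed.

(** Each condition holds near a given point of the source by the lemmas on the exponential; [tube]
    makes it uniform, over [A2] for the first condition and over [A1] for the other two. *)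
Lemma comp_dom_open : open comp_dom.
Proof.
rewrite openE => t Ot; have [sd [rd hr]] := Ot; rewrite /interior.
have n1 : \forall t' \near t, forall y, exp_dom eB (f0 y, s t' y).
  apply: (tube (Q := fun t' y => exp_dom eB (f0 y, s t' y)) cA2) => y i iy.
  by have [H _] := goodmap_exp hM hlc hmg (@f0good t y) (@sgood t y) stan (sd y); exact: H.
have n2 : \forall t' \near t, forall x, exp_dom e2 (g0 x, r t' x).
  apply: (tube (Q := fun t' x => exp_dom e2 (g0 x, r t' x)) cA1) => x i ix.
  by have [H _] := goodmap_exp hM hlc hmg (@g0good t x) (@rgood t x) rtan (rd x); exact: H.
have n3 : \forall t' \near t, forall x, exp_rng eB (h0 x, exp_comp t' x).
  apply: (tube (Q := fun t' x => exp_rng eB (h0 x, exp_comp t' x)) cA1) => x i ix.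
  by have [H _] := goodsec_inv_exp hM hlc hmg invCM invK (@h0good t x) (@comp_good t x Ot) (hr x); exact: H.
by apply: filterS3 n1 n2 n3 => t' h1 h2 h3; split.
Qed.

Lemma comp_sec_tangent t x : comp_dom t -> is_tangent (h0 x) (comp_sec t x).
Proof. by move=> [_ [_ hr]]; exact: exp_dom_tangent (inv_expP invK (hr x)).1. Qed.

Lemma comp_sec_good t x : comp_dom t -> goodsec Dt Vt h0 comp_sec t x.
Proof.
move=> Ot; have [_ [_ hr]] := Ot.
by have [] := goodsec_inv_exp hM hlc hmg invCM invK (@h0good t x) (@comp_good t x Ot) (hr x).
Qed.

End CompositeFamily.

Section Products.
Context {R : realType}.

Lemma diffq_scale1 (E : tvsType R) (D : R -> E) (l : E) t :
  h^-1 *: (D (t + h *: (1 : R)) - D t) @[h --> (0 : R)^'] --> l ->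
  h^-1 *: (D (t + h) - D t) @[h --> (0 : R)^'] --> l.
Proof.
have -> // : (fun h : R => h^-1 *: (D (t + h *: (1 : R)) - D t)) = (fun h : R => h^-1 *: (D (t + h) - D t)).
by apply/funext => h; rewrite -[h *: 1]/(h * 1) mulr1.
Qed.

Lemma smooth_curve_fst (E F : tvsType R) (c : R -> (E * F)%type) : smooth_curve c -> smooth_curve (fun t => (c t).1).
Proof.
move=> [d d0 dP]; exists (fun k t => (d k t).1); first by rewrite d0.
move=> k t; exact: (cvg_comp _ _ (dP k t) (@cvg_fst _ _ _ _ _)).
Qed.

Lemma smooth_curve_snd (E F : tvsType R) (c : R -> (E * F)%type) : smooth_curve c -> smooth_curve (fun t => (c t).2).
Proof.
move=> [d d0 dP]; exists (fun k t => (d k t).2); first by rewrite d0.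
move=> k t; exact: (cvg_comp _ _ (dP k t) (@cvg_snd _ _ _ _ _)).
Qed.

Lemma disk_seminorm_bound (E : tvsType R) (D : disk E) (p : E -> R) : seminorm p ->
  nbhs (0 : E) [set x | p x < 1] -> exists C, forall t : disk_space D, p (disk_incl t) <= C * `|t|.
Proof.
move=> [pD pZ] /(@disk_bounded _ _ D)[C C0 HC]; exists C => t.
apply/ler_addgt0Pl => eta eta0.
have d0 : 0 < eta / C by exact: divr_gt0.
have tr : `|t| < `|t| + eta / C by rewrite ltrDl.
have s0 : 0 < `|t| + eta / C by apply: le_lt_trans tr.
have [u u1 uE] := HC _ (disk_set_scale tr).
have -> : disk_incl t = (`|t| + eta / C) *: (C *: u).
  by rewrite uE scalerA mulfV ?scale1r// gt_eqF.
rewrite !pZ !gtr0_norm//; apply: (@le_trans _ _ ((`|t| + eta / C) * (C * 1))).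
  by rewrite ler_pM2l// ler_pM2l// ltW.
by rewrite mulr1 mulrDl divfK ?gt_eqF// mulrC addrC.
Qed.

End Products.

(** * The chart expression is smooth and of class C^[M] *)

Section CompositionChart.
Context {R : realType} {kd : dc_kind} {M : nat -> R}.
Hypotheses (hM : weight_sequence M) (hlc : log_convex M) (hmg : moderate_growth M).
Variables (A1 A2 B : manifold kd M).
Hypotheses (cA1 : compact [set: A1]) (cA2 : compact [set: A2]).
Variables (g2 : metric A2) (e2 : local_exp g2) (gB : metric B) (eB : local_exp gB).
Variable inv_exp : @crestrict R (cprod (charted_of B) (charted_of B)) (exp_rng eB) -> crestrict (exp_dom eB).
Hypotheses (invCM : @CM_map R kd M _ _ inv_exp)
  (invK : forall p, exp_dom eB p -> inv_exp (p.1, rexp eB p) = p).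
Variables (f0 : A2 -> B) (g0 : A1 -> A2) (h0 : A1 -> B).
Hypotheses (f0CM : is_CM f0) (g0CM : is_CM g0) (h0CM : is_CM h0).

Local Notation X := (section_space f0 * section_space g0)%type.
Local Notation Sec A B f := (spanType (@CM_sections R kd M A B f)).
Let s1 (p : X) : A2 -> tvector B := span_val (p.1 : Sec A2 B f0).
Let s2 (p : X) : A1 -> tvector A2 := span_val (p.2 : Sec A1 A2 g0).

Definition chart_dom : set X := comp_dom e2 eB f0 g0 h0 s1 s2.

Definition chart_map (p : X) : section_space h0 := sec_of h0 (comp_sec e2 inv_exp f0 g0 h0 s1 s2 p).

Let s1tan p y : is_tangent (f0 y) (s1 p y). Proof. exact: section_tangent. Qed.
Let s2tan p x : is_tangent (g0 x) (s2 p x). Proof. exact: section_tangent. Qed.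

Let good_curve (c : R -> X) : smooth_curve c ->
  (forall t y, goodsec setT set0 f0 (fun t => s1 (c t)) t y) /\
  (forall t x, goodsec setT set0 g0 (fun t => s2 (c t)) t x).
Proof.
move=> sc; split=> t x.
  exact: (@curve_goodsec R kd M hM hlc hmg A2 B f0 f0CM (fun t => (c t).1) t x (smooth_curve_fst sc)).
exact: (@curve_goodsec R kd M hM hlc hmg A1 A2 g0 g0CM (fun t => (c t).2) t x (smooth_curve_snd sc)).
Qed.

Lemma chart_dom_open : cinf_open chart_dom.
Proof.
move=> c sc; have [G1 G2] := good_curve sc.
exact: (@comp_dom_open R kd M hM hlc hmg R setT set0 A1 A2 B cA1 cA2 g2 e2 gB eB inv_exp invCM invK f0 g0 h0
  f0CM g0CM h0CM (fun t => s1 (c t)) (fun t => s2 (c t)) (fun t => @s1tan (c t)) (fun t => @s2tan (c t)) G1 G2).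
Qed.

Lemma chart_map_smooth : smooth_map chart_dom chart_map.
Proof.
move=> c sc cU; have [G1 G2] := good_curve sc.
pose sg := comp_sec e2 inv_exp f0 g0 h0 (fun t => s1 (c t)) (fun t => s2 (c t)).
have sgt t x : [set: R] t -> is_tangent (h0 x) (sg t x).
  by move=> _; exact: (@comp_sec_tangent R kd M R A1 A2 B g2 e2 gB eB inv_exp invK f0 g0 h0
    (fun t => s1 (c t)) (fun t => s2 (c t)) t x (cU t)).
have sgg t x : [set: R] t -> goodsec setT set0 h0 sg t x.
  by move=> _; exact: (@comp_sec_good R kd M hM hlc hmg R setT set0 A1 A2 B g2 e2 gB eB inv_exp invCM invK
    f0 g0 h0 f0CM g0CM h0CM (fun t => s1 (c t)) (fun t => s2 (c t)) (fun t => @s1tan (c t)) (fun t => @s2tan (c t)) G1 G2 t x (cU t)).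
(* The derivatives of the image curve are the pointwise derivatives of the composite family in the
   direction 1. *)
exists (fun k t => sec_of h0 (sder sg (nseq k 1) t)).
  by apply/funext => t; rewrite sder0.
move=> k t.
apply: (@diffq_scale1 _ (section_space h0) (fun t => sec_of h0 (sder sg (nseq k 1) t))).
exact: (@sder_cvg R kd M hM hlc hmg R setT set0 (@real_GT R kd M) A1 B h0 h0CM sg setT openT sgt sgg 1 (nseq k 1) t I (oner_neq0 _)).
Qed.

Lemma chart_map_CM : CM kd M chart_dom chart_map.
Proof.
split; first exact: chart_map_smooth.
move=> l cl D; pose T := disk_space D.
pose L1 (t : T) : Sec A2 B f0 := (disk_incl t).1.
pose L2 (t : T) : Sec A1 A2 g0 := (disk_incl t).2.
have L1l : linear L1 by [].
have L2l : linear L2 by [].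
pose K1 : {linear T -> Sec A2 B f0} := HB.pack L1 (GRing.isLinear.Build R T (Sec A2 B f0) *:%R L1 L1l).
pose K2 : {linear T -> Sec A1 A2 g0} := HB.pack L2 (GRing.isLinear.Build R T (Sec A1 A2 g0) *:%R L2 L2l).
have HT n (z : T * 'rV[R]_n) f : GG kd M (axisD set0) (axisV uball) z f -> GT kd M z f by exact: GT_banach.
(* A disk is bounded, so every seminorm is dominated by its gauge, which is the hypothesis of
   [linear_goodsec]. *)
have G1 t y : goodsec set0 uball f0 (fun t : T => s1 (disk_incl t)) t y.
  apply: (@linear_goodsec R kd M hM hlc hmg A2 B f0 f0CM T K1 t y) => p pP ps.
  apply: (@disk_seminorm_bound R X D (fun x => p (x.1 : Sec A2 B f0))).
    by case: ps => pD pZ; split=> [x x'|b x]; [exact: pD|exact: pZ].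
  have n1 : nbhs (0 : section_space f0) [set u | p (u : Sec A2 B f0) < 1].
    exists [:: p], 1; split=> // [q|u /(_ p)]; first by rewrite inE => /eqP ->.
    by rewrite mem_head subr0; exact.
  exact: (@cvg_fst _ _ (nbhs (0 : section_space f0)) (nbhs (0 : section_space g0)) _ _ n1).
have G2 t x : goodsec set0 uball g0 (fun t : T => s2 (disk_incl t)) t x.
  apply: (@linear_goodsec R kd M hM hlc hmg A1 A2 g0 g0CM T K2 t x) => p pP ps.
  apply: (@disk_seminorm_bound R X D (fun x => p (x.2 : Sec A1 A2 g0))).
    by case: ps => pD pZ; split=> [y y'|b y]; [exact: pD|exact: pZ].
  have n1 : nbhs (0 : section_space g0) [set u | p (u : Sec A1 A2 g0) < 1].
    exists [:: p], 1; split=> // [q|u /(_ p)]; first by rewrite inE => /eqP ->.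
    by rewrite mem_head subr0; exact.
  exact: (@cvg_snd _ _ (nbhs (0 : section_space f0)) (nbhs (0 : section_space g0)) _ _ n1).
set U := @disk_incl R _ D @^-1` chart_dom.
pose sg := comp_sec e2 inv_exp f0 g0 h0 (fun t : T => s1 (disk_incl t)) (fun t => s2 (disk_incl t)).
have oU : open U.
  exact: (@comp_dom_open R kd M hM hlc hmg T set0 uball A1 A2 B cA1 cA2 g2 e2 gB eB inv_exp invCM invK f0 g0 h0
    f0CM g0CM h0CM _ _ (fun t => @s1tan (disk_incl t)) (fun t => @s2tan (disk_incl t)) G1 G2).
have sgt t x : U t -> is_tangent (h0 x) (sg t x).
  exact: (@comp_sec_tangent R kd M T A1 A2 B g2 e2 gB eB inv_exp invK f0 g0 h0
    (fun t : T => s1 (disk_incl t)) (fun t => s2 (disk_incl t)) t x).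
have sgg t x : U t -> goodsec set0 uball h0 sg t x.
  exact: (@comp_sec_good R kd M hM hlc hmg T set0 uball A1 A2 B g2 e2 gB eB inv_exp invCM invK
    f0 g0 h0 f0CM g0CM h0CM _ _ (fun t => @s1tan (disk_incl t)) (fun t => @s2tan (disk_incl t)) G1 G2 t x).
have [ps [C [C0 psP lC]]] := continuous_functional_bound cl.
have E : l \o chart_map \o @disk_incl R _ D = (fun t : T => l (sec_of h0 (sder sg [::] t))).
  by apply/funext => t; rewrite sder0.
rewrite E.
apply: (banach_CM_of hM oU).
  exact: (scalar_smo hM hlc hmg HT h0CM oU sgt sgg C0 psP lC).
move=> t Ut; exact: (scalar_LC hM hlc hmg HT h0CM oU sgt sgg C0 psP lC _ Ut).
Qed.

End CompositionChart.

Theorem corollary9p6 (R : realType) (kd : dc_kind) (M : nat -> R)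
    (hM : weight_sequence M) (hlc : log_convex M) (hmg : moderate_growth M)
    (hB : kd = Beurling -> root_to_infty M)
    (A1 A2 B : manifold kd M)
    (hA1 : compact [set: A1]) (hA2 : compact [set: A2])
    (g2 : metric A2) (e2 : local_exp g2) (gB : metric B) (eB : local_exp gB) :
  @CM_map R kd M
    (cprod (mapping_space A2 eB) (mapping_space A1 e2)) (mapping_space A1 eB)
    (fun fg => fg.1 \o fg.2).
Proof.
have [invB [_ invBCM invBK]] := exp_diffeo eB.
have [inv2 [_ inv2CM inv2K]] := exp_diffeo e2.
split=> [[f g] /= [fCM gCM]|[f0 g0] h0]; first exact: is_CM_comp hM hlc hmg _ _ _ _ _ fCM gCM.
set D := (X in let D := X in _); cbv zeta.
pose cm := cmap (cprod (mapping_space A2 eB) (mapping_space A1 e2)) (f0, g0).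
have cmP f g : D (f, g) ->
    (forall y, exp_dom eB (sval f0 y, span_val (cm (f, g)).1 y) /\
       rexp eB (sval f0 y, span_val (cm (f, g)).1 y) = f y) /\
    (forall x, exp_dom e2 (sval g0 x, span_val (cm (f, g)).2 x) /\
       rexp e2 (sval g0 x, span_val (cm (f, g)).2 x) = g x).
  move=> [[[fCM gCM] [fd gd]] _]; split.
    exact: cmapP hM hlc hmg _ _ _ _ _ invBCM invBK _ _ fCM fd.
  exact: cmapP hM hlc hmg _ _ _ _ _ inv2CM inv2K _ _ gCM gd.
have compE f g x : D (f, g) ->
    exp_comp e2 eB (sval f0) (sval g0) (fun p => span_val p.1) (fun p => span_val p.2) (cm (f, g)) x = f (g x).
  by move=> /cmP[fP gP]; rewrite /exp_comp (gP x).2 (fP _).2.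
(* A pair of sections in [chart_dom] comes from the pair of maps obtained by exponentiating both;
   [cmap_unique] recovers the sections. *)
have DE : cm @` D = chart_dom (f0 := sval f0) (g0 := sval g0) e2 eB (sval h0).
  apply/seteqP; split=> [_ [[f g] Dfg <-]|[s t] [sd [td hr]]].
    have [fP gP] := cmP _ _ Dfg; split; first by move=> y; exact: (fP y).1.
    split=> x; first exact: (gP x).1.
    by rewrite (compE _ _ _ Dfg); case: Dfg => _; exact.
  exists (fun y => rexp eB (sval f0 y, span_val s y), fun x => rexp e2 (sval g0 x, span_val t x)).
    split; last exact: hr.
    split; split=> /=.
    - by apply: (rexp_is_CM hM hlc hmg (svalP f0)).
    - by apply: (rexp_is_CM hM hlc hmg (svalP g0)).
    - by move=> y; exists (sval f0 y, span_val s y) => //; exact: sd.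
    - by move=> x; exists (sval g0 x, span_val t x) => //; exact: td.
  congr pair; apply: cmap_unique.
  - exact: invBK.
  - by move=> y; split => //; exact: sd.
  - exact: inv2K.
  - by move=> x; split => //; exact: td.
rewrite DE; split.
  exact: (chart_dom_open hM hlc hmg hA1 hA2 invBCM invBK (svalP f0) (svalP g0) (svalP h0)).
exists (chart_map (f0 := sval f0) (g0 := sval g0) e2 invB (sval h0)).
  exact: (chart_map_CM hM hlc hmg hA1 hA2 e2 invBCM invBK (svalP f0) (svalP g0) (svalP h0)).
move=> [f g] Dfg; apply/esym; apply: (cmap_unique invBK).
have [[[fCM gCM] _] hr] := Dfg.
have cE : comp_sec e2 invB (sval f0) (sval g0) (sval h0) (fun p => span_val p.1) (fun p => span_val p.2)
    (cm (f, g)) = (fun x => (invB (sval h0 x, f (g x))).2).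
  by apply/funext => x; rewrite /comp_sec (compE _ _ _ Dfg).
have fgCM : is_CM (f \o g) by exact: is_CM_comp hM hlc hmg _ _ _ _ _ fCM gCM.
have sc := inv_exp_section hM hlc hmg invBCM invBK (svalP h0) fgCM hr.
by move=> x; rewrite /chart_map cE (sec_ofE sc); apply: inv_expP => //; exact: hr.
Qed.
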